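(* Let $X=\Sigma_N\circ W_N+A_N$, where $W_N$ is GOE ($\beta=1$) or GUE ($\beta=2$), and assume (B1) and (B2). Let $s\ge1$ be fixed, $n_1,\dots,n_s\ge1$, $n=\sum_jn_j$ and $a=\|A_N\|_{\mathrm{op}}$. (i) There exists a constant $C>0$ such that $$\mathbb E\Bigl[\prod_{j=1}^s\operatorname{Tr}U_{n_j}\bigl(\tfrac X2\bigr)\Bigr]\le(1+a^n)(Cn)^s\Bigl\{e^{Cn^{3/2}/\sqrt N}+\bigl(1\vee\tfrac{t_N}{n}\bigr)^se^{Cn^2t_N/N}+\Bigl(\bigl(\tfrac{Cn^2t_N}{N}\bigr)^{\lfloor n/t_N\rfloor}\wedge1\Bigr)e^{Cn^3/N}\Bigr\}.$$ (ii) If $a\le1+O(N^{-1/3})$ and $t_N\ll n_j=O(N^{1/3})$ for all $j$, then $$\mathbb E\Bigl[\prod_{j=1}^s\operatorname{Tr}U_{n_j}\bigl(\tfrac X2\bigr)\Bigr]=\mathbb E\Bigl[\prod_{j=1}^s\operatorname{Tr}U_{n_j}\bigl(\tfrac{\widetilde X}2\bigr)\Bigr]+o(n^s),$$ where $\widetilde X=N^{-1/2}W_N^{(\mathrm G\beta\mathrm E)}+A_N$.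
   Context: $U_n$ is the Chebyshev polynomial of the second kind, $U_n(\cos\phi)=\sin((n+1)\phi)/\sin\phi$. GOE: real symmetric with independent Gaussian entries, $\mathbb EW_{ii}^2=2$ and $\mathbb EW_{ij}^2=1$. GUE: Hermitian with $\mathbb EW_{ii}^2=1$, $\mathbb E|W_{ij}|^2=1$ and $\mathbb EW_{ij}^2=0$. $W_N^{(\mathrm G\beta\mathrm E)}$ denotes such a matrix. $\Sigma_N=(\sigma_{ij})$ is deterministic, symmetric, nonnegative, with $\sum_j\sigma_{ij}^2=1$; $\circ$ is the entrywise product. $A_N$ is deterministic real symmetric (resp. Hermitian) of fixed finite rank $r$. Let $p_w(x,y)=(P_N^w)_{xy}$ with $P_N=(\sigma_{ij}^2)$, and let $t_N$ be nondecreasing positive integers. - (B1): there exist $\gamma\ge1$ and $N_0$ such that $\frac1{t_N}\sum_{w=1}^{t_N}p_w(x,y)\le\gamma/N$ for $N\ge N_0$. - (B2): there is $\delta\in(0,0.1)$ (one may additionally impose $\delta=\delta_N\to0$) with $|p_w(x,y)-1/N|\le\delta/N$ for $w\ge t_N$. *)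

(* Defs.v *)
From HB Require Import structures.
From mathcomp Require Import all_boot all_order all_algebra.
From mathcomp Require Import all_classical all_reals all_analysis.
From mathcomp.real_closed Require Import complex.

Set Implicit Arguments.
Unset Strict Implicit.
Unset Printing Implicit Defensive.

Import Order.TTheory GRing.Theory Num.Theory.
Local Open Scope classical_set_scope.
Local Open Scope ring_scope.

(* (These are the polynomials with U_n(cos phi) = sin((n+1)phi)/sin phi.)   *)
Fixpoint chebU_pair (A : pzRingType) (x : A) (n : nat) : A * A :=
  match n with
  | 0 => (1, x *+ 2)
  | n'.+1 => let: (a, b) := chebU_pair x n' in (b, x *+ 2 * b - a)
  end.
Definition chebU (A : pzRingType) (x : A) (n : nat) : A := (chebU_pair x n).1.

Definition cplx (R : realType) (x : R) : R[i] := Complex x 0.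

Definition hermitian (R : realType) (N : nat) (M : 'M[R[i]]_N) : Prop :=
  forall i j, M j i = conjc (M i j).

Definition real_symmetric (R : realType) (N : nat) (M : 'M[R[i]]_N) : Prop :=
  hermitian M /\ forall i j, complex.Im (M i j) = 0.

Definition sqnormv (R : realType) (N : nat) (v : 'cV[R[i]]_N) : R :=
  \sum_(i < N) (complex.Re (v i 0) ^+ 2 + complex.Im (v i 0) ^+ 2).

Definition opnorm (R : realType) (N : nat) (M : 'M[R[i]]_N) : R :=
  sup [set Num.sqrt (sqnormv (M *m v)) | v in [set v : 'cV[R[i]]_N | sqnormv v = 1]].

Definition pmat (R : realType) (N : nat) (S : 'M[R]_N) : 'M[R]_N :=
  map_mx (fun s => s ^+ 2) S.
Definition pw (R : realType) (N : nat) (S : 'M[R]_N) (w : nat) (x y : 'I_N) : R :=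
  (pmat S ^+ w) x y.

Definition variance_profile (R : realType) (N : nat) (S : 'M[R]_N) : Prop :=
  [/\ S^T = S, (forall i j, 0 <= S i j) & (forall i, \sum_(j < N) S i j ^+ 2 = 1)].

Definition condB1 (R : realType) (S : forall N, 'M[R]_N) (t : nat -> nat)
  (gamma : R) (N0 : nat) : Prop :=
  1 <= gamma /\
  forall N, (N0 <= N)%N -> forall x y : 'I_N,
    (t N)%:R^-1 * (\sum_(1 <= w < (t N).+1) pw (S N) w x y) <= gamma / N%:R.

Definition condB2 (R : realType) (S : forall N, 'M[R]_N) (t : nat -> nat)
  (delta : R) : Prop :=
  0 < delta < 10%:R^-1 /\
  forall N (x y : 'I_N) w, (t N <= w)%N ->
    `|pw (S N) w x y - N%:R^-1| <= delta / N%:R.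

Definition mutually_independent d (T : measurableType d) (R : realType)
  (P : probability T R) (K : finType) (X : K -> T -> R) : Prop :=
  forall (J : {set K}) (B : K -> set R), (forall k, measurable (B k)) ->
    P (\bigcap_(k in [set k | k \in J]) (X k @^-1` B k)) =
    (\prod_(k in J) P (X k @^-1` B k))%E.

Definition std_gaussian d (T : measurableType d) (R : realType)
  (P : probability T R) (X : T -> R) : Prop :=
  measurable_fun setT X /\
  forall B : set R, measurable B -> P (X @^-1` B) = normal_prob 0 1 B.

Definition gaussian_family d (T : measurableType d) (R : realType)
  (P : probability T R) (N : nat) (g : 'I_N -> 'I_N -> bool -> T -> R) : Prop :=
  (forall i j b, std_gaussian P (g i j b)) /\
  mutually_independent P (fun k : 'I_N * 'I_N * bool => g k.1.1 k.1.2 k.2).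

Inductive ensemble := GOE | GUE.

(* The GOE / GUE matrix built from the Gaussian family g (at outcome w):
   GOE: W_ii = sqrt 2 g_ii, W_ij = g_ij (i<j), symmetric  (E W_ii^2 = 2, E W_ij^2 = 1);
   GUE: W_ii = g_ii, W_ij = (g_ij + i h_ij)/sqrt 2 (i<j), Hermitian
        (E W_ii^2 = 1, E |W_ij|^2 = 1, E W_ij^2 = 0). *)
Definition Wentry (R : realType) (e : ensemble) (N : nat)
  (g : 'I_N -> 'I_N -> bool -> R) (i j : 'I_N) : R[i] :=
  match e with
  | GOE => Complex (if i == j then Num.sqrt 2 * g i i false else g i j false) 0
  | GUE => if i == j then Complex (g i i false) 0
           else Complex (g i j false / Num.sqrt 2) (g i j true / Num.sqrt 2)
  end.

Definition Wmat (R : realType) (e : ensemble) (N : nat)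
  (g : 'I_N -> 'I_N -> bool -> R) : 'M[R[i]]_N :=
  \matrix_(i, j) if (i <= j)%N then Wentry e g i j else conjc (Wentry e g j i).

Definition Xmat (R : realType) (e : ensemble) (N : nat) (S : 'M[R]_N)
  (A : 'M[R[i]]_N) (g : 'I_N -> 'I_N -> bool -> R) : 'M[R[i]]_N :=
  \matrix_(i, j) (cplx (S i j) * Wmat e g i j) + A.

Definition Xtilde (R : realType) (e : ensemble) (N : nat)
  (A : 'M[R[i]]_N) (g : 'I_N -> 'I_N -> bool -> R) : 'M[R[i]]_N :=
  cplx (Num.sqrt N%:R)^-1 *: Wmat e g + A.

(* prod_{j<s} Tr U_{n_j}(M/2)  (a real number for Hermitian M; we take Re) *)
Definition trU_prod (R : realType) (N s : nat) (n : 'I_s -> nat)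
  (M : 'M[R[i]]_N) : R :=
  complex.Re (\prod_(j < s) \tr (chebU (cplx (2^-1) *: M) (n j))).

Definition admissible_A (R : realType) (e : ensemble) (N : nat) (A : 'M[R[i]]_N) : Prop :=
  match e with GOE => real_symmetric A | GUE => hermitian A end.

(* Main.v *)
(** Expand each U_m as a signed sum over tilings of a cycle by letters X and
    dominoes of weight -1, and apply Wick's formula to the Gaussian letters.
    Since the rows of P sum to 1, dominoes cancel exactly the pairings having
    two adjacent letters matched without a twist.  The expectation becomes a
    sum over involutions of the n letters (fixed letters carry A, pairs carry P)
    with a twist bit (zero for GUE) and no such adjacent pair.

    Contracting maximal ladders of parallel pairs and maximal runs of A-letters
    gives a skeleton with at most 6k + 4s letters, where k is the number of
    pairs minus the number of corner classes free of A; the contracted edges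
    carry powers of P and A.  The kernel of a class made of a single root does
    not matter, so it may be taken uniform.  Weighting an edge of length w by
    (1 + h)^(-w), h = (k+1)/n, decouples the lengths, (B1) bounds the entries of
    the resulting kernels, and the powers of A are at most a^k q(x) q(y) with
    the sum of q^2 at most r by the spectral theorem.  There are at most
    C^(k+s) k^(k+s) skeletons with parameter k, because every class free of A
    and of roots determines one of its letters; summing over k gives (i).  For
    (ii) one replaces the kernels by 1/N one at a time, and (B2) makes the sum
    of the differences over all lengths O(t/N), so that each term gains a factor
    k^2 t/n.  *)

(* A domino may not straddle a root, the first letter of a trace, so an untwisted pair made of the
   last and the first letter of a trace survives the cancellation. Its corner class is a lone root,
   a tail. Each tail weakens the degree inequality by one; this is paid for by not summing over its
   length, which the root positions and the other lengths determine. The linear order of the letters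
   is used twice: the least corner of a class is where its label is first met ([label_sum]), and the
   greatest one is where a partner is already determined ([diagram_determined]). The choice h =
   (k+1)/n costs (1+h)^n <= e^(k+1) and bounds each free length sum by n/(k+1). With T = G(t +
   n/(k+1)), a skeleton is of order T^(k+s) (n/(k+1))^(2k) N^(-k). Multiplied by the number of
   skeletons, the part of T with n/(k+1) leaves (n^3/N)^k/(k!)^2, which sums to exp(C n^(3/2)/sqrt
   N), and the part with t leaves (n^2 t/N)^k/k!. Wick's formula rests on the moment recursion of
   one Gaussian variable, obtained by integration by parts, and on the expectation of products of
   independent factors. *)
From HB Require Import structures.
From mathcomp Require Import all_boot all_order all_algebra.
From mathcomp Require Import zify lra ring boolp.
Set Implicit Arguments.
Unset Strict Implicit.
Unset Printing Implicit Defensive.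
Import Order.TTheory GRing.Theory Num.Theory.

(** * Corner classes of a pairing diagram and the degree inequality *)

Section Diagram.
Variables (M : nat) (Rt : {set 'I_M}) (nx : 'I_M -> 'I_M).
Hypothesis nx_inj : injective nx.
Hypothesis nxP : forall p, (nx p = p.+1 :> nat /\ nx p \notin Rt) \/ (nx p \in Rt /\ nx p <= p).
Variables (rho : 'I_M -> 'I_M) (b : 'I_M -> bool).

(** A side is an end of a letter: [(p, false)] sits at the corner before [p], and [(p, true)] at the
    corner after it. [alp] glues opposite ends for an untwisted pair, as in E[W_xy W_yx], and equal
    ends for a twisted one. *)
Definition side := ('I_M * bool)%type.
Definition cor (s : side) : 'I_M := if s.2 then nx s.1 else s.1.
Definition alp (s : side) : side := (rho s.1, s.2 (+) ~~ b s.1).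
Definition sealed (s : side) : bool := rho s.1 == s.1.
Definition adjr : rel 'I_M := fun p q =>
  [exists s : side, [&& ~~ sealed s, cor s == p & cor (alp s) == q]].
Definition con : rel 'I_M := connect adjr.
(** These are the classes that touch no A-letter; only their labels are summed without the weight
    [q]. *)
Definition pure (p : 'I_M) : bool := [forall s : side, con p (cor s) ==> ~~ sealed s].
Definition lead (p : 'I_M) : bool := [forall q, con p q ==> (p <= q)].
Definition PL : {set 'I_M} := [set p | lead p & pure p].
Definition Frst : {set 'I_M} := [set p : 'I_M | p < rho p].
Definition Alet : {set 'I_M} := [set p : 'I_M | rho p == p].
Definition Scnd : {set 'I_M} := [set p : 'I_M | rho p < p].
(** Roots closed off by an untwisted pair formed by the last and the first letter of their trace.
    Such a root is alone in its class. *)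
Definition tails : {set 'I_M} :=
  [set r in Rt | [exists p, [&& nx p == r, rho p == r, p != r & ~~ b r]]].

Hypothesis rhoK : involutive rho.
Hypothesis brho : forall p, b (rho p) = b p.

Lemma alpK : involutive alp.
Proof. by move=> [p e]; rewrite /alp /= brho rhoK -addbA addbb addbF. Qed.

Lemma sealed_alp s : sealed (alp s) = sealed s.
Proof. by rewrite /sealed /= rhoK eq_sym. Qed.

Lemma adjr_sym : symmetric adjr.
Proof.
suff H p q : adjr p q -> adjr q p by move=> p q; apply/idP/idP; apply: H.
case/existsP=> s /and3P[hs /eqP<- /eqP<-].
by apply/existsP; exists (alp s); rewrite sealed_alp hs alpK !eqxx.
Qed.

Lemma con_sym : symmetric con.
Proof. by apply: sym_connect_sym; apply: adjr_sym. Qed.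

Lemma con_refl p : con p p.
Proof. exact: connect0. Qed.

Lemma con_trans p q r : con p q -> con q r -> con p r.
Proof. exact: connect_trans. Qed.

Lemma con_alp s : ~~ sealed s -> con (cor s) (cor (alp s)).
Proof. by move=> hs; apply: connect1; apply/existsP; exists s; rewrite hs !eqxx. Qed.

Lemma con_eqr p q r : con p q -> con r p = con r q.
Proof.
by move=> h; apply/idP/idP=> h2; [apply: con_trans h2 h | apply: con_trans h2 _; rewrite con_sym].
Qed.

Lemma con_eql p q r : con p q -> con p r = con q r.
Proof. by move=> h; rewrite con_sym (con_eqr _ h) con_sym. Qed.

Lemma pure_con p q : con p q -> pure p = pure q.
Proof.
move=> h; rewrite /pure; apply: eq_forallb => s.
by rewrite (con_eql _ h).
Qed.

Lemma con_closed (T : Type) (x : 'I_M -> T) :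
  (forall s, ~~ sealed s -> x (cor (alp s)) = x (cor s)) ->
  forall p q, con p q -> x p = x q.
Proof.
move=> hx p q /connectP[l]; elim: l p => [|r l IH] p /=; first by move=> _ ->.
case/andP=> /existsP[s /and3P[hs /eqP<- /eqP<-]] hl hq.
by rewrite -(IH _ hl hq) hx.
Qed.

Definition ld (p : 'I_M) : 'I_M := [arg min_(q < p | con p q) (q : nat)].

Lemma ldP p : con p (ld p) /\ (forall q, con p q -> ld p <= q).
Proof. by rewrite /ld; case: arg_minnP => [|q hq hm]; [exact: con_refl|split]. Qed.

Lemma lead_ld p : lead (ld p).
Proof.
have [h1 h2] := ldP p; apply/forallP=> q; apply/implyP=> h.
by apply: h2; apply: con_trans h1 h.
Qed.

Lemma lead_uniq p q : lead p -> lead q -> con p q -> p = q.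
Proof.
move=> /forallP hp /forallP hq h; apply/val_inj/eqP; rewrite /= eqn_leq.
by rewrite (implyP (hp q) h) /= (implyP (hq p)) // con_sym.
Qed.

Lemma lead_ldE p : lead p = (ld p == p).
Proof.
apply/idP/eqP => [h|<-]; last exact: lead_ld.
by apply: lead_uniq h _; [exact: lead_ld|rewrite con_sym; case: (ldP p)].
Qed.

Lemma con_ldE p q : con p q = (ld p == ld q).
Proof.
apply/idP/eqP => [h|h].
  apply: lead_uniq; try exact: lead_ld.
  have [h1 _] := ldP p; have [h2 _] := ldP q.
  by apply: con_trans (con_trans h h2); rewrite con_sym.
have [h1 _] := ldP p; have [h2 _] := ldP q.
by apply: con_trans h1 _; rewrite h con_sym.
Qed.

Lemma ld_lt p : ~~ lead p -> ld p < p.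
Proof.
have [_ h] := ldP p; rewrite lead_ldE => hn.
by rewrite ltn_neqAle hn /=; apply: h; apply: con_refl.
Qed.

Lemma cls_sum (F : 'I_M -> nat) :
  \sum_p F p = \sum_(l | lead l) \sum_(p | con l p) F p.
Proof.
rewrite (partition_big ld lead) /=; last by move=> p _; apply: lead_ld.
apply: eq_bigr => l hl; apply: eq_bigl => p.
by rewrite con_ldE (eqP (_ : ld l == l)) ?[l == _]eq_sym -?lead_ldE.
Qed.

Lemma card_letters : M = #|Frst|.*2 + #|Alet|.
Proof.
have hS : #|Scnd| = #|Frst|.
  rewrite -(card_imset _ (inv_inj rhoK)); apply: eq_card => p; apply/imsetP/idP.
    by case=> q; rewrite !inE => h ->; rewrite rhoK.
  by rewrite !inE => h; exists (rho p); rewrite ?inE ?rhoK.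
rewrite -{1}(card_ord M) -cardsT -(cardsID Frst [set: 'I_M]) setTI.
rewrite -(cardsID Alet (_ :\: _)).
have -> : ([set: 'I_M] :\: Frst) :&: Alet = Alet.
  by apply/setP=> p; rewrite !inE; case: eqP => [->|]; rewrite ?ltnn ?andbF.
have -> : ([set: 'I_M] :\: Frst) :\: Alet = Scnd.
  apply/setP=> p; rewrite !inE andbT -leqNgt (ltn_neqAle _ p).
  by rewrite -val_eqE.
by rewrite hS -addnn; lia.
Qed.

Lemma nx_surj q : exists p, nx p = q.
Proof. by have [g _ h] := injF_bij nx_inj; exists (g q); apply: h. Qed.

Lemma nx_leS p : nx p <= p.+1.
Proof. by case: (nxP p) => -[]; lia. Qed.

(* Each corner carries exactly the two sides (p, start) and (pv p, end). *)
Lemma sum_sides (F : side -> nat) :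
  \sum_s F s = \sum_p \sum_(s | cor s == p) F s.
Proof. by rewrite (partition_big cor predT). Qed.

Lemma cor_sides p p' s : nx p' = p -> (cor s == p) = (s == (p, false)) || (s == (p', true)).
Proof.
move=> h; case: s => q [] /=; rewrite /cor /= !xpair_eqE /= ?andbT ?andbF ?orbF //.
by rewrite -h (inj_eq nx_inj).
Qed.

Lemma sum_cor (F : side -> nat) p p' : nx p' = p ->
  \sum_(s | cor s == p) F s = F (p, false) + F (p', true).
Proof.
move=> h; under eq_bigl do rewrite (cor_sides _ h).
rewrite (bigD1 (p, false)) ?eqxx //= (bigD1 (p', true)) ?eqxx ?orbT //=; last first.
  by rewrite xpair_eqE andbF.
rewrite big1 ?addn0 // => s.
by case/andP=> /andP[/orP[/eqP->|/eqP->]]; rewrite ?eqxx.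
Qed.

Section Reduced.
Hypothesis H1 : forall p, nx p \notin Rt -> rho p = nx p -> b p.
Hypothesis H2 : forall p, nx p \notin Rt -> rho p = p -> rho (nx p) = nx p -> False.
Hypothesis H3 : forall p q, nx p \notin Rt -> nx q \notin Rt -> ~~ b p -> ~~ b q ->
  rho p != p -> rho q != q ->
  rho p = nx q -> rho q = nx p -> False.
Hypothesis H4 : forall p q, nx p \notin Rt -> nx q \notin Rt -> b p -> b (nx p) -> p != q ->
  rho p = q -> rho (nx p) = nx q -> False.

Definition nseal p := \sum_(s | cor s == p) (sealed s : nat).

(** Two adjacent A-letters belong to one run and would have been contracted, except across a
    root. *)
Lemma nseal_le p : nseal p <= 1 + (p \in Rt).
Proof.
have [p' hp'] := nx_surj p.
rewrite /nseal (sum_cor _ hp') /sealed /=.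
case: (boolP (p \in Rt)) => hr; first by case: eqP; case: eqP.
case: eqP => h1; case: eqP => h2 //.
by case: (@H2 p'); rewrite ?hp'.
Qed.

Lemma pure_nseal p : pure p -> nseal p = 0.
Proof.
move=> /forallP h; rewrite /nseal big1 // => s /eqP hs.
by move: (h s); rewrite hs con_refl /= => /negbTE->.
Qed.

(** A class with a single corner forces the two letters around it to be an untwisted pair, so the
    corner is a tail and counts 1 + 1 + 1. A class of two non-roots forces two parallel pairs, which
    [H3] and [H4] exclude; hence a class of two contains a root and counts 2 + 1. *)
Lemma pure_class_size l : pure l -> 3 <= #|[set p | con l p]| + #|[set p in Rt | con l p]|
   + #|[set p in tails | con l p]|.
Proof.
move=> hl; set C := [set p | con l p].
have lC : l \in C by rewrite inE con_refl.
have unseal s : cor s \in C -> ~~ sealed s.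
  by rewrite inE => h; move/forallP: hl => /(_ s); rewrite h.
have clos s : cor s \in C -> cor (alp s) \in C.
  move=> h; have h' := unseal _ h; move: h; rewrite !inE => h.
  by apply: con_trans h (con_alp h').
have [|h3] := leqP 3 #|C|; first by lia.
have [l' hl'] := nx_surj l.
have sealp s : cor s \in C -> alp s != s.
  by move=> /unseal; apply: contra => /eqP hs; rewrite /sealed -{2}hs.
case: (pickP [pred q in C | q != l]) => [q /= /andP[qC ql]|hC]; last first.
  have C1 q : q \in C -> q = l by move=> h; move: (hC q); rewrite /= h /= => /negbFE/eqP.
  have hs : cor (alp (l, false)) == l by apply/eqP/C1/clos.
  rewrite (cor_sides _ hl') (negbTE (sealp _ _)) //= in hs.
  move/eqP: hs; rewrite /alp /= => -[hr hb].
  have hrl' : rho l' = l by rewrite -hr rhoK.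
  have ll' : l' != l.
    by have := unseal (l, false) lC; rewrite /sealed /= hr.
  have lR : l \in Rt.
    apply/negPn/negP=> hn; have := @H1 l'; rewrite hl' => /(_ hn hrl').
    by rewrite -hrl' brho in hb *; move: hb => /negbTE ->.
  have lT : l \in tails.
    rewrite inE lR /=; apply/existsP; exists l'; rewrite hl' hrl' !eqxx ll' /=.
    by move: hb.
  have : 0 < #|[set p in Rt | con l p]| by apply/card_gt0P; exists l; rewrite inE lR con_refl.
  have : 0 < #|[set p in tails | con l p]| by apply/card_gt0P; exists l; rewrite inE lT con_refl.
  have : 0 < #|C| by apply/card_gt0P; exists l.
  by move=> x1 x2 x3; exact: (leq_add (leq_add x1 x3) x2).
have C2 p : p \in C -> (p == l) || (p == q).
  move=> pC; apply/negPn/negP; rewrite negb_or => /andP[h1 h2].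
  suff : 3 <= #|C| by lia.
  have <- : #|[set l; q; p]| = 3.
    by rewrite -setUA cardsU1 cards2 !inE negb_or eq_sym ql /= (eq_sym l) h1 (eq_sym q) h2.
  by apply/subset_leq_card/subsetP => z; rewrite !inE => /orP[/orP[]|] /eqP->; [exact: con_refl|rewrite inE in qC|rewrite inE in pC].
have : 2 <= #|C|.
  have <- : #|[set l; q]| = 2 by rewrite cards2 eq_sym ql.
  by apply/subset_leq_card/subsetP => z; rewrite !inE => /orP[] /eqP->; [exact: con_refl|rewrite inE in qC].
suff [r rR rC] : exists2 r, r \in Rt & con l r.
  have : 0 < #|[set p in Rt | con l p]| by apply/card_gt0P; exists r; rewrite inE rR rC.
  move=> x1 x2; apply: leq_trans (leq_addr _ _); exact: (leq_add x2 x1).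
case: (boolP (l \in Rt)) => [h|lR]; first by exists l => //; apply: con_refl.
case: (boolP (q \in Rt)) => [h|qR]; first by exists q => //; rewrite inE in qC.
exfalso.
have [q' hq'] := nx_surj q.
have sC s : cor s \in C -> [|| s == (l, false), s == (l', true), s == (q, false) | s == (q', true)].
  by move=> /C2; rewrite (cor_sides _ hl') (cor_sides _ hq') -!orbA.
have a1 := sC _ (clos (l, false) lC).
rewrite (negbTE (sealp _ _)) //= in a1.
have nadj : alp (l, false) != (l', true).
  apply/eqP; rewrite /alp /= => -[hr hb].
  have := @H1 l'; rewrite hl' => /(_ lR); rewrite -hr rhoK => /(_ erefl).
  by rewrite brho; move: hb => /negbTE->.
rewrite (negbTE nadj) /= in a1.
have l'C : cor (l', true) \in C by rewrite /cor /= hl'.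
have a2 := sC _ (clos (l', true) l'C).
rewrite (negbTE (sealp _ l'C)) in a2.
have nadj2 : alp (l', true) != (l, false).
  by apply: contra nadj => /eqP <-; rewrite alpK.
rewrite (negbTE nadj2) /= in a2.
(* If a start is glued to a start, both pairs are twisted and [H4] applies; if a start is glued to
   an end, both are straight and [H3] applies. *)
case/orP: a1 => /eqP a1.
  have a3 : alp (l', true) = (q', true).
    by case/orP: a2 => /eqP // a2; have := congr1 alp a2; rewrite -a1 !alpK => /(congr1 snd).
  move: a1 a3; rewrite /alp /= => -[h1 h2] [h3' h4].
  have bl : b l by move: h2; case: (b l).
  have bl' : b l' by move: h4; case: (b l').
  have lq : l' != q' by apply: contra ql => /eqP h; rewrite -hq' -hl' h.
  by apply: (@H4 l' q'); rewrite ?hl' ?hq'.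
have a3 : alp (l', true) = (q, false).
  by case/orP: a2 => /eqP // a2; have := congr1 alp a2; rewrite -a1 !alpK => /(congr1 snd).
move: a1 a3; rewrite /alp /= => -[h1 h2] [h3' h4].
have bl' : ~~ b l' by move: h4; case: (b l').
have bq' : ~~ b q' by rewrite -h1 brho; move: h2; case: (b l).
have ul' := unseal (l', true) l'C.
have uq' : ~~ sealed (q', true) by apply: unseal; rewrite /cor /= hq'.
by apply: (@H3 l' q'); rewrite ?hl' ?hq' // -h1 rhoK.
Qed.

(** Sum over the classes. Pure ones are covered by [pure_class_size]. In the others the sealed
    sides, two for each A-letter, number at most one per corner and one more per root. The count M =
    2F + A of the letters then gives this form. *)
Lemma degree_ineq :
  3 * #|PL| + #|Alet| <= 2 * #|Frst| + #|Rt| + #|tails|.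
Proof.
suff : 3 * #|PL| + 2 * #|Alet| <= M + #|Rt| + #|tails|.
  have := card_letters; lia.
have card_sum (B : {set 'I_M}) : #|B| = \sum_(l | lead l) #|[set p in B | con l p]|.
  rewrite -sum1_card big_mkcond /= cls_sum; apply: eq_bigr => l _.
  rewrite -sum1_card -big_mkcondr /=; apply: eq_bigl => p; rewrite !inE andbC //.
have eM : M = \sum_(l | lead l) #|[set p | con l p]|.
  rewrite -{1}(card_ord M) -cardsT card_sum; apply: eq_bigr => l _.
  by apply: eq_card => p; rewrite !inE.
have eA : 2 * #|Alet| = \sum_(l | lead l) \sum_(p | con l p) nseal p.
  rewrite -cls_sum /nseal -sum_sides.
  have -> : \sum_(s : side) (sealed s : nat) = \sum_p \sum_(e : bool) (rho p == p : nat).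
    by rewrite pair_bigA; apply: eq_bigr => -[].
  under eq_bigr do rewrite big_bool /= addnn -mul2n.
  rewrite -big_distrr /= -sum1_card big_mkcond /=; congr (2 * _).
  by apply: eq_bigr => p _; rewrite !inE; case: eqP.
have eP : 3 * #|PL| = \sum_(l | lead l) (3 * pure l).
  rewrite -big_distrr /= -sum1_card big_mkcond /= [in RHS]big_mkcond /=; congr (3 * _).
  by apply: eq_bigr => p _; rewrite !inE; case: lead; case: pure.
rewrite eP eA [in X in _ <= X + _ + _]eM [X in _ <= _ + X + _]card_sum [X in _ <= _ + X]card_sum -!big_split /=.
apply: leq_sum => l hl; case: (boolP (pure l)) => hp.
  rewrite [X in _ + X]big1 ?addn0 ?muln1; first exact: pure_class_size.
  by move=> p hlp; rewrite pure_nseal // -(pure_con hlp).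
rewrite muln0 add0n; apply: leq_trans (leq_addr _ _).
apply: (@leq_trans (\sum_(p | con l p) (1 + (p \in Rt)))).
  by apply: leq_sum => p _; apply: nseal_le.
rewrite big_split /= sum1_card; apply: eq_leq; congr (_ + _).
  by apply: eq_card => p; rewrite !inE.
rewrite -sum1_card -big_mkcondr /=.
by rewrite big_mkcond [in RHS]big_mkcond; apply: eq_bigr => p _; rewrite !inE andbC; case: con; case: (p \in Rt).
Qed.

End Reduced.
End Diagram.

(** * Summing out single coordinates of a labelling *)

Section Update.
Variables (I T : finType).
Implicit Types (x : {ffun I -> T}).

Definition upd x (p : I) (y : T) : {ffun I -> T} := [ffun q => if q == p then y else x q].

Lemma updE x p y : upd x p y p = y.
Proof. by rewrite ffunE eqxx. Qed.

Lemma updN x p y q : q != p -> upd x p y q = x q.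
Proof. by rewrite ffunE => /negbTE->. Qed.

Lemma upd_id x p : upd x p (x p) = x.
Proof. by apply/ffunP=> q; rewrite ffunE; case: eqP => // ->. Qed.

Lemma upd_upd x p y z : upd (upd x p y) p z = upd x p z.
Proof. by apply/ffunP=> q; rewrite !ffunE; case: eqP. Qed.

(** Exchanging the value at [p] with the fresh value [y] is an involution on pairs (labelling,
    value). This sums out one coordinate without a change of index type. *)
Lemma sum_upd (V : nmodType) (F : {ffun I -> T} -> V) p :
  (\sum_x \sum_y F (upd x p y) = (\sum_x F x) *+ #|T|)%R.
Proof.
pose phi (u : {ffun I -> T} * T) := (upd u.1 p u.2, u.1 p).
have phiK : involutive phi by move=> [x y]; rewrite /phi /= updE upd_upd upd_id.
rewrite (pair_bigA _ (fun x y => F (upd x p y))) /=.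
rewrite (reindex_inj (inv_inj phiK)) /=.
under eq_bigr do rewrite upd_upd upd_id.
rewrite -(pair_bigA _ (fun x (y : T) => F x)) /= -sumrMnl.
by apply: eq_bigr => x _; rewrite sumr_const.
Qed.

End Update.

Section SequentialSum.
Local Open Scope ring_scope.
Variables (R : realFieldType) (M : nat) (T : finType).
Variables (g : 'I_M -> {ffun 'I_M -> T} -> R) (c : 'I_M -> R).
Hypothesis T0 : (0 < #|T|)%N.
Hypothesis g_ge0 : forall p x, 0 <= g p x.
Hypothesis g_loc : forall (p : 'I_M) (x x' : {ffun 'I_M -> T}),
  (forall q : 'I_M, (q <= p)%N -> x q = x' q) -> g p x = g p x'.
Hypothesis g_sum : forall p x, \sum_y g p (upd x p y) <= c p.

(** The last coordinates are summed first, since no earlier factor sees them. Labellings are never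
    truncated: coordinate [pj] is resampled at each step, and the power of [N] counts the
    coordinates that have become free. *)
Lemma seq_sum : \sum_x \prod_p g p x <= \prod_p c p.
Proof.
pose N : R := #|T|%:R.
have N0 : 0 < N by rewrite ltr0n.
have c_ge0 p : 0 <= c p.
  have /card_gt0P[t _] := T0.
  apply: le_trans (g_sum p [ffun=> t]); apply: sumr_ge0 => y _; exact: g_ge0.
have main j : (j <= M)%N ->
    \sum_x \prod_(p < M | (p < j)%N) g p x <= N ^+ (M - j) * \prod_(p < M | (p < j)%N) c p.
  elim: j => [|j IH] hj.
    rewrite [X in _ * X]big_pred0 // mulr1 subn0.
    have -> : \sum_x \prod_(p < M | (p < 0)%N) g p x = \sum_(x : {ffun 'I_M -> T}) 1.
      by apply: eq_bigr => x _; rewrite big_pred0.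
    by rewrite sumr_const card_ffun card_ord natrX.
  pose pj := Ordinal hj.
  have split (F : 'I_M -> R) : \prod_(p < M | (p < j.+1)%N) F p = F pj * \prod_(p < M | (p < j)%N) F p.
    rewrite (bigD1 pj) /= ?leqnn //; congr (_ * _); apply: eq_bigl => p.
    by rewrite ltnS [in RHS]ltn_neqAle andbC.
  rewrite split mulrCA.
  under eq_bigr do rewrite split.
  rewrite -(ler_pM2l N0) mulr_natl -(sum_upd _ pj).
  have -> : N * (c pj * (N ^+ (M - j.+1) * \prod_(p < M | (p < j)%N) c p)) =
            c pj * (N ^+ (M - j) * \prod_(p < M | (p < j)%N) c p).
    by rewrite mulrCA; congr (_ * _); rewrite mulrA -exprS subnSK.
  apply: le_trans (_ : \sum_x c pj * \prod_(p < M | (p < j)%N) g p x <= _); last first.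
    by rewrite -mulr_sumr ler_wpM2l // IH // ltnW.
  apply: ler_sum => x _.
  have e y : \prod_(p < M | (p < j)%N) g p (upd x pj y) = \prod_(p < M | (p < j)%N) g p x.
    apply: eq_bigr => p hp; apply: g_loc => q hq; rewrite updN //.
    by rewrite -val_eqE /= neq_ltn (leq_ltn_trans hq hp).
  under eq_bigr do rewrite e.
  rewrite -mulr_suml ler_wpM2r // prodr_ge0 //.
have := main M (leqnn _); rewrite subnn expr0 mul1r.
have E (F : 'I_M -> R) : \prod_(p < M | (p < M)%N) F p = \prod_p F p.
  by apply: eq_bigl => p; rewrite ltn_ord.
by rewrite E => h; rewrite (le_trans _ h) // ler_sum // => x _; rewrite (E (g^~ x)).
Qed.

End SequentialSum.

Lemma card_involution_even (T : finType) (f : T -> T) (A : {set T}) :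
  involutive f -> (forall s, s \in A -> f s \in A) -> (forall s, s \in A -> f s != s) ->
  ~~ odd #|A|.
Proof.
move=> fK fA fN.
pose A1 := [set s in A | enum_rank s < enum_rank (f s)].
pose A2 := [set s in A | enum_rank (f s) < enum_rank s].
have e12 : #|A1| = #|A2|.
  rewrite -(card_imset _ (inv_inj fK)); apply: eq_card => p; apply/imsetP/idP.
    by case=> q; rewrite !inE => /andP[hA h] ->; rewrite fK fA.
  by rewrite !inE => /andP[hA h]; exists (f p); rewrite ?inE ?fK ?fA.
have e : #|A| = #|A1| + #|A2|.
  rewrite -(cardsID A1 A); congr (_ + _); apply: eq_card => p; rewrite !inE.
    by case: (p \in A).
  case: (boolP (p \in A)) => hA; last by rewrite !andbF.
  by rewrite /= andbT -leqNgt ltn_neqAle (inj_eq val_inj) (inj_eq enum_rank_inj) fN.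
by rewrite e -e12 addnn odd_double.
Qed.

(** * Bounding the sum over consistent labels *)

Section LabelSum.
Local Open Scope ring_scope.
Variables (M : nat) (Rt : {set 'I_M}) (nx : 'I_M -> 'I_M).
Hypothesis nx_inj : injective nx.
Hypothesis nxP : forall p, ((nx p = p.+1 :> nat) /\ nx p \notin Rt) \/ (nx p \in Rt /\ (nx p <= p)%N).
Variables (rho : 'I_M -> 'I_M) (b : 'I_M -> bool).
Hypothesis rhoK : involutive rho.
Hypothesis brho : forall p, b (rho p) = b p.
Hypothesis H1 : forall p, nx p \notin Rt -> rho p = nx p -> b p.

Local Notation cor := (cor nx).
Local Notation alp := (alp rho b).
Local Notation sealed := (sealed rho).
Local Notation con := (con nx rho b).
Local Notation pure := (pure nx rho b).
Local Notation lead := (lead nx rho b).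
Local Notation ld := (ld nx rho b).
Local Notation PL := (PL nx rho b).
Local Notation Frst := (Frst rho).
Local Notation Alet := (Alet rho).

(** Reading the word from left to right, these first letters lead to a label not met before: their
    end corner is a non-root and the least corner of a pure class. *)
Definition newl : {set 'I_M} := [set p in Frst | (nx p \notin Rt) && (nx p \in PL)].

Lemma pure_not_Alet p (e : bool) : pure (cor (p, e)) -> rho p != p.
Proof. by move=> /forallP/(_ (p, e)); rewrite con_refl. Qed.

Lemma lead_min c q : lead c -> con c q -> (c <= q)%N.
Proof. by move=> /forallP/(_ q)/implyP. Qed.

(** Were the partner of [c] earlier, the corner glued to the start of [c] would lie before [c],
    unless it is [c] itself; that is the adjacent untwisted pair excluded by [H1]. *)
Lemma PL_Frst c : c \in PL -> c \in Frst.
Proof.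
rewrite !inE => /andP[hl hp].
have hA := @pure_not_Alet c false hp.
rewrite ltn_neqAle eq_sym hA /= leqNgt; apply/negP => hlt.
have h := @con_alp M nx rho b (c, false) hA.
move: h; rewrite /alp /cor /=; case: (boolP (b c)) => hb /= /(lead_min hl); first by lia.
move=> h2; case: (nxP (rho c)) => -[h3 h4]; last by lia.
have e : nx (rho c) = c by apply: val_inj => /=; lia.
have := @H1 (rho c); rewrite e rhoK brho (negbTE hb) => /(_ _ erefl).
by move: h4; rewrite e => -> /(_ isT).
Qed.

Lemma PL_pred c p : c \in PL -> c \notin Rt -> nx p = c -> p \in Frst.
Proof.
rewrite !inE => /andP[hl hp] hR hc.
have hpc : c = p.+1 :> nat by case: (nxP p); rewrite hc (negbTE hR); lia.
have hA : rho p != p by apply: (@pure_not_Alet p true); rewrite /cor /= hc.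
rewrite ltn_neqAle eq_sym hA /= leqNgt; apply/negP => hlt.
have := @con_alp M nx rho b (p, true) hA.
rewrite /alp /cor /= hc; case: (boolP (b p)) => hb /= /(lead_min hl); last by lia.
by have := nx_leS nxP (rho p); lia.
Qed.

Lemma card_PL_le : (#|PL| <= #|Frst|)%N.
Proof. by apply/subset_leq_card/subsetP => c; apply: PL_Frst. Qed.

Definition pvx (c : 'I_M) : 'I_M := invF nx_inj c.
Lemma pvxK c : nx (pvx c) = c. Proof. exact: f_invF. Qed.
Lemma nxK c : pvx (nx c) = c. Proof. exact: invF_f. Qed.

Lemma newl_imset : nx @: newl = PL :\: Rt.
Proof.
apply/setP=> c; apply/imsetP/idP => [[p]|]; first by rewrite !inE => /and3P[_ h1 h2] ->; rewrite h1.
rewrite inE => /andP[h1 h2]; exists (pvx c); rewrite ?pvxK // inE pvxK h1 h2 andbT.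
by rewrite andbT; exact: PL_pred h2 h1 (pvxK c).
Qed.

Lemma card_PL_split : #|PL| = (#|PL :&: Rt| + #|newl|)%N.
Proof. by rewrite -(cardsID Rt PL) -newl_imset (card_imset _ nx_inj). Qed.

Variables (R : realFieldType) (N : nat).
Local Notation T := 'I_N.
Variables (kap : 'I_M -> T -> T -> R) (mu Rr : 'I_M -> R) (q : T -> R) (r : R).
Hypothesis N0 : (0 < N)%N.
Hypothesis kap_ge0 : forall p x y, 0 <= kap p x y.
Hypothesis kap_mu : forall p x y, kap p x y <= mu p.
Hypothesis kap_R : forall p x, \sum_y kap p x y <= Rr p.
Hypothesis q_ge0 : forall x, 0 <= q x.
Hypothesis q_le1 : forall x, q x <= 1.
Hypothesis q_sum : \sum_x q x ^+ 2 <= r.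
Hypothesis r_ge1 : 1 <= r.

Definition consl (x : {ffun 'I_M -> T}) : bool :=
  [forall s : side M, ~~ sealed s ==> (x (cor (alp s)) == x (cor s))].

Lemma consl_con x p p' : consl x -> con p p' -> x p = x p'.
Proof.
move=> /forallP hx; apply: con_closed => s hs.
by move: (hx s); rewrite hs => /eqP.
Qed.

Definition NPL : {set 'I_M} := [set p | lead p && ~~ pure p].
Definition nsl l : nat := #|[set s : side M | sealed s && con l (cor s)]|.

Lemma pure_nsl l : pure l -> nsl l = 0%N.
Proof.
move=> /forallP h; apply/eqP; rewrite cards_eq0; apply/eqP/setP=> s; rewrite !inE.
by move: (h s); case: (con l _) => /=; [move/negbTE->|rewrite andbF].
Qed.

(** Parity: a class of m corners has 2m sides, and [alp] matches the unsealed ones in pairs, so the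
    number of sealed sides is even. *)
Lemma nsl_ge2 l : ~~ pure l -> (2 <= nsl l)%N.
Proof.
rewrite negb_forall => /existsP[s]; rewrite negb_imply negbK => /andP[h1 h2].
have pos : (0 < nsl l)%N by apply/card_gt0P; exists s; rewrite inE h1 h2.
suff : ~~ odd (nsl l) by move: pos; case: (nsl l) => [|[]].
pose U := [set s : side M | ~~ sealed s && con l (cor s)].
have evU : ~~ odd #|U|.
  apply: (card_involution_even (alpK rhoK brho)) => [s0|s0]; rewrite !inE => /andP[hs hc].
    by rewrite (sealed_alp _ rhoK) hs andTb; apply: (con_trans hc); apply: con_alp.
  by apply: contra hs => /eqP hs; rewrite /sealed -{2}hs.
have tot : (nsl l + #|U| = #|[set p | con l p]|.*2)%N.
  rewrite /nsl /U -!sum1_card.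
  have -> : (\sum_(i in [set s | sealed s && con l (cor s)]) 1)%N =
     (\sum_(s | con l (cor s)) sealed s)%N.
    rewrite big_mkcond [RHS]big_mkcond; apply: eq_bigr => s0 _; rewrite inE; by case: sealed; case: con.
  have -> : (\sum_(i in [set s | ~~ sealed s && con l (cor s)]) 1)%N =
     (\sum_(s | con l (cor s)) ~~ sealed s)%N.
    rewrite big_mkcond [RHS]big_mkcond; apply: eq_bigr => s0 _; rewrite inE; by case: sealed; case: con.
  rewrite -big_split /= -mul2n big_distrr /=.
  rewrite (partition_big cor (con l)) //=.
  rewrite [RHS](eq_bigl (con l)); last by move=> p; rewrite inE.
  apply: eq_bigr => p hp; rewrite (eq_bigl (fun s => cor s == p)); last first.
    by move=> s0; case: eqP => [->|]; rewrite ?hp ?andbF.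
  have [p' hp'] := nx_surj nx_inj p.
  by rewrite (sum_cor nx_inj _ hp'); case: sealed; case: sealed.
have := odd_double #|[set p | con l p]|; rewrite -tot oddD.
by rewrite (negbTE evU) addbF => ->.
Qed.

Lemma sum_nsl : (\sum_(l | lead l) nsl l = 2 * #|Alet|)%N.
Proof.
have -> : (\sum_(l | lead l) nsl l = \sum_(l | lead l) \sum_(p | con l p) \sum_(s | cor s == p) (sealed s : nat))%N.
  apply: eq_bigr => l _; rewrite /nsl -sum1_card.
  rewrite [RHS](_ : _ = \sum_(s | con l (cor s)) (sealed s : nat))%N.
    rewrite big_mkcond [RHS]big_mkcond; apply: eq_bigr => s _; rewrite inE; by case: sealed; case: con.
  rewrite (partition_big cor (con l)) //=; apply: eq_bigr => p hp; apply: eq_bigl => s.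
  by case: eqP => [->|]; rewrite ?hp ?andbF.
rewrite -(cls_sum nx rhoK brho) -sum_sides.
have -> : (\sum_(s : side M) (sealed s : nat) = \sum_p \sum_(e : bool) (rho p == p : nat))%N.
  by rewrite pair_bigA; apply: eq_bigr => -[].
under eq_bigr do rewrite big_bool /= addnn -mul2n.
rewrite -big_distrr /= -sum1_card [in RHS]big_mkcond /=; congr (2 * _)%N.
by apply: eq_bigr => p _; rewrite !inE; case: eqP.
Qed.

Lemma card_NPL_le : (#|NPL| <= #|Alet|)%N.
Proof.
rewrite -(leq_pmul2l (isT : 0 < 2)%N) -sum_nsl -sum1_card big_distrr /=.
rewrite [leqLHS]big_mkcond [leqRHS]big_mkcond /=; apply: leq_sum => l _.
by rewrite inE; case: lead => //=; case: (boolP (pure l)) => //= /nsl_ge2.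
Qed.

(** Grouped by classes, the product contains [q] to the number of sealed sides of each class. This
    number is at least 2 for an impure class, and [q] is at most 1. *)
Lemma qprod_le x : consl x ->
  \prod_(p in Alet) (q (x p) * q (x (nx p))) <= \prod_(l in NPL) q (x l) ^+ 2.
Proof.
move=> hx.
have -> : \prod_(p in Alet) (q (x p) * q (x (nx p))) =
   \prod_(l | lead l) \prod_(s | sealed s && con l (cor s)) q (x l).
  have -> : \prod_(p in Alet) (q (x p) * q (x (nx p))) = \prod_(s | sealed s) q (x (cor s)).
    rewrite big_mkcond /=.
    have -> : \prod_(s | sealed s) q (x (cor s)) =
       \prod_p \prod_(e : bool) (if rho p == p then q (x (cor (p, e))) else 1).
      by rewrite big_mkcond pair_bigA; apply: eq_bigr => -[].
    apply: eq_bigr => p _; rewrite big_bool inE /=; case: eqP => _; last by rewrite mulr1.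
    by rewrite mulrC.
  rewrite (partition_big (fun s => ld (cor s)) lead) /=; last by move=> s _; apply: lead_ld.
  apply: eq_bigr => l hl.
  rewrite (eq_bigl (fun s => sealed s && con l (cor s))); last first.
    by move=> s; rewrite (con_ldE nx rhoK brho) (eqP (_ : ld l == l)) ?[l == _]eq_sym // -lead_ldE.
  by apply: eq_bigr => s /andP[_ /(consl_con hx)->].
rewrite [leRHS]big_mkcond [leLHS]big_mkcond /=; apply: ler_prod => l _.
have -> : \prod_(s | sealed s && con l (cor s)) q (x l) = q (x l) ^+ nsl l.
  by rewrite prodr_const /nsl; congr (_ ^+ _); apply: eq_card => s; rewrite !inE.
rewrite inE; case: lead => /=; last by rewrite ler01 lexx.
rewrite exprn_ge0 //=; case: (boolP (pure l)) => /= hp; first by rewrite pure_nsl.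
by rewrite ler_wiXn2l // nsl_ge2.
Qed.

(** The factor charged to corner [c] when labels are summed from the last corner to the first. The
    leader of a pure class brings a free label (at a root) or a kernel entry, the leader of an
    impure class brings the weight [q], and any other corner copies the label of its leader. *)
Definition gk (c : 'I_M) (x : {ffun 'I_M -> T}) : R :=
  if lead c then if pure c then if c \in Rt then 1 else kap (pvx c) (x (pvx c)) (x c)
                 else q (x c) ^+ 2
  else (x c == x (ld c))%:R.
Definition ck (c : 'I_M) : R :=
  if lead c then if pure c then if c \in Rt then N%:R else Rr (pvx c) else r else 1.

Lemma prod_cases (f1 f2 f3 f4 : 'I_M -> R) :
  \prod_c (if lead c then if pure c then if c \in Rt then f1 c else f2 (pvx c) else f3 c else f4 c)
  = \prod_(c in PL :&: Rt) f1 c * \prod_(p in newl) f2 p * \prod_(c in NPL) f3 c * \prod_(c | ~~ lead c) f4 c.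
Proof.
have -> : \prod_(p in newl) f2 p = \prod_(c in PL :\: Rt) f2 (pvx c).
  rewrite -newl_imset big_imset /=; last by move=> ? ? _ _; apply: nx_inj.
  by apply: eq_bigr => p _; rewrite nxK.
rewrite (big_mkcond (mem (PL :&: Rt))) (big_mkcond (mem (PL :\: Rt))) (big_mkcond (mem NPL)).
rewrite (big_mkcond (fun c => ~~ lead c)) -!big_split /=; apply: eq_bigr => c _.
by rewrite !inE; case: lead => /=; case: pure => /=; case: (c \in Rt) => /=; rewrite ?mulr1 ?mul1r.
Qed.

Lemma pvx_lt c : c \notin Rt -> (pvx c < c)%N.
Proof. by move=> h; case: (nxP (pvx c)); rewrite pvxK (negbTE h); lia. Qed.

(** The letters of [newl] are bounded by row sums, because their end label is being summed there;
    the other first letters are bounded by their largest entry. A pure class led by a root has a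
    free label, hence a factor [N], and an impure class costs at most [r]. *)
Lemma label_sum :
  \sum_(x | consl x) (\prod_(p in Frst) kap p (x p) (x (nx p)) *
                      \prod_(p in Alet) (q (x p) * q (x (nx p))))
  <= N%:R ^+ #|PL :&: Rt| * \prod_(p in Frst) (if p \in newl then Rr p else mu p) * r ^+ #|Alet|.
Proof.
have mu_ge0 p : 0 <= mu p.
  by apply: le_trans (kap_ge0 p (Ordinal N0) (Ordinal N0)) (kap_mu _ _ _).
have R_ge0 p : 0 <= Rr p.
  by apply: le_trans (kap_R p (Ordinal N0)); apply: sumr_ge0 => y _; apply: kap_ge0.
have splitF (F1 F2 : 'I_M -> R) : \prod_(p in Frst) (if p \in newl then F1 p else F2 p) =
   \prod_(p in newl) F1 p * \prod_(p in Frst :\: newl) F2 p.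
  rewrite big_mkcond (big_mkcond (mem newl)) (big_mkcond (mem (Frst :\: newl))) -big_split /=.
  apply: eq_bigr => p _; rewrite in_setD.
  have hN : p \in newl -> p \in Frst by rewrite inE => /andP[].
  by case: (p \in newl) hN => [->//|_] /=; rewrite ?mulr1 // mul1r.
rewrite splitF.
set Q := \prod_(p in Frst :\: newl) mu p.
have Q0 : 0 <= Q by apply: prodr_ge0.
apply: (@le_trans _ _ (\sum_x Q * \prod_c gk c x)).
  rewrite big_mkcond; apply: ler_sum => x _.
  have g0 c : 0 <= gk c x.
    rewrite /gk; case: lead; last by rewrite ler0n.
    by case: pure; [case: (c \in Rt)|]; rewrite ?ler01 ?exprn_ge0.
  case: (boolP (consl x)) => hx; last by rewrite mulr_ge0 // prodr_ge0.
  have -> : \prod_c gk c x = \prod_(p in newl) kap p (x p) (x (nx p)) * \prod_(l in NPL) q (x l) ^+ 2.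
    have := prod_cases (fun=> 1) (fun p => kap p (x p) (x (nx p))) (fun c => q (x c) ^+ 2) (fun=> 1).
    rewrite /= !big1_eq mul1r mulr1 => <-; apply: eq_bigr => c _.
    rewrite /gk pvxK; case: (boolP (lead c)) => // hl.
    by rewrite (consl_con hx (proj1 (ldP nx rho b c))) eqxx.
  rewrite mulrA; apply: ler_pM.
  - by apply: prodr_ge0.
  - by apply: prodr_ge0 => p _; rewrite mulr_ge0.
  - have -> : \prod_(p in Frst) kap p (x p) (x (nx p)) =
      \prod_(p in Frst) (if p \in newl then kap p (x p) (x (nx p)) else kap p (x p) (x (nx p))).
      by apply: eq_bigr => p _; rewrite if_same.
    rewrite splitF mulrC; apply: ler_wpM2r; first by apply: prodr_ge0.
    by apply: ler_prod => p _; rewrite kap_ge0 kap_mu.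
  - exact: qprod_le.
rewrite -mulr_sumr.
apply: (@le_trans _ _ (Q * \prod_c ck c)).
  apply: ler_wpM2l => //; apply: seq_sum.
  - by rewrite card_ord.
  - move=> c x; rewrite /gk; case: lead; last by rewrite ler0n.
    by case: pure; [case: (c \in Rt)|]; rewrite ?ler01 ?exprn_ge0.
  - move=> c x x' h; rewrite /gk; case: (boolP (lead c)) => hl.
      case: pure; last by rewrite h.
      case: (boolP (c \in Rt)) => // hr; rewrite !h //; exact: ltnW (pvx_lt hr).
    by rewrite !h // ltnW // (ld_lt rhoK brho).
  move=> c x; rewrite /gk /ck; case: (boolP (lead c)) => hl.
    case: pure; last by under eq_bigr do rewrite updE.
    case: (boolP (c \in Rt)) => hr; first by rewrite sumr_const card_ord.
    apply: le_trans (kap_R (pvx c) (x (pvx c))); apply: ler_sum => y _.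
    by rewrite updE updN // -val_eqE /= ltn_eqF // pvx_lt.
  have hlt := ld_lt rhoK brho hl.
  have hne : ld c != c by rewrite -val_eqE /= ltn_eqF.
  under eq_bigr do rewrite updE (updN _ _ hne).
  rewrite (bigD1 (x (ld c))) //= eqxx big1 ?addr0 // => y /negbTE->//.
have := prod_cases (fun=> N%:R) Rr (fun=> r) (fun=> 1).
rewrite /= big1_eq mulr1 !prodr_const /ck => ->.
set P := \prod_(p in newl) Rr p.
have P0 : 0 <= P by apply: prodr_ge0.
rewrite (_ : _ * (P * Q) * _ = Q * (N%:R ^+ #|PL :&: Rt| * P * r ^+ #|Alet|)); last by ring.
apply: ler_wpM2l => //; apply: ler_wpM2l; first by rewrite mulr_ge0 ?exprn_ge0 ?ler0n.
by rewrite ler_weXn2l // card_NPL_le.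
Qed.

End LabelSum.

(** * Counting diagrams of given defect *)

Section Forced.
Variables (M : nat) (Rt : {set 'I_M}) (nx : 'I_M -> 'I_M).
Hypothesis nx_inj : injective nx.
Hypothesis nxP : forall p, (nx p = p.+1 :> nat /\ nx p \notin Rt) \/ (nx p \in Rt /\ nx p <= p).

(** Greatest corners of the pure classes without roots. When the letters are read in order, such a
    class is closed at its greatest corner, which leaves a single choice for the partner of the
    letter there. *)
Definition forced (rho : 'I_M -> 'I_M) (b : 'I_M -> bool) : {set 'I_M} :=
  [set p | pure nx rho b p & [forall q, con nx rho b p q ==> (q <= p) && (q \notin Rt)]].

(** The gluings by pairs lying entirely before [p]: what is known of the diagram when letter [p] is
    reached. *)
Definition past (rho : 'I_M -> 'I_M) (b : 'I_M -> bool) (p : nat) : rel 'I_M := fun q q' =>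
  [exists s : side M, [&& s.1 < p, rho s.1 < p, ~~ sealed rho s, cor nx s == q
                        & cor nx (alp rho b s) == q']].

Section One.
Variables (rho : 'I_M -> 'I_M) (b : 'I_M -> bool).
Hypothesis rhoK : involutive rho.
Hypothesis brho : forall p, b (rho p) = b p.
Local Notation cor := (cor nx).
Local Notation alp := (alp rho b).
Local Notation sealed := (sealed rho).
Local Notation con := (con nx rho b).
Local Notation pure := (pure nx rho b).
Local Notation lead := (lead nx rho b).
Local Notation PL := (PL nx rho b).
Local Notation forced := (forced rho b).

Lemma forced_max p q : p \in forced -> con p q -> (q <= p) && (q \notin Rt).
Proof. by rewrite inE => /andP[_ /forallP/(_ q)/implyP]. Qed.

Lemma forced_unsealed p s : p \in forced -> con p (cor s) -> ~~ sealed s.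
Proof. by rewrite inE => /andP[/forallP/(_ s)/implyP]. Qed.

Lemma forced_side_ge p s : p \in forced -> con p (cor s) -> p <= s.1 -> s = (p, false).
Proof.
case: s => q [] hF /(forced_max hF); rewrite /cor /= => /andP[h1 h2] h3.
  by case: (nxP q) => -[]; [lia|rewrite (negbTE h2)].
by congr pair; apply: val_inj => /=; lia.
Qed.

Lemma forced_Scnd : forced \subset Scnd rho.
Proof.
apply/subsetP => p hp; rewrite inE.
have hs : ~~ sealed (p, false) by apply: forced_unsealed hp _; apply: con_refl.
rewrite ltnNge; apply/negP => hge.
have := con_alp nx b hs; rewrite {1}/cor /= => hc.
have e := forced_side_ge hp hc hge.
by move: hs; rewrite /sealed /=; move/(congr1 fst): e => /= ->; rewrite eqxx.
Qed.

(** The greatest corner of a pure class is forced unless the class contains a root. *)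
Lemma card_forced : #|PL| <= #|forced| + #|Rt|.
Proof.
have card_sum (B : {set 'I_M}) : #|B| = \sum_(l | lead l) \sum_(p | con l p) (p \in B : nat).
  by rewrite -sum1_card big_mkcond /= (cls_sum nx rhoK brho).
rewrite -sum1_card big_mkcond /= [X in _ <= X + _]card_sum [X in _ <= _ + X]card_sum -big_split /=.
rewrite [leqRHS]big_mkcond; apply: leq_sum => l _; rewrite inE; case: lead => //=.
case: (boolP (pure l)) => // hl.
case: (pickP [pred p | con l p & p \in Rt]) => [p /= /andP[h1 h2]|hn].
  by rewrite addnC (bigD1 p) //= h2.
pose m := [arg max_(p > l | con l p) (p : nat)].
have [hm hmax] : con l m /\ (forall q, con l q -> q <= m).
  by rewrite /m; case: arg_maxnP => [|i hi hm]; [exact: con_refl|split].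
suff hmF : m \in forced by rewrite (bigD1 m) //= hmF.
rewrite inE -(pure_con rhoK brho hm) hl /=; apply/forallP=> q; apply/implyP=> h.
have hq := con_trans hm h.
by rewrite hmax //=; move: (hn q); rewrite /= hq /= => ->.
Qed.

Lemma past_con p q q' : connect (past rho b p) q q' -> con q q'.
Proof.
apply: connect_sub => x y /existsP[s /and5P[_ _ hs /eqP<- /eqP<-]].
exact: con_alp.
Qed.

Lemma forced_open_side p s : p \in forced -> connect (past rho b p) p (cor s) ->
  s.1 < p -> p <= rho s.1 -> s = alp (p, false).
Proof.
move=> hF /past_con hc h1 h2.
have hs := forced_unsealed hF hc.
rewrite -(forced_side_ge hF (con_trans hc (con_alp _ _ hs)) h2).
by rewrite (alpK rhoK brho).
Qed.

(** Parity again. Otherwise all sides at the past component of [p], except [(p, false)], would be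
    glued among themselves; but their number is odd. *)
Lemma forced_alp_connected p : p \in forced -> connect (past rho b p) p (cor (alp (p, false))).
Proof.
move=> hF; apply/negPn/negP => hn.
pose X := [set q | connect (past rho b p) p q].
pose U := [set s : side M | cor s \in X] :\ (p, false).
have inC s : s \in U -> con p (cor s).
  by rewrite !inE => /andP[_ /past_con].
have ltp s : s \in U -> s.1 < p.
  move=> hs; rewrite ltnNge; apply/negP => /(forced_side_ge hF (inC s hs)) e.
  by move: hs; rewrite e !inE eqxx.
have rlt s : s \in U -> rho s.1 < p.
  move=> hs; rewrite ltnNge; apply/negP => h.
  have e := forced_open_side hF _ (ltp s hs) h.
  have hX : connect (past rho b p) p (cor s) by move: hs; rewrite !inE => /andP[].
  by move: hn; rewrite -e // hX.
have evU : ~~ odd #|U|.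
  apply: (card_involution_even (alpK rhoK brho)) => s hs.
    have hsl := forced_unsealed hF (inC s hs).
    rewrite !inE; apply/andP; split.
      by apply/eqP => e; have := rlt s hs; move/(congr1 fst): e => /= ->; rewrite ltnn.
    have : connect (past rho b p) p (cor s) by move: hs; rewrite !inE => /andP[].
    move=> h; apply: connect_trans h _; apply: connect1.
    by apply/existsP; exists s; rewrite ltp // rlt // hsl !eqxx.
  by have := forced_unsealed hF (inC s hs); apply: contra => /eqP hs'; rewrite /sealed -{2}hs'.
have tot : #|U|.+1 = #|X|.*2.
  have -> : #|U|.+1 = #|[set s : side M | cor s \in X]|.
    have hp : (p, false) \in [set s : side M | cor s \in X] by rewrite !inE connect0.
    by rewrite [RHS](cardsD1 (p, false)) hp.
  rewrite -!sum1_card -mul2n big_distrr /= (partition_big cor (mem X)) /=; last by move=> s; rewrite inE.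
  apply: eq_bigr => q hq; rewrite (eq_bigl (fun s => cor s == q)); last first.
    by move=> s; rewrite inE; case: eqP => [->|]; rewrite ?hq ?andbF.
  have [q' hq'] := nx_surj nx_inj q.
  by rewrite (sum_cor nx_inj _ hq').
by have := odd_double #|X|; rewrite -tot /= (negbTE evU).
Qed.

End One.

(** Induction on the position. At a forced second letter the past component is the same in both
    diagrams, and it has exactly one side of an earlier letter whose partner is not earlier: this is
    the side that the letter must take. *)
Lemma diagram_determined (rho rho' : 'I_M -> 'I_M) (b : 'I_M -> bool) :
  involutive rho -> involutive rho' ->
  (forall p, b (rho p) = b p) -> (forall p, b (rho' p) = b p) ->
  Frst rho = Frst rho' -> Alet rho = Alet rho' -> forced rho b = forced rho' b ->
  {in Scnd rho :\: forced rho b, rho =1 rho'} -> rho =1 rho'.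
Proof.
move=> rhoK rhoK' brho brho' eF eA eD eS.
have eSc : Scnd rho = Scnd rho'.
  apply/setP=> p; move/setP: eF => /(_ p); move/setP: eA => /(_ p); rewrite !inE -!val_eqE /=.
  by case: (ltngtP (rho p) p); case: (ltngtP (rho' p) p).
suff main (p : nat) (q : 'I_M) : q < p -> q \in Scnd rho -> rho q = rho' q.
  move=> q; have [h|hge] := boolP (q \in Scnd rho); first exact: (main q.+1).
  have [/eqP h|h] := boolP (rho q == q).
    by move/setP: eA => /(_ q); rewrite !inE h eqxx => /esym/eqP.
  have qF : q \in Frst rho by move: hge h; rewrite !inE -val_eqE /=; lia.
  have h1 : rho (rho' q) = rho' (rho' q).
    by apply: (main (rho' q).+1) => //; move: qF; rewrite eF eSc !inE rhoK'.
  by rewrite rhoK' in h1; rewrite -[RHS]rhoK h1.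
elim: p q => [|p IH] q //; rewrite ltnS leq_eqVlt => /orP[/eqP ep|]; last exact: IH.
move=> hS; have [hF|hF] := boolP (q \in forced rho b); last first.
  by apply: eS; rewrite inE hF.
have agree (u : 'I_M) : u < q -> rho u < q -> rho' u = rho u.
  move=> hu hru; have [h|hge] := boolP (u \in Scnd rho); first by rewrite (IH u) // -ep.
  have [/eqP h|h] := boolP (rho u == u).
    by move/setP: eA => /(_ u); rewrite !inE h eqxx => /esym/eqP.
  have uF : u \in Frst rho by move: hge h; rewrite !inE -val_eqE /=; lia.
  have : rho (rho u) = rho' (rho u).
    by apply: IH; rewrite -?ep //; move: uF; rewrite !inE rhoK.
  by rewrite rhoK => e; rewrite {1}e rhoK'.
have agree' (u : 'I_M) : u < q -> rho' u < q -> rho' u = rho u.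
  move=> hu hru; have [h|hge] := boolP (u \in Scnd rho); first by rewrite (IH u) // -ep.
  have [/eqP h|h] := boolP (rho u == u).
    by move/setP: eA => /(_ u); rewrite !inE h eqxx => /esym/eqP.
  have uF : u \in Frst rho by move: hge h; rewrite !inE -val_eqE /=; lia.
  have : rho (rho' u) = rho' (rho' u).
    by apply: IH; rewrite -?ep //; move: uF; rewrite eF eSc !inE rhoK'.
  by rewrite rhoK' => e; rewrite -{2}e rhoK.
have hF' : q \in forced rho' b by rewrite -eD.
have epast : past rho b q =2 past rho' b q.
  move=> x y; apply: eq_existsb => s.
  case: (boolP (s.1 < q)) => //= h1; case: (boolP (rho s.1 < q)) => /= h2.
    by rewrite agree // h2 /sealed /alp agree.
  by symmetry; apply/negbTE; apply: contra h2 => /and4P[h2 _ _ _]; rewrite -agree'.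
have h1 := forced_alp_connected rhoK' brho' hF'.
rewrite -(eq_connect epast) in h1.
have rq : rho' q < q by move: hS; rewrite eSc inE.
suff e : alp rho' b (q, false) = alp rho b (q, false) by move/(congr1 fst): e => /= ->.
apply: (forced_open_side rhoK brho hF h1 rq).
rewrite /= leqNgt; apply/negP => h2.
by have := agree _ rq h2; rewrite rhoK' => e; move: h2; rewrite -e ltnn.
Qed.

Lemma card_small_support K :
  #|[set f : {ffun 'I_M -> option 'I_M} | #|[set p | f p != None]| <= K]| <= 2 ^ M * M.+1 ^ K.
Proof.
set S := [set f | _].
have -> : #|S| = \sum_(D : {set 'I_M}) #|[set f in S | [set p | f p != None] == D]|.
  rewrite -sum1_card (partition_big (fun f : {ffun 'I_M -> option 'I_M} => [set p | f p != None]) predT) //=.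
  by apply: eq_bigr => D _; rewrite -sum1_card; apply: eq_bigl => f; rewrite [in RHS]inE.
apply: (@leq_trans (\sum_(D : {set 'I_M}) M.+1 ^ K)); last first.
  by rewrite sum_nat_const -cardsT -powersetT card_powerset cardsT card_ord.
apply: leq_sum => D _; have [hD|hD] := leqP #|D| K; last first.
  rewrite (_ : [set _ in _ | _] = set0) ?cards0 //; apply/setP=> f; rewrite !inE.
  by apply/negbTE/negP => /andP[h /eqP e]; move: h; rewrite e leqNgt hD.
apply: leq_trans (_ : M.+1 ^ #|D| <= _); last by rewrite leq_pexp2l.
have -> : M.+1 ^ #|D| = #|pffun_on (@None 'I_M) D (predT : pred (option 'I_M))|.
  have cO : #|{: option 'I_M}| = M.+1 by rewrite card_option card_ord.
  by rewrite card_pffun_on -cO; congr (_ ^ _); apply: eq_card.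
apply/subset_leq_card/subsetP => f; rewrite !inE => /andP[_ /eqP<-].
apply/pffun_onP; split => //; apply/subsetP => p; rewrite !inE //.
Qed.

(** The code stores [b], the first letters, the A-letters and the partner map on the unforced second
    letters. The first three and the support of the map give 2^M each; the map has at most [K]
    values to be chosen. *)
Lemma count_diagrams K (S : {set {ffun 'I_M -> 'I_M} * {ffun 'I_M -> bool}}) :
  (forall u, u \in S -> [/\ involutive u.1, (forall p, u.2 (u.1 p) = u.2 p)
      & #|Frst u.1| + #|Rt| <= K + #|PL nx u.1 u.2|]) ->
  #|S| <= 16 ^ M * M.+1 ^ K.
Proof.
move=> hS.
pose W := [set f : {ffun 'I_M -> option 'I_M} | #|[set p | f p != None]| <= K].
pose code (u : {ffun 'I_M -> 'I_M} * {ffun 'I_M -> bool}) :=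
  (u.2, (Frst u.1, (Alet u.1,
    [ffun p => if p \in Scnd u.1 :\: forced u.1 u.2 then Some (u.1 p) else None] : {ffun 'I_M -> option 'I_M}))).
have code_inj : {in S &, injective code}.
  move=> [r1 b1] [r2 b2] h1 h2 /= e; have [k1 bb1 _] := hS _ h1; have [k2 bb2 _] := hS _ h2.
  move: e; rewrite /code /= => -[eb eF eA ef]; subst b2; congr pair; apply/ffunP.
  have eSc : Scnd r1 = Scnd r2.
    apply/setP=> p; move/setP: eF => /(_ p); move/setP: eA => /(_ p); rewrite !inE -!val_eqE /=.
    by case: (ltngtP (r1 p) p); case: (ltngtP (r2 p) p).
  have efp p : (p \in Scnd r1 :\: forced r1 b1) = (p \in Scnd r2 :\: forced r2 b1) /\
      (p \in Scnd r1 :\: forced r1 b1 -> r1 p = r2 p).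
    by move/ffunP: ef => /(_ p); rewrite !ffunE; case: ifP => _; case: ifP => _ // -[].
  apply: (diagram_determined k1 k2 bb1 bb2 eF eA).
    apply/setP=> p; have [h _] := efp p; move: h; rewrite !in_setD eSc.
    have s1 := subsetP (forced_Scnd r1 b1) p; have s2 := subsetP (forced_Scnd r2 b1) p.
    rewrite -?eSc in s2 *; move: s1 s2; case: (p \in Scnd r1); rewrite ?andbT ?andbF.
      by move=> _ _; case: (_ \in _); case: (_ \in _).
    by move=> s1 s2 _; apply/idP/idP => [/s1|/s2].
  by move=> p hp; have [_ ->] := efp p.
rewrite -(card_in_imset code_inj).
apply: (@leq_trans #|setX [set: {ffun 'I_M -> bool}] (setX [set: {set 'I_M}] (setX [set: {set 'I_M}] W))|).
  apply/subset_leq_card/subsetP => c /imsetP[u hu ->]; have [k bb hK] := hS _ hu.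
  rewrite !inE /=; apply: (@leq_trans #|Scnd u.1 :\: forced u.1 u.2|).
    by apply/subset_leq_card/subsetP => p; rewrite inE ffunE; case: ifP.
  rewrite cardsD (setIidPr (forced_Scnd _ _)).
  have eSF : #|Scnd u.1| = #|Frst u.1|.
    rewrite -(card_imset _ (inv_inj k)); apply: eq_card => p; apply/imsetP/idP.
      by case=> q; rewrite !inE => h ->; rewrite k.
    by rewrite !inE => h; exists (u.1 p); rewrite ?inE ?k.
  have := card_forced k bb; rewrite eSF; move: hK.
  by move: #|_| #|_| #|_| #|_|; lia.
rewrite !cardsX !cardsT card_ffun card_bool card_ord.
have -> : #|{: {set 'I_M}}| = 2 ^ M by rewrite -cardsT -powersetT card_powerset cardsT card_ord.
have h := card_small_support K.
rewrite (_ : 16 ^ M = 2 ^ M * (2 ^ M * (2 ^ M * 2 ^ M))); last by rewrite -!expnD -(expnM 2 4); congr (2 ^ _); lia.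
by rewrite -!mulnA !leq_mul2l; apply/orP; right; apply/orP; right; apply/orP; right.
Qed.
End Forced.

(** * Links, breaks and ladders in a word of letters *)

Module Ladders.

Section Next.
Variables (M : nat) (rt : pred nat).

(** The start of the trace that contains [p]; [nxn] below is the cyclic successor within that
    trace. *)
Fixpoint rtn (p : nat) : nat := if p is p'.+1 then (if rt p then p else rtn p') else 0.

Lemma rtn_le p : rtn p <= p.
Proof. by elim: p => //= p IH; case: ifP => // _; lia. Qed.

Lemma rtn_root p : rt 0 -> rt (rtn p).
Proof. by move=> h; elim: p => //= p IH; case: ifP. Qed.

Lemma rtn_gap p q : rtn p < q -> q <= p -> ~~ rt q.
Proof.
elim: p => [|p IH] /=; first by case: q.
case: ifP => h h1 h2; first by lia.
move: h2; rewrite leq_eqVlt => /orP[/eqP->|]; first by rewrite h.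
by move=> h2; apply: IH.
Qed.

Lemma rtn_eq p r : rt 0 -> rt r -> r <= p -> (forall q, r < q -> q <= p -> ~~ rt q) -> rtn p = r.
Proof.
move=> h0 hr hle hg; apply/eqP; rewrite eqn_leq; apply/andP; split.
  rewrite leqNgt; apply/negP => h; have := hg _ h (rtn_le p).
  by rewrite rtn_root.
by rewrite leqNgt; apply/negP => h; have := rtn_gap h hle; rewrite hr.
Qed.

Definition nxn (p : nat) : nat := if (p.+1 < M) && ~~ rt p.+1 then p.+1 else rtn p.

Lemma nxn_lt p : p < M -> nxn p < M.
Proof. by move=> h; rewrite /nxn; case: ifP => [/andP[]//|_]; apply: leq_ltn_trans (rtn_le p) h. Qed.

Definition nxo (p : 'I_M) : 'I_M := Ordinal (nxn_lt (ltn_ord p)).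

Definition Rto : {set 'I_M} := [set p : 'I_M | rt p].

Hypothesis rt0 : rt 0.

Lemma nxoP p : (nxo p = p.+1 :> nat /\ nxo p \notin Rto) \/ (nxo p \in Rto /\ nxo p <= p).
Proof.
rewrite !inE /= /nxn; case: ifP => [/andP[h1 h2]|_]; first by left.
by right; rewrite rtn_root // rtn_le.
Qed.

Lemma nxo_inj : injective nxo.
Proof.
suff H (p q : 'I_M) : p < q -> nxo p != nxo q.
  move=> p q h; apply/val_inj; case: (ltngtP p q) => // /H; rewrite h eqxx //.
move=> h; apply/negP => /eqP/(congr1 val) /=; rewrite /nxn.
have hq := ltn_ord q.
case: ifP => [/andP[h1 h2]|h1]; case: ifP => [/andP[h3 h4]|h3]; first by lia.
- by move=> e; move: h2; rewrite e rtn_root.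
- by move=> e; move: h4; rewrite -e rtn_root.
move=> e; have h5 : p.+1 < M by lia.
move: h1; rewrite h5 /= => /negbFE h1.
have := @rtn_gap q p.+1; rewrite -e ltnS rtn_le => /(_ isT); rewrite h1 => /(_ h) //.
Qed.

End Next.

Section Links.
Variables (n : nat) (rt : pred nat) (rn : nat -> nat) (bn : nat -> bool).
Hypothesis rt0 : rt 0.
Hypothesis rn_lt : forall p, p < n -> rn p < n.
Hypothesis rnK : forall p, p < n -> rn (rn p) = p.
Hypothesis bnr : forall p, p < n -> bn (rn p) = bn p.
Hypothesis bnA : forall p, p < n -> rn p = p -> ~~ bn p.
Hypothesis nadj : forall p, p.+1 < n -> ~~ rt p.+1 -> rn p = p.+1 -> bn p.

(* Corner [c] separates the letters [c.-1] and [c]; at a link the partners of these letters are adjacent too, or both letters are fixed. *)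
Definition lk (c : nat) : bool :=
  [&& 0 < c, ~~ rt c & let p := c.-1 in
   [|| (rn p == p) && (rn c == c),
       [&& ~~ bn p, ~~ bn c, rn p != p, rn c != c, rn p == (rn c).+1 & ~~ rt (rn p)] |
       [&& bn p, bn c, rn c == (rn p).+1 & ~~ rt (rn c)]]].

Definition brk (c : nat) : bool := ~~ lk c.

Lemma brk0 : brk 0. Proof. by rewrite /brk /lk. Qed.
Lemma rt_brk c : rt c -> brk c. Proof. by rewrite /brk /lk => ->; rewrite andbF. Qed.

Variant link_spec (c : nat) : Prop :=
| LinkA of rn c.-1 = c.-1 & rn c = c & ~~ bn c.-1 & ~~ bn c
| LinkS of ~~ bn c.-1 & ~~ bn c & rn c.-1 != c.-1 & rn c != c & rn c.-1 = (rn c).+1 & ~~ rt (rn c.-1)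
| LinkT of bn c.-1 & bn c & rn c.-1 != c.-1 & rn c != c & rn c = (rn c.-1).+1 & ~~ rt (rn c).

Lemma lkP c : c < n -> lk c -> [/\ 0 < c, ~~ rt c & link_spec c].
Proof.
move=> hc /and3P[h1 h2 /or3P[/andP[/eqP h3 /eqP h4]|/and5P[h3 h4 h5 h6 /andP[/eqP h7 h8]]|/and4P[h3 h4 /eqP h5 h6]]]; split => //.
- by apply: LinkA => //; apply: bnA => //; lia.
- exact: LinkS.
- apply: LinkT => //.
    by apply/eqP => e; have := @bnA c.-1; rewrite h3 => /(_ _ e); lia.
  by apply/eqP => e; have := @bnA c; rewrite h4 => /(_ hc e).
Qed.

Lemma lkS c : 0 < c -> ~~ rt c -> ~~ bn c.-1 -> ~~ bn c -> rn c.-1 != c.-1 -> rn c != c ->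
  rn c.-1 = (rn c).+1 -> ~~ rt (rn c.-1) -> lk c.
Proof.
move=> h1 h2 h3 h4 h5 h6 h7 h8; rewrite /lk h1 h2 /=; apply/or3P; apply: Or32.
by rewrite h3 h4 h5 h6 h8 /= {1}h7 eqxx.
Qed.

Lemma lkT c : 0 < c -> ~~ rt c -> bn c.-1 -> bn c -> rn c = (rn c.-1).+1 -> ~~ rt (rn c) -> lk c.
Proof.
move=> h1 h2 h3 h4 h7 h8; rewrite /lk h1 h2 /=; apply/or3P; apply: Or33.
by rewrite h3 h4 h8 {1}h7 eqxx.
Qed.

(** The mirror corner of a link on the other side of the ladder: it separates the partners of the
    letters [c.-1] and [c]. *)
Definition lp (c : nat) : nat := if bn c then rn c else (rn c).+1.

Lemma lk_lp c : c < n -> lk c -> rn c != c ->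
  [/\ lp c < n, lk (lp c), rn (lp c) != lp c & lp (lp c) = c] /\
  [/\ lp c != c, bn (lp c) = bn c & lp c = (if bn c then (rn c.-1).+1 else rn c.-1)].
Proof.
move=> hc /(lkP hc)[c0 cr [_ e _ _|b1 b2 n1 n2 e r1|b1 b2 n1 n2 e r1]] hn; first by rewrite e eqxx in hn.
  have hp : c.-1 < n by lia.
  have hl : lp c = rn c.-1 by rewrite /lp (negbTE b2) e.
  have hl1 : (lp c).-1 = rn c by rewrite hl e.
  have r2 := rnK hc; have r3 := rnK hp.
  have hne : lp c != c.
    rewrite hl; apply/eqP => e2; have := @nadj c.-1; rewrite prednK // => /(_ hc cr e2).
    by rewrite (negbTE b1).
  have hlt : lp c < n by rewrite hl rn_lt.
  have bl : bn (lp c) = bn c by rewrite hl bnr // (negbTE b1) (negbTE b2).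
  have rl : rn (lp c) != lp c by rewrite hl r3 eq_sym.
  split; split => //; last by rewrite (negbTE b2).
    apply: lkS; rewrite ?hl1 ?r2 ?hl ?r3 //.
    - by rewrite e.
    - by rewrite bnr.
    - by rewrite bnr.
    - by rewrite eq_sym.
    - by rewrite eq_sym.
    - by rewrite prednK.
  by rewrite /lp -/(lp c) bl (negbTE b2) hl r3 prednK.
have hp : c.-1 < n by lia.
have hl : lp c = rn c by rewrite /lp b2.
have hl1 : (lp c).-1 = rn c.-1 by rewrite hl e.
have r2 := rnK hc; have r3 := rnK hp.
have hlt : lp c < n by rewrite hl rn_lt.
have bl : bn (lp c) = bn c by rewrite hl bnr.
have rl : rn (lp c) != lp c by rewrite hl r2 eq_sym.
split; split => //; last by rewrite b2 hl e.
- apply: lkT; rewrite ?hl1 ?hl ?r2 ?r3 //.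
  + by rewrite e.
  + by rewrite bnr.
  + by rewrite bnr.
  + by rewrite prednK.
- by rewrite /lp -/(lp c) bl b2 hl r2.
- by rewrite hl.
Qed.

Lemma lk_type c : c < n -> lk c ->
  [/\ c.-1 < n, bn c = bn c.-1, (rn c == c) = (rn c.-1 == c.-1) & (rn c < c) = (rn c.-1 < c.-1)].
Proof.
move=> hc /(lkP hc)[c0 cr hs]; have hp : c.-1 < n by lia.
case: hs => [e1 e2 b1 b2|b1 b2 n1 n2 e r1|b1 b2 n1 n2 e r1].
- by rewrite (negbTE b1) (negbTE b2) e1 e2 !eqxx !ltnn.
- rewrite (negbTE b1) (negbTE b2) (negbTE n1) (negbTE n2) e; split => //.
  have hne : rn c.-1 != c.
    apply/eqP => e2; have := @nadj c.-1; rewrite prednK // => /(_ hc cr e2).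
    by rewrite (negbTE b1).
  move: n1 n2 e hne; lia.
- rewrite b1 b2 (negbTE n1) (negbTE n2) e; split => //.
  have : rn c.-1 != c.
    apply/eqP => e2; have h := rnK hp; move: h; rewrite e2 e; lia.
  move: n1 n2 e; lia.
Qed.

Definition stl : seq nat := [seq c <- iota 0 n | brk c].
(** Start of run number [i]. The default value [n] past the last run makes [wid] correct for the
    last run as well. *)
Definition st (i : nat) : nat := nth n stl i.
Definition sM : nat := size stl.
Hypothesis n0 : 0 < n.

Lemma st_sorted : sorted ltn stl.
Proof. by apply: sorted_filter; [apply: ltn_trans|apply: iota_ltn_sorted]. Qed.

Lemma mem_stl c : (c \in stl) = (c < n) && brk c.
Proof. by rewrite mem_filter mem_iota /= add0n andbC. Qed.

Lemma st_mem i : i < sM -> st i \in stl.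
Proof. exact: mem_nth. Qed.

Lemma st_lt i : i < sM -> st i < n.
Proof. by move/st_mem; rewrite mem_stl => /andP[]. Qed.

Lemma st_brk i : i < sM -> brk (st i).
Proof. by move/st_mem; rewrite mem_stl => /andP[]. Qed.

Lemma st_end i : sM <= i -> st i = n.
Proof. by move=> h; rewrite /st nth_default. Qed.

Lemma st_le i : st i <= n.
Proof. by case: (ltnP i sM) => [/st_lt/ltnW|/st_end->]. Qed.

Lemma st_ltS i j : i < sM -> i < j -> st i < st j.
Proof.
move=> hi hij; case: (ltnP j sM) => hj; last by rewrite (st_end hj) st_lt.
by apply: (sorted_ltn_nth ltn_trans n st_sorted); rewrite ?inE.
Qed.

Lemma st_inj i j : i < sM -> j < sM -> st i = st j -> i = j.
Proof.
move=> hi hj e; case: (ltngtP i j) => // h; [have := st_ltS hi h|have := st_ltS hj h];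
by rewrite e ltnn.
Qed.

Lemma st_ex c : c < n -> brk c -> exists2 i, i < sM & st i = c.
Proof.
move=> h1 h2; have hc : c \in stl by rewrite mem_stl h1.
by exists (index c stl); rewrite ?index_mem // /st nth_index.
Qed.

Lemma st0 : 0 < sM /\ st 0 = 0.
Proof.
have [i hi e] := st_ex n0 brk0; have h : 0 < sM by lia.
split => //; case: i hi e => // i hi e.
by have := @st_ltS 0 i.+1 h (ltn0Sn _); rewrite e.
Qed.

Lemma st_gap i c : i < sM -> st i < c -> c < st i.+1 -> lk c.
Proof.
move=> hi h1 h2; apply/negPn/negP => hb.
have hc : c < n by apply: leq_trans h2 (st_le _).
have [j hj e] := st_ex hc hb; subst c.
case: (ltngtP j i) => hij; first by have := st_ltS hj hij; lia.
  case: (ltngtP j i.+1) => hij2; first by lia.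
    have := @st_ltS i.+1 j; lia.
  by rewrite hij2 ltnn in h2.
by rewrite hij ltnn in h1.
Qed.

Lemma st_cover p : p < n -> exists2 i, i < sM & st i <= p < st i.+1.
Proof.
elim: p => [_|p IH hp].
  by have [h1 h2] := st0; exists 0 => //; rewrite h2 /= -{1}h2; apply: st_ltS.
have [i hi /andP[h1 h2]] := IH (ltnW hp).
case: (ltngtP p.+1 (st i.+1)) => h; [|lia|].
  by exists i => //; rewrite h andbT; apply: leqW.
have hi1 : i.+1 < sM by rewrite ltnNge; apply/negP => /st_end; lia.
by exists i.+1; rewrite // h leqnn /=; apply: st_ltS.
Qed.

Lemma st_next j w : j < sM -> 0 < w -> (forall c, st j < c -> c < st j + w -> lk c) ->
  st j + w <= n -> (st j + w < n -> brk (st j + w)) -> st j.+1 = st j + w.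
Proof.
move=> hj w0 hl hle hb.
case: (ltngtP (st j.+1) (st j + w)) => h //.
  have h1 := hl _ (st_ltS hj (ltnSn j)) h.
  have hM : j.+1 < sM by rewrite ltnNge; apply/negP => /st_end; lia.
  by have := st_brk hM; rewrite /brk h1.
have h1 : st j + w < n by apply: leq_trans h (st_le _).
have h2 : st j < st j + w by lia.
by have := st_gap hj h2 h; have := hb h1; rewrite /brk => /negbTE->.
Qed.

Definition wid i := st i.+1 - st i.

Lemma wid_gt0 i : i < sM -> 0 < wid i.
Proof. by move=> h; rewrite subn_gt0 st_ltS. Qed.

Lemma ladder i o : i < sM -> o < wid i ->
  [/\ bn (st i + o) = bn (st i), (rn (st i + o) == st i + o) = (rn (st i) == st i),
      (rn (st i + o) < st i + o) = (rn (st i) < st i)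
    & rn (st i) != st i -> if bn (st i) then rn (st i + o) = rn (st i) + o
                           else rn (st i + o) + o = rn (st i)].
Proof.
move=> hi; elim: o => [|o IH] ho; first by rewrite !addn0; split => //; case: ifP.
have [h1 h2 h3 h4] := IH (ltnW ho).
have hg : lk (st i + o.+1) by apply: (st_gap hi); move: ho; rewrite /wid; lia.
have hn : st i + o.+1 < n by have := st_le i.+1; move: ho; rewrite /wid; lia.
have [k1 k2 k3 k4] := lk_type hn hg.
rewrite addnS /= in k1 k2 k3 k4 *.
rewrite k2 k3 k4 h1 h2 h3; split => // hA; move: (h4 hA) => {}h4.
rewrite addnS in hg hn.
have [_ _ []] := lkP hn hg => /=.
- by move=> e; move: h2; rewrite e eqxx (negbTE hA).
- by rewrite h1 => /negbTE hb; rewrite hb in h4 *; lia.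
- by rewrite h1 => hb; rewrite hb in h4 *; lia.
Qed.

(** Start of the partner run. A straight ladder reverses direction, so there the partner of the last
    letter comes first. *)
Definition sig i := if bn (st i) then rn (st i) else rn (st i.+1).-1.

Lemma st_last i : i < sM -> (st i.+1).-1 = st i + (wid i).-1 /\ (st i.+1).-1 < n.
Proof. by move=> h; have := st_ltS h (ltnSn i); have := st_le i.+1; rewrite /wid; lia. Qed.

(** Links are carried across the ladder by [lk_lp], so the image of a run is a run. It is maximal
    too: a link at one of its ends would be carried back to a link at an end of run [i]. *)
Lemma partner i : i < sM -> rn (st i) != st i ->
  exists2 j, j < sM & [/\ st j = sig i, wid j = wid i, bn (st j) = bn (st i),
    (rn (st j) != st j) && (j != i) & sig j = st i /\ (rn (st j) < st j) = ~~ (rn (st i) < st i)].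
Proof.
move=> hi hA; set w := wid i.
have w0 : 0 < w by apply: wid_gt0.
have [e1 e1n] := st_last hi; rewrite -/w in e1.
have stn := st_lt hi.
have iw : st i + w = st i.+1 by rewrite /w /wid; have := st_ltS hi (ltnSn i); lia.
have L o : o < w -> _ := @ladder i o hi.
have inlk c : st i < c -> c < st i + w -> [/\ c < n, lk c, rn c != c & bn c = bn (st i)].
  move=> h1 h2; have hg : lk c by apply: (st_gap hi); lia.
  have hw : c - st i < w by lia.
  have [k1 k2 k3 k4] := L _ hw; rewrite subnKC in k1 k2; last by lia.
  by split => //; [have := st_le i.+1; lia|rewrite k2].
have [hb|hb] := boolP (bn (st i)).
  have sE : sig i = rn (st i) by rewrite /sig hb.
  have Lr o : o < w -> rn (st i + o) = rn (st i) + o.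
    by move=> ho; have [_ _ _] := L o ho; rewrite hb; apply.
  have sn : sig i < n by rewrite sE rn_lt.
  have sw : sig i + w <= n.
    have : rn (st i + w.-1) < n by apply: rn_lt; lia.
    by rewrite Lr; lia.
  have sr : rn (sig i) = st i by rewrite sE rnK.
  have sA : rn (sig i) != sig i by rewrite sr sE eq_sym.
  have sb : bn (sig i) by rewrite sE bnr.
  have hbrk : brk (sig i).
    apply/negP => hl; have [[p1 p2 p3 p4] [p5 p6 p7]] := lk_lp sn hl sA.
    by move: p2; rewrite /lp sb sr; have := st_brk hi; rewrite /brk => /negbTE->.
  have hint c : sig i < c -> c < sig i + w -> lk c.
    move=> h1 h2; have [q1 q2 q3 q4] := inlk (st i + (c - sig i)) ltac:(lia) ltac:(lia).
    have [[p1 p2 p3 p4] [p5 p6 p7]] := lk_lp q1 q2 q3.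
    move: p2; rewrite /lp q4 hb Lr; last by lia.
    by rewrite -sE subnKC //; lia.
  have hend : sig i + w < n -> brk (sig i + w).
    move=> hn; apply/negP => hl.
    have hpp : sig i + w.-1 < n by lia.
    have [t1 t2 t3 t4] := lk_type hn hl.
    have e2 : (sig i + w).-1 = sig i + w.-1 by lia.
    have rr : rn (sig i + w.-1) = st i + w.-1.
      by rewrite sE -Lr ?rnK //; lia.
    have hA2 : rn (sig i + w) != sig i + w.
      by rewrite t3 e2 rr; move: sA; rewrite sr; lia.
    have [[p1 p2 p3 p4] [p5 p6 p7]] := lk_lp hn hl hA2.
    have hb2 : bn (sig i + w).
      rewrite t2 e2 -[_ + _]rnK // bnr ?rn_lt // rr.
      by have [-> _ _ _] := L w.-1 ltac:(lia).
    rewrite hb2 e2 rr in p7.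
    have e3 : lp (sig i + w) = st i.+1 by rewrite p7; lia.
    have hM : i.+1 < sM by rewrite ltnNge; apply/negP => /st_end; lia.
    by have := st_brk hM; rewrite /brk -e3 p2.
  have [j hj ej] := st_ex sn hbrk; exists j => //.
  have ew : wid j = w.
    by rewrite /wid (@st_next j w hj w0) ?ej //; lia.
  split => //; first by rewrite ej sb.
    rewrite ej sA /=; apply/eqP => e; by move: sA; rewrite sr -ej e eqxx.
  rewrite /sig ej sb sr; split => //.
  by rewrite sE -leqNgt; move: hA; lia.
have sE : sig i = rn (st i + w.-1) by rewrite /sig (negbTE hb) e1.
have Lr o : o < w -> rn (st i + o) + o = rn (st i).
  by move=> ho; have [_ _ _] := L o ho; rewrite (negbTE hb); apply.
have sn : sig i < n by rewrite sE rn_lt //; lia.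
have sr0 : sig i + w.-1 = rn (st i) by rewrite sE Lr //; lia.
have sw : sig i + w <= n.
  have h := rn_lt stn; lia.
have sr : rn (sig i) = st i + w.-1 by rewrite sE rnK //; lia.
have sb : ~~ bn (sig i).
  by rewrite sE bnr; [have [-> _ _ _] := L w.-1 ltac:(lia)|lia].
have sA : rn (sig i) != sig i.
  by rewrite sr sE eq_sym; have [_ -> _ _] := L w.-1 ltac:(lia).
have notAdj : rn (st i.+1).-1 != st i.+1 \/ rt (st i.+1) \/ st i.+1 = n.
  case: (boolP (rt (st i.+1))) => [|hr]; first by right; left.
  case: (ltngtP (st i.+1) n) => h; [left|by have := st_le i.+1; lia|by right; right].
  apply/eqP => e; have := @nadj (st i.+1).-1; rewrite prednK; last by lia.
  move=> /(_ h hr e); rewrite e1; have [-> _ _ _] := L w.-1 ltac:(lia).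
  by rewrite (negbTE hb).
have hbrk : brk (sig i).
  apply/negP => hl; have [[p1 p2 p3 p4] [p5 p6 p7]] := lk_lp sn hl sA.
  have e3 : lp (sig i) = st i.+1 by rewrite /lp (negbTE sb) sr; lia.
  have hM : i.+1 < sM by rewrite ltnNge; apply/negP => /st_end; lia.
  by have := st_brk hM; rewrite /brk -e3 p2.
have hint c : sig i < c -> c < sig i + w -> lk c.
  move=> h1 h2; pose o := w - (c - sig i).
  have [q1 q2 q3 q4] := inlk (st i + o) ltac:(lia) ltac:(lia).
  have [[p1 p2 p3 p4] [p5 p6 p7]] := lk_lp q1 q2 q3.
  have h3 := Lr o ltac:(lia).
  by move: p2; rewrite /lp q4 (negbTE hb) (_ : (rn (st i + o)).+1 = c) //; lia.
have hend : sig i + w < n -> brk (sig i + w).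
  move=> hn; apply/negP => hl.
  have [t1 t2 t3 t4] := lk_type hn hl.
  have e2 : (sig i + w).-1 = rn (st i) by lia.
  have rr : rn (rn (st i)) = st i by rewrite rnK.
  have hA2 : rn (sig i + w) != sig i + w by rewrite t3 e2 rr eq_sym.
  have [[p1 p2 p3 p4] [p5 p6 p7]] := lk_lp hn hl hA2.
  have hb2 : ~~ bn (sig i + w) by rewrite t2 e2 bnr.
  rewrite (negbTE hb2) e2 rr in p7.
  by have := st_brk hi; rewrite /brk -p7 p2.
have [j hj ej] := st_ex sn hbrk; exists j => //.
have ew : wid j = w.
  by rewrite /wid (@st_next j w hj w0) ?ej //; lia.
split => //; first by rewrite ej (negbTE sb).
  rewrite ej sA /=; apply/eqP => e; subst j.
  (* a straight ladder cannot be its own partner: its middle would be a fixed point or an adjacent pair *)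
  have hh := Lr; rewrite -ej in sr sr0.
  have [k|k] := boolP (odd w.-1).
    have h1 := odd_double_half w.-1; rewrite k in h1.
    have h2 := Lr (w.-1)./2 ltac:(lia).
    have h5 := inlk (st i + (w.-1)./2.+1) ltac:(lia) ltac:(lia).
    case: h5 => q1 q2 _ _; have [_ qr _] := lkP q1 q2.
    have := @nadj (st i + (w.-1)./2); rewrite -addnS => /(_ q1 qr).
    have [-> _ _ _] := L (w.-1)./2 ltac:(lia).
    by rewrite (negbTE hb) => /(_ ltac:(lia)).
  have h1 := odd_double_half w.-1; rewrite (negbTE k) in h1.
  have h2 := Lr (w.-1)./2 ltac:(lia).
  have [_ h3 _ _] := L (w.-1)./2 ltac:(lia).
  by move: h3; rewrite (negbTE hA) => /negbT/eqP; apply; lia.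
rewrite /sig ej (negbTE sb).
have e3 : (st j.+1).-1 = rn (st i).
  by have := st_ltS hj (ltnSn j); move: ew; rewrite /wid ej; lia.
rewrite e3 rnK //; split => //.
have [_ _ h3 h4] := L w.-1 ltac:(lia).
by move: sA; rewrite sr; move: h3; rewrite -sE; lia.
Qed.

End Links.

End Ladders.
Import Ladders.

(** * The value of a diagram and the contraction of its ladders *)

Lemma sum_restrict (V : nmodType) (n M : nat) (T : finType) (e : 'I_M -> 'I_n)
    (G : {ffun 'I_M -> T} -> V) : injective e ->
  (\sum_(x : {ffun 'I_n -> T}) G [ffun i => x (e i)] = (\sum_y G y) *+ (#|T| ^ (n - M)))%R.
Proof.
move=> e_inj.
rewrite (partition_big (fun x : {ffun 'I_n -> T} => [ffun i => x (e i)]) predT) //= -sumrMnl.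
apply: eq_bigr => y _; rewrite (eq_bigr (fun=> G y)); last by move=> x /eqP->.
rewrite sumr_const; congr (_ *+ _)%R.
pose F (p : 'I_n) : pred T := fun t => [forall i, (e i == p) ==> (y i == t)].
have -> : #|[pred x : {ffun 'I_n -> T} | [ffun i => x (e i)] == y]| = #|(family F : pred {ffun 'I_n -> T})|.
  apply: eq_card => x; rewrite !inE; apply/eqP/familyP => [h p|h].
    by apply/forallP=> i; apply/implyP=> /eqP<-; rewrite -h ffunE.
  by apply/ffunP=> i; rewrite ffunE; move: (h (e i)) => /forallP/(_ i); rewrite eqxx /= => /eqP.
rewrite card_family foldrE big_map big_enum /=.
rewrite (bigID (mem (codom e))) /= big1 ?mul1n.
  rewrite (eq_bigr (fun=> #|T|)); last first.
    move=> p hp; apply: eq_card => t; rewrite [RHS]inE [LHS]unfold_in /F /=.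
    by apply/forallP=> i; apply/implyP=> /eqP h; case/negP: hp; rewrite -h codom_f.
  rewrite prod_nat_const; congr (_ ^ _).
  have := cardC (mem (codom e)); rewrite card_codom // [X in _ = X]card_ord [X in X + _]card_ord.
  move=> h; apply/eqP; rewrite -(eqn_add2l M) subnKC; last by rewrite -h leq_addr.
  by rewrite -[X in _ == X]h; apply/eqP; congr (_ + _); apply: eq_card => p; rewrite !inE.
move=> p /codomP[i ->]; rewrite -[RHS](card1 (y i)); apply: eq_card => t; rewrite inE unfold_in /F /=.
apply/forallP/eqP => [/(_ i)|-> j]; first by rewrite eqxx => /eqP.
by apply/implyP => /eqP/e_inj->.
Qed.

(** A pair is weighted once, at its first letter; a second letter acts only through the consistency
    of the labels. *)
Definition dval (F : numFieldType) (M N : nat) (nx rho : 'I_M -> 'I_M) (b : 'I_M -> bool)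
    (K : 'I_M -> 'M[F]_N) : F :=
  (\sum_(x : {ffun 'I_M -> 'I_N} | consl nx rho b x)
     \prod_(p | p \notin Scnd rho) K p (x p) (x (nx p)))%R.

Section Compress.
Variables (n : nat) (rt : pred nat).
Variables (rho : 'I_n -> 'I_n) (b : 'I_n -> bool).
Hypothesis rt0 : rt 0.
Hypothesis n0 : 0 < n.
Hypothesis rhoK : involutive rho.
Hypothesis brho : forall p, b (rho p) = b p.
Hypothesis bA : forall p, rho p = p -> ~~ b p.
Local Notation nx := (@nxo n rt).
Local Notation Rt := (Rto n rt).
Hypothesis adjfree : forall p, nx p \notin Rt -> rho p = nx p -> b p.

Definition rn (p : nat) : nat := if insub p is Some q then rho q else p.
Definition bn (p : nat) : bool := if insub p is Some q then b q else false.

Lemma rnE (p : 'I_n) : rn p = rho p.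
Proof. by rewrite /rn valK. Qed.
Lemma bnE (p : 'I_n) : bn p = b p.
Proof. by rewrite /bn valK. Qed.

Lemma rn_lt p : p < n -> rn p < n.
Proof. by move=> h; rewrite (rnE (Ordinal h)). Qed.
Lemma rnK p : p < n -> rn (rn p) = p.
Proof. by move=> h; rewrite (rnE (Ordinal h)) rnE rhoK. Qed.
Lemma bnr p : p < n -> bn (rn p) = bn p.
Proof. by move=> h; rewrite (rnE (Ordinal h)) bnE brho -(bnE (Ordinal h)). Qed.
Lemma bnA p : p < n -> rn p = p -> ~~ bn p.
Proof.
move=> h; rewrite (rnE (Ordinal h)) (bnE (Ordinal h)) => e.
by apply: bA; apply: val_inj.
Qed.
Lemma nadj p : p.+1 < n -> ~~ rt p.+1 -> rn p = p.+1 -> bn p.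
Proof.
move=> h h1 e; have hp := ltnW h.
rewrite (bnE (Ordinal hp)); apply: adjfree; first by rewrite !inE /= /nxn h h1.
by apply: val_inj => /=; rewrite -(rnE (Ordinal hp)) /= e /nxn h h1.
Qed.

Local Notation stl := (stl n rt rn bn).
Local Notation st := (st n rt rn bn).
Local Notation sM := (sM n rt rn bn).
Local Notation sig := (sig n rt rn bn).
Local Notation wid := (wid n rt rn bn).
Local Notation brk := (brk rt rn bn).
Local Notation lk := (lk rt rn bn).

Variable M : nat.
Hypothesis hM : sM = M.

Lemma iM (i : 'I_M) : i < sM. Proof. by rewrite hM. Qed.
Hint Resolve iM : core.

Definition srho (i : 'I_M) : 'I_M :=
  if rn (st i) == st i then i else insubd i (index (sig i) stl).
Definition sb (i : 'I_M) : bool := bn (st i).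
Definition srt : pred nat := fun k => rt (st k).
Local Notation snx := (@nxo M srt).

Lemma srt0 : srt 0.
Proof. by have [_ h] := @st0 n rt rn bn rt0 n0; rewrite /srt h. Qed.

Lemma srhoP (i : 'I_M) : rn (st i) != st i ->
  [/\ st (srho i) = sig i, wid (srho i) = wid i, bn (st (srho i)) = bn (st i),
      (rn (st (srho i)) != st (srho i)) && (srho i != i) &
      sig (srho i) = st i /\ (rn (st (srho i)) < st (srho i)) = ~~ (rn (st i) < st i)].
Proof.
move=> hA; have [j hj [e1 e2 e3 e4 e5]] := partner rt0 rn_lt rnK bnr bnA nadj n0 (iM i) hA.
have hj' : j < M by rewrite -hM.
have -> : srho i = Ordinal hj'.
  apply: val_inj; rewrite /srho (negbTE hA) /= val_insubd -e1 /st index_uniq ?hj' //.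
  by apply: filter_uniq; apply: iota_uniq.
by split.
Qed.

Lemma srho_A (i : 'I_M) : (srho i == i) = (rn (st i) == st i).
Proof.
have [h|h] := boolP (rn (st i) == st i); first by rewrite /srho h eqxx.
by apply/negbTE; have [_ _ _ /andP[]] := srhoP h.
Qed.

Lemma srhoK : involutive srho.
Proof.
move=> i; have [hA|hA] := boolP (rn (st i) == st i).
  by have := hA; rewrite -srho_A => /eqP e; rewrite e e.
have [e1 _ _ /andP[hA2 _] [e2 _]] := srhoP hA.
have [e3 _ _ _ _] := srhoP hA2.
by apply: ord_inj; apply: (st_inj (iM _) (iM _)); rewrite e3.
Qed.

Lemma sbrho i : sb (srho i) = sb i.
Proof.
have [hA|hA] := boolP (rn (st i) == st i); last by rewrite /sb; have [] := srhoP hA.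
by have := hA; rewrite -srho_A => /eqP->.
Qed.

Lemma sbA i : srho i = i -> ~~ sb i.
Proof. by move/eqP; rewrite srho_A => /eqP; apply: bnA; apply: st_lt. Qed.

Lemma wid_srho i : wid (srho i) = wid i.
Proof.
have [hA|hA] := boolP (rn (st i) == st i); last by have [] := srhoP hA.
by have := hA; rewrite -srho_A => /eqP->.
Qed.

Definition stO (i : 'I_M) : 'I_n := Ordinal (st_lt (iM i)).

Lemma enO_subproof (i : 'I_M) : (st i.+1).-1 < n.
Proof. by case: (st_last rt0 n0 (iM i)). Qed.
Definition enO (i : 'I_M) : 'I_n := Ordinal (enO_subproof i).

Lemma enOE (i : 'I_M) : enO i = st i + (wid i).-1 :> nat.
Proof. by case: (st_last rt0 n0 (iM i)). Qed.

Lemma stO_inj : injective stO.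
Proof.
by move=> i j /(congr1 val) /= e; apply: ord_inj; apply: (st_inj (iM _) (iM _)).
Qed.

Lemma st_snx i : stO (snx i) = nx (enO i).
Proof.
apply: val_inj; rewrite /= /nxn.
have hlt := st_ltS (iM i) (ltnSn i); have hle := st_le n rt rn bn i.+1.
rewrite prednK; last by lia.
case: (ltnP i.+1 M) => h1 /=; last first.
  rewrite (@st_end n rt rn bn i.+1) ?hM // ltnn /=; symmetry; apply: rtn_eq => //.
  - by have := rtn_root i srt0.
  - have := rtn_le srt i; rewrite leq_eqVlt => /orP[/eqP->|h].
      by have := st_lt (iM i); lia.
    have : st (rtn srt i) < st i by apply: st_ltS => //; rewrite hM; have := ltn_ord i; lia.
    by have := st_lt (iM i); lia.
  move=> q hq1 hq2; apply/negP => hr.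
  have hqn : q < n by lia.
  have [j hj ej] := st_ex hqn (rt_brk rn bn hr); subst q.
  have hj2 : rtn srt i < j.
    rewrite ltnNge leq_eqVlt; apply/negP => /orP[/eqP ej|hjr]; first by rewrite ej ltnn in hq1.
    by have := st_ltS hj hjr; lia.
  have := @rtn_gap srt i j hj2; rewrite /srt hr => hh.
  by have := hh ltac:(lia).
have hn1 : st i.+1 < n by apply: st_lt; rewrite hM.
rewrite hn1 /= -/(srt i.+1); case: (boolP (srt i.+1)) => hr //=.
symmetry; apply: rtn_eq => //.
- by have := rtn_root i srt0.
- have := rtn_le srt i; rewrite leq_eqVlt => /orP[/eqP->|h]; first by lia.
  have : st (rtn srt i) < st i by apply: st_ltS => //; rewrite hM; have := ltn_ord i; lia.
  by lia.
move=> q hq1 hq2; apply/negP => hrq.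
have hqn : q < n by lia.
have [j hj ej] := st_ex hqn (rt_brk rn bn hrq); subst q.
have hj2 : rtn srt i < j.
  rewrite ltnNge leq_eqVlt; apply/negP => /orP[/eqP ej|hjr]; first by rewrite ej ltnn in hq1.
  by have := st_ltS hj hjr; lia.
have hj3 : j <= i.
  rewrite leqNgt; apply/negP => h; have : st i.+1 <= st j; last by lia.
  case: (ltngtP i.+1 j) h => // [h _|<- //]; apply: ltnW; apply: st_ltS => //; rewrite hM //.
by have := @rtn_gap srt i j hj2 hj3; rewrite /srt hrq.
Qed.

(** The two ends of a skeleton letter are the outer ends of its run: the start of the first letter
    and the end of the last one. *)
Definition rside (s : side M) : side n := if s.2 then (enO s.1, true) else (stO s.1, false).

Lemma rside_cor s : cor nx (rside s) = stO (cor snx s).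
Proof. by case: s => i [] /=; rewrite /cor /= ?st_snx. Qed.

Lemma ladderO (i : 'I_M) : [/\ b (enO i) = sb i & (rho (enO i) == enO i) = (srho i == i)].
Proof.
have hw : (wid i).-1 < wid i by rewrite prednK // wid_gt0.
have [h1 h2 _ _] := ladder rt0 rnK bnA nadj n0 (iM i) hw.
rewrite -bnE enOE h1; split => //.
by rewrite srho_A -h2 -enOE rnE.
Qed.

Lemma rside_sealed s : sealed rho (rside s) = sealed srho s.
Proof.
case: s => i [] /=; rewrite /sealed /=; first by have [] := ladderO i.
by rewrite srho_A -(inj_eq val_inj) /= -(rnE (stO i)).
Qed.

Lemma rside_alp s : ~~ sealed srho s ->
  cor nx (alp rho b (rside s)) = stO (cor snx (alp srho sb s)).
Proof.
case: s => i e; rewrite /sealed /= srho_A => hA.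
have [e1 e2 e3 /andP[e4 _] [e5 _]] := srhoP hA.
have hw : (wid i).-1 < wid i by rewrite prednK // wid_gt0.
have [h1 h2 _ /(_ hA) h3] := ladder rt0 rnK bnA nadj n0 (iM i) hw.
have ben : b (enO i) = sb i by have [] := ladderO i.
have bst : b (stO i) = sb i by rewrite -bnE.
case: e => /=; rewrite /alp /rside /=.
  rewrite ben; case: (boolP (sb i)) => hb /=.
    rewrite /cor /= st_snx; congr (nx _); apply: ord_inj.
    rewrite -rnE !enOE; rewrite /sb in hb; rewrite hb in h3.
    by rewrite h3 e2 e1 /sig hb.
  rewrite /cor /=; apply: val_inj; rewrite /= -rnE e1 /sig.
  by rewrite /sb in hb; rewrite (negbTE hb).
rewrite bst; case: (boolP (sb i)) => hb /=.
  rewrite /cor /=; apply: val_inj; rewrite /= -rnE e1 /sig.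
  by rewrite /sb in hb; rewrite hb.
rewrite /cor /= st_snx; congr (nx _); apply: val_inj; rewrite /= -rnE.
move: e5; rewrite /sig e3; rewrite /sb in hb; rewrite (negbTE hb) => e5.
by have := rnK (enO_subproof (srho i)); rewrite e5.
Qed.

Lemma rn_en (i : 'I_M) : rn (st i.+1).-1 = rho (enO i).
Proof. by rewrite -rnE. Qed.

Lemma snx_notin i : snx i \notin Rto M srt ->
  [/\ snx i = i.+1 :> nat, i.+1 < M, ~~ rt (st i.+1) & enO i = (st i.+1).-1 :> nat].
Proof.
by rewrite inE /= /nxn; case: ifP => [/andP[h1 h2] _|_]; [split|rewrite rtn_root // srt0].
Qed.

(** [skel_H1] to [skel_H4] say that the skeleton is reduced. An untwisted adjacent pair of runs
    would give such a pair of letters in the word; each of the other forbidden configurations would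
    make a break into a link. *)
Lemma skel_H1 i : snx i \notin Rto M srt -> srho i = snx i -> sb i.
Proof.
move=> /snx_notin[h1 h2 h3 h4] e; apply/negPn/negP => hb.
have hA : rn (st i) != st i.
  by rewrite -srho_A e; apply/eqP => /(congr1 (@nat_of_ord _)); rewrite h1; lia.
have [e1 _ _ _ _] := srhoP hA.
have hlt := st_ltS (iM i) (ltnSn i).
have hn : st i.+1 < n by apply: st_lt; rewrite hM.
have en : bn (st i.+1).-1 = sb i by have [<- _] := ladderO i; rewrite -bnE.
have hb' : bn (st i) = false by apply/negbTE.
move: e1; rewrite e h1 /sig hb' => e1.
have := @nadj (st i.+1).-1; rewrite prednK; last by lia.
by move=> /(_ hn h3 (esym e1)); rewrite en (negbTE hb).
Qed.

Lemma skel_H2 i : snx i \notin Rto M srt -> srho i = i -> srho (snx i) = snx i -> False.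
Proof.
move=> /snx_notin[h1 h2 h3 h4] /eqP e /eqP.
rewrite srho_A h1 => e2; have hM1 : i.+1 < sM by rewrite hM.
have := st_brk hM1; rewrite /Ladders.brk /Ladders.lk h3.
have hlt := st_ltS (iM i) (ltnSn i); rewrite (leq_ltn_trans _ hlt) //=.
rewrite rn_en -h4 (inj_eq val_inj); have [_ ->] := ladderO i.
by rewrite e e2.
Qed.

Lemma skel_H3 p q : snx p \notin Rto M srt -> snx q \notin Rto M srt -> ~~ sb p -> ~~ sb q ->
  srho p != p -> srho q != q -> srho p = snx q -> srho q = snx p -> False.
Proof.
move=> /snx_notin[h1 h2 h3 h4] /snx_notin[k1 k2 k3 k4] bp bq np nq ep eq.
have hM1 : p.+1 < sM by rewrite hM.
have := st_brk hM1; rewrite /Ladders.brk => /negP; apply.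
have hp := np; have hq := nq; rewrite srho_A in hp; rewrite srho_A in hq.
have [e1 _ e2 /andP[e3 _] [e4 _]] := srhoP hp; have [f1 _ f2 /andP[f3 _] [f4 _]] := srhoP hq.
have bp' := bp; have bq' := bq; rewrite /sb in bp' bq'.
rewrite /sig (negbTE bp') ep k1 in e1; rewrite /sig (negbTE bq') eq h1 in f1.
have lp := st_ltS (iM p) (ltnSn p); have lq := st_ltS (iM q) (ltnSn q).
have [ben sen] := ladderO p; have [ben' sen'] := ladderO q.
have np1 : st p.+1 < n by apply: st_lt.
have r1 : rn (st p.+1) = (st q.+1).-1.
  by rewrite f1 rnK //; exact: enO_subproof.
apply: lkS => //.
- by apply: leq_ltn_trans lp.
- by rewrite -h4 bnE ben.
- by rewrite -h1 -eq f2.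
- by rewrite rn_en -h4 (inj_eq val_inj) sen.
- by rewrite -h1 -eq.
- by rewrite -e1 r1 prednK //; apply: leq_ltn_trans lq.
- by rewrite -e1.
Qed.

Lemma skel_H4 p q : snx p \notin Rto M srt -> snx q \notin Rto M srt -> sb p -> sb (snx p) -> p != q ->
  srho p = q -> srho (snx p) = snx q -> False.
Proof.
move=> /snx_notin[h1 h2 h3 h4] /snx_notin[k1 k2 k3 k4] bp bp1 npq ep eq.
have hM1 : p.+1 < sM by rewrite hM.
have := st_brk hM1; rewrite /Ladders.brk => /negP; apply.
have hp : rn (st p) != st p by rewrite -srho_A ep eq_sym.
have hp1 : rn (st (snx p)) != st (snx p).
  apply/eqP => h; have /eqP e0 : srho (snx p) == snx p by rewrite srho_A; apply/eqP.
  by have := sbA e0; rewrite bp1.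
have [e1 w1 e2 /andP[e3 _] [e4 _]] := srhoP hp; have [f1 _ f2 /andP[f3 _] [f4 _]] := srhoP hp1.
have bp' := bp; have bp1' := bp1; rewrite /sb in bp' bp1'.
rewrite /sig bp' ep in e1; rewrite /sig bp1' eq h1 k1 in f1.
have lp := st_ltS (iM p) (ltnSn p); have lq := st_ltS (iM q) (ltnSn q).
have [ben sen] := ladderO p.
have hw : (wid p).-1 < wid p by rewrite prednK // wid_gt0.
have [_ _ _ /(_ hp)] := ladder rt0 rnK bnA nadj n0 (iM p) hw.
rewrite bp' -enOE h4 => r1.
have r2 : (rn (st p.+1).-1).+1 = st q.+1.
  by rewrite r1 -e1; rewrite ep in w1; move: w1; rewrite /wid; clear -lp lq; lia.
apply: lkT => //.
- by apply: leq_ltn_trans lp.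
- by rewrite -h4 bnE ben.
- by rewrite -h1.
- by rewrite -f1 r2.
- by rewrite -f1.
Qed.

Lemma brk_stO i : brk (stO i).
Proof. exact: st_brk. Qed.

Lemma stO_ex (p : 'I_n) : brk p -> exists i, p = stO i.
Proof.
move=> h; have [i hi e] := st_ex (ltn_ord p) h.
have hi' : i < M by rewrite -hM.
by exists (Ordinal hi'); apply: ord_inj.
Qed.

Lemma li_ex (p : 'I_n) : exists i : 'I_M, st i <= p < st i.+1.
Proof.
have [i hi h] := @st_cover n rt rn bn rt0 n0 _ (ltn_ord p).
have hi' : i < M by rewrite -hM.
by exists (Ordinal hi').
Qed.

Definition li (p : 'I_n) : 'I_M := xchoose (li_ex p).
Lemma liP (p : 'I_n) : st (li p) <= p < st (li p).+1.
Proof. exact: (xchooseP (li_ex p)). Qed.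

Lemma li_uniq (p : 'I_n) (i : 'I_M) : st i <= p < st i.+1 -> li p = i.
Proof.
move=> /andP[h1 h2]; have /andP[h3 h4] := liP p.
have key (u v : 'I_M) : u < v -> st v <= p -> p < st u.+1 -> False.
  move=> huv hv hu; have : st u.+1 <= st v; last by move: hu hv; clear; lia.
  case: (ltngtP u.+1 v) huv => // [h _|<- //].
  by apply: ltnW; apply: st_ltS => //; rewrite hM; apply: ltn_trans h _.
by apply: ord_inj; case: (ltngtP (li p) i) => // h; [case: (key _ _ h)|case: (key _ _ h)].
Qed.

Lemma li_stO i : li (stO i) = i.
Proof. by apply: li_uniq; rewrite leqnn /=; apply: st_ltS. Qed.

(** The end corner of the run through [p]; [ln] counts the letters from [p] to that end. *)
Definition eg (p : 'I_n) : 'I_n := stO (snx (li p)).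
Definition ln (p : 'I_n) : nat := st (li p).+1 - p.

Lemma li_lk (p q : 'I_n) : q = p.+1 :> nat -> lk q -> li q = li p /\ nx p = q.
Proof.
move=> e hl; have /andP[h1 h2] := liP p.
have qn := ltn_ord q.
split; last first.
  apply: ord_inj; rewrite /= /nxn -e qn /=.
  by have [_ -> _] := lkP rt0 bnA qn hl.
apply: li_uniq; rewrite e ltnW //= ltn_neqAle h2 andbT; apply/eqP => e2.
have hM2 : (li p).+1 < sM by rewrite ltnNge; apply/negP => /st_end; rewrite -e2 -e; move: qn; clear; lia.
by have := st_brk hM2; rewrite -e2 -e /Ladders.brk hl.
Qed.

Lemma ln_end (p : 'I_n) : (p.+1 < n -> brk p.+1) -> ln p = 1 /\ eg p = nx p.
Proof.
move=> h; have /andP[h1 h2] := liP p.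
have e : st (li p).+1 = p.+1.
  apply/eqP; rewrite eq_sym eqn_leq h2 leqNgt; apply/negP => h3.
  have hn : p.+1 < n by apply: leq_trans h3 (st_le _ _ _ _ _).
  have := st_gap rt0 n0 (iM (li p)) _ h3; rewrite ltnS h1 => /(_ isT).
  by have := h hn; rewrite /Ladders.brk => /negbTE->.
split; first by rewrite /ln e subSnn.
by rewrite /eg st_snx; congr (nx _); apply: ord_inj; rewrite /= e.
Qed.

Lemma ln_lk (p q : 'I_n) : q = p.+1 :> nat -> lk q -> ln p = (ln q).+1 /\ eg p = eg q.
Proof.
move=> e hl; have [e1 _] := li_lk e hl; rewrite /ln /eg e1; split => //.
have /andP[_ h2] := liP q; rewrite e1 e in h2; rewrite e; move: h2; clear; lia.
Qed.

(** The corner glued to the start of [p]; at a link between paired letters it is the mirror corner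
    [lp]. *)
Definition lpO (p : 'I_n) : 'I_n := cor nx (alp rho b (p, false)).

Lemma lpO_val (p : 'I_n) : lk p -> rho p != p -> lpO p = lp rn bn p :> nat.
Proof.
move=> hl hA; have hA' : rn p != p by rewrite rnE.
have [[p1 p2 _ _] _] := lk_lp rt0 rn_lt rnK bnr bnA nadj (ltn_ord p) hl hA'.
have [_ r1 _] := lkP rt0 bnA p1 p2.
move: p1 r1; rewrite /lpO /lp bnE rnE /alp /cor /=; case: (b p) => //= p1 r1.
by rewrite /nxn p1 r1.
Qed.

Lemma lpO_pred (p0 p : 'I_n) : p = p0.+1 :> nat -> lk p -> rho p != p ->
  cor nx (alp rho b (p0, true)) = lpO p.
Proof.
move=> e hl hA; have hA' : rn p != p by rewrite rnE.
have [[p1 p2 _ _] [_ _ p7]] := lk_lp rt0 rn_lt rnK bnr bnA nadj (ltn_ord p) hl hA'.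
have [_ r1 _] := lkP rt0 bnA p1 p2.
have [_ tb _ _] := lk_type rt0 rnK bnA nadj (ltn_ord p) hl.
apply: ord_inj; rewrite lpO_val // p7 e /= in tb *.
rewrite p7 e /= in p1 r1; move: p1 r1; rewrite tb bnE rnE /alp /cor /=.
by case: (b p0) => //= p1 r1; rewrite /nxn p1 r1.
Qed.

Lemma lpO_facts (p : 'I_n) : lk p -> rho p != p ->
  [/\ lk (lpO p), rho (lpO p) != lpO p, lpO (lpO p) = p,
      (lpO p \in Scnd rho) = (p \notin Scnd rho) & (p \in Scnd rho -> lpO p < p)].
Proof.
move=> hl hA; have hA' : rn p != p by rewrite rnE.
have [[p1 p2 p3 p4] [p5 p6 p7]] := lk_lp rt0 rn_lt rnK bnr bnA nadj (ltn_ord p) hl hA'.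
have ev := lpO_val hl hA.
have hA2 : rho (lpO p) != lpO p by rewrite -(inj_eq val_inj) /= -rnE ev.
have hl2 : lk (lpO p) by rewrite ev.
have [c0 _ _] := lkP rt0 bnA (ltn_ord p) hl.
have [q1 q2 q3 q4] := lk_type rt0 rnK bnA nadj (ltn_ord p) hl.
have hlt : (rn p < p) -> lp rn bn p < p.
  rewrite p7 q2; case: ifP => hb h; last by rewrite q4 in h; apply: ltn_trans h _; rewrite prednK.
  by rewrite q4 in h; apply: leq_ltn_trans h _; rewrite prednK.
split => //.
- by apply: ord_inj; rewrite lpO_val // ev.
- rewrite !inE -!rnE ev; move: p7; rewrite /lp; case: ifP => hb h7.
    by rewrite rnK // -leqNgt ltn_neqAle eq_sym hA'.
  have hA1 : rn p.-1 != p.-1 by rewrite -q3.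
  by rewrite q4 h7 rnK // -leqNgt ltn_neqAle eq_sym hA1.
- by rewrite inE -rnE ev.
Qed.

Lemma Scnd_lk (p0 p : 'I_n) : p = p0.+1 :> nat -> lk p ->
  [/\ (p \in Scnd rho) = (p0 \in Scnd rho) & (rho p == p) = (rho p0 == p0)].
Proof.
move=> e hl; have [_ _ q3 q4] := lk_type rt0 rnK bnA nadj (ltn_ord p) hl.
rewrite e /= in q3 q4; rewrite !inE -!(inj_eq val_inj) /= -!rnE e.
by split.
Qed.

Definition rx (T : finType) (x : {ffun 'I_n -> T}) : {ffun 'I_M -> T} := [ffun i => x (stO i)].

(** The gluings at the ends of runs are those of the skeleton. Those inside a ladder identify each
    linked corner with its mirror, and it is enough to ask this at the second letters, since
    mirroring exchanges first and second letters. *)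
Lemma consl_compress N (x : {ffun 'I_n -> 'I_N}) :
  consl nx rho b x = consl snx srho sb (rx x) &&
    [forall p : 'I_n, (p \in Scnd rho) && lk p ==> (x p == x (lpO p))].
Proof.
apply/idP/andP => [/forallP h|[/forallP h1 /forallP h2]].
  split.
    apply/forallP=> s; apply/implyP=> hs; rewrite !ffunE -rside_alp // -rside_cor.
    by move: (h (rside s)); rewrite rside_sealed hs.
  apply/forallP=> p; apply/implyP=> /andP[hS hl]; rewrite eq_sym.
  have hA : rho p != p by apply/eqP => e; move: hS; rewrite inE e ltnn.
  by move: (h (p, false)); rewrite /sealed /= hA.
have clink (p : 'I_n) : lk p -> rho p != p -> x (lpO p) = x p.
  move=> hl hA; have [f1 f2 f3 f4 _] := lpO_facts hl hA.
  case: (boolP (p \in Scnd rho)) => hS.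
    by move: (h2 p); rewrite hS hl /= => /eqP.
  by move: (h2 (lpO p)); rewrite f4 hS f1 f3 /= => /eqP.
apply/forallP => -[p e]; apply/implyP; rewrite /sealed /= => hA; apply/eqP.
case: e.
  have [hl|hl] := boolP ((p.+1 < n) && lk p.+1).
    case/andP: hl => hn hl; pose q := Ordinal hn.
    have eq : q = p.+1 :> nat by [].
    have [_ eA] := Scnd_lk eq hl; have [_ enx] := li_lk eq hl.
    have hAq : rho q != q by rewrite eA.
    by rewrite (lpO_pred eq hl hAq) clink // /cor /= enx.
  have hb : p.+1 < n -> brk p.+1 by move=> hn; move: hl; rewrite hn.
  have ep : p = enO (li p).
    apply: ord_inj => /=; have [e _] := ln_end hb; have /andP[_ k] := liP p.
    by move: e k; rewrite /ln; clear; lia.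
  have hs : ~~ sealed srho (li p, true) by rewrite -rside_sealed /rside /sealed /= -ep.
  move: (h1 (li p, true)); rewrite hs /= !ffunE -rside_alp // -rside_cor /rside /= -ep.
  by move/eqP.
have [hl|hb] := boolP (lk p).
  by rewrite -/(lpO p) clink.
have [i ei] := stO_ex hb.
have hs : ~~ sealed srho (i, false) by rewrite -rside_sealed /rside /sealed /= -ei.
move: (h1 (i, false)); rewrite hs /= !ffunE -rside_alp // -rside_cor /rside /= -ei.
by move/eqP.
Qed.

Section Values.
Local Open Scope ring_scope.
Variables (F : numFieldType) (N : nat) (K : 'I_n -> 'M[F]_N).
Hypothesis N0 : (0 < N)%N.
Hypothesis Klk : forall p q : 'I_n, q = p.+1 :> nat -> lk q -> K q = K p.

(** Interpolates between the word and its skeleton. Letters well before [j] carry their own kernels,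
    runs starting at or after [j] carry one power, and letter [j - 1] carries the power for what
    remains of its run, itself included. *)
Let psi (j : nat) (p : 'I_n) (x : {ffun 'I_n -> 'I_N}) : F :=
  if (p.+1 < j)%N then K p (x p) (x (nx p))
  else if (p.+1 == j) || brk p then (K p ^+ ln p) (x p) (x (eg p)) else 1.
Let wt (j : nat) (p : 'I_n) (x : {ffun 'I_n -> 'I_N}) : F :=
  if p \in Scnd rho then (if lk p && (p < j)%N then (x p == x (lpO p))%:R else 1) else psi j p x.
Let Phi (j : nat) (x : {ffun 'I_n -> 'I_N}) : F :=
  (consl snx srho sb (rx x))%:R * \prod_p wt j p x.

Lemma eg_brk p : brk (eg p). Proof. exact: brk_stO. Qed.

Lemma rx_upd (x : {ffun 'I_n -> 'I_N}) (p : 'I_n) y : lk p -> rx (upd x p y) = rx x.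
Proof.
move=> hl; apply/ffunP=> i; rewrite !ffunE; case: eqP => // e.
by have := brk_stO i; rewrite e /Ladders.brk hl.
Qed.

Lemma Phi_brk (j : 'I_n) x : brk j -> Phi j.+1 x = Phi j x.
Proof.
move=> hb; congr (_ * _); apply: eq_bigr => p _; rewrite /wt.
case: (boolP (p \in Scnd rho)) => hS.
  have [e|ne] := eqVneq p j; first by move: hb; rewrite -e /Ladders.brk => /negbTE->.
  by rewrite ltnS [in LHS]leq_eqVlt -val_eqE in ne *; rewrite (negbTE ne).
rewrite /psi; have [h|h|h] := ltngtP p.+1 j.
- by rewrite ltnW.
- have -> : (p.+1 < j.+1)%N = false by move: h; clear; lia.
  have [e|ne] := eqVneq p j; first by rewrite e eqxx hb.
  by rewrite eqSS (negbTE (_ : (p : nat) != j)).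
- rewrite h ltnSn /=.
  have [e1 e2] : ln p = 1%N /\ eg p = nx p by apply: ln_end => _; rewrite h.
  by rewrite e1 e2 expr1.
Qed.

(** [Phi j] does not depend on the label at the link [j], which explains the factor [N]. In
    [Phi j.+1] this label is the inner index of a matrix product, or, at a second letter, pinned to
    the mirror label. *)
Lemma Phi_lk (j : 'I_n) : lk j -> (\sum_x Phi j.+1 x) *+ N = \sum_x Phi j x.
Proof.
move=> hl; have [j0 _ _] := lkP rt0 bnA (ltn_ord j) hl.
have hp0 : (j.-1 < n)%N by apply: leq_ltn_trans (leq_pred j) _.
pose p0 := Ordinal hp0.
have ej : j = p0.+1 :> nat by rewrite /= prednK.
have [eS eA] := Scnd_lk ej hl.
have [_ enx] := li_lk ej hl.
have [eln eeg] := ln_lk ej hl.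
rewrite -[X in _ *+ X](card_ord N) -(sum_upd _ j); apply: eq_bigr => x _.
have egj p : eg p != j by apply/eqP => e; have := eg_brk p; rewrite e /Ladders.brk hl.
rewrite /Phi; under [LHS]eq_bigr => y _ do rewrite (rx_upd x y hl).
rewrite -mulr_sumr; congr (_ * _).
have nxj p : p != p0 -> nx p != j by apply: contra => /eqP h; apply/eqP/(nxo_inj rt0); rewrite enx.
have pj p : p != p0 -> p.+1 != j :> nat by apply: contra => /eqP h; apply/eqP/ord_inj => /=; rewrite -h.
have rest p y : p != j -> (p != p0) || (p0 \in Scnd rho) -> wt j.+1 p (upd x j y) = wt j p x.
  move=> hpj hp0'; have hpj' : (p : nat) != j by rewrite val_eqE.
  rewrite /wt; case: (boolP (p \in Scnd rho)) => hS.
    have -> : (p < j.+1)%N = (p < j)%N by rewrite ltnS leq_eqVlt (negbTE hpj').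
    case: (boolP (lk p && (p < j)%N)) => // /andP[hlp hlt].
    have hA : rho p != p by apply/eqP => e; move: hS; rewrite inE e ltnn.
    have [f1 f2 f3 f4 f5] := lpO_facts hlp hA.
    rewrite !updN //; apply/eqP => e.
    by have := f5 hS; rewrite e ltnNge ltnW.
  have hne : p != p0.
    by case/orP: hp0' => // h; apply/eqP => e; move: hS; rewrite e h.
  rewrite /psi; have [h|h|h] := ltngtP p.+1 j.
  - by rewrite ltnW // !updN // nxj.
  - have -> : (p.+1 < j.+1)%N = false by move: h; clear; lia.
    by rewrite eqSS (negbTE hpj') /=; case: ifP => // _; rewrite !updN.
  - by move: (pj p hne); rewrite h eqxx.
have [hS|hS] := boolP (j \in Scnd rho).
  have hA : rho j != j by apply/eqP => e; move: hS; rewrite inE e ltnn.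
  have [f1 f2 f3 f4 f5] := lpO_facts hl hA.
  have hlpj : lpO j != j by apply/eqP => e; move: (f5 hS); rewrite e ltnn.
  rewrite (bigD1 j) //= [wt j j x]/wt hS hl ltnn mul1r.
  under [LHS]eq_bigr => y _.
    rewrite (bigD1 j) //= [wt j.+1 j _]/wt hS hl ltnSn /= updE updN //.
    under eq_bigr => p hp do rewrite rest // -?eS ?hS ?orbT //.
    over.
  rewrite -mulr_suml (bigD1 (x (lpO j))) //= eqxx big1 ?addr0 ?mul1r // => y /negbTE->//.
have hS0 : p0 \notin Scnd rho by rewrite -eS.
have p0j : p0 != j by rewrite -val_eqE /= ltn_eqF // prednK.
rewrite (bigD1 j) //= (bigD1 p0) //= [wt j j x]/wt (negbTE hS) [wt j p0 x]/wt (negbTE hS0).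
rewrite /psi ltnNge leqnSn /= /Ladders.brk hl orbF (gtn_eqF (ltnSn j)) mul1r.
rewrite -ej ltnn eqxx /=.
under [LHS]eq_bigr => y _.
  rewrite (bigD1 j) //= (bigD1 p0) //= [wt j.+1 j _]/wt (negbTE hS) [wt j.+1 p0 _]/wt (negbTE hS0).
  rewrite /psi ltnn eqxx /= -ej ltnSn.
  rewrite (updN _ _ (egj j)) updE enx updE (updN _ _ p0j).
  under eq_bigr => p /andP[hp1 hp2] do rewrite (rest _ _ hp1) ?hp2 //.
  rewrite mulrA; over.
rewrite -mulr_suml eln eeg exprS -[(_ * _ : 'M_N) _ _]/((_ *m _) _ _) mxE.
congr (_ * _); apply: eq_bigr => y _; rewrite mulrC (Klk ej hl) //.
Qed.

Lemma Scnd_stO i : (stO i \in Scnd rho) = (i \in Scnd srho).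
Proof.
rewrite !inE -rnE /=; have [hA|hA] := boolP (rn (st i) == st i).
  have := hA; rewrite -srho_A => /eqP->; rewrite (eqP hA) !ltnn //.
have [e1 e2 e3 _ [e4 e5]] := srhoP hA.
have keyst (u v : 'I_M) : (u < v)%N -> (st u < st v)%N by move=> h; apply: st_ltS.
have stlt (u v : 'I_M) : (u < v)%N = (st u < st v)%N.
  apply/idP/idP; first exact: keyst.
  by case: (ltngtP u v) => // [/keyst|/ord_inj->]; [move: (st u) (st v); clear; lia|rewrite ltnn].
rewrite stlt e1 /sig; case: ifP => // hb.
have hw : ((wid i).-1 < wid i)%N by rewrite prednK // wid_gt0.
have [_ _ h3 h4] := ladder rt0 rnK bnA nadj n0 (iM i) hw.
move: (h4 hA); rewrite hb => h5.
have [e6 _] := st_last rt0 n0 (iM i); rewrite e6.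
have : rn (st i) != st i by [].
move: h3 h5; move: (rn (st i)) (st i) (rn _) ((wid i).-1); clear; lia.
Qed.

(** From position 0 to [n] the interpolation picks up one factor [N] at each link. There are n - M
    links, as many as the labels that the skeleton forgets, so these factors cancel. *)
Lemma dval_compress :
  dval nx rho b K = dval snx srho sb (fun i => K (stO i) ^+ wid i).
Proof.
have S1 : dval nx rho b K = \sum_x Phi n x.
  rewrite /dval big_mkcond; apply: eq_bigr => x _.
  rewrite consl_compress /Phi; case: (consl snx srho sb (rx x)) => /=; last by rewrite mul0r.
  rewrite mul1r [RHS](bigID (fun p => p \in Scnd rho)) /=.
  have -> : \prod_(i | i \notin Scnd rho) wt n i x = \prod_(p | p \notin Scnd rho) K p (x p) (x (nx p)).
    apply: eq_bigr => p /negbTE hp; rewrite /wt hp /psi.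
    case: ifP => // h; have e : p.+1 = n by have := ltn_ord p; move: h; clear; lia.
    have [-> ->] : ln p = 1%N /\ eg p = nx p by apply: ln_end; rewrite e ltnn.
    by rewrite e eqxx expr1.
  case: ifP => [/forallP h|/negbT].
    rewrite [X in _ = X * _]big1 ?mul1r // => p hp; rewrite /wt hp ltn_ord andbT; case: ifP => // hl.
    by move: (h p); rewrite hp hl /= => ->.
  rewrite negb_forall => /existsP[p]; rewrite negb_imply => /andP[/andP[h1 h2] h3].
  by rewrite (bigD1 p) //= /wt h1 h2 ltn_ord (negbTE h3) !mul0r.
pose cnt j := count lk (iota 0 j).
have S2 j : (j <= n)%N -> (\sum_x Phi j x) *+ (N ^ cnt j) = \sum_x Phi 0 x.
  elim: j => [|j IH] hj; first by rewrite /cnt /= expn0.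
  have -> : cnt j.+1 = (cnt j + lk j)%N by rewrite /cnt -[in LHS]addn1 iotaD count_cat /= add0n addn0.
  rewrite -IH ?(ltnW hj) //.
  case: (boolP (lk j)) => hl.
    by rewrite addn1 expnS mulrnA (Phi_lk (j := Ordinal hj) hl).
  by rewrite addn0; congr (_ *+ _); apply: eq_bigr => x _; rewrite (Phi_brk (j := Ordinal hj)).
have S3 : \sum_x Phi 0 x = (dval snx srho sb (fun i => K (stO i) ^+ wid i)) *+ (N ^ (n - M)).
  pose G (y : {ffun 'I_M -> 'I_N}) : F := if consl snx srho sb y then
    \prod_(p | p \notin Scnd srho) (K (stO p) ^+ wid p) (y p) (y (snx p)) else 0.
  have -> : dval snx srho sb (fun i => K (stO i) ^+ wid i) = \sum_y G y by rewrite /dval big_mkcond.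
  rewrite -[X in (X ^ _)%N](card_ord N) -(sum_restrict _ stO_inj).
  apply: eq_bigr => x _; rewrite -/(rx x) /Phi /G.
  case: (consl snx srho sb (rx x)); last by rewrite mul0r.
  rewrite mul1r (bigID (fun p : 'I_n => brk p)) /= [X in _ * X]big1 ?mulr1; last first.
    move=> p; rewrite /Ladders.brk negbK => hl; rewrite /wt /psi hl /=.
    by case: ifP => // _; rewrite /Ladders.brk hl.
  rewrite (eq_bigl (mem [set stO i | i : 'I_M])); last first.
    move=> p; rewrite inE; apply/idP/imsetP => [/stO_ex[i ->]|[i _ ->]]; first by exists i.
    exact: brk_stO.
  rewrite big_imset /=; last by move=> ? ? _ _; apply: stO_inj.
  rewrite [RHS]big_mkcond; apply: eq_big => [i|i _]; first by rewrite inE.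
  rewrite /wt Scnd_stO /= andbF; case: (i \in Scnd srho) => //=.
  by rewrite /psi /= brk_stO !ffunE /eg /ln li_stO.
have cn : cnt n = (n - M)%N.
  rewrite -hM /Ladders.sM /Ladders.stl size_filter.
  have := count_predC lk (iota 0 n); rewrite size_iota -[X in _ = X -> _]/n => h.
  by rewrite -[X in (X - _)%N]h addnK.
have := S2 n (leqnn n); rewrite -S1 S3 cn => /eqP; rewrite -subr_eq0 -mulrnBl mulrn_eq0.
by rewrite expn_eq0 -[(N == 0)%N]negbK -lt0n N0 /= subr_eq0 => /eqP.
Qed.

End Values.

End Compress.

(** * Recovering a diagram from its skeleton and its run positions *)

Section Injective.
Variables (n : nat) (rt : pred nat).
Hypothesis rt0 : rt 0.
Hypothesis n0 : 0 < n.
Local Notation nx := (@nxo n rt).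
Local Notation Rt := (Rto n rt).

(** Fixed letters get the bit false, so that each diagram occurs once. The last clause is what
    remains after the cancellation by dominoes. *)
Definition rawdiag (rho : 'I_n -> 'I_n) (b : 'I_n -> bool) : Prop :=
  [/\ involutive rho, forall p, b (rho p) = b p, forall p, rho p = p -> ~~ b p
    & forall p, nx p \notin Rt -> rho p = nx p -> b p].

Variables (rho1 rho2 : 'I_n -> 'I_n) (b1 b2 : 'I_n -> bool).
Hypothesis D1 : rawdiag rho1 b1.
Hypothesis D2 : rawdiag rho2 b2.
Variable M : nat.
Local Notation stA := (st n rt (rn rho1) (bn b1)).
Local Notation stB := (st n rt (rn rho2) (bn b2)).
Hypothesis hM1 : sM n rt (rn rho1) (bn b1) = M.
Hypothesis hM2 : sM n rt (rn rho2) (bn b2) = M.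
Hypothesis est : forall i, i < M -> stA i = stB i.
Hypothesis erho : forall i : 'I_M, @srho n rt rho1 b1 M i = @srho n rt rho2 b2 M i.
Hypothesis eb : forall i : 'I_M, @sb n rt rho1 b1 M i = @sb n rt rho2 b2 M i.

Lemma stAB i : stA i = stB i.
Proof. by case: (ltnP i M) => [/est//|h]; rewrite !st_end ?hM1 ?hM2. Qed.

Lemma compress_inj : rho1 =1 rho2 /\ b1 =1 b2.
Proof.
have [k1 r1 a1 d1] := D1; have [k2 r2 a2 d2] := D2.
suff main (p : 'I_n) : rn rho1 p = rn rho2 p /\ bn b1 p = bn b2 p.
  split=> p; first by apply: ord_inj; case: (main p); rewrite !rnE.
  by case: (main p) => _; rewrite !bnE.
have [i hp] := li_ex rt0 n0 hM1 p.
have hpB : stB i <= p < stB i.+1 by rewrite -!stAB.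
have wA : p - stA i < wid n rt (rn rho1) (bn b1) i.
  by move: hp; rewrite /wid; clear; lia.
have wB : p - stA i < wid n rt (rn rho2) (bn b2) i.
  by move: hpB; rewrite /wid -!stAB; clear; lia.
have iA : i < sM n rt (rn rho1) (bn b1) by rewrite hM1.
have iB : i < sM n rt (rn rho2) (bn b2) by rewrite hM2.
have [A1 A2 _ A3] := ladder rt0 (rnK k1) (bnA a1) (nadj d1) n0 iA wA.
have [B1 B2 _ B3] := ladder rt0 (rnK k2) (bnA a2) (nadj d2) n0 iB wB.
have eo : stA i + (p - stA i) = p by move: hp; clear; lia.
have eoB : stB i + (p - stA i) = p by rewrite -stAB.
rewrite eo in A1 A2 A3; rewrite eoB in B1 B2 B3.
have ebi : bn b1 (stA i) = bn b2 (stB i) := eb i.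
split; last by rewrite A1 B1.
have fixE : (rn rho1 (stA i) == stA i) = (rn rho2 (stB i) == stB i).
  rewrite -(srho_A rt0 n0 k1 r1 a1 d1 hM1) -(srho_A rt0 n0 k2 r2 a2 d2 hM2).
  by rewrite erho.
have [hA|hA] := boolP (rn rho1 (stA i) == stA i).
  have hB := hA; rewrite fixE in hB.
  by rewrite hA in A2; rewrite hB in B2; rewrite (eqP A2) (eqP B2).
have hB := hA; rewrite fixE in hB.
have [e1 e2 e3 _ [e4 _]] := srhoP rt0 n0 k1 r1 a1 d1 hM1 hA.
have [f1 f2 f3 _ [f4 _]] := srhoP rt0 n0 k2 r2 a2 d2 hM2 hB.
move: (A3 hA) (B3 hB); rewrite ebi; case: ifP => hb2.
  move=> -> ->; congr (_ + _).
  by move: e1 f1; rewrite /sig ebi hb2 => <- <-; rewrite erho stAB.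
move: e4 f4; rewrite /sig e3 f3 ebi hb2 => e4 f4.
have g1 := rnK k1 (enO_subproof rt0 n0 hM1 (@srho n rt rho1 b1 M i)).
have g2 := rnK k2 (enO_subproof rt0 n0 hM2 (@srho n rt rho2 b2 M i)).
rewrite e4 in g1; rewrite f4 in g2; rewrite g1 g2 erho stAB.
by rewrite stAB => h1 h2; apply/eqP; rewrite -(eqn_add2r (p - stB i)) h1 h2.
Qed.
End Injective.

Definition ptt M (Rs : {set 'I_M}) : pred nat :=
  fun k => [exists i : 'I_M, (i == k :> nat) && (i \in Rs)].

Lemma pttE M (Rs : {set 'I_M}) (i : 'I_M) : ptt Rs i = (i \in Rs).
Proof.
apply/existsP/idP => [[j /andP[/eqP/ord_inj->]]//|h].
by exists i; rewrite eqxx.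
Qed.

Lemma Rto_ptt M (Rs : {set 'I_M}) : Rto M (ptt Rs) = Rs.
Proof. by apply/setP=> i; rewrite inE pttE. Qed.

Definition nxS M (Rs : {set 'I_M}) : 'I_M -> 'I_M := @nxo M (ptt Rs).

Lemma nxo_ext M (r1 r2 : pred nat) : (forall k, k < M -> r1 k = r2 k) -> @nxo M r1 = @nxo M r2.
Proof.
move=> h; apply/funext => p; apply: ord_inj; rewrite /= /nxn.
have -> : (p.+1 < M) && ~~ r1 p.+1 = (p.+1 < M) && ~~ r2 p.+1.
  by case: ltnP => //= hp; rewrite h.
case: ifP => // _; have := ltn_ord p; elim: (nat_of_ord p) => //= k IH hk.
by rewrite h // IH // ltnW.
Qed.

(** The letters whose lengths are recorded. The two runs of a pair have the same length, kept at the
    first letter, and the length of a tail follows from the extent of its trace. *)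
Definition Efree M (Rs : {set 'I_M}) (rho : 'I_M -> 'I_M) (b : 'I_M -> bool) : {set 'I_M} :=
  (Frst rho :\: tails Rs (nxS Rs) rho b) :|: Alet rho.

(** * Coding a diagram by its skeleton and free lengths *)

Section Code.
Variables (n : nat) (rt : pred nat).
Hypothesis rt0 : rt 0.
Hypothesis n0 : 0 < n.
Local Notation nx := (@nxo n rt).
Local Notation raw := (rawdiag rt).
Local Notation diag k := ({ffun 'I_k -> 'I_k} * {ffun 'I_k -> bool})%type.

Implicit Types u : diag n.

Definition nbrk (u : diag n) : nat := sM n rt (rn u.1) (bn u.2).
Definition cst (u : diag n) : nat -> nat := st n rt (rn u.1) (bn u.2).
Definition cwid (u : diag n) : nat -> nat := wid n rt (rn u.1) (bn u.2).
Definition cRt M (u : diag n) : {set 'I_M} := Rto M (srt rt u.1 u.2).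
Definition crho M (u : diag n) : {ffun 'I_M -> 'I_M} := [ffun i => @srho n rt u.1 u.2 M i].
Definition cb M (u : diag n) : {ffun 'I_M -> bool} := [ffun i => @sb n rt u.1 u.2 M i].
Definition cv M (u : diag n) : {ffun 'I_M -> 'I_n.+1} :=
  [ffun i => if i \in Efree (cRt M u) (crho M u) (cb M u) then inord (cwid u i) else ord0].
Definition code M (u : diag n) := ((cRt M u, (crho M u, cb M u)), cv M u).

Lemma crhoE M u : fun_of_fin (crho M u) = @srho n rt u.1 u.2 M.
Proof. by apply/funext => i; rewrite ffunE. Qed.
Lemma cbE M u : fun_of_fin (cb M u) = @sb n rt u.1 u.2 M.
Proof. by apply/funext => i; rewrite ffunE. Qed.
Lemma cnxE M u : nxS (cRt M u) = @nxo M (srt rt u.1 u.2).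
Proof. by apply: nxo_ext => k hk; rewrite -[k]/(nat_of_ord (Ordinal hk)) pttE inE. Qed.

Lemma cwid_le u i : cwid u i < n.+1.
Proof. by rewrite ltnS /cwid /wid; apply: leq_trans (leq_subr _ _) (st_le _ _ _ _ _). Qed.

Lemma cst_succ M u (i : 'I_M) : nbrk u = M -> cst u i.+1 = cst u i + cwid u i.
Proof. by move=> h; rewrite /cwid /wid subnKC // ltnW // st_ltS // [sM _ _ _ _]h. Qed.

Lemma cwid_rho M u (i : 'I_M) : raw u.1 u.2 -> nbrk u = M -> cwid u (crho M u i) = cwid u i.
Proof. by move=> [k r a d] h; rewrite ffunE; apply: (wid_srho rt0 n0 k r a d h). Qed.

(** Every root of the word is a break, so the root runs enumerate the roots of the word in order.
    Two words with root runs at the same indices therefore have these runs at the same positions. *)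
Lemma root_aligned M (u1 u2 : diag n) : nbrk u1 = M -> nbrk u2 = M -> cRt M u1 = cRt M u2 ->
  forall i : 'I_M, i \in cRt M u1 -> cst u1 i = cst u2 i.
Proof.
move=> h1 h2 eR.
have rtE (k : 'I_M) : rt (cst u1 k) = rt (cst u2 k).
  by move/setP: eR => /(_ k); rewrite !inE.
have key (v1 v2 : diag n) (j i : 'I_M) : nbrk v1 = M -> nbrk v2 = M ->
   (forall k : 'I_M, rt (cst v1 k) = rt (cst v2 k)) -> rt (cst v1 i) -> cst v1 j = cst v2 j ->
   (j < i) -> (forall k : 'I_M, j < k -> k < i -> ~~ rt (cst v1 k)) -> cst v2 i <= cst v1 i.
  move=> g1 g2 eE hr ej hji hgap; rewrite leqNgt; apply/negP => hlt.
  have hn : cst v1 i < n by apply: st_lt; rewrite [sM _ _ _ _]g1.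
  have [k hk ek] := st_ex hn (rt_brk (rn v2.1) (bn v2.2) hr).
  have hk' : k < M by rewrite -g2.
  pose ko := Ordinal hk'.
  have ek' : cst v2 ko = cst v1 i := ek.
  have mono (a c : 'I_M) : cst v2 a < cst v2 c -> a < c.
    rewrite ltnNge => /negP hh; rewrite ltnNge; apply/negP => hle; apply: hh.
    move: hle; rewrite leq_eqVlt => /orP[/eqP e|hac]; first by rewrite /cst e.
    by apply: ltnW; apply: st_ltS hac; rewrite [sM _ _ _ _]g2.
  have hjk : j < ko.
    by apply: mono; rewrite ek' -ej; apply: st_ltS hji; rewrite [sM _ _ _ _]g1.
  have hki : ko < i by apply: mono; rewrite ek'.
  by have := hgap ko hjk hki; rewrite eE ek' hr.
move=> i; move: {2}(nat_of_ord i) (leqnn i) => m; elim: m i => [|m IH] i hm hi.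
  have e0 : (i : nat) = 0 by move: hm; clear; lia.
  rewrite /cst e0; have [_ ->] := @st0 n rt (rn u1.1) (bn u1.2) rt0 n0.
  by have [_ ->] := @st0 n rt (rn u2.1) (bn u2.2) rt0 n0.
case: (posnP i) => i0; first by apply: IH => //; rewrite i0.
have hs0 : srt rt u1.1 u1.2 0 by apply: srt0.
(* The preceding root run, where the two words agree by induction. *)
pose jn := rtn (srt rt u1.1 u1.2) i.-1.
have hjn : jn < i by apply: leq_ltn_trans (rtn_le _ _) _; rewrite prednK.
have hjM : jn < M by apply: ltn_trans hjn _.
pose j := Ordinal hjM.
have hjr : j \in cRt M u1 by rewrite inE; apply: rtn_root.
have gap (k : 'I_M) : j < k -> k < i -> ~~ rt (cst u1 k).
  by move=> hk1 hk2; apply: (rtn_gap hk1); rewrite -ltnS prednK.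
have ej : cst u1 j = cst u2 j.
  by apply: IH => //; rewrite -ltnS; apply: leq_trans hjn hm.
have hri : rt (cst u1 i) by move: hi; rewrite inE.
apply/eqP; rewrite eqn_leq; apply/andP; split.
  apply: (key u2 u1 j i) => //; first by rewrite -rtE.
  by move=> k hk1 hk2; rewrite -rtE; apply: gap.
exact: (key u1 u2 j i).
Qed.

(** All lengths except those of tails are read off the code. Between a tail and the end of its
    trace, both fixed by [root_aligned], the unknown length occurs exactly twice, at the two letters
    of the pair, and so it is determined. *)
Lemma code_inj M (u1 u2 : diag n) : raw u1.1 u1.2 -> raw u2.1 u2.2 ->
  nbrk u1 = M -> nbrk u2 = M -> code M u1 = code M u2 -> u1 = u2.
Proof.
move=> d1 d2 h1 h2 [eR er eb ev].
have wE (i : 'I_M) : i \in Efree (cRt M u1) (crho M u1) (cb M u1) -> cwid u1 i = cwid u2 i.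
  move=> hi; move/ffunP: ev => /(_ i); rewrite !ffunE -eR -er -eb hi => /(congr1 (@nat_of_ord _)).
  by rewrite !inordK ?cwid_le.
have [k1 r1 a1 q1] := d1.
have rK : involutive (crho M u1) by rewrite crhoE; apply: (srhoK rt0 n0 k1 r1 a1 q1 h1).
have s0 : srt rt u1.1 u1.2 0 by apply: srt0.
have nxP := nxoP s0 (M := M).
have aligned := root_aligned h1 h2 eR.
have endE (p : 'I_M) : p.+1 = M \/ (exists2 i : 'I_M, i = p.+1 :> nat & i \in cRt M u1) ->
    cst u1 p.+1 = cst u2 p.+1.
  case=> [e|[i <- hi]]; last exact: aligned.
  by rewrite /cst !st_end // e [sM _ _ _ _](h1, h2) // [sM _ _ _ _]h2.
pose tl := tails (cRt M u1) (nxS (cRt M u1)) (crho M u1) (cb M u1).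
have wnt (i : 'I_M) : i \notin tl -> crho M u1 i \notin tl -> cwid u1 i = cwid u2 i.
  move=> hi hri; have [hS|hS] := boolP (i \in Scnd (crho M u1)); last first.
    apply: wE; rewrite in_setU in_setD -/tl hi /= !inE.
    by move: hS; rewrite inE -val_eqE /=; clear; lia.
  rewrite -(cwid_rho i d1 h1) -(cwid_rho i d2 h2) -er; apply: wE.
  rewrite in_setU in_setD -/tl hri /= inE rK.
  by move: hS; rewrite inE => ->.
have tail_notl (r : 'I_M) : r \in tl -> cwid u1 r = cwid u2 r.
  rewrite inE => /andP[hr /existsP[p /and4P[/eqP e1 /eqP e2 hpr hb]]].
  rewrite cnxE in e1.
  have [hrp gap] : r <= p /\ forall q, r < q -> q <= p -> ~~ srt rt u1.1 u1.2 q.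
    move: (congr1 (@nat_of_ord _) e1) hr; rewrite inE /= /nxn; case: ifP => [/andP[_ hh] <-|_ <- _].
      by rewrite (negbTE hh).
    by split; [apply: rtn_le|move=> q; apply: rtn_gap].
  have hlt : r < p by rewrite ltn_neqAle hrp andbT eq_sym.
  have hend : cst u1 p.+1 = cst u2 p.+1.
    apply: endE; case: (ltngtP p.+1 M) => hM; [right|by have := ltn_ord p; move: hM; clear; lia|by left].
    exists (Ordinal hM) => //; rewrite inE /=; apply/negPn/negP => hh.
    move: (congr1 (@nat_of_ord _) e1); rewrite /= /nxn hM hh /=.
    by move: hrp; clear; lia.
  have hst := aligned r hr.
  (* Inside the trace the two words stay shifted by the difference of the tail lengths, since all
     intermediate lengths agree. *)
  have inner (d : nat) : r + d.+1 <= p -> cst u1 (r + d.+1) + cwid u2 r = cst u2 (r + d.+1) + cwid u1 r.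
    elim: d => [|d IH] hd.
      by rewrite addn1 (cst_succ r h1) (cst_succ r h2) hst addnAC.
    have hj : r + d.+1 < M by apply: leq_ltn_trans (ltn_ord p); move: hd; clear; lia.
    pose j := Ordinal hj.
    have hjt i : i \in tl -> i \in cRt M u1 by rewrite inE => /andP[].
    have jnr : j \notin cRt M u1 by rewrite inE; apply: gap; move: hd; rewrite /=; clear; lia.
    have wj : cwid u1 j = cwid u2 j.
      apply: wnt; first by apply: contra jnr => /hjt.
      apply/negP; rewrite inE => /andP[hr' /existsP[p' /and4P[/eqP f1 /eqP f2 _ _]]].
      have ep : p' = j by rewrite -[p']rK f2 rK.
      move: f1 hr'; rewrite ep => <-; rewrite cnxE.
      have hj1 : (nat_of_ord j).+1 < M by apply: leq_ltn_trans (ltn_ord p); move: hd => /=; clear; lia.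
      rewrite inE /= /nxn hj1 /=.
      have hg : ~~ srt rt u1.1 u1.2 (r + d.+1).+1 by apply: gap; move: hd; clear; lia.
      by rewrite hg /= (negbTE hg).
    have hd' : r + d.+1 <= p by apply: leq_trans hd; rewrite leq_add2l.
    have := IH hd'.
    rewrite [r + d.+2]addnS -/(nat_of_ord j) (cst_succ j h1) (cst_succ j h2) wj /=.
    clear; lia.
  have wp1 := cwid_rho p d1 h1; have wp2 := cwid_rho p d2 h2.
  rewrite -er in wp2; rewrite e2 in wp1 wp2.
  have := inner (p - r).-1; rewrite prednK ?subn_gt0 // subnKC // => /(_ (leqnn _)).
  move: hend; rewrite (cst_succ p h1) (cst_succ p h2) -wp1 -wp2.
  clear; lia.
have wall (i : 'I_M) : cwid u1 i = cwid u2 i.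
  have [h|h] := boolP (i \in tl); first exact: tail_notl.
  have [h'|h'] := boolP (crho M u1 i \in tl); last exact: wnt.
  by rewrite -(cwid_rho i d1 h1) -(cwid_rho i d2 h2) -er tail_notl.
have est (i : nat) : i < M -> cst u1 i = cst u2 i.
  elim: i => [|i IH] hi.
    rewrite /cst; have [_ ->] := @st0 n rt (rn u1.1) (bn u1.2) rt0 n0.
    by have [_ ->] := @st0 n rt (rn u2.1) (bn u2.2) rt0 n0.
  have hi' := ltnW hi; pose io := Ordinal hi'.
  by rewrite (cst_succ io h1) (cst_succ io h2) wall IH.
have [e1 e2] : u1.1 =1 u2.1 /\ u1.2 =1 u2.2.
  apply: (compress_inj rt0 n0 d1 d2 h1 h2 est) => i.
    by move/ffunP: er => /(_ i); rewrite !ffunE.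
  by move/ffunP: eb => /(_ i); rewrite !ffunE.
rewrite (surjective_pairing u1) (surjective_pairing u2).
by congr pair; apply/ffunP.
Qed.

End Code.

(** * Reduced skeletons and their defect *)

Local Notation diag k := ({ffun 'I_k -> 'I_k} * {ffun 'I_k -> bool})%type.

(** The second group repeats [H1] to [H4]: no pair that dominoes would cancel, and nothing left to
    contract. *)
Definition skeleton (s M : nat) (Rs : {set 'I_M}) (u : diag M) : Prop :=
  let nx := nxS Rs in let rho := fun_of_fin u.1 in let b := fun_of_fin u.2 in
  [/\ ptt Rs 0, #|Rs| <= s, involutive rho & forall p, b (rho p) = b p] /\
  [/\ forall p, nx p \notin Rs -> rho p = nx p -> b p,
      forall p, nx p \notin Rs -> rho p = p -> rho (nx p) = nx p -> False,
      forall p q, nx p \notin Rs -> nx q \notin Rs -> ~~ b p -> ~~ b q ->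
        rho p != p -> rho q != q -> rho p = nx q -> rho q = nx p -> False
    & forall p q, nx p \notin Rs -> nx q \notin Rs -> b p -> b (nx p) -> p != q ->
        rho p = q -> rho (nx p) = nx q -> False].

(** The parameter k, which becomes the power of 1/N carried by the diagram. By [sk_PL_le] the
    natural subtraction is exact on skeletons. *)
Definition defect (M : nat) (Rs : {set 'I_M}) (u : diag M) : nat :=
  #|Frst u.1| - #|PL (nxS Rs) u.1 u.2|.

Definition lengths (n M : nat) (Rs : {set 'I_M}) (u : diag M) (v : {ffun 'I_M -> 'I_n.+1}) : bool :=
  let E := Efree Rs u.1 u.2 in
  [forall i, if i \in E then v i != ord0 else v i == ord0] && (\sum_(i in E) v i <= n).

Lemma nxS_inj M (Rs : {set 'I_M}) : ptt Rs 0 -> injective (nxS Rs).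
Proof. exact: nxo_inj. Qed.

Lemma nxSP M (Rs : {set 'I_M}) : ptt Rs 0 ->
  forall p, (nxS Rs p = p.+1 :> nat /\ nxS Rs p \notin Rs) \/ (nxS Rs p \in Rs /\ nxS Rs p <= p).
Proof. by move=> h p; have := nxoP h p; rewrite Rto_ptt. Qed.

Section SkeletonFacts.
Variables (s M : nat) (Rs : {set 'I_M}) (u : diag M).
Hypothesis hu : skeleton s Rs u.
Local Notation nx := (nxS Rs).
Local Notation rho := (fun_of_fin u.1).
Local Notation b := (fun_of_fin u.2).
Local Notation tl := (tails Rs nx rho b).

Lemma sk_PL_le : #|PL nx rho b| <= #|Frst rho|.
Proof.
have [[h0 hs k r] [a1 a2 a3 a4]] := hu.
exact: (card_PL_le (nxSP h0) k r a1).
Qed.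

Lemma tail_prop r : r \in tl -> exists p, [/\ nx p = r, rho p = r, p != r, ~~ b r & r < p].
Proof.
have [[h0 hs k rr] [a1 a2 a3 a4]] := hu.
rewrite inE => /andP[hr /existsP[p /and4P[/eqP e1 /eqP e2 hpr hb]]].
exists p; split=> //; case: (nxSP h0 p); rewrite e1 => -[h1 h2]; first by rewrite hr in h2.
by rewrite ltn_neqAle h2 andbT eq_sym.
Qed.

Lemma tails_Frst : tl \subset Frst rho.
Proof.
have [[h0 hs k rr] _] := hu.
by apply/subsetP => r /tail_prop[p [e1 e2 h3 h4 h5]]; rewrite inE -{2}e2 k.
Qed.

(** The two sides at a tail are glued to each other, so no gluing leads away from it. *)
Lemma tail_class r q : r \in tl -> con nx rho b r q -> q = r.
Proof.
have [[h0 hs k rr] _] := hu.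
move=> /tail_prop[p [e1 e2 h3 h4 h5]] hc.
suff hx : (r == r) = (q == r) by apply/eqP; rewrite -hx.
apply: (@con_closed M nx rho b _ (fun c => c == r)) hc => sd hsd /=.
have nxi := nxS_inj h0.
rewrite !(cor_sides nxi _ e1).
have er : rho r = p by rewrite -e2 k.
have bp : ~~ b p by rewrite -er rr.
have a1 : alp rho b (r, false) = (p, true) by rewrite /alp /= er (negbTE h4).
have a2 : alp rho b (p, true) = (r, false) by rewrite /alp /= e2 (negbTE bp).
have aI := inv_inj (alpK k rr).
have f1 : (alp rho b sd == (r, false)) = (sd == (p, true)) by rewrite -a2 (inj_eq aI).
have f2 : (alp rho b sd == (p, true)) = (sd == (r, false)) by rewrite -a1 (inj_eq aI).
by rewrite f1 f2 orbC.
Qed.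

Lemma tails_PL : tl \subset PL nx rho b :&: Rs.
Proof.
have [[h0 hs k rr] _] := hu.
apply/subsetP => r hr; have hr' := hr; rewrite inE in hr'; case/andP: hr' => hrR _.
rewrite !inE hrR andbT; apply/andP; split.
  by apply/forallP => q; apply/implyP => /(tail_class hr)->.
have [p [e1 e2 h3 h4 h5]] := tail_prop hr.
have er : rho r = p by rewrite -e2 k.
apply/forallP => sd; apply/implyP => /(tail_class hr)/eqP.
rewrite (cor_sides (nxS_inj h0) _ e1) => /orP[] /eqP->; rewrite /sealed /=.
  by rewrite er.
by rewrite e2 eq_sym.
Qed.

Lemma sk_degree : 3 * #|PL nx rho b| + #|Alet rho| <= 2 * #|Frst rho| + #|Rs| + #|tl|.
Proof.
have [[h0 hs k r] [a1 a2 a3 a4]] := hu.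
exact: (degree_ineq (nxS_inj h0) k r a1 a2 a3 a4).
Qed.

Lemma sk_tails_le : #|tl| <= #|PL nx rho b :&: Rs|.
Proof. exact: subset_leq_card tails_PL. Qed.

Lemma sk_roots_le : #|PL nx rho b :&: Rs| <= s.
Proof.
have [[h0 hs k r] _] := hu.
by apply: leq_trans hs; apply: subset_leq_card (subsetIr _ _).
Qed.

(** With F = PL + k and at most s tails, the degree inequality reads PL + A <= 2k + 2s. Insert this
    into M = 2F + A. *)
Lemma sk_M_le : M <= 6 * defect Rs u + 4 * s.
Proof.
have [[h0 hs k r] _] := hu.
have := card_letters k; have := sk_PL_le; have := sk_degree; have := sk_tails_le; have := sk_roots_le.
move: hs; rewrite /defect; move: #|_| #|_| #|_| #|_| #|_| #|_|; clear; lia.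
Qed.

Lemma sk_defect_lt n : 0 < M -> M <= n -> defect Rs u < n.
Proof.
have [[h0 hs k r] _] := hu.
have := card_letters k; rewrite /defect; move: #|_| #|_| #|_|; clear; lia.
Qed.

End SkeletonFacts.

(** * Summation over all diagrams through their codes *)

Section Master.
Local Open Scope ring_scope.
Variables (n : nat) (rt : pred nat).
Hypothesis rt0 : rt 0%N.
Hypothesis n0 : (0 < n)%N.
Let s := #|Rto n rt|.

Implicit Types u : diag n.

Definition rawset : {set diag n} := [set u : diag n | `[< rawdiag rt u.1 u.2 >]].

Lemma rawsetP u : reflect (rawdiag rt u.1 u.2) (u \in rawset).
Proof. by rewrite inE; apply: asboolP. Qed.

Lemma code_skeleton M (u : diag n) : rawdiag rt u.1 u.2 -> nbrk rt u = M ->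
  skeleton s (cRt rt M u) (crho rt M u, cb rt M u).
Proof.
move=> [k r a d] hM; rewrite /skeleton /= cnxE crhoE cbE.
split; split.
- have h : srt rt u.1 u.2 0 by apply: srt0.
  have M0 : (0 < M)%N by rewrite -hM; case: (@st0 n rt (rn u.1) (bn u.2) rt0 n0).
  by apply/existsP; exists (Ordinal M0); rewrite /= inE.
- rewrite /s -(card_imset _ (stO_inj (rt := rt) (rho := u.1) (b := u.2) (hM := hM))).
  apply/subset_leq_card/subsetP => p /imsetP[i]; rewrite !inE => hi ->.
  by move: hi; rewrite /srt.
- exact: (srhoK rt0 n0 k r a d hM).
- exact: (sbrho rt0 n0 k r a d hM).
- exact: (skel_H1 rt0 n0 k r a d hM).
- exact: (skel_H2 rt0 n0 k r a d hM).
- exact: (skel_H3 rt0 n0 k r a d hM).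
- exact: (skel_H4 rt0 n0 k r a d hM).
Qed.

Lemma code_lengths M (u : diag n) : rawdiag rt u.1 u.2 -> nbrk rt u = M ->
  lengths (cRt rt M u) (crho rt M u, cb rt M u) (cv rt M u).
Proof.
move=> [k r a d] hM; apply/andP; split.
  apply/forallP => i; rewrite ffunE /=; case: (i \in Efree _ _ _) => //.
  rewrite -val_eqE /= inordK ?cwid_le // -lt0n; apply: wid_gt0.
  by rewrite [sM _ _ _ _]hM.
rewrite /=; set E := Efree _ _ _.
apply: (@leq_trans (\sum_(i < M) cwid rt u i)).
  rewrite [leqRHS](bigID (fun i : 'I_M => i \in E)) /= -[leqLHS]addn0; apply: leq_add => //.
  by apply: leq_sum => i hi; rewrite ffunE -/E hi inordK // cwid_le.
have -> : (\sum_(i < M) cwid rt u i = \sum_(0 <= i < M) cwid rt u i)%N by rewrite big_mkord.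
have h (j : nat) : (j <= M)%N -> (\sum_(0 <= i < j) cwid rt u i = cst rt u j)%N.
  elim: j => [|j IH] hj.
    by rewrite big_nil; case: (@st0 n rt (rn u.1) (bn u.2) rt0 n0) => _; rewrite /cst => ->.
  by rewrite big_nat_recr //= IH ?(ltnW hj) // -(cst_succ (Ordinal hj) hM).
by rewrite h //; apply: st_le.
Qed.

Lemma nbrk_gt0 u : (0 < nbrk rt u)%N.
Proof. by case: (@st0 n rt (rn u.1) (bn u.2) rt0 n0). Qed.

Lemma nbrk_le u : (nbrk rt u <= n)%N.
Proof. by rewrite /nbrk /sM /stl size_filter (leq_trans (count_size _ _)) // size_iota. Qed.

Variable R : realFieldType.
Variable f : forall M : nat, {set 'I_M} * diag M * {ffun 'I_M -> 'I_n.+1} -> R.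
Variable B : nat -> R.
Hypothesis f_ge0 : forall M c, 0 <= @f M c.
Hypothesis B_ge0 : forall k, 0 <= B k.
Hypothesis fB : forall M (Rs : {set 'I_M}) (w : diag M), (0 < M)%N -> (M <= n)%N -> skeleton s Rs w ->
  \sum_(v : {ffun 'I_M -> 'I_n.+1} | lengths Rs w v) f (Rs, w, v) <= B (defect Rs w).

(** With Q = 6k + 4s, the bound of [sk_M_le]: choices for the number of letters, for the root set,
    and for the skeleton by [count_diagrams] with K = k + s. *)
Definition Wk (k : nat) : nat := ((6 * k + 4 * s).+1 * (2 ^ (6 * k + 4 * s) * (16 ^ (6 * k + 4 * s) * (6 * k + 4 * s).+1 ^ (k + s))))%N.

(** As codes are injective and [f] is nonnegative, the sum may be extended to all skeletons with all
    admissible lengths; skeletons are then sorted by their defect. *)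
Lemma master_sum : \sum_(u in rawset) f (code rt (nbrk rt u) u) <= \sum_(k < n) (Wk k)%:R * B k.
Proof.
have step1 : \sum_(u in rawset) f (code rt (nbrk rt u) u) =
    \sum_(M < n.+1) \sum_(u in rawset | nbrk rt u == M) f (code rt M u).
  have hb u : (nbrk rt u < n.+1)%N by rewrite ltnS nbrk_le.
  rewrite (partition_big (fun u => Ordinal (hb u)) predT) //=; apply: eq_bigr => M _.
  rewrite (eq_bigl (fun u => (u \in rawset) && (nbrk rt u == M))); last by move=> u; rewrite -val_eqE.
  by apply: eq_bigr => u /andP[_ /eqP->].
have step2 (M : 'I_n.+1) : (0 < M)%N -> \sum_(u in rawset | nbrk rt u == M) f (code rt M u) <=
    \sum_(Rs : {set 'I_M}) \sum_(w : diag M | `[< skeleton s Rs w >]) B (defect Rs w).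
  move=> M0.
  apply: (@le_trans _ _ (\sum_(Rs : {set 'I_M}) \sum_(w : diag M | `[< skeleton s Rs w >])
      \sum_(v : {ffun 'I_M -> 'I_n.+1} | lengths Rs w v) f (Rs, w, v))); last first.
    apply: ler_sum => Rs _; apply: ler_sum => w /asboolP hw; apply: fB => //.
    by rewrite -ltnS.
  rewrite pair_big_dep /= pair_big_dep /=.
  pose S := [set u in rawset | nbrk rt u == M].
  rewrite (eq_bigl (mem S)); last by move=> u; rewrite !inE.
  have cinj : {in S &, injective (@code n rt M)}.
    move=> u1 u2; rewrite !inE => /andP[/asboolP d1 /eqP h1] /andP[/asboolP d2 /eqP h2].
    exact: code_inj.
  rewrite -(big_imset (fun c => f c) cinj) /= [leRHS](bigID (mem [set code rt M u | u in S])) /=.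
  rewrite -[leLHS]addr0; apply: lerD; last by apply: sumr_ge0.
  rewrite le_eqVlt; apply/orP; left; apply/eqP; apply: eq_big => [c|c _]; last by case: c => -[].
  case: (boolP (c \in _)) => hc; last by rewrite andbF.
  case/imsetP: hc => u; rewrite inE => /andP[/rawsetP hu /eqP hM] ->.
  rewrite /= code_lengths // !andbT; symmetry; apply/asboolP; exact: code_skeleton.
rewrite step1 big_ord_recl big1 ?add0r; last first.
  by move=> u /andP[_ /eqP h]; have := nbrk_gt0 u; rewrite h.
apply: (@le_trans _ _ (\sum_(M < n) \sum_(Rs : {set 'I_M.+1})
    \sum_(w : diag M.+1 | `[< skeleton s Rs w >]) B (defect Rs w))).
  by apply: ler_sum => M _; apply: (step2 (lift ord0 M)).
pose cnt (M k : nat) (Rs : {set 'I_M}) := #|[set w : diag M | `[< skeleton s Rs w >] & defect Rs w == k]|.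
have step3 (M : 'I_n) (Rs : {set 'I_M.+1}) :
   \sum_(w : diag M.+1 | `[< skeleton s Rs w >]) B (defect Rs w) = \sum_(k < n) (cnt M.+1 k Rs)%:R * B k.
  pose df (w : diag M.+1) : 'I_n := insubd (Ordinal n0) (defect Rs w).
  rewrite (partition_big df predT) //=; apply: eq_bigr => k _.
  have e w : (`[< skeleton s Rs w >] && (df w == k)) = (w \in [set w : diag M.+1 | `[< skeleton s Rs w >] & defect Rs w == k]).
    rewrite inE; case: (asboolP (skeleton s Rs w)) => //= hw.
    have hd : (defect Rs w < n)%N by apply: (sk_defect_lt hw).
    by rewrite -val_eqE /df /= insubdK.
  rewrite (eq_bigl _ _ e) (eq_bigr (fun=> B k)); last by move=> w; rewrite inE => /andP[_ /eqP->].
  by rewrite sumr_const mulr_natl.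
under eq_bigr => M _ do under eq_bigr => Rs _ do rewrite step3.
have -> : \sum_(M < n) \sum_(Rs : {set 'I_M.+1}) \sum_(k < n) (cnt M.+1 k Rs)%:R * B k =
    \sum_(k < n) (\sum_(M < n) \sum_(Rs : {set 'I_M.+1}) cnt M.+1 k Rs)%N%:R * B k.
  rewrite (eq_bigr (fun M : 'I_n => \sum_(k < n) \sum_(Rs : {set 'I_M.+1}) (cnt M.+1 k Rs)%:R * B k)); last first.
    by move=> M _; rewrite exchange_big.
  rewrite exchange_big /=; apply: eq_bigr => k _.
  rewrite natr_sum mulr_suml; apply: eq_bigr => M _.
  by rewrite natr_sum mulr_suml.
apply: ler_sum => k _; apply: ler_wpM2r => //; rewrite ler_nat.
pose Q := (6 * k + 4 * s)%N.
apply: (@leq_trans (\sum_(M < n | (M.+1 <= Q)%N) 2 ^ Q * (16 ^ Q * Q.+1 ^ (k + s)))%N).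
  rewrite [leqRHS]big_mkcond /=; apply: leq_sum => M _; case: (leqP M.+1 Q) => hMQ; last first.
    rewrite big1 // => Rs _; apply/eqP; rewrite cards_eq0; apply/eqP/setP=> w; rewrite !inE.
    apply/negbTE/negP => /andP[/asboolP hw /eqP hk].
    by have := sk_M_le hw; rewrite hk -/Q leqNgt hMQ.
  apply: (@leq_trans (\sum_(Rs : {set 'I_M.+1}) 16 ^ M.+1 * M.+2 ^ (k + s))%N).
    apply: leq_sum => Rs _; have [h0|h0] := boolP (ptt Rs 0); last first.
      rewrite (_ : cnt _ _ _ = 0%N) //; apply/eqP; rewrite cards_eq0; apply/eqP/setP=> w; rewrite !inE.
      by apply/negbTE/negP => /andP[/asboolP[[]]]; rewrite (negbTE h0).
    apply: (count_diagrams (nxS_inj h0) (nxSP h0)) => w; rewrite inE => /andP[/asboolP hw /eqP hk].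
    have [[_ hs k1 r1] _] := hw; split => //.
    have := sk_PL_le hw; move: hs hk; rewrite /defect.
    move: #|_| #|_| #|_|; clear; lia.
  rewrite sum_nat_const -cardsT -powersetT card_powerset cardsT card_ord.
  apply: leq_mul; first by rewrite leq_exp2l.
  apply: leq_mul; first by rewrite leq_exp2l.
  by case: (k + s)%N => [|e0]; rewrite ?expn0 ?leq_exp2r.
rewrite sum_nat_const /Wk -/Q; apply: leq_mul => //.
have inj : {in [pred M : 'I_n | (M.+1 <= Q)%N] &, injective (fun M : 'I_n => inord M : 'I_Q.+1)}.
  move=> M1 M2; rewrite !inE => h1 h2 /(congr1 (@nat_of_ord _)).
  by rewrite !inordK ?ltnS 1?ltnW // => /ord_inj.
by rewrite -(card_in_imset inj) (leq_trans (max_card _)) // card_ord.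
Qed.

End Master.

Local Open Scope ring_scope.

(** * Decoupling the lengths and bounding one skeleton *)

Lemma geometric_le (R : realFieldType) (h : R) n : 0 < h ->
  \sum_(j < n.+1 | j != ord0) (1 + h) ^- j <= h^-1.
Proof.
move=> h0; have h1 : 0 < 1 + h by lra.
suff e : h * (\sum_(j < n.+1 | j != ord0) (1 + h) ^- j) = 1 - (1 + h) ^- n.
  rewrite -(ler_pM2l h0) e divff ?gt_eqF // gerBl invr_ge0 exprn_ge0 // ltW //.
rewrite big_mkcond big_ord_recl /= add0r mulr_sumr.
elim: n => [|n IH]; first by rewrite big_ord0 expr0 invr1 subrr.
rewrite big_ord_recr /= IH /bump /= add1n exprS.
have : (1 + h) ^+ n != 0 by rewrite expf_neq0 // gt_eqF.
by move=> hn; field; rewrite hn gt_eqF.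
Qed.

(** Meaning of the counts: [c] pure classes led by roots, [a] letters bounded by row sums, [b]
    letters bounded by entries, [to] tails bounded by 1/N, [EA] A-letters. The powers of [N] combine
    to N^(-k) because b + to = k + c. The degree inequality limits the powers of [R0], and those in
    excess of 2k are absorbed by [T0]. *)
Lemma exponent_balance (R : realFieldType) (N R0 T0 r : R) (c a b to k s EA : nat) :
  0 < N -> 1 <= R0 -> R0 <= T0 -> 1 <= r ->
  (b + to = k + c)%N -> (c <= s)%N -> (to <= c)%N -> (a + EA + c <= 2 * k + s + to)%N ->
  (EA <= 2 * k + 2 * s)%N ->
  N ^+ c * (R0 ^+ a * ((T0 / N) ^+ b * N^-1 ^+ to)) * r ^+ EA * R0 ^+ EA
   <= r ^+ (2 * k + 2 * s) * T0 ^+ (k + s) * R0 ^+ (2 * k) * N ^- k.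
Proof.
move=> N0 R1 RT r1 e1 e2 e3 e4 e5.
have Nn : N != 0 by rewrite gt_eqF.
have eN : N ^+ c * (R0 ^+ a * ((T0 / N) ^+ b * N^-1 ^+ to)) * r ^+ EA * R0 ^+ EA =
   r ^+ EA * (T0 ^+ b * R0 ^+ (a + EA)) * N ^- k.
  have -> : N ^- k = N ^+ c * (N^-1 ^+ b * N^-1 ^+ to).
    by rewrite -exprD e1 addnC exprD mulrA -exprMn divff // expr1n mul1r exprVn.
  by rewrite exprMn exprD; ring.
rewrite eN; have R00 : 0 <= R0 by lra.
have T00 : 0 <= T0 by lra.
have r0 : 0 <= r by lra.
have T1 : 1 <= T0 by lra.
apply: ler_wpM2r; first by rewrite invr_ge0 exprn_ge0 // ltW.
rewrite -mulrA; apply: ler_pM; rewrite ?exprn_ge0 ?mulr_ge0 ?exprn_ge0 //.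
  exact: ler_weXn2l.
pose d := (s - (c - to))%N.
apply: (@le_trans _ _ (T0 ^+ b * (R0 ^+ (2 * k) * R0 ^+ d))).
  apply: ler_wpM2l; first exact: exprn_ge0.
  rewrite -exprD; apply: ler_weXn2l => //; rewrite /d; lia.
have -> : (k + s = b + d)%N by rewrite /d; lia.
rewrite (exprD T0) -!mulrA; apply: ler_wpM2l; first exact: exprn_ge0.
rewrite mulrC; apply: ler_wpM2r; first exact: exprn_ge0.
by apply: lerXn2r.
Qed.

Section SkeletonBound.
Variables (R : realFieldType) (N n s M : nat) (Rs : {set 'I_M}) (w : diag M).
Hypothesis N0 : (0 < N)%N.
Hypothesis hw : skeleton s Rs w.
Local Notation T := 'I_N.
Local Notation nx := (nxS Rs).
Local Notation rho := (fun_of_fin w.1).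
Local Notation b := (fun_of_fin w.2).
Local Notation tl := (tails Rs nx rho b).
Local Notation E := (Efree Rs rho b).
Variables (q : T -> R) (r : R).
Hypothesis q_ge0 : forall x, 0 <= q x.
Hypothesis q_le1 : forall x, q x <= 1.
Hypothesis q_sum : \sum_x q x ^+ 2 <= r.
Hypothesis r_ge1 : 1 <= r.

Definition lsum (kap : 'I_M -> T -> T -> R) : R :=
  \sum_(x : {ffun 'I_M -> T} | consl nx rho b x)
    (\prod_(p in Frst rho) kap p (x p) (x (nx p)) * \prod_(p in Alet rho) (q (x p) * q (x (nx p)))).

Lemma lsum_ge0 kap : (forall p x y, 0 <= kap p x y) -> 0 <= lsum kap.
Proof.
move=> h; apply: sumr_ge0 => x _; apply: mulr_ge0; apply: prodr_ge0 => p _ //.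
by apply: mulr_ge0.
Qed.

Variables (kap : 'I_M -> nat -> T -> T -> R) (h : R).
Hypothesis kap_ge0 : forall p j x y, 0 <= kap p j x y.
Hypothesis h0 : 0 < h.

(** The Laplace transform of a kernel in the length of its edge. *)
Definition hat (p : 'I_M) (x y : T) : R := \sum_(j < n.+1 | j != ord0) (1 + h) ^- j * kap p j x y.
Definition kaph (p : 'I_M) (x y : T) : R := if p \in E then hat p x y else kap p 0 x y.

Lemma Efree_cases (p : 'I_M) : [\/ [/\ p \in Frst rho, p \notin Alet rho & (p \in E) = (p \notin tl)],
   [/\ p \notin Frst rho, p \in Alet rho & p \in E] | [/\ p \notin Frst rho, p \notin Alet rho & p \notin E]].
Proof.
rewrite in_setU in_setD !inE -!(inj_eq val_inj) /=; case: (ltngtP p (rho p)) => hp.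
- by apply: Or31; rewrite orbF andbT.
- by apply: Or33; rewrite andbF.
- by apply: Or32; rewrite andbF.
Qed.

(** The total length is at most n, so multiplying by (1+h)^n and by the weights (1+h)^(-v) only
    increases the sum. Once the constraint is dropped, the sum over lengths factorises. The powers
    of A have already been bounded, so an A-letter leaves a geometric sum of at most 1/h. *)
Lemma laplace :
  \sum_(v : {ffun 'I_M -> 'I_n.+1} | lengths Rs w v) lsum (fun p => kap p (v p)) <=
  (1 + h) ^+ n * h^-1 ^+ #|Alet rho| * lsum kaph.
Proof.
have h1 : 0 < 1 + h by rewrite addr_gt0.
have h1' : 1 <= 1 + h by rewrite lerDl ltW.
pose F (x : {ffun 'I_M -> T}) (p : 'I_M) (j : 'I_n.+1) : R :=
  (if p \in E then if j == ord0 then 0 else (1 + h) ^- j else (j == ord0)%:R) *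
  (if p \in Frst rho then kap p j (x p) (x (nx p)) else 1).
have F_ge0 x p j : 0 <= F x p j.
  rewrite /F; apply: mulr_ge0; last by case: ifP.
  by case: ifP => _; [case: ifP => // _; rewrite invr_ge0 exprn_ge0 // ltW|rewrite ler0n].
have q0 (x : {ffun 'I_M -> T}) : 0 <= \prod_(p in Alet rho) (q (x p) * q (x (nx p))).
  by apply: prodr_ge0 => p _; apply: mulr_ge0.
apply: (@le_trans _ _ (\sum_(v : {ffun 'I_M -> 'I_n.+1}) \sum_(x : {ffun 'I_M -> T} | consl nx rho b x)
   (1 + h) ^+ n * (\prod_p F x p (v p) * \prod_(p in Alet rho) (q (x p) * q (x (nx p)))))).
  rewrite big_mkcond; apply: ler_sum => v _; case: ifP => [/andP[/forallP hv hs]|_]; last first.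
    apply: sumr_ge0 => x _; apply: mulr_ge0; first by rewrite exprn_ge0 // ltW.
    by apply: mulr_ge0 => //; apply: prodr_ge0.
  apply: ler_sum => x _; rewrite mulrA; apply: ler_wpM2r => //.
  have -> : \prod_p F x p (v p) = \prod_(p in E) (1 + h) ^- (v p) * \prod_(p in Frst rho) kap p (v p) (x p) (x (nx p)).
    rewrite /F big_split /=; congr (_ * _); last by rewrite -big_mkcond.
    rewrite [RHS]big_mkcond; apply: eq_bigr => p _; move: (hv p).
    by case: ifP => _ => [/negbTE->|/eqP->].
  rewrite mulrA ler_peMl //; first by apply: prodr_ge0.
  have -> : \prod_(p in E) (1 + h) ^- v p = (1 + h) ^- (\sum_(p in E) v p)%N.
    rewrite prodfV; congr (_^-1); by rewrite expr_sum.
  rewrite ler_pdivlMr ?exprn_gt0 // mul1r; exact: ler_weXn2l.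
rewrite exchange_big /= /lsum mulr_sumr; apply: ler_sum => x _.
rewrite -mulr_sumr -mulrA; apply: ler_wpM2l; first by rewrite exprn_ge0 // ltW.
rewrite -mulr_suml mulrA; apply: ler_wpM2r => //.
rewrite -(bigA_distr_bigA (F x)) /=.
have -> : h^-1 ^+ #|Alet rho| * \prod_(p in Frst rho) kaph p (x p) (x (nx p)) =
   \prod_p ((if p \in Alet rho then h^-1 else 1) * (if p \in Frst rho then kaph p (x p) (x (nx p)) else 1)).
  by rewrite big_split /= -!big_mkcond /= prodr_const.
apply: ler_prod => p _; apply/andP; split; first by apply: sumr_ge0.
have S0 (G : 'I_n.+1 -> R) : \sum_j ((j == ord0)%:R * G j) = G ord0.
  rewrite (bigD1 ord0) //= ?eqxx mul1r big1 ?addr0 // => j /negbTE->; by rewrite mul0r.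
have S1 (G : 'I_n.+1 -> R) : \sum_j (if j == ord0 then 0 else (1 + h) ^- j) * G j = \sum_(j | j != ord0) (1 + h) ^- j * G j.
  by rewrite [RHS]big_mkcond; apply: eq_bigr => j _; case: ifP => //=; rewrite mul0r.
case: (Efree_cases p) => -[c1 c2 c3]; rewrite /F /kaph.
- rewrite c1 (negbTE c2) mul1r c3; case: (p \notin tl) => /=; first by rewrite S1.
  by rewrite (S0 (fun j => kap p j (x p) (x (nx p)))).
- by rewrite (negbTE c1) c2 c3 mulr1 S1; under eq_bigr do rewrite mulr1; apply: geometric_le.
- by rewrite (negbTE c1) (negbTE c2) (negbTE c3) mulr1 (S0 (fun=> 1)).
Qed.

Variables (R0 T0 : R) (gm : 'I_M -> R).
Hypothesis R1 : 1 <= R0.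
Hypothesis RT : R0 <= T0.
Hypothesis gm_ge0 : forall p, 0 <= gm p.
Hypothesis hatT : forall p x y, p \in Frst rho -> p \notin tl -> hat p x y <= gm p * (T0 / N%:R).
Hypothesis hatR : forall p x, p \in Frst rho -> p \notin tl -> \sum_y hat p x y <= gm p * R0.
Hypothesis tlT : forall p x y, p \in tl -> kap p 0 x y <= N%:R^-1.
Hypothesis tlR : forall p x, p \in tl -> \sum_y kap p 0 x y <= 1.
Hypothesis hR : h = R0^-1.

(** The individual factors [gm] let one letter carry the difference of two kernels while the others
    carry ordinary ones. *)
Lemma skeleton_bound :
  \sum_(v : {ffun 'I_M -> 'I_n.+1} | lengths Rs w v) lsum (fun p => kap p (v p)) <=
  (\prod_(p in Frst rho :\: tl) gm p) * ((1 + h) ^+ n *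
    (r ^+ (2 * defect Rs w + 2 * s) * T0 ^+ (defect Rs w + s) * R0 ^+ (2 * defect Rs w) * N%:R ^- (defect Rs w))).
Proof.
have [[p0 hs k rr] [a1 a2 a3 a4]] := hw.
apply: (le_trans laplace).
have h1 : 0 < 1 + h by rewrite addr_gt0.
have NR : 0 < N%:R :> R by rewrite ltr0n.
rewrite -mulrA [leRHS]mulrCA; apply: ler_wpM2l; first by rewrite exprn_ge0 // ltW.
pose mu (p : 'I_M) : R := if p \in tl then N%:R^-1 else gm p * (T0 / N%:R).
pose Rr (p : 'I_M) : R := if p \in tl then 1 else gm p * R0.
pose kp (p : 'I_M) (x y : T) : R := if p \in Frst rho then kaph p x y else 0.
have R00 : 0 <= R0 := le_trans ler01 R1.
have T00 : 0 <= T0 := le_trans R00 RT.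
have hat_ge0 p x y : 0 <= hat p x y.
  by apply: sumr_ge0 => j _; apply: mulr_ge0 => //; rewrite invr_ge0 exprn_ge0 // ltW.
have -> : lsum kaph = lsum kp.
  by apply: eq_bigr => x _; congr (_ * _); apply: eq_bigr => p hp; rewrite /kp hp.
have kp_ge0 p x y : 0 <= kp p x y by rewrite /kp /kaph; case: ifP => // _; case: ifP.
have kp_mu p x y : kp p x y <= mu p.
  rewrite /kp /mu /kaph; case: (Efree_cases p) => -[c1 c2 c3]; rewrite ?c1 ?(negbTE c1).
  - by rewrite c3; case: (boolP (p \in tl)) => ht; [apply: tlT|apply: hatT].
  - by case: ifP => _; rewrite ?invr_ge0 ?ler0n // mulr_ge0 // divr_ge0 // ler0n.
  - by case: ifP => _; rewrite ?invr_ge0 ?ler0n // mulr_ge0 // divr_ge0 // ler0n.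
have kp_R p x : \sum_y kp p x y <= Rr p.
  rewrite /kp /Rr /kaph; case: (Efree_cases p) => -[c1 c2 c3]; rewrite ?c1 ?(negbTE c1).
  - by rewrite c3; case: (boolP (p \in tl)) => ht; [apply: tlR|apply: hatR].
  - by rewrite big1 //; case: ifP => _ //; rewrite ?mulr_ge0.
  - by rewrite big1 //; case: ifP => _ //; rewrite ?mulr_ge0.
have LS := label_sum (nxS_inj p0) (nxSP p0) k rr N0 kp_ge0 kp_mu kp_R q_ge0 q_le1 q_sum r_ge1.
apply: (le_trans (ler_wpM2l _ LS)); first by rewrite exprn_ge0 // invr_ge0 ltW.
set nl := newl Rs nx rho b.
have hR' : h^-1 = R0 by rewrite hR invrK.
have tF := subsetP (tails_Frst hw).
have nF p : p \in nl -> p \in Frst rho by rewrite inE => /andP[].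
have -> : \prod_(p in Frst rho) (if p \in nl then Rr p else mu p) =
   (\prod_(p in Frst rho :\: tl) gm p) *
   (R0 ^+ #|nl :\: tl| * ((T0 / N%:R) ^+ #|(Frst rho :\: nl) :\: tl| * N%:R^-1 ^+ #|tl :\: nl|)).
  rewrite -!prodr_const (big_mkcond (mem (Frst rho))) (big_mkcond (mem (Frst rho :\: tl))).
  rewrite (big_mkcond (mem (nl :\: tl))) (big_mkcond (mem ((Frst rho :\: nl) :\: tl))).
  rewrite (big_mkcond (mem (tl :\: nl))) -!big_split /=; apply: eq_bigr => p _.
  rewrite !in_setD /mu /Rr; move: (tF p) (nF p).
  case: (p \in Frst rho) => t1 t2.
    by case: (p \in tl); case: (p \in nl) => /=; rewrite ?mulr1 ?mul1r.
  have -> : (p \in tl) = false by apply/negP => /t1.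
  have -> : (p \in nl) = false by apply/negP => /t2.
  by rewrite /= !mulr1.
set G := \prod_(p in _) gm p; have G0 : 0 <= G by apply: prodr_ge0.
rewrite hR' [leLHS]mulrC !mulrA -!mulrA [leLHS]mulrCA; apply: ler_wpM2l => //.
have cF : #|Frst rho| = (#|nl :\: tl| + #|nl :&: tl| + #|(Frst rho :\: nl) :\: tl| + #|tl :\: nl|)%N.
  rewrite -(cardsID nl (Frst rho)) -(cardsID tl (_ :&: nl)) -(cardsID tl (Frst rho :\: nl)).
  have -> : Frst rho :&: nl = nl by apply/setIidPr/subsetP.
  have -> : (Frst rho :\: nl) :&: tl = tl :\: nl.
    by apply/setP=> p; rewrite !in_setI !in_setD; move: (tF p); case: (p \in tl) => [/(_ isT)->|_]; rewrite ?andbT ?andbF.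
  by move: #|_| #|_| #|_| #|_|; clear; lia.
have cN : #|nl| = (#|nl :&: tl| + #|nl :\: tl|)%N by rewrite cardsID.
have cT : #|tl| = (#|nl :&: tl| + #|tl :\: nl|)%N by rewrite -(cardsID nl tl) setIC.
have cP := card_PL_split (nxS_inj p0) (nxSP p0) rho b; rewrite -/nl in cP.
have cR := sk_roots_le hw.
have cPL := sk_PL_le hw; have cD := sk_degree hw; have cTL := sk_tails_le hw.
have tR : (#|tl :\: nl| <= #|PL nx rho b :&: Rs|)%N.
  apply: leq_trans (subset_leq_card (tails_PL hw)); apply: subset_leq_card; exact: subsetDl.
have eB := @exponent_balance R N%:R R0 T0 r #|PL nx rho b :&: Rs| #|nl :\: tl|
   #|(Frst rho :\: nl) :\: tl| #|tl :\: nl| (defect Rs w) s #|Alet rho| NR R1 RT r_ge1.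
rewrite -!mulrA in eB; apply: eB => //.
- rewrite /defect; move: cF cN cP cPL; move: #|_| #|_| #|_| #|_| #|_| #|_| #|_| #|_|; clear; lia.
- rewrite /defect; move: cF cN cT cP cPL cD hs; move: #|_| #|_| #|_| #|_| #|_| #|_| #|_| #|_| #|_| #|_|; clear; lia.
- rewrite /defect; move: cPL cD cTL cR hs; move: #|_| #|_| #|_| #|_| #|_| #|_|; clear; lia.
Qed.

End SkeletonBound.

(** * Replacing the kernels of tails *)

Section TailKernel.
Variables (F : numFieldType) (N s M : nat) (Rs : {set 'I_M}) (w : diag M).
Hypothesis N0 : (0 < N)%N.
Hypothesis hw : skeleton s Rs w.
Local Notation nx := (nxS Rs).
Local Notation rho := (fun_of_fin w.1).
Local Notation b := (fun_of_fin w.2).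
Local Notation tl := (tails Rs nx rho b).
Implicit Types (K : 'I_M -> 'M[F]_N).

Lemma consl_upd_tail r (x : {ffun 'I_M -> 'I_N}) y : r \in tl ->
  consl nx rho b (upd x r y) = consl nx rho b x.
Proof.
move=> hr; apply: eq_forallb => sd; case: (boolP (sealed rho sd)) => //= hs.
have hc := con_alp nx b hs.
have e : (cor nx (alp rho b sd) == r) = (cor nx sd == r).
  have [[p0 hs' k rr] _] := hw.
  apply/eqP/eqP => e.
    by rewrite e (con_sym nx k rr) in hc; apply: (tail_class hw hr hc).
  by rewrite e in hc; apply: (tail_class hw hr hc).
rewrite !ffunE; move: e; case: eqP => [->|_]; case: eqP => [->|_] // _; by rewrite ?eqxx.
Qed.

(** The label of a tail enters the product only as the row index of its own kernel; summing over it
    leaves a column sum. *)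
Lemma dval_tail1 K K' r : r \in tl -> (forall p, p != r -> K p = K' p) ->
  (forall z, \sum_y K r y z = \sum_y K' r y z) -> dval nx rho b K = dval nx rho b K'.
Proof.
move=> hr hK hs.
have [[p0 _ k rr] _] := hw; have nxi := nxS_inj p0.
have [pe [e1 e2 h3 h4 h5]] := tail_prop hw hr.
have rF : r \notin Scnd rho.
  have := subsetP (tails_Frst hw) _ hr; rewrite !inE; move: (rho r) => q.
  by rewrite -leqNgt => /ltnW.
have nxr : nx r != r by rewrite -{2}e1 (inj_eq nxi) eq_sym.
pose V K x := if consl nx rho b x then \prod_(p | p \notin Scnd rho) K p (x p) (x (nx p)) else 0.
have V1 K0 x : \sum_y V K0 (upd x r y) = if consl nx rho b x then
   (\sum_y K0 r y (x (nx r))) * \prod_(p | (p \notin Scnd rho) && (p != r)) K0 p (x p) (x (nx p)) else 0.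
  rewrite /V (eq_bigr (fun y => if consl nx rho b x then
    \prod_(p | p \notin Scnd rho) K0 p (upd x r y p) (upd x r y (nx p)) else 0)); last first.
    by move=> y _; rewrite consl_upd_tail.
  case: ifP => _; last by rewrite big1.
  rewrite mulr_suml; apply: eq_bigr => y _; rewrite (bigD1 r) //= updE updN //; congr (_ * _).
  apply: eq_bigr => p /andP[hp hpr]; rewrite !updN //.
  apply: contra hp => /eqP hp; have -> : p = pe by apply: nxi; rewrite hp.
  by rewrite inE e2.
apply/eqP; rewrite -subr_eq0; have : (dval nx rho b K - dval nx rho b K') *+ N == 0.
  have dE K0 : dval nx rho b K0 = \sum_x V K0 x by rewrite /dval big_mkcond.
  rewrite mulrnBl subr_eq0 !dE.
  have su K0 := sum_upd (V K0) r; rewrite card_ord in su.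
  rewrite -!su.
  apply/eqP/eq_bigr => x _.
  rewrite !V1 hs; case: ifP => // _; congr (_ * _); apply: eq_bigr => p /andP[_ hp].
  by rewrite hK.
by rewrite mulrn_eq0 -[(N == 0)%N]negbK -lt0n N0.
Qed.

Lemma dval_tails K K' : (forall p, p \notin tl -> K p = K' p) ->
  (forall p z, p \in tl -> \sum_y K p y z = \sum_y K' p y z) -> dval nx rho b K = dval nx rho b K'.
Proof.
move: {2}(#|[set p | K p != K' p]|) (leqnn #|[set p | K p != K' p]|) => m.
elim: m K => [|m IH] K hm h1 h2.
  move: hm; rewrite leqn0 cards_eq0 => /eqP/setP e; congr (dval _ _ _ _); apply/funext => p.
  by apply/eqP; move: (e p); rewrite !inE => /negbFE.
have [|[r hr]] := set_0Vmem [set p | K p != K' p].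
  by move=> e; apply: IH => //; rewrite e cards0.
have rt : r \in tl by apply: contraLR hr => /h1 e; rewrite inE e eqxx.
pose K1 p := if p == r then K' p else K p.
rewrite (@dval_tail1 K K1 r rt); last 2 first.
- by move=> p /negbTE hp; rewrite /K1 hp.
- by move=> z; rewrite /K1 eqxx; apply: h2.
apply: IH.
- rewrite -ltnS; apply: leq_trans hm; apply: proper_card; apply/properP; split.
    by apply/subsetP=> p; rewrite !inE /K1; case: (p == r); rewrite ?eqxx.
  by exists r => //; rewrite inE /K1 !eqxx.
- by move=> p hp; rewrite /K1; case: (p == r) => //; apply: h1.
- by move=> p z hp; rewrite /K1; case: (p == r) => //; apply: h2.
Qed.

End TailKernel.

(** * Sums, products and telescoping for an absolute value *)

Section AbsoluteValue.
Variables (F : numFieldType) (R : realFieldType) (nm : F -> R).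
Hypothesis nm_ge0 : forall x, 0 <= nm x.
Hypothesis nm0 : nm 0 = 0.
Hypothesis nm1 : nm 1 = 1.
Hypothesis nmM : {morph nm : x y / x * y}.
Hypothesis nmD : forall x y, nm (x + y) <= nm x + nm y.

Lemma nm_sum (I : finType) (P : pred I) (f : I -> F) :
  nm (\sum_(i | P i) f i) <= \sum_(i | P i) nm (f i).
Proof.
apply: (big_ind2 (fun x y => nm x <= y)) => //; first by rewrite nm0.
by move=> x1 y1 x2 y2 h1 h2; apply: le_trans (nmD _ _) (lerD h1 h2).
Qed.

Lemma nm_prod (I : finType) (P : pred I) (f : I -> F) :
  nm (\prod_(i | P i) f i) = \prod_(i | P i) nm (f i).
Proof. exact: (big_morph nm nmM nm1). Qed.

(** Telescoping: the factors pass from [f] to [g] one at a time. *)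
Lemma prod_diff (I : finType) (P : pred I) (f g : I -> F) (a c : I -> R) :
  (forall i, P i -> nm (f i) <= a i) -> (forall i, P i -> nm (g i) <= a i) ->
  (forall i, P i -> nm (f i - g i) <= c i) ->
  nm (\prod_(i | P i) f i - \prod_(i | P i) g i) <=
  \sum_(j | P j) \prod_(i | P i) (if i == j then c i else a i).
Proof.
move=> h1 h2 h3.
have gen (l : seq I) : uniq l -> (forall i, i \in l -> P i) ->
  nm (\prod_(i <- l) f i - \prod_(i <- l) g i) <=
  \sum_(j <- l) \prod_(i <- l) (if i == j then c i else a i).
  elim: l => [|i l IH] hu hl; first by rewrite !big_nil subrr nm0.
  move: hu => /= /andP[il ul].
  have hi : P i by apply: hl; rewrite mem_head.
  have hl' k : k \in l -> P k by move=> hk; apply: hl; rewrite inE hk orbT.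
  rewrite !big_cons eqxx.
  have -> : \prod_(j <- l) (if j == i then c j else a j) = \prod_(j <- l) a j.
    by apply: eq_big_seq => j hj; case: eqP => // e; rewrite -e hj in il.
  have -> : \sum_(j <- l) \prod_(k <- i :: l) (if k == j then c k else a k) =
    a i * \sum_(j <- l) \prod_(k <- l) (if k == j then c k else a k).
    rewrite mulr_sumr; apply: eq_big_seq => j hj; rewrite big_cons; case: eqP => // e.
    by rewrite e hj in il.
  have -> : f i * \prod_(j <- l) f j - g i * \prod_(j <- l) g j =
    (f i - g i) * \prod_(j <- l) f j + g i * (\prod_(j <- l) f j - \prod_(j <- l) g j) by ring.
  apply: le_trans (nmD _ _) _; rewrite !nmM; apply: lerD; apply: ler_pM; rewrite ?nm_ge0 ?h3 ?h2 ?IH //.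
  rewrite (big_morph nm nmM nm1) big_seq [leRHS]big_seq; apply: ler_prod => j hj.
  by rewrite nm_ge0 h1 // hl'.
have hP i : i \in enum P -> P i by rewrite mem_enum.
have := gen (enum P) (enum_uniq _) hP.
rewrite !big_enum /= => h; apply: le_trans h _.
by apply: ler_sum => j _; rewrite big_enum.
Qed.

End AbsoluteValue.

(** * Bounds for sums of diagram values and of their differences *)

Section DiagramBounds.
Variables (F : numFieldType) (R : realFieldType) (nm : F -> R).
Hypothesis nm_ge0 : forall x, 0 <= nm x.
Hypothesis nm0 : nm 0 = 0.
Hypothesis nm1 : nm 1 = 1.
Hypothesis nmM : {morph nm : x y / x * y}.
Hypothesis nmD : forall x y, nm (x + y) <= nm x + nm y.
Hypothesis nmV : forall m : nat, nm (m%:R^-1) = m%:R^-1.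

Variables (n : nat) (rt : pred nat) (N : nat).
Hypothesis rt0 : rt 0%N.
Hypothesis n0 : (0 < n)%N.
Hypothesis N0 : (0 < N)%N.
Let s := #|Rto n rt|.
Let NR : 0 < N%:R :> R. Proof. by rewrite ltr0n. Qed.

Variables (A : 'M[F]_N) (q : 'I_N -> R) (r a : R).
Hypothesis q_ge0 : forall x, 0 <= q x.
Hypothesis q_le1 : forall x, q x <= 1.
Hypothesis q_sum : \sum_x q x ^+ 2 <= r.
Hypothesis r_ge1 : 1 <= r.
Hypothesis a_ge1 : 1 <= a.
Hypothesis A_pow : forall k x y, (0 < k)%N -> nm ((A ^+ k) x y) <= a ^+ k * (q x * q y).

Definition Kraw (P : 'M[F]_N) (u : diag n) (p : 'I_n) : 'M[F]_N := if u.1 p == p then A else P.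

Definition Jm : 'M[F]_N := const_mx N%:R^-1.

(** A tail receives the uniform kernel, whose column sums are those of every power of [P]; in this
    form its length has disappeared. *)
Definition Kcode (P : 'M[F]_N) M (Rs : {set 'I_M}) (w : diag M) (v : {ffun 'I_M -> 'I_n.+1}) (i : 'I_M) :=
  if w.1 i == i then A ^+ v i else
  if i \in tails Rs (nxS Rs) w.1 w.2 then Jm else P ^+ v i.

Lemma col_sum_exp (P : 'M[F]_N) : (forall z, \sum_y P y z = 1) ->
  forall k z, \sum_y (P ^+ k) y z = 1.
Proof.
move=> h; elim=> [|k IH] z.
  rewrite expr0 (bigD1 z) //= big1 ?addr0 ?mxE ?eqxx // => y /negbTE hy.
  by rewrite -[1]/(1%:M) mxE hy.
rewrite exprS -[_ * _]/(_ *m _); under eq_bigr do rewrite mxE.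
rewrite exchange_big /= -[RHS](IH z); apply: eq_bigr => y _.
by rewrite -mulr_suml h mul1r.
Qed.

Lemma dval_code (P : 'M[F]_N) (u : diag n) : rawdiag rt u.1 u.2 ->
  (forall z, \sum_y P y z = 1) ->
  let M := nbrk rt u in let c := code rt M u in
  dval (@nxo n rt) u.1 u.2 (Kraw P u) = dval (nxS c.1.1) c.1.2.1 c.1.2.2 (Kcode P c.1.1 c.1.2 c.2).
Proof.
move=> hu hP M c; have [k rr ab d] := hu; have hM : nbrk rt u = M by [].
have hw : skeleton s c.1.1 c.1.2 by apply: code_skeleton.
rewrite (dval_compress rt0 n0 k rr ab d (M := M) hM N0); last first.
  by move=> p p' e hl; have [_ hA] := Scnd_lk rt0 k ab d e hl; rewrite /Kraw hA.
rewrite [nxS c.1.1]cnxE /c /= crhoE cbE.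
set K1 := fun i : 'I_M => _; set K3 := Kcode _ _ _ _.
pose tl := tails (cRt rt M u) (nxS (cRt rt M u)) (crho rt M u) (cb rt M u).
pose K2 i := if i \in tl then Jm else K1 i.
have -> : dval (nxo (srt rt u.1 u.2)) (srho rt u.1 u.2 (M:=M)) (sb rt u.1 u.2 (M:=M)) K1 =
   dval (nxo (srt rt u.1 u.2)) (srho rt u.1 u.2 (M:=M)) (sb rt u.1 u.2 (M:=M)) K2.
  rewrite -crhoE -cbE -cnxE; apply: (dval_tails N0 hw) => p; rewrite /c /= -/tl.
    by rewrite /K2 => /negbTE->.
  move=> z hp; rewrite /K2 hp.
  have hA : (u.1 (stO hM p) == stO hM p) = false.
    rewrite -val_eqE /= -rnE -(srho_A rt0 n0 k rr ab d hM) -crhoE.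
    have := subsetP (tails_Frst hw) _ hp; rewrite inE /= => hlt.
    by rewrite -val_eqE /= gtn_eqF.
  rewrite /K1 /Kraw hA col_sum_exp //.
  under eq_bigr do rewrite mxE; rewrite sumr_const card_ord -[_ *+ N]mulr_natl mulfV //.
  by rewrite pnatr_eq0 -lt0n.
apply: eq_bigr => x _; apply: eq_bigr => i hi; congr (_ _ _); rewrite /K2 /K3 /Kcode /=.
have eA : (crho rt M u i == i) = (u.1 (stO hM i) == stO hM i).
  by rewrite crhoE (srho_A rt0 n0 k rr ab d hM) -val_eqE /= -rnE.
rewrite -/tl; case: (Efree_cases (cRt rt M u) (crho rt M u, cb rt M u) i) => -[c1 c2 c3].
- move: c2 c3; rewrite inE /= => /negbTE -> ; rewrite -/tl; case: (boolP (i \in tl)) => //= ht c3.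
  by rewrite /K1 /Kraw -eA; case: eqP => [e|_]; [move: c1; rewrite inE /= e ltnn|rewrite ffunE c3 inordK ?cwid_le].
- move: c2; rewrite inE /= => hA; rewrite hA.
  have -> : (i \in tl) = false.
    by apply/negP => /(subsetP (tails_Frst hw)); rewrite inE /= (eqP hA) ltnn.
  by rewrite /K1 /Kraw -eA hA ffunE c3 inordK ?cwid_le.
- by move: c1 c2 hi; rewrite !inE /= -crhoE -val_eqE /=; case: ltngtP.
Qed.

Lemma prod_letters (V : comPzSemiRingType) M (rho : 'I_M -> 'I_M) (al be : 'I_M -> V) :
  \prod_(p | p \notin Scnd rho) (if rho p == p then al p else be p) =
  (\prod_(p in Frst rho) be p) * \prod_(p in Alet rho) al p.
Proof.
rewrite (bigID (mem (Alet rho))) /= mulrC; congr (_ * _).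
  apply: eq_big => [p|p /andP[_]]; last by rewrite inE => /negbTE->.
  by rewrite !inE -val_eqE /=; case: ltngtP.
apply: eq_big => [p|p /andP[_]]; last by rewrite inE => ->.
by rewrite !inE -val_eqE /=; case: ltngtP.
Qed.

Section OneCode.
Variables (M : nat) (Rs : {set 'I_M}) (w : diag M) (v : {ffun 'I_M -> 'I_n.+1}).
Hypothesis hw : skeleton s Rs w.
Hypothesis hv : lengths Rs w v.
Local Notation nx := (nxS Rs).
Local Notation tl := (tails Rs nx w.1 w.2).

(** The runs of A-letters have total length at most n and [a] is at least 1, so all powers of [a]
    together cost a^n. *)
Lemma prod_letters_le (be : 'I_M -> R) (x : 'I_M -> 'I_N) : (forall p, p \in Frst w.1 -> 0 <= be p) ->
  \prod_(p | p \notin Scnd w.1) (if w.1 p == p then a ^+ v p * (q (x p) * q (x (nx p))) else be p) <=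
  a ^+ n * ((\prod_(p in Frst w.1) be p) * \prod_(p in Alet w.1) (q (x p) * q (x (nx p)))).
Proof.
move=> hb; rewrite (prod_letters (M := M) w.1) big_split /= mulrCA; apply: ler_wpM2r.
  by apply: mulr_ge0; apply: prodr_ge0 => // p _; apply: mulr_ge0.
rewrite -expr_sum; apply: ler_weXn2l => //.
case/andP: hv => _ hs; apply: leq_trans hs; rewrite /Efree [leqRHS](bigID (mem (Alet w.1))) /=.
apply: leq_trans (leq_addr _ _); rewrite big_mkcond [leqRHS]big_mkcond; apply: leq_sum => p _.
by rewrite in_setU; case: (p \in Alet _); rewrite ?orbT.
Qed.

Lemma v_pos p : p \notin Scnd w.1 -> p \notin tl -> (0 < v p)%N.
Proof.
move=> h1 h2; case/andP: hv => /forallP /(_ p) + _; case: (Efree_cases Rs w p) => -[c1 c2 c3].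
- by rewrite c3 h2 lt0n.
- by rewrite c3 lt0n.
- by move: h1 c1 c2; rewrite !inE -val_eqE /=; case: ltngtP.
Qed.

Lemma tl_noA p : p \in tl -> (w.1 p == p) = false.
Proof.
move=> /(subsetP (tails_Frst hw)); rewrite inE /= => h.
by rewrite -val_eqE /= gtn_eqF.
Qed.

Definition kapc (pr : nat -> 'I_N -> 'I_N -> R) (p : 'I_M) (j : nat) x y : R :=
  if p \in tl then N%:R^-1 else pr j x y.

Lemma Kcode_le (P : 'M[F]_N) (pr : nat -> 'I_N -> 'I_N -> R) p x y :
  (forall j x y, (0 < j)%N -> nm ((P ^+ j) x y) <= pr j x y) -> p \notin Scnd w.1 ->
  nm (Kcode P Rs w v p x y) <= if w.1 p == p then a ^+ v p * (q x * q y) else kapc pr p (v p) x y.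
Proof.
move=> hp hS; rewrite /Kcode /kapc; have [ht|ht] := boolP (p \in tl).
  by rewrite (tl_noA ht) mxE nmV.
by case: ifP => hA; [apply: A_pow|apply: hp]; apply: v_pos.
Qed.

Lemma code_bound (P : 'M[F]_N) (pr : nat -> 'I_N -> 'I_N -> R) : (forall j x y, 0 <= pr j x y) ->
  (forall j x y, (0 < j)%N -> nm ((P ^+ j) x y) <= pr j x y) ->
  nm (dval nx w.1 w.2 (Kcode P Rs w v)) <= a ^+ n * lsum Rs w q (fun p => kapc pr p (v p)).
Proof.
move=> pr0 hp; apply: le_trans (nm_sum nm0 nmD _ _) _.
rewrite /lsum mulr_sumr; apply: ler_sum => x _; rewrite (nm_prod nm1 nmM).
apply: le_trans (prod_letters_le _ _); last first.
  by move=> p _; rewrite /kapc; case: ifP => // _; rewrite invr_ge0 ler0n.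
by apply: ler_prod => p hS; rewrite nm_ge0 Kcode_le.
Qed.

Definition kapd (pr df : nat -> 'I_N -> 'I_N -> R) (j0 p : 'I_M) (j : nat) x y : R :=
  if p == j0 then df j x y else kapc pr p j x y.

Lemma code_diff (P P' : 'M[F]_N) (pr df : nat -> 'I_N -> 'I_N -> R) :
  (forall j x y, 0 <= pr j x y) -> (forall j x y, 0 <= df j x y) ->
  (forall j x y, (0 < j)%N -> nm ((P ^+ j) x y) <= pr j x y) ->
  (forall j x y, (0 < j)%N -> nm ((P' ^+ j) x y) <= pr j x y) ->
  (forall j x y, (0 < j)%N -> nm ((P ^+ j) x y - (P' ^+ j) x y) <= df j x y) ->
  nm (dval nx w.1 w.2 (Kcode P Rs w v) - dval nx w.1 w.2 (Kcode P' Rs w v)) <=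
  \sum_(j0 in Frst w.1 :\: tl) a ^+ n * lsum Rs w q (fun p => kapd pr df j0 p (v p)).
Proof.
move=> pr0 df0 hP hP' hd; rewrite /dval -sumrB; apply: le_trans (nm_sum nm0 nmD _ _) _.
under [leRHS]eq_bigr do rewrite /lsum mulr_sumr.
rewrite exchange_big /=; apply: ler_sum => x _.
pose be p := if w.1 p == p then a ^+ v p * (q (x p) * q (x (nx p))) else kapc pr p (v p) (x p) (x (nx p)).
pose ce p := if (w.1 p == p) || (p \in tl) then 0 else df (v p) (x p) (x (nx p)).
apply: le_trans (prod_diff nm_ge0 nm0 nm1 nmM nmD (a := be) (c := ce) _ _ _) _.
- by move=> p hS; apply: Kcode_le.
- by move=> p hS; apply: Kcode_le.
- move=> p hS; rewrite /Kcode /ce; case: (boolP (w.1 p == p)) => hA; first by rewrite subrr nm0.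
  by case: (boolP (p \in tl)) => ht /=; [rewrite subrr nm0|apply: hd; apply: v_pos].
rewrite (bigID (mem (Frst w.1 :\: tl))) /= [X in _ + X]big1 ?addr0; last first.
  move=> p /andP[hS hp]; rewrite (bigD1 p) //= eqxx /ce.
  have -> : (w.1 p == p) || (p \in tl).
    by move: hS hp; rewrite in_setD !inE -val_eqE /=; case: (ltngtP p (w.1 p)); rewrite ?andbT ?negbK // => _ _; rewrite orbC => ->.
  by rewrite mul0r.
rewrite (eq_bigl (fun p => p \in Frst w.1 :\: tl)); last first.
  move=> p; rewrite in_setD !inE; case: (ltngtP p (w.1 p)); rewrite ?andbF //.
apply: ler_sum => j0 hj.
apply: le_trans (prod_letters_le _ _); last first.
  by move=> p _; rewrite /kapd /kapc; case: ifP => // _; case: ifP => // _; rewrite invr_ge0 ler0n.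
apply: ler_prod => p hS.
case/setDP: hj => hF /negbTE jt; rewrite inE /= in hF.
have jF : (w.1 j0 == j0) = false by rewrite -val_eqE /= gtn_eqF.
rewrite /kapd; case: eqP => [->|_]; first by rewrite /ce jF jt /= df0 lexx.
rewrite /be lexx andbT; case: ifP => _; first by rewrite !mulr_ge0 ?exprn_ge0 // (le_trans ler01).
by rewrite /kapc; case: ifP => // _; rewrite invr_ge0 ler0n.
Qed.

End OneCode.

Variables (T0 : nat -> R) (pr : nat -> 'I_N -> 'I_N -> R) (c0 : R).
(** The length scale 1/h = n/(k+1): large enough for (1+h)^n to be exponential in k only, small
    enough to beat the number of skeletons. *)
Definition Rk (k : nat) : R := n%:R / k.+1%:R.
Definition Bk (k : nat) : R := (1 + (Rk k)^-1) ^+ n *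
  (r ^+ (2 * k + 2 * s) * T0 k ^+ (k + s) * Rk k ^+ (2 * k) * N%:R ^- k).
Hypothesis RT : forall k, Rk k <= T0 k.
Hypothesis pr_ge0 : forall j x y, 0 <= pr j x y.
Hypothesis pr_row : forall j x, \sum_y pr j x y <= c0.
Hypothesis prT : forall k x y, (k < n)%N ->
  \sum_(j < n.+1 | j != ord0) (1 + (Rk k)^-1) ^- j * pr j x y <= c0 * (T0 k / N%:R).

Lemma Rk_gt0 k : 0 < Rk k.
Proof. by rewrite divr_gt0 // ltr0n. Qed.

Lemma Rk_ge1 k : (k < n)%N -> 1 <= Rk k.
Proof. by move=> h; rewrite ler_pdivlMr ?ltr0n // mul1r ler_nat. Qed.

Lemma Bk_ge0 k : 0 <= Bk k.
Proof.
have h := Rk_gt0 k; have hT := le_trans (ltW h) (RT k).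
by rewrite !mulr_ge0 ?exprn_ge0 ?invr_ge0 ?exprn_ge0 ?ler0n ?addr_ge0 ?invr_ge0 // ?(ltW h) // (le_trans ler01).
Qed.

Lemma skeleton_sum M (Rs : {set 'I_M}) (w : diag M) (gm : 'I_M -> R)
    (kap : 'I_M -> nat -> 'I_N -> 'I_N -> R) : (0 < M)%N -> (M <= n)%N -> skeleton s Rs w ->
  let tl := tails Rs (nxS Rs) w.1 w.2 in let k := defect Rs w in
  (forall p, 0 <= gm p) -> (forall p j x y, 0 <= kap p j x y) ->
  (forall p j x y, p \in tl -> kap p j x y = N%:R^-1) ->
  (forall p x y, p \notin tl ->
     \sum_(j < n.+1 | j != ord0) (1 + (Rk k)^-1) ^- j * kap p j x y <= gm p * (T0 k / N%:R)) ->
  (forall p x, p \notin tl ->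
     \sum_y \sum_(j < n.+1 | j != ord0) (1 + (Rk k)^-1) ^- j * kap p j x y <= gm p * Rk k) ->
  \sum_(v : {ffun 'I_M -> 'I_n.+1} | lengths Rs w v) lsum Rs w q (fun p => kap p (v p)) <=
  (\prod_(p in Frst w.1 :\: tl) gm p) * Bk k.
Proof.
move=> M0 Mn hw tl k gm0 kap0 kt kT kR.
have kn : (k < n)%N by apply: sk_defect_lt hw _ _ _.
apply: (skeleton_bound N0 hw q_ge0 q_le1 q_sum r_ge1 (kap := kap) (h := (Rk k)^-1)) => //.
- by rewrite invr_gt0 Rk_gt0.
- exact: Rk_ge1.
- by move=> p x y _; apply: kT.
- by move=> p x _; apply: kR.
- by move=> p x y /kt->.
- move=> p x hp; under eq_bigr do rewrite kt //; rewrite sumr_const card_ord -[_ *+ N]mulr_natl mulfV //.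
  by rewrite pnatr_eq0 -lt0n.
Qed.

Lemma hat_row (kp : nat -> 'I_N -> 'I_N -> R) c k x :
  (forall j x, \sum_y kp j x y <= c) -> 0 <= c ->
  \sum_y \sum_(j < n.+1 | j != ord0) (1 + (Rk k)^-1) ^- j * kp j x y <= c * Rk k.
Proof.
move=> hc c00; have hR := Rk_gt0 k; rewrite exchange_big /=.
apply: (@le_trans _ _ (\sum_(j < n.+1 | j != ord0) (1 + (Rk k)^-1) ^- j * c)).
  apply: ler_sum => j _; rewrite -mulr_sumr; apply: ler_wpM2l => //.
  by rewrite invr_ge0 exprn_ge0 // addr_ge0 // invr_ge0 ltW.
rewrite -mulr_suml mulrC; apply: ler_wpM2l => //.
by apply: le_trans (geometric_le _ _) _; rewrite ?invr_gt0 // invrK.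
Qed.

Lemma diagram_sum (P : 'M[F]_N) : (forall z, \sum_y P y z = 1) -> c0 = 1 ->
  (forall j x y, (0 < j)%N -> nm ((P ^+ j) x y) <= pr j x y) ->
  \sum_(u in rawset n rt) nm (dval (@nxo n rt) u.1 u.2 (Kraw P u)) <=
  a ^+ n * \sum_(k < n) (Wk n rt k)%:R * Bk k.
Proof.
move=> hP c1 hp; have a0 : 0 <= a ^+ n by rewrite exprn_ge0 // (le_trans ler01).
pose f M (c : {set 'I_M} * diag M * {ffun 'I_M -> 'I_n.+1}) : R :=
  a ^+ n * lsum c.1.1 c.1.2 q (fun p => kapc c.1.1 c.1.2 pr p (c.2 p)).
have kap0 M (Rs : {set 'I_M}) (w : diag M) p j x y : 0 <= kapc Rs w pr p j x y.
  by rewrite /kapc; case: ifP => // _; rewrite invr_ge0 ler0n.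
apply: (@le_trans _ _ (\sum_(u in rawset n rt) @f (nbrk rt u) (code rt (nbrk rt u) u))).
  apply: ler_sum => u /rawsetP hu; rewrite (dval_code hu hP).
  by apply: code_bound => //; [apply: code_skeleton|apply: code_lengths].
apply: le_trans (master_sum rt0 n0 (B := fun k => a ^+ n * Bk k) _ _ _) _ => [M c|k|M Rs w M0 Mn hw|].
- by apply: mulr_ge0 => //; apply: lsum_ge0.
- by apply: mulr_ge0 => //; apply: Bk_ge0.
- rewrite /f /= -mulr_sumr; apply: ler_wpM2l => //.
  apply: le_trans (skeleton_sum (gm := fun=> 1) (kap := kapc Rs w pr) M0 Mn hw _ _ _ _ _) _ => //.
  + by move=> p j x y ht; rewrite /kapc ht.
  + move=> p x y /negbTE ht; rewrite /kapc ht.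
    have hk : (defect Rs w < n)%N by apply: sk_defect_lt hw _ _ _.
    by have := prT x y hk; rewrite c1.
  + move=> p x /negbTE ht; rewrite /kapc ht; apply: hat_row => //.
    by move=> j x0; have := pr_row j x0; rewrite c1.
  + by rewrite big1 // mul1r.
by rewrite mulr_sumr le_eqVlt; apply/orP; left; apply/eqP/eq_bigr => k _; rewrite mulrCA.
Qed.

(** The differing letter [j0] has total mass D/N over all lengths, hence factor D/[Rk k] relative to
    an ordinary letter. The other letters cost 2 each, as [pr] dominates two kernels at once. There
    are at most M <= 2^M choices of [j0], and 2^M times 2^M is at most 4^(6k+4s). *)
Lemma diagram_diff (P P' : 'M[F]_N) (df : nat -> 'I_N -> 'I_N -> R) (D : R) :
  (forall z, \sum_y P y z = 1) -> (forall z, \sum_y P' y z = 1) -> c0 = 2%:R -> 0 <= D ->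
  (forall j x y, 0 <= df j x y) ->
  (forall j x y, (0 < j)%N -> nm ((P ^+ j) x y) <= pr j x y) ->
  (forall j x y, (0 < j)%N -> nm ((P' ^+ j) x y) <= pr j x y) ->
  (forall j x y, (0 < j)%N -> nm ((P ^+ j) x y - (P' ^+ j) x y) <= df j x y) ->
  (forall x y, \sum_(j < n.+1 | j != ord0) df j x y <= D / N%:R) ->
  \sum_(u in rawset n rt) nm (dval (@nxo n rt) u.1 u.2 (Kraw P u) - dval (@nxo n rt) u.1 u.2 (Kraw P' u)) <=
  a ^+ n * \sum_(k < n) (Wk n rt k)%:R * (4%:R ^+ (6 * k + 4 * s) * (D / Rk k) * Bk k).
Proof.
move=> hP hP' c2 D0 df0 hp hp' hd hD; have a0 : 0 <= a ^+ n by rewrite exprn_ge0 // (le_trans ler01).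
pose f M (c : {set 'I_M} * diag M * {ffun 'I_M -> 'I_n.+1}) : R :=
  \sum_(j0 in Frst c.1.2.1 :\: tails c.1.1 (nxS c.1.1) c.1.2.1 c.1.2.2)
  a ^+ n * lsum c.1.1 c.1.2 q (fun p => kapd c.1.1 c.1.2 pr df j0 p (c.2 p)).
have kap0 M (Rs : {set 'I_M}) (w : diag M) j0 p j x y : 0 <= kapd Rs w pr df j0 p j x y.
  by rewrite /kapd /kapc; case: ifP => // _; case: ifP => // _; rewrite invr_ge0 ler0n.
have B0 k : 0 <= 4%:R ^+ (6 * k + 4 * s) * (D / Rk k) * Bk k.
  have hR := ltW (Rk_gt0 k); have hB := Bk_ge0 k.
  by apply: mulr_ge0 => //; apply: mulr_ge0; [rewrite exprn_ge0 ?ler0n|apply: divr_ge0].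
apply: (@le_trans _ _ (\sum_(u in rawset n rt) @f (nbrk rt u) (code rt (nbrk rt u) u))).
  apply: ler_sum => u /rawsetP hu; rewrite (dval_code hu hP) (dval_code hu hP').
  by apply: code_diff => //; [apply: code_skeleton|apply: code_lengths].
apply: le_trans (master_sum rt0 n0
  (B := fun k => a ^+ n * (4%:R ^+ (6 * k + 4 * s) * (D / Rk k) * Bk k)) _ _ _) _ => [M c|k|M Rs w M0 Mn hw|].
- by apply: sumr_ge0 => j _; apply: mulr_ge0 => //; apply: lsum_ge0.
- by apply: mulr_ge0.
- set k := defect Rs w; rewrite /f /= exchange_big /=.
  set tl := tails _ _ _ _; set FT := _ :\: tl.
  have kn : (k < n)%N by apply: sk_defect_lt hw _ _ _.
  have hR := Rk_gt0 k; have hT := le_trans (ltW hR) (RT k).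
  have g0 : 0 <= D / Rk k by rewrite divr_ge0 // ltW.
  apply: (@le_trans _ _ (\sum_(j0 in FT) a ^+ n * (2%:R ^+ M * (D / Rk k) * Bk k))); last first.
    rewrite sumr_const -[_ *+ _]mulr_natl mulrCA; apply: ler_wpM2l => //.
    have hB := Bk_ge0 k; move: (Bk k) hB => B hB.
    rewrite !mulrA; apply: ler_wpM2r => //.
    apply: ler_wpM2r; first by rewrite invr_ge0 ltW.
    apply: ler_wpM2r => //; have hM := sk_M_le hw; rewrite -/k in hM.
    rewrite -natrX -natrM -natrX ler_nat (_ : 4 = 2 * 2)%N // expnMn; apply: leq_mul; last by rewrite leq_exp2l.
    apply: leq_trans (max_card _) _; rewrite card_ord; apply: leq_trans hM _; apply: ltnW; exact: ltn_expl.
  apply: ler_sum => j0 hj; rewrite -mulr_sumr; apply: ler_wpM2l => //.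
  have jt : j0 \notin tl by move: hj; rewrite in_setD => /andP[].
  apply: le_trans (skeleton_sum (gm := fun p => if p == j0 then D / Rk k else 2%:R)
     (kap := kapd Rs w pr df j0) M0 Mn hw _ _ _ _ _) _ => //.
  + by move=> p; case: ifP => // _; rewrite ler0n.
  + move=> p j x y ht; rewrite /kapd /kapc ht; case: eqP => // e; by move: jt; rewrite -e ht.
  + move=> p x y /negbTE ht; rewrite /kapd /kapc ht -/k; case: eqP => _; last by have := prT x y kn; rewrite c2.
    apply: (@le_trans _ _ (D / N%:R)).
      apply: le_trans (hD x y); apply: ler_sum => j _; apply: ler_piMl => //.
      by rewrite invf_le1 ?exprn_gt0 ?exprn_ege1 // ?addr_gt0 ?invr_gt0 // lerDl invr_ge0 ltW.
    rewrite mulrA; apply: ler_wpM2r; first by rewrite invr_ge0 ler0n.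
    by rewrite -mulrA ler_peMr // ler_pdivlMl // mulr1 RT.
  + move=> p x /negbTE ht; rewrite /kapd /kapc ht -/k; case: eqP => _; last first.
      apply: hat_row; last by rewrite ler0n.
      by move=> j x0; have := pr_row j x0; rewrite c2.
    apply: (@le_trans _ _ (\sum_(y : 'I_N) D / N%:R)).
      apply: ler_sum => y _; apply: le_trans (hD x y); apply: ler_sum => j _; apply: ler_piMl => //.
      by rewrite invf_le1 ?exprn_gt0 ?exprn_ege1 // ?addr_gt0 ?invr_gt0 // lerDl invr_ge0 ltW.
    by rewrite sumr_const card_ord -mulrnAl -mulr_natr mulfK ?pnatr_eq0 -?lt0n // divfK // gt_eqF.
  + apply: ler_wpM2r; first exact: Bk_ge0.
    rewrite (bigD1 j0) //= eqxx mulrC; apply: ler_wpM2r => //.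
    rewrite (eq_bigr (fun=> 2%:R)); last by move=> p /andP[_ /negbTE->].
    rewrite prodr_const; apply: ler_weXn2l; first by rewrite ler1n.
    by apply: leq_trans (max_card _) _; rewrite card_ord.
by rewrite mulr_sumr le_eqVlt; apply/orP; left; apply/eqP/eq_bigr => k _; rewrite mulrCA.
Qed.

End DiagramBounds.

(** * Powers of a doubly stochastic matrix in blocks of length t *)

Section Blocks.
Variable R : realFieldType.

Lemma sum_blocks (V : nmodType) (f : nat -> V) t Q :
  \sum_(i < Q * t) f i.+1 = \sum_(q < Q) \sum_(r < t) f (q * t + r.+1)%N.
Proof.
elim: Q => [|Q IH]; first by rewrite !big_ord0.
rewrite big_ord_recr /= -IH mulSn addnC big_split_ord /=; congr (_ + _).
by apply: eq_bigr => r _; rewrite addnS.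
Qed.

Lemma sum_le_blocks (f : nat -> R) n t : (0 < t)%N -> (forall j, 0 <= f j) ->
  \sum_(j < n.+1 | j != ord0) f j <= \sum_(q < n) \sum_(r < t) f (q * t + r.+1)%N.
Proof.
move=> t0 f0; rewrite -sum_blocks big_mkcond big_ord_recl /= add0r.
have -> : \sum_(i < n) f (bump 0 i) = \sum_(i < n) f i.+1 by apply: eq_bigr.
have h : (n <= n * t)%N by rewrite leq_pmulr.
rewrite (big_ord_widen _ (fun i => f i.+1) h) big_mkcond.
by apply: ler_sum => i _; case: ifP.
Qed.

Lemma geometric_sum_le (x : R) n : 0 <= x -> x < 1 -> \sum_(q < n) x ^+ q <= (1 - x)^-1.
Proof.
move=> x0 x1; have h : 0 < 1 - x by rewrite subr_gt0.
rewrite -(ler_pM2l h) divff ?gt_eqF //.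
have -> : (1 - x) * \sum_(q < n) x ^+ q = 1 - x ^+ n.
  by have := subrXX 1 x n; rewrite expr1n => ->; congr (_ * _); apply: eq_bigr => i _; rewrite expr1n mul1r.
by rewrite gerBl exprn_ge0.
Qed.

Lemma bernoulli_le (h : R) t : 0 <= h -> 1 + t%:R * h <= (1 + h) ^+ t.
Proof.
move=> h0; elim: t => [|t IH]; first by rewrite expr0 mul0r addr0.
rewrite exprS; apply: (@le_trans _ _ ((1 + h) * (1 + t%:R * h))); last first.
  by apply: ler_wpM2l => //; rewrite addr_ge0.
have : 0 <= t%:R * h * h by rewrite !mulr_ge0 ?ler0n.
by rewrite -[t.+1]addn1 natrD; nra.
Qed.

Variables (N t : nat) (P : 'M[R]_N) (g dl : R).
Hypothesis N0 : (0 < N)%N.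
Hypothesis t0 : (0 < t)%N.
Hypothesis P_ge0 : forall x y, 0 <= P x y.
Hypothesis P_row : forall x, \sum_y P x y = 1.
Hypothesis P_col : forall y, \sum_x P x y = 1.
Local Notation p j := (P ^+ j).
Hypothesis g1 : 1 <= g.
Hypothesis B1 : forall x y, \sum_(r < t) p r.+1 x y <= g * t%:R / N%:R.

Lemma pow_ge0 j x y : 0 <= p j x y.
Proof.
elim: j x y => [|j IH] x y; first by rewrite expr0 mxE ler0n.
by rewrite exprS -[_ * _]/(_ *m _) mxE sumr_ge0 // => z _; rewrite mulr_ge0.
Qed.

Lemma pow_row j x : \sum_y p j x y = 1.
Proof.
elim: j x => [|j IH] x.
  by rewrite expr0 (bigD1 x) //= big1 ?addr0 ?mxE ?eqxx // => y hy; rewrite mxE eq_sym (negbTE hy).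
rewrite exprS -[_ * _]/(_ *m _); under eq_bigr do rewrite mxE.
by rewrite exchange_big /= -[RHS](P_row x); apply: eq_bigr => z _; rewrite -mulr_sumr IH mulr1.
Qed.

Lemma pow_col j y : \sum_x p j x y = 1.
Proof.
elim: j y => [|j IH] y.
  by rewrite expr0 (bigD1 y) //= big1 ?addr0 ?mxE ?eqxx // => x hx; rewrite mxE (negbTE hx).
rewrite exprS -[_ * _]/(_ *m _); under eq_bigr do rewrite mxE.
rewrite exchange_big /= -[RHS](IH y); apply: eq_bigr => z _; rewrite -mulr_suml P_col mul1r //.
Qed.

Lemma pow_le1 j x y : p j x y <= 1.
Proof.
rewrite -(pow_row j x) (bigD1 y) //= lerDl; apply: sumr_ge0 => z _; exact: pow_ge0.
Qed.

Lemma pow_block q x y : \sum_(r < t) p (q * t + r.+1) x y <= g * t%:R / N%:R.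
Proof.
under eq_bigr do rewrite exprD -[_ * _]/(_ *m _) mxE.
rewrite exchange_big /=; under eq_bigr do rewrite -mulr_sumr.
apply: (@le_trans _ _ (\sum_z p (q * t) x z * (g * t%:R / N%:R))).
  by apply: ler_sum => z _; apply: ler_wpM2l => //; apply: pow_ge0.
by rewrite -mulr_suml pow_row mul1r.
Qed.

(** Each block of [t] consecutive powers has sum at most g t/N, and the weights decay by z =
    (1+h)^(-t) from block to block. Bernoulli's inequality gives 1/(1-z) <= 1 + 1/(t h), and 1/h =
    R0. *)
Lemma laplace_pow (R0 : R) n x y : 0 < R0 ->
  \sum_(j < n.+1 | j != ord0) (1 + R0^-1) ^- j * p j x y <= g * (t%:R + R0) / N%:R.
Proof.
move=> R00; set h := R0^-1; have h0 : 0 < h by rewrite invr_gt0.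
have h1 : 0 < 1 + h by rewrite addr_gt0.
have h1' : 1 <= 1 + h by rewrite lerDl ltW.
have T0 : 0 < t%:R :> R by rewrite ltr0n.
have G0 : 0 <= g * t%:R / N%:R by rewrite !mulr_ge0 ?invr_ge0 ?ler0n // (le_trans ler01).
apply: le_trans (sum_le_blocks (f := fun j => (1 + h) ^- j * p j x y) n t0 _) _.
  by move=> j; rewrite mulr_ge0 ?pow_ge0 // invr_ge0 exprn_ge0 // ltW.
set z := (1 + h) ^- t.
have z0 : 0 <= z by rewrite invr_ge0 exprn_ge0 // ltW.
have zb := @bernoulli_le h t (ltW h0).
have zx : z <= (1 + t%:R * h)^-1.
  by rewrite lef_pV2 ?posrE ?exprn_gt0 ?addr_gt0 ?mulr_gt0.
have z1 : z < 1.
  apply: le_lt_trans zx _; rewrite invf_lt1 ?ltrDl ?mulr_gt0 // addr_gt0 // mulr_gt0 //.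
apply: (@le_trans _ _ (\sum_(q < n) z ^+ q * (g * t%:R / N%:R))).
  apply: ler_sum => q _; apply: le_trans (ler_wpM2l _ (pow_block q x y)); last exact: exprn_ge0.
  rewrite mulr_sumr; apply: ler_sum => r _; apply: ler_wpM2r; first exact: pow_ge0.
  rewrite /z exprVn -exprM mulnC lef_pV2 ?posrE ?exprn_gt0 //.
  by apply: ler_weXn2l => //; rewrite leq_addr.
rewrite -mulr_suml; apply: (@le_trans _ _ ((1 - z)^-1 * (g * t%:R / N%:R))).
  by apply: ler_wpM2r => //; apply: geometric_sum_le.
have -> : g * (t%:R + R0) / N%:R = (1 + (t%:R * h)^-1) * (g * t%:R / N%:R).
  by rewrite /h; field; rewrite !gt_eqF ?ltr0n.
apply: ler_wpM2r => //.
have -> : 1 + (t%:R * h)^-1 = (1 - (1 + t%:R * h)^-1)^-1.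
  have : 0 < t%:R * h by rewrite mulr_gt0.
  move: (t%:R * h) => u u0.
  have e : 1 - (1 + u)^-1 = u / (1 + u) by field; rewrite gt_eqF // addr_gt0.
  by rewrite e invf_div mulrDl div1r divff ?gt_eqF // addrC.
rewrite lef_pV2 ?posrE ?subr_gt0 //; last by rewrite invf_lt1 ?ltrDl ?mulr_gt0 // addr_gt0 // mulr_gt0.
by rewrite lerD2l lerN2.
Qed.

Hypothesis dl0 : 0 <= dl.
Hypothesis dl1 : dl <= 2^-1.
Hypothesis B2 : forall x y j, (t <= j)%N -> `|p j x y - N%:R^-1| <= dl / N%:R.

(** For the uniform matrix J, double stochasticity gives P^j - J = (P^(j-t) - J)(P^t - J); every
    further [t] steps gain a factor [dl]. *)
Lemma contraction q j x y : (q.+1 * t <= j)%N -> `|p j x y - N%:R^-1| <= dl ^+ q.+1 / N%:R.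
Proof.
have NR : N%:R != 0 :> R by rewrite pnatr_eq0 -lt0n.
elim: q j x y => [|q IH] j x y hj; first by rewrite expr1; apply: B2; rewrite mul1n in hj.
have hj1 : (q.+1 * t <= j - t)%N by rewrite leq_subRL ?(leq_trans _ hj) // ?mulSn // leq_addr.
have ej : j = (j - t + t)%N by rewrite subnK // (leq_trans _ hj) // mulSn leq_addr.
have -> : p j x y - N%:R^-1 = \sum_z (p (j - t) x z - N%:R^-1) * (p t z y - N%:R^-1).
  rewrite {1}ej exprD -[_ * _]/(_ *m _) mxE.
  rewrite [RHS](eq_bigr (fun z => p (j - t) x z * p t z y - N%:R^-1 * p (j - t) x z
     - N%:R^-1 * p t z y + N%:R^-1 * N%:R^-1)); last by move=> z _; ring.
  rewrite big_split /= !sumrB -!mulr_sumr pow_row pow_col sumr_const card_ord -[_ *+ N]mulr_natl.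
  by field.
apply: le_trans (ler_norm_sum _ _ _) _.
apply: (@le_trans _ _ (\sum_(z : 'I_N) dl ^+ q.+1 / N%:R * (dl / N%:R))).
  by apply: ler_sum => z _; rewrite normrM; apply: ler_pM => //; [apply: IH|apply: B2].
rewrite sumr_const card_ord -[_ *+ N]mulr_natl le_eqVlt; apply/orP; left; apply/eqP.
by rewrite [in RHS]exprSr; field.
Qed.

(** The first block costs its (B1) bound plus t/N. The later blocks form a geometric series in [dl],
    which is at most t/N because [dl] is at most 1/2. *)
Lemma difference_sum n x y :
  \sum_(j < n.+1 | j != ord0) `|p j x y - N%:R^-1| <= (g + 2%:R) * t%:R / N%:R.
Proof.
have NR : 0 < N%:R :> R by rewrite ltr0n.
apply: le_trans (sum_le_blocks (f := fun j => `|p j x y - N%:R^-1|) n t0 _) _ => //.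
case: n => [|n]; first by rewrite big_ord0 !mulr_ge0 ?invr_ge0 ?ler0n // addr_ge0 // (le_trans ler01).
rewrite big_ord_recl.
have -> : (g + 2%:R) * t%:R / N%:R = (g * t%:R / N%:R + t%:R / N%:R) + t%:R / N%:R by ring.
apply: lerD.
  apply: (@le_trans _ _ (\sum_(r < t) (p r.+1 x y + N%:R^-1))).
    apply: ler_sum => r _; rewrite mul0n add0n; apply: le_trans (ler_normB _ _) _.
    by rewrite !ger0_norm ?pow_ge0 // invr_ge0 ltW.
  rewrite big_split /= sumr_const card_ord -[_ *+ t]mulr_natl; apply: lerD => //; exact: B1.
have d1 : dl < 1 by apply: le_lt_trans dl1 _; rewrite invf_lt1 // ltr1n.
apply: (@le_trans _ _ (\sum_(q < n) dl ^+ q * (dl * t%:R / N%:R))).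
  apply: ler_sum => q _; apply: (@le_trans _ _ (\sum_(r < t) dl ^+ q.+1 / N%:R)).
    by apply: ler_sum => r _; apply: contraction; rewrite leq_addr.
  rewrite sumr_const card_ord -[_ *+ t]mulr_natl exprSr le_eqVlt; apply/orP; left; apply/eqP; ring.
rewrite -mulr_suml; apply: (@le_trans _ _ (2%:R * (2%:R^-1 * t%:R / N%:R))); last first.
  by rewrite !mulrA divff ?mul1r // pnatr_eq0.
apply: ler_pM.
- by apply: sumr_ge0 => q _; apply: exprn_ge0.
- by rewrite !mulr_ge0 ?invr_ge0 ?ler0n.
- apply: le_trans (geometric_sum_le n dl0 d1) _; rewrite invf_ple ?posrE ?subr_gt0 //.
  by move: dl1; lra.
- by rewrite -!mulrA; apply: ler_wpM2r => //; rewrite divr_ge0 ?ler0n.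
Qed.

End Blocks.

(** * Hafnians with fixed points *)

Section Hafnian.
Variables (F : comPzRingType) (n : nat).
Local Notation I := 'I_n.
Implicit Types (S : {set I}) (h : {ffun I -> I}) (a : I -> F) (C : I -> I -> F).

Definition invol_on S : {set {ffun I -> I}} :=
  [set h : {ffun I -> I} | [forall p, h (h p) == p] && [forall p, (p \notin S) ==> (h p == p)]].

Lemma invol_onP S h : reflect (involutive h /\ forall p, p \notin S -> h p = p) (h \in invol_on S).
Proof.
rewrite inE; apply: (iffP andP) => -[h1 h2]; split.
- by move=> p; apply/eqP/(forallP h1).
- by move=> p hp; apply/eqP; have := forallP h2 p; rewrite hp.
- by apply/forallP => p; rewrite h1.
- by apply/forallP => p; apply/implyP => /h2->.
Qed.

Definition hwt a C S h : F :=
  \prod_p ((if (p \in S) && (h p == p) then a p else 1) * (if (p < h p)%N then C p (h p) else 1)).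

Definition haf a C S : F := \sum_(h in invol_on S) hwt a C S h.

Lemma haf0 a C : haf a C set0 = 1.
Proof.
rewrite /haf (big_pred1 [ffun p => p]) => [|h].
  by rewrite /hwt big1 // => p _; rewrite inE ffunE ltnn mulr1.
apply/invol_onP/eqP => [[_ hp]|->]; first by apply/ffunP => p; rewrite ffunE hp // inE.
by split => [p|p _]; rewrite !ffunE.
Qed.

Lemma invol_on_fix S p0 h : (h \in invol_on (S :\ p0)) = (h \in invol_on S) && (h p0 == p0).
Proof.
apply/invol_onP/andP => [[h1 h2]|[/invol_onP[h1 h2] /eqP h3]].
  split; last by rewrite h2 // !inE eqxx.
  by apply/invol_onP; split => // p hp; apply: h2; rewrite !inE (negbTE hp) andbF.
by split => // p; rewrite !inE negb_and negbK => /orP[/eqP->|/h2].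
Qed.

(** Sort the involutions by the partner of [p0]. *)
Lemma haf_rec a C S p0 : (forall p q, C p q = C q p) -> p0 \in S ->
  haf a C S = a p0 * haf a C (S :\ p0) + \sum_(q in S :\ p0) C p0 q * haf a C (S :\ p0 :\ q).
Proof.
move=> Cs hp0; rewrite {1}/haf (bigID (fun h : {ffun I -> I} => h p0 == p0)) /=; congr (_ + _).
  rewrite /haf mulr_sumr; apply: eq_big => [h|h]; first by rewrite invol_on_fix.
  move=> /andP[/invol_onP[h1 h2] /eqP h3].
  rewrite /hwt (bigD1 p0) //= [in RHS](bigD1 p0) //= !inE hp0 h3 eqxx ltnn mulr1 /= mul1r; congr (_ * _).
  by rewrite mul1r; apply: eq_bigr => p /negbTE hp; rewrite !inE hp.
rewrite (partition_big (fun h : {ffun I -> I} => h p0) (fun q => q \in S :\ p0)) /=; last first.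
  move=> h /andP[/invol_onP[h1 h2] h3]; rewrite !inE h3 /=.
  by apply: contraR h3 => /h2; rewrite h1 => e; rewrite -e.
apply: eq_bigr => q; rewrite !inE => /andP[hq hqS].
(* [psi] adds the pair of [p0] and [q] to an involution fixing both, and [phi] removes it. *)
pose psi h : {ffun I -> I} := [ffun p => if p == p0 then q else if p == q then p0 else h p].
pose phi h : {ffun I -> I} := [ffun p => if (p == p0) || (p == q) then p else h p].
rewrite /haf mulr_sumr (reindex_onto psi phi) /=; last first.
  move=> h /andP[/andP[/invol_onP[h1 h2] h3] /eqP h4]; apply/ffunP => p; rewrite !ffunE.
  case: eqP => [->//|_]; case: eqP => [->|//]; by rewrite -h4 h1.
have mem h : [&& psi h \in invol_on S, psi h p0 != p0, psi h p0 == q & phi (psi h) == h] =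
    (h \in invol_on (S :\ p0 :\ q)).
  rewrite [psi h p0]ffunE eqxx hq eqxx /=; apply/andP/invol_onP => [[/invol_onP[h1 h2] /eqP h3]|[h1 h2]].
    have hE p : h p = if (p == p0) || (p == q) then p else psi h p.
      by rewrite -{1}h3 ffunE.
    split => [p|p].
      have [e|/norP[n1 n2]] := boolP ((p == p0) || (p == q)).
        by have := hE p; rewrite e => ep; rewrite !ep.
      have e2 : psi h p = h p by rewrite ffunE (negbTE n1) (negbTE n2).
      have m1 : h p != p0.
        apply: contraNneq n2 => e; have := h1 p; rewrite e2 e ffunE eqxx => ->; exact: eqxx.
      have m2 : h p != q.
        apply: contraNneq n1 => e; have := h1 p; rewrite e2 e ffunE (negbTE hq) eqxx => ->; exact: eqxx.
      by have := h1 p; rewrite e2 ffunE (negbTE m1) (negbTE m2).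
    rewrite !inE; case: (boolP (p == q)) => /= [e _|n2]; first by rewrite hE e orbT.
    case: (boolP (p == p0)) => /= [e _|n1 hp]; first by rewrite hE e.
    by rewrite -[RHS](h2 _ hp) ffunE (negbTE n1) (negbTE n2).
  have f0 : h p0 = p0 by apply: h2; rewrite !inE eqxx andbF.
  have fq : h q = q by apply: h2; rewrite !inE eqxx.
  have inj := inv_inj h1.
  split; last first.
    apply/eqP/ffunP => p; rewrite !ffunE.
    by case: (eqVneq p p0) => [->|_] /=; [rewrite f0|case: (eqVneq p q) => // ->; rewrite fq].
  apply/invol_onP; split=> p; rewrite !ffunE.
    case: (eqVneq p p0) => [->|n1]; first by rewrite (negbTE hq) eqxx.
    case: (eqVneq p q) => [->|n2]; first by rewrite eqxx.
    by rewrite -{1}f0 (inj_eq inj) (negbTE n1) -{1}fq (inj_eq inj) (negbTE n2) h1.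
  move=> hp; case: (eqVneq p p0) hp => [->|n1 hp]; first by rewrite hp0.
  case: (eqVneq p q) hp => [->|n2 hp]; first by rewrite hqS.
  by apply: h2; rewrite !inE (negbTE hp) !andbF.
apply: eq_big => [h|h hh]; first by rewrite -!andbA mem.
have {}hh : h \in invol_on (S :\ p0 :\ q) by rewrite -mem -!andbA in hh *.
case/invol_onP: hh => h1 h2.
have f0 : h p0 = p0 by apply: h2; rewrite !inE eqxx andbF.
have fq : h q = q by apply: h2; rewrite !inE eqxx.
rewrite /hwt (bigD1 p0) //= (bigD1 q) //= [in RHS](bigD1 p0) //= [in RHS](bigD1 q) //=.
rewrite !inE ![psi h _]ffunE !eqxx (negbTE hq) [p0 == q]eq_sym (negbTE hq) f0 fq ?ltnn ?andbF /= ?mulr1 ?mul1r.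
rewrite mulrA; congr (_ * _).
  case: (ltngtP p0 q) => [_|_|/ord_inj e]; rewrite ?mulr1 ?mul1r //.
  by rewrite e eqxx in hq.
by apply: eq_bigr => p /andP[/negbTE n1 /negbTE n2]; rewrite !inE ffunE n1 n2.
Qed.

End Hafnian.

(** * Wick's formula from a Stein recursion for moments *)

Section Words.
Variables (F : comPzRingType) (K : finType) (m : seq K -> F).
Hypothesis m_perm : forall w w', perm_eq w w' -> m w = m w'.
Hypothesis m_stein : forall k w, m (k :: w) = (count_mem k w)%:R * m (rem k w).
Hypothesis m_nil : m [::] = 1.
Variables (n : nat) (a : 'I_n -> F) (c : 'I_n -> K -> F).
Local Notation I := 'I_n.

(** The expectation of the monomial [w] times the product of the affine forms listed in [l],
    obtained by expanding one form after another into its variables. *)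
Fixpoint wordv (w : seq K) (l : seq I) : F :=
  if l is p :: l' then a p * wordv w l' + \sum_k c p k * wordv (k :: w) l' else m w.

Lemma wordv_perm w w' l : perm_eq w w' -> wordv w l = wordv w' l.
Proof.
elim: l w w' => [|p l IH] w w' h /=; first exact: m_perm.
rewrite (IH _ _ h); congr (_ + _); apply: eq_bigr => k _; congr (_ * _).
by apply: IH; rewrite perm_cons.
Qed.

(** Integration by parts, lifted from monomials to forms: the variable [k] is contracted either with
    a copy of itself in [w] or with a form, through the coefficient of [k] there. *)
Lemma wordv_stein k w l : uniq l ->
  wordv (k :: w) l = (count_mem k w)%:R * wordv (rem k w) l + \sum_(q <- l) c q k * wordv w (rem q l).
Proof.
elim: l w => [|p l IH] w /=; first by rewrite big_nil addr0.
case/andP=> pl ul.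
have e1 j : wordv (j :: k :: w) l = (j == k)%:R * wordv w l +
    (count_mem k w)%:R * wordv (j :: rem k w) l + \sum_(q <- l) c q k * wordv (j :: w) (rem q l).
  rewrite (@wordv_perm _ (k :: j :: w)); last first.
    by rewrite -[X in perm_eq X]/([:: j] ++ [:: k] ++ w) -[X in perm_eq _ X]/([:: k] ++ [:: j] ++ w) perm_catCA.
  rewrite IH //= natrD; congr (_ + _); case: (eqVneq j k) => [->|_] /=; last by rewrite mul0r !add0r.
  rewrite mulrDl; congr (_ + _); case: (boolP (k \in w)) => hk.
    by congr (_ * _); apply: wordv_perm; apply: perm_to_rem.
  by rewrite (count_memPn hk) !mul0r.
under eq_bigr do rewrite e1 !mulrDr.
rewrite !big_split /= IH // big_cons eqxx.
have -> : \sum_i c p i * ((i == k)%:R * wordv w l) = c p k * wordv w l.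
  by rewrite (bigD1 k) //= eqxx mul1r big1 ?addr0 // => i /negbTE->; rewrite mul0r mulr0.
have -> : \sum_(j <- l) c j k * wordv w (if p == j then l else p :: rem j l) =
   \sum_(j <- l) (a p * (c j k * wordv w (rem j l)) + \sum_i c p i * (c j k * wordv (i :: w) (rem j l))).
  apply: eq_big_seq => j hj; case: eqP => [e|_]; first by rewrite e hj in pl.
  rewrite /= mulrDr mulr_sumr; congr (_ + _); first by rewrite mulrCA.
  by apply: eq_bigr => i _; rewrite mulrCA.
rewrite big_split /= [X in _ + (_ + (_ + X))]exchange_big /= -mulr_sumr.
under [X in _ + (_ + (_ + X))]eq_bigr do rewrite -mulr_sumr.
have -> : \sum_i c p i * ((count_mem k w)%:R * wordv (i :: rem k w) l) =
    (count_mem k w)%:R * \sum_i c p i * wordv (i :: rem k w) l.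
  by rewrite mulr_sumr; apply: eq_bigr => i _; rewrite mulrCA.
by ring.
Qed.

Definition cov p q : F := \sum_k c p k * c q k.

Lemma wordv_wick p l : uniq (p :: l) ->
  wordv [::] (p :: l) = a p * wordv [::] l + \sum_(q <- l) cov p q * wordv [::] (rem q l).
Proof.
move=> /= /andP[_ ul]; congr (_ + _); under eq_bigr do rewrite wordv_stein //= mul0r add0r mulr_sumr.
rewrite exchange_big /=; apply: eq_bigr => q _; rewrite /cov mulr_suml.
by apply: eq_bigr => k _; rewrite mulrA.
Qed.

Lemma cov_sym p q : cov p q = cov q p.
Proof. by apply: eq_bigr => k _; rewrite mulrC. Qed.

Lemma wordv_haf l : uniq l -> wordv [::] l = haf a cov [set p in l].
Proof.
have [k] := ubnP (size l); elim: k l => // k IH [|p l] hs ul.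
  rewrite /= m_nil (_ : [set p in [::]] = set0) ?haf0 //; by apply/setP => p; rewrite !inE.
rewrite wordv_wick // (haf_rec a (S := [set q in p :: l]) cov_sym (p0 := p)); last by rewrite inE mem_head.
case/andP: (ul) => pl ul'.
have e : [set q in p :: l] :\ p = [set q in l].
  by apply/setP => q; rewrite !inE; case: eqP => // ->; rewrite (negbTE pl).
rewrite e IH //; congr (_ + _); rewrite big_uniq //=.
apply: eq_big => [q|q hq]; [by rewrite inE|congr (_ * _)].
rewrite IH ?rem_uniq //; last by rewrite size_rem // (leq_ltn_trans (leq_pred _)).
by congr haf; apply/setP => x; rewrite !inE mem_rem_uniq // inE.
Qed.

End Words.

(** * Concatenation of finite words *)

Section Accessor.
Variables (T : finType) (t0 : T).

Definition nthf n (z : {ffun 'I_n -> T}) (i : nat) : T := if insub i is Some j then z j else t0.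

Lemma nthfE n (z : {ffun 'I_n -> T}) (j : 'I_n) : nthf z j = z j.
Proof. by rewrite /nthf valK. Qed.

Definition catf m k (z : {ffun 'I_m -> T} * {ffun 'I_k -> T}) : {ffun 'I_(m + k) -> T} :=
  [ffun i => match split i with inl j => z.1 j | inr j => z.2 j end].

Lemma nthf_catl m k (z1 : {ffun 'I_m -> T}) (z2 : {ffun 'I_k -> T}) i : (i < m)%N ->
  nthf (catf (z1, z2)) i = nthf z1 i.
Proof.
move=> h; have e : i = lshift k (Ordinal h) :> nat by [].
rewrite {1}e nthfE ffunE; have -> : split (lshift k (Ordinal h)) = inl (Ordinal h) by exact: (unsplitK (inl _)).
by rewrite -(nthfE z1).
Qed.

Lemma nthf_catr m k (z1 : {ffun 'I_m -> T}) (z2 : {ffun 'I_k -> T}) i : (i < k)%N ->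
  nthf (catf (z1, z2)) (m + i) = nthf z2 i.
Proof.
move=> h; have e : (m + i)%N = rshift m (Ordinal h) :> nat by [].
rewrite {1}e nthfE ffunE; have -> : split (rshift m (Ordinal h)) = inr (Ordinal h) by exact: (unsplitK (inr _)).
by rewrite -(nthfE z2).
Qed.

Lemma sum_catf (V : nmodType) m k (G : {ffun 'I_(m + k) -> T} -> V) :
  (\sum_z G z = \sum_z1 \sum_z2 G (catf (z1, z2)))%R.
Proof.
rewrite pair_bigA /= (reindex (@catf m k)); last first.
  exists (fun z : {ffun 'I_(m + k) -> T} => ([ffun i => z (lshift k i)], [ffun i => z (rshift m i)])) => [[z1 z2] _|z _].
    congr pair; apply/ffunP => i; rewrite !ffunE.
      by have -> : split (lshift k i) = inl i by exact: (unsplitK (inl _)).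
    by have -> : split (rshift m i) = inr i by exact: (unsplitK (inr _)).
  by apply/ffunP => i; rewrite ffunE; case: splitP => j e; rewrite ffunE; congr (z _); apply: val_inj.
by apply: eq_bigr => -[].
Qed.

Lemma sum_ffun1 (V : nmodType) (G : {ffun 'I_1 -> T} -> V) : (\sum_z G z = \sum_t G [ffun=> t])%R.
Proof.
rewrite (reindex (fun t : T => [ffun=> t] : {ffun 'I_1 -> T})) //=.
exists (fun z : {ffun 'I_1 -> T} => z ord0) => [t _|z _]; first by rewrite ffunE.
by apply/ffunP => i; rewrite ffunE (ord1 i).
Qed.

Lemma sum_ffun0 (V : nmodType) (G : {ffun 'I_0 -> T} -> V) : (\sum_z G z = G (finfun (fun=> t0)))%R.
Proof.
rewrite (big_pred1 (finfun (fun=> t0))) // => z; symmetry; apply/eqP/ffunP => -[]//.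
Qed.

End Accessor.

(** * Chebyshev polynomials as signed sums over tilings *)

Section Tilings.
Variables (F : comPzRingType) (N : nat) (X P : 'M[F]_N) (x0 : 'I_N).
Hypothesis P_row : forall x, \sum_y P x y = 1.
Variable Y : nat -> 'M[F]_N.
Hypothesis Y0 : Y 0 = 1%:M.
Hypothesis Y1 : Y 1 = X.
Hypothesis YS : forall k, Y k.+2 = X *m Y k.+1 - Y k.
Local Notation T := (bool * 'I_N)%type.
Local Notation nth0 := (nthf (false, x0)).

(** The bit of [t] marks the first half of a domino, and [e] says that the preceding letter was one;
    in that case the label must return to [xp]. As the rows of [P] sum to 1, a domino sums to minus
    the identity. The flag [last] keeps dominoes from straddling a root: the tilings are those of a
    path, as for the second kind, although the labels close up cyclically. *)
Definition tw (e : bool) (xp : 'I_N) (t : T) (x' : 'I_N) (last : bool) : F :=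
  if t.1 then (if e || last then 0 else - P t.2 x') else if e then (x' == xp)%:R else X t.2 x'.

Definition tn (n : nat) (rt : pred nat) (f : nat -> T) (p : nat) : F :=
  tw (~~ rt p && (f p.-1).1) (f p.-1).2 (f p) (f (nxn n rt p)).2 (rt (nxn n rt p)).

Definition bw (e : bool) (xp y : 'I_N) (f : nat -> T) (m i : nat) : F :=
  tw (if i is i'.+1 then (f i').1 else e) (if i is i'.+1 then (f i').2 else xp) (f i)
     (if i == m then y else (f i.+1).2) (i == m).

Definition chain (m : nat) (e : bool) (xp : 'I_N) (t : T) (y : 'I_N) : F :=
  \sum_(z : {ffun 'I_m -> T}) \prod_(i < m.+1) bw e xp y (fun i => if i is i'.+1 then nth0 z i' else t) m i.

Lemma chain0 e xp t y : chain 0 e xp t y = tw e xp t y true.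
Proof. by rewrite /chain (sum_ffun0 (false, x0)) big_ord1. Qed.

Lemma chainS m e xp t y : chain m.+1 e xp t y = \sum_t' tw e xp t t'.2 false * chain m t.1 t.2 t' y.
Proof.
rewrite /chain -[m.+1]/(1 + m)%N sum_catf sum_ffun1; apply: eq_bigr => t' _.
rewrite mulr_sumr; apply: eq_bigr => z _; rewrite big_ord_recl.
have c0 : nth0 (catf ([ffun=> t'] : {ffun 'I_1 -> T}, z)) 0 = t'.
  by rewrite nthf_catl // -[0%N]/(nat_of_ord (ord0 : 'I_1)) nthfE ffunE.
have cS i : (i < m)%N -> nth0 (catf ([ffun=> t'] : {ffun 'I_1 -> T}, z)) i.+1 = nth0 z i.
  by move=> h; rewrite -[i.+1]/(1 + i)%N nthf_catr.
rewrite {1}/bw /= c0; congr (_ * _); apply: eq_bigr => i _; rewrite /bw /= /bump /= ?add0n !(add1n (nat_of_ord i)).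
have -> : (i.+1 == (1 + m)%N) = (i == m :> nat) by [].
case: i => -[|i] hi /=.
  rewrite c0; case: (eqVneq 0%N m) => // ne; by rewrite cS // lt0n eq_sym.
have h1 : (i < m)%N by [].
have e1 : nth0 (catf ([ffun=> t'] : {ffun 'I_1 -> T}, z)) i = if i is i'.+1 then nth0 z i' else t'.
  by case: i {hi} h1 => [|i] h1; rewrite ?c0 // cS // ltnW.
rewrite cS // e1; case: (eqVneq i.+1 m) => // h2; rewrite cS //.
by rewrite ltn_neqAle h2.
Qed.

(** A transfer-matrix recursion: the first letter is either X, or the first half of a domino, which
    takes two letters and gives -1. This is the recursion [YS]. The second part, with a domino
    already open at [xp], is needed to run the induction. *)
Lemma chain_Y m x y xp : (\sum_d chain m false xp (d, x) y = Y m.+1 x y) /\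
  (\sum_d chain m true xp (d, x) y = Y m xp y).
Proof.
elim: m x xp => [|m IH] x xp.
  rewrite !big_bool /= !chain0 /tw /= !add0r Y0 Y1 mxE; split => //.
  by rewrite eq_sym.
have sp (G : T -> F) : \sum_t G t = \sum_z \sum_d G (d, z).
  by rewrite exchange_big /= pair_bigA /=; apply: eq_bigr => -[].
split; rewrite big_bool /= !chainS !sp /tw /=.
  rewrite YS [RHS]mxE [X in _ = _ + X]mxE mxE addrC; congr (_ + _).
    by apply: eq_bigr => z _; rewrite -mulr_sumr; have [-> _] := IH z x.
  under eq_bigr => z _ do rewrite -mulr_sumr (proj2 (IH z x)).
  by rewrite -mulr_suml sumrN P_row mulN1r.
rewrite big1 ?add0r; last by move=> z _; apply: big1 => d _; rewrite mul0r.
under eq_bigr => z _ do rewrite -mulr_sumr (proj1 (IH z x)).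
by rewrite (bigD1 xp) //= eqxx mul1r big1 ?addr0 // => z /negbTE->; rewrite mul0r.
Qed.

Lemma block_trace m : \sum_(z : {ffun 'I_m.+1 -> T}) \prod_(i < m.+1)
    bw false x0 (nth0 z 0).2 (nth0 z) m i = \tr (Y m.+1).
Proof.
have sp (G : T -> F) : \sum_t G t = \sum_z \sum_d G (d, z).
  by rewrite exchange_big /= pair_bigA /=; apply: eq_bigr => -[].
rewrite -[m.+1]/(1 + m)%N sum_catf sum_ffun1 sp /mxtrace; apply: eq_bigr => x _.
rewrite -(proj1 (chain_Y m x x x0)); apply: eq_bigr => d _; apply: eq_bigr => z _.
have c0 : nth0 (catf ([ffun=> (d, x)] : {ffun 'I_1 -> T}, z)) 0 = (d, x).
  by rewrite nthf_catl // -[0%N]/(nat_of_ord (ord0 : 'I_1)) nthfE ffunE.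
have cS i : (i <= m)%N -> nth0 (catf ([ffun=> (d, x)] : {ffun 'I_1 -> T}, z)) i =
    if i is i'.+1 then nth0 z i' else (d, x).
  case: i => [|i] h; first exact: c0.
  by rewrite -[i.+1]/(1 + i)%N nthf_catr.
rewrite c0; apply: eq_bigr => i _; rewrite /bw; have hi : (i <= m)%N := ltn_ord i.
rewrite (cS i) //; case: (eqVneq (i : nat) m) => [_|ne]; last first.
  have -> : nth0 (catf ([ffun=> (d, x)] : {ffun 'I_1 -> T}, z)) i.+1 = nth0 z i.
    by rewrite cS // ltn_neqAle ne.
  by case: (nat_of_ord i) hi {ne} => [|j] hj //; rewrite cS // ltnW.
by case: (nat_of_ord i) hi => [|j] hj //; rewrite cS // ltnW.
Qed.

(** The roots of a word to which a new trace is appended at position [n1]. *)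
Definition addrt (n1 : nat) (rt : pred nat) : pred nat := fun i => if (i < n1)%N then rt i else i == n1.

Lemma addrt_nxl n1 m rt p : (p < n1)%N -> nxn (n1 + m.+1) (addrt n1 rt) p = nxn n1 rt p.
Proof.
move=> h; have rE q : (q <= p)%N -> rtn (addrt n1 rt) q = rtn rt q.
  elim: q => //= q IH hq; rewrite IH ?(ltnW hq) // /addrt.
  by rewrite (leq_ltn_trans hq h).
rewrite /nxn rE //; case: (ltnP p.+1 n1) => h1.
  by rewrite (leq_trans h1) ?leq_addr //= /addrt h1.
have e : p.+1 = n1 by apply/eqP; rewrite eqn_leq h h1.
by rewrite e /addrt ltnn eqxx andbF.
Qed.

Lemma addrt_nxr n1 m rt i : (i < m.+1)%N -> addrt n1 rt 0 ->
  nxn (n1 + m.+1) (addrt n1 rt) (n1 + i) = if i == m then n1 else (n1 + i).+1.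
Proof.
move=> h r0; have fr q : (0 < q)%N -> addrt n1 rt (n1 + q) = false.
  by move=> hq; rewrite /addrt ltnNge leq_addr /= -[X in _ == X]addn0 eqn_add2l; case: q hq.
have rE : rtn (addrt n1 rt) (n1 + i) = n1.
  apply: rtn_eq => //; [by rewrite /addrt ltnn eqxx|exact: leq_addr|].
  move=> q hq1 hq2; rewrite -(subnKC (ltnW hq1)) fr // subn_gt0 //.
rewrite /nxn rE -(addnS n1 i) ltn_add2l ltnS fr // andbT.
by rewrite -ltnS ltn_neqAle h andbT eqSS; case: eqP.
Qed.

Lemma concat_block n1 m rt : addrt n1 rt 0 ->
  \sum_(z : {ffun 'I_(n1 + m.+1) -> T}) \prod_(p < n1 + m.+1) tn (n1 + m.+1) (addrt n1 rt) (nth0 z) p =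
  (\sum_(z : {ffun 'I_n1 -> T}) \prod_(p < n1) tn n1 rt (nth0 z) p) * \tr (Y m.+1).
Proof.
move=> r0; rewrite sum_catf mulr_suml; apply: eq_bigr => z1 _.
rewrite -block_trace mulr_sumr; apply: eq_bigr => z2 _.
rewrite big_split_ord /=; congr (_ * _); apply: eq_bigr => p _.
  have hp := ltn_ord p; have hn := nxn_lt rt hp.
  rewrite /tn addrt_nxl // !nthf_catl //; last by apply: leq_ltn_trans (leq_pred _) hp.
  by rewrite /addrt hp hn.
have fr q : addrt n1 rt (n1 + q) = (q == 0)%N.
  by rewrite /addrt ltnNge leq_addr /= -[X in _ == X]addn0 eqn_add2l.
rewrite /tn /bw (addrt_nxr _ r0) //; have hp := ltn_ord p.
rewrite fr; case: (eqVneq (p : nat) m) => [e|ne].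
  have an : addrt n1 rt n1 = true by rewrite /addrt ltnn eqxx.
  have nz : nth0 (catf (z1, z2)) n1 = nth0 z2 0.
    by have := nthf_catr (false, x0) z1 z2 (ltn0Sn m); rewrite addn0.
  rewrite an nz nthf_catr //.
  case: (nat_of_ord p) hp {e} => [|i] hp /=; first by rewrite !addn0 /tw.
  by rewrite (addnS n1 i) /= nthf_catr // ltnW.
rewrite -(addnS n1 p) fr !nthf_catr //; last by rewrite ltn_neqAle eqSS ne hp.
case: (nat_of_ord p) hp {ne} => [|i] hp /=; last by rewrite (addnS n1 i) /= nthf_catr // ltnW.
by rewrite addn0 /tw.
Qed.

End Tilings.

(** The roots depend on the lengths only, so the same [rt] serves both matrices that are compared in
    (ii). *)
Lemma tilings_exist s (n : 'I_s -> nat) nn : (forall j, 0 < n j)%N -> nn = (\sum_(j < s) n j)%N ->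
  exists2 rt : pred nat, (rt 0 /\ #|Rto nn rt| = s) &
    forall (F : comPzRingType) (N : nat) (X P : 'M[F]_N) (x0 : 'I_N) (Y : nat -> 'M[F]_N),
    (forall x, \sum_y P x y = 1) -> Y 0 = 1%:M -> Y 1 = X -> (forall k, Y k.+2 = X *m Y k.+1 - Y k) ->
    \prod_(j < s) \tr (Y (n j)) =
    \sum_(z : {ffun 'I_nn -> bool * 'I_N}) \prod_(p < nn) tn X P nn rt (nthf (false, x0) z) p.
Proof.
elim: s n nn => [|s IH] n nn n0 ->.
  exists (pred1 0%N); first by split => //; rewrite big_ord0; apply/eqP; rewrite cards_eq0; apply/eqP/setP => -[].
  move=> F N X P x0 Y _ _ _ _; rewrite !big_ord0 (sum_ffun0 (false, x0)) big_ord0 //.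
have [rt [r0 cr] hrt] := IH (fun j => n (widen_ord (leqnSn s) j)) _ (fun j => n0 _) erefl.
rewrite big_ord_recr /=; move: cr hrt; set n1 := (\sum_(j < s) _)%N => cr hrt.
have := n0 ord_max; case e : (n ord_max) => [|m] // _.
have a0 : addrt n1 rt 0 by rewrite /addrt; case: n1 {cr hrt} => //=.
exists (addrt n1 rt).
  have cE (k : nat) (r : pred nat) : #|Rto k r| = (\sum_(p < k) r p)%N.
    by rewrite -sum1_card big_mkcond; apply: eq_bigr => p _; rewrite inE; case: (r p).
  split => //; rewrite cE big_split_ord /= -[RHS]addn1 -cr cE; congr (_ + _)%N.
    by apply: eq_bigr => p _; rewrite /addrt ltn_ord.
  rewrite big_ord_recl big1 ?addn0; first by rewrite /addrt /= ?addn0 ltnn eqxx.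
  by move=> i _; rewrite /addrt /= ltnNge leq_addr /= -[X in _ == X]addn0 eqn_add2l.
move=> F N X P x0 Y h1 h2 h3 h4.
by rewrite big_ord_recr /= e (hrt _ _ X P x0 Y) // (concat_block x0 h1 h2 h3 h4).
Qed.

Lemma haf_congr (F : comPzRingType) n (a a' : 'I_n -> F) C C' (S : {set 'I_n}) :
  {in S, a =1 a'} -> {in S &, C =2 C'} -> haf a C S = haf a' C' S.
Proof.
move=> ha hC; apply: eq_bigr => h /invol_onP[h1 h2]; apply: eq_bigr => p _; congr (_ * _).
  by case: ifP => // /andP[/ha].
case: ifP => // hp; apply: hC.
  by apply: contraLR hp => /h2->; rewrite ltnn.
by apply: contraLR hp => /h2; rewrite h1 => e; rewrite -e ltnn.
Qed.

(** * Cancellation of dominoes against adjacent untwisted pairs *)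

Section RawFormula.
Variables (F : numFieldType) (n N : nat) (rt : pred nat).
Hypothesis rt0 : rt 0%N.
Local Notation nx := (@nxo n rt).
Local Notation Rt := (Rto n rt).
Local Notation I := 'I_n.
Local Notation diag := ({ffun I -> I} * {ffun I -> bool})%type.
Variables (A P : 'M[F]_N) (G : bool).
Hypothesis P_sym : forall x y, P x y = P y x.

Lemma nx_nonroot_val p : nx p \notin Rt -> nx p = p.+1 :> nat.
Proof. by move=> h; case: (nxoP rt0 p) => [[]//|[h2]]; rewrite h2 in h. Qed.

Section FixedLabels.
Variable x : {ffun I -> 'I_N}.

(** The two terms in the covariance of entries: the straight one occurs in both ensembles, the
    twisted one only in GOE, which is what [G] stands for. *)
Definition straight p q : F := P (x p) (x (nx p)) * ((x p == x (nx q)) && (x (nx p) == x q))%:R.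
Definition twisted p q : F := P (x p) (x (nx p)) * ((x p == x q) && (x (nx p) == x (nx q)))%:R.
Definition lcov p q : F := straight p q + G%:R * twisted p q.
Definition la p : F := A (x p) (x (nx p)).

Lemma straight_sym p q : straight p q = straight q p.
Proof.
rewrite /straight [in RHS]andbC (eq_sym (x (nx q))) (eq_sym (x q)).
by case: andP => [[/eqP-> /eqP->]|_]; rewrite ?mulr0 // P_sym.
Qed.

Lemma twisted_sym p q : twisted p q = twisted q p.
Proof.
rewrite /twisted (eq_sym (x (nx q))) (eq_sym (x q)).
by case: andP => [[/eqP-> /eqP->]|_]; rewrite ?mulr0.
Qed.

Lemma lcov_sym p q : lcov p q = lcov q p.
Proof. by rewrite /lcov straight_sym twisted_sym. Qed.

Definition dom (D : {set I}) : {set I} := D :|: [set nx p | p in D].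
(** The sets of domino starts for which no domino straddles a root and no two overlap. *)
Definition valid (D : {set I}) : bool := [forall p in D, (nx p \notin Rt) && (nx p \notin D)].
(** With the weights [aD] and [cD] the dominoes of [D] become compulsory straight pairs. A tiling is
    then a hafnian over all the letters, whatever [D] is, and the sums over [D] and over involutions
    can be exchanged. *)
Definition aD (D : {set I}) p : F := if p \in dom D then 0 else la p.
Definition cD (D : {set I}) p q : F :=
  if (p \in dom D) || (q \in dom D) then
    if ((p \in D) && (q == nx p)) || ((q \in D) && (p == nx q)) then straight p q else 0
  else lcov p q.

Lemma cD_sym D p q : cD D p q = cD D q p.
Proof. by rewrite /cD orbC [in X in if _ then if X then _ else _ else _]orbC straight_sym lcov_sym. Qed.

Lemma mem_imnx (D : {set I}) p : (nx p \in [set nx q | q in D]) = (p \in D).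
Proof. by rewrite mem_imset //; apply: nxo_inj. Qed.

Lemma haf_dominoes D : valid D ->
  haf (aD D) (cD D) setT = (\prod_(p in D) straight p (nx p)) * haf la lcov (~: dom D).
Proof.
move=> /forall_inP vD.
have gen k (E : {set I}) : #|D :\: E| = k -> E \subset D ->
   haf (aD D) (cD D) (~: dom E) = (\prod_(p in D :\: E) straight p (nx p)) * haf la lcov (~: dom D).
  elim: k E => [|k IH] E hk sE.
    have eE : E = D by apply/eqP; rewrite eqEsubset sE -setD_eq0 -cards_eq0 hk.
    rewrite eE setDv big_set0 mul1r; apply: haf_congr => [p|p q]; rewrite !inE => hp.
      by rewrite /aD !inE (negbTE hp).
    by move=> hq; rewrite /cD !inE (negbTE hp) (negbTE hq).
  have [p] : exists p, p \in D :\: E by apply/card_gt0P; rewrite hk.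
  rewrite inE => /andP[pE pD]; have /andP[v1 v2] := vD p pD.
  have dE q : q \in [set nx e | e in E] -> q \notin D.
    by case/imsetP => e he ->; have /andP[] := vD e (subsetP sE e he).
  have pS : p \in ~: dom E.
    by rewrite !inE negb_or pE /=; apply/negP => /dE; rewrite pD.
  rewrite (haf_rec _ (cD_sym D) pS) {1}/aD !inE pD /= mul0r add0r.
  have nS : nx p \in (~: dom E) :\ p.
    rewrite !inE negb_or mem_imnx pE andbT; apply/andP; split; first by apply: contraNneq v2 => ->.
    by apply: contra v2 => /(subsetP sE).
  rewrite (bigD1 (nx p)) //= [X in _ + X]big1 ?addr0; last first.
    move=> q /andP[_ hq]; rewrite /cD !inE pD /= (negbTE hq) /=; case: ifP => [/andP[h1 /eqP h2]|_]; last by rewrite mul0r.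
    by have /andP[_] := vD q h1; rewrite -h2 pD.
  rewrite {1}/cD !inE pD eqxx /= (bigD1 p) /=; last by rewrite inE pE.
  have -> : ~: dom E :\ p :\ nx p = ~: dom (p |: E).
    apply/setP => q; rewrite !inE imsetU1 !inE !negb_or.
    by case: (q == p); case: (q == nx p); rewrite /= ?andbF ?andbT.
  rewrite (IH (p |: E)); last 2 first.
  - apply/eqP; rewrite -eqSS -hk (cardsD1 p (D :\: E)) inE pE pD add1n eqSS; apply/eqP.
    by apply: eq_card => q; rewrite !inE negb_or andbA.
  - by rewrite subUset sub1set pD.
  rewrite mulrA; congr (_ * _ * _); apply: eq_bigl => q; rewrite !inE.
  by case: (q == p); case: (q \in E); case: (q \in D).
have := gen _ set0 erefl (sub0set _); rewrite setD0 => <-.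
by congr haf; rewrite /dom imset0 setU0 setC0.
Qed.

Definition adjs (h : {ffun I -> I}) : {set I} := [set p | (nx p \notin Rt) && (h p == nx p)].

Lemma adjs_lt (h : {ffun I -> I}) p : p \in adjs h -> (p < h p)%N.
Proof. by rewrite inE => /andP[h1 /eqP->]; rewrite (nx_nonroot_val h1). Qed.

Lemma adjs_valid (h : {ffun I -> I}) (D : {set I}) : involutive h -> D \subset adjs h -> valid D.
Proof.
move=> hK /subsetP hD; apply/forall_inP => p pD; have := hD p pD; rewrite inE => /andP[h1 /eqP h2].
rewrite h1; apply/negP => /hD; rewrite inE => /andP[h3 /eqP]; rewrite -h2 hK => e.
have := nx_nonroot_val h1; have := nx_nonroot_val h3; rewrite -h2 -e => e1 e2.
by move: e1; rewrite e2; lia.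
Qed.

Lemma hwt_dominoes (h : {ffun I -> I}) (D : {set I}) : involutive h -> valid D ->
  hwt (aD D) (cD D) setT h = if D \subset adjs h then
    \prod_p ((if h p == p then la p else 1) *
             (if (p < h p)%N then if p \in D then straight p (h p) else lcov p (h p) else 1)) else 0.
Proof.
move=> hK vD0; have /forall_inP vD := vD0.
case: ifP => [hD|/negbT].
  have hD' := subsetP hD.
  have hin p : p \in D -> h p = nx p by move=> /hD'; rewrite inE => /andP[_ /eqP].
  apply: eq_bigr => p _; rewrite inE /=.
  have [pd|pd] := boolP (p \in dom D).
    have hp : h p != p.
      move: pd; rewrite !inE => /orP[pD|/imsetP[q qD e]].
        by apply: contraTneq (adjs_lt (hD' _ pD)) => ->; rewrite ltnn.
      rewrite e -(hin q qD) hK; apply: contraTneq (adjs_lt (hD' _ qD)) => {1}->; by rewrite ltnn.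
    rewrite (negbTE hp); congr (_ * _); case: ifP => // hlt; rewrite /cD pd /=.
    have [pD|pD] := boolP (p \in D); first by rewrite (hin p pD) eqxx.
    move: pd; rewrite !inE (negbTE pD) /= => /imsetP[q qD e].
    have h1 := adjs_lt (hD' _ qD).
    by move: hlt; rewrite e -(hin q qD) hK => h2; have := ltn_trans h1 h2; rewrite ltnn.
  rewrite /aD (negbTE pd); congr (_ * _); case: ifP => // hlt.
  have pD : p \notin D by apply: contra pd; rewrite inE => ->.
  rewrite (negbTE pD) /cD (negbTE pd) /=; case: ifP => // hd; case/negP: pd.
  move: hd; rewrite !inE => /orP[hpD|/imsetP[q qD e]].
    have e : p = nx (h p) by rewrite -(hin _ hpD) hK.
    by rewrite {2}e imset_f // orbT.
  have -> : p = q by apply: (inv_inj hK); rewrite e hin.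
  by rewrite qD.
case/subsetPn => p pD pa; have /andP[v1 v2] := vD p pD.
have hpn : h p != nx p by apply: contra pa => e; rewrite inE v1.
rewrite /hwt; have [hp|hp] := eqVneq (h p) p.
  by rewrite (bigD1 p) //= inE hp eqxx /= /aD !inE pD /= !mul0r.
have c0 : cD D p (h p) = 0.
  rewrite /cD !inE pD (negbTE hpn) /=; case: ifP => // /andP[h1 /eqP h2].
  by have /andP[_] := vD _ h1; rewrite -h2 pD.
have [hlt|hlt] := ltnP p (h p).
  by rewrite (bigD1 p) //= hlt c0 mulr0 mul0r.
rewrite (bigD1 (h p)) //= hK.
have -> : (h p < p)%N by rewrite ltn_neqAle hlt andbT; apply: contra hp => /eqP/ord_inj->.
by rewrite cD_sym c0 mulr0 mul0r.
Qed.

(** For a fixed involution [h], the sets [D] that contribute are the subsets of [adjs h]. Summed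
    with signs, they put -straight + [lcov] at each adjacent pair, and there only the twisted term
    survives. *)
Lemma sum_dominoes : \sum_(D | valid D) (-1) ^+ #|D| * haf (aD D) (cD D) setT =
  \sum_(h in invol_on setT) \prod_(p : I) ((if h p == p then la p else 1) *
    (if (p < h p)%N then G%:R * twisted p (h p) + (p \notin adjs h)%:R * straight p (h p) else 1)).
Proof.
under eq_bigr do rewrite /haf mulr_sumr.
rewrite exchange_big /=; apply: eq_bigr => h /invol_onP[hK _].
rewrite (eq_bigr (fun D : {set I} => if D \subset adjs h then (-1) ^+ #|D| * \prod_(p : I) ((if h p == p then la p else 1) *
   (if (p < h p)%N then if p \in D then straight p (h p) else lcov p (h p) else 1)) else 0)); last first.
  by move=> D vD; rewrite hwt_dominoes //; case: ifP => // _; rewrite mulr0.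
rewrite -big_mkcondr /= (eq_bigl (fun D : {set I} => D \subset adjs h)); last first.
  by move=> D; case: (boolP (D \subset adjs h)) => hD; rewrite ?andbF // (adjs_valid hK hD).
rewrite big_split /=.
under eq_bigr do rewrite big_split /= mulrCA.
rewrite -mulr_sumr; congr (_ * _).
have -> : \prod_(p : I) (if (p < h p)%N then G%:R * twisted p (h p) + (p \notin adjs h)%:R * straight p (h p) else 1) =
   \prod_(p : I) ((if p \in adjs h then - straight p (h p) else 0) + (if (p < h p)%N then lcov p (h p) else 1)).
  apply: eq_bigr => p _; have [pa|pa] := boolP (p \in adjs h).
    by rewrite (adjs_lt pa) /lcov mul0r; ring.
  by rewrite add0r /lcov mul1r addrC.
rewrite bigA_distr [RHS](bigID (fun D : {set I} => D \subset adjs h)) /= [X in _ = _ + X]big1 ?addr0; last first.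
  by move=> D /subsetPn[p pD pa]; rewrite (bigD1 p) //= pD (negbTE pa) mul0r.
apply: eq_bigr => D /subsetP hD.
have -> : (-1) ^+ #|D| = \prod_(p : I) (if p \in D then -1 else 1) :> F by rewrite -big_mkcond prodr_const.
rewrite -big_split /=; apply: eq_bigr => p _; case: ifP => [pD|_]; last by rewrite mul1r.
by rewrite (hD p pD) (adjs_lt (hD p pD)) mulN1r.
Qed.

Definition ind (h : I -> I) (b : I -> bool) p : bool :=
  if b p then (x p == x (h p)) && (x (nx p) == x (nx (h p)))
  else (x p == x (nx (h p))) && (x (nx p) == x (h p)).

Lemma conslE (h : I -> I) (b : I -> bool) : involutive h -> (forall p, b (h p) = b p) ->
  consl nx h b x = [forall p : I, (p < h p)%N ==> ind h b p].
Proof.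
move=> hK hb; have indS p : ind h b (h p) = ind h b p.
  rewrite /ind hb hK; case: ifP => _; first by rewrite (eq_sym (x p)) (eq_sym (x (nx p))).
  by rewrite andbC (eq_sym (x p)) (eq_sym (x (nx p))).
have indE p : ind h b p = (x (cor nx (alp h b (p, false))) == x p) && (x (cor nx (alp h b (p, true))) == x (nx p)).
  rewrite /ind /alp /cor /=; case: (b p) => /=; first by rewrite (eq_sym (x p)) (eq_sym (x (nx p))).
  by rewrite (eq_sym (x p)) (eq_sym (x (nx p))).
apply/forallP/forallP => [hc p|hi [p e]].
  apply/implyP => hp; have hs e : ~~ sealed h (p, e) by rewrite /sealed /= -val_eqE /= gtn_eqF.
  by rewrite indE; have := hc (p, false); have := hc (p, true); rewrite !hs /= => -> ->.
apply/implyP; rewrite /sealed /= => hp.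
have : ind h b p.
  case: (ltngtP p (h p)) => [hlt|hlt|/ord_inj e0].
  - by have := hi p; rewrite hlt.
  - by have := hi (h p); rewrite hK hlt indS.
  - by rewrite -e0 eqxx in hp.
by rewrite indE => /andP[h1 h2]; case: e.
Qed.

Definition lwt (h : {ffun I -> I}) (b : I -> bool) : F :=
  \prod_(p : I) ((if h p == p then la p else 1) *
    (if (p < h p)%N then if b p then twisted p (h p) else straight p (h p) else 1)).

Lemma lwtE (h : {ffun I -> I}) (b : {ffun I -> bool}) : involutive h -> (forall p, b (h p) = b p) ->
  lwt h b = if consl nx h b x then \prod_(p | p \notin Scnd h) Kraw A P (h, b) p (x p) (x (nx p)) else 0.
Proof.
move=> hK hb; have hE (p : I) : (p < h p)%N ->
    (if b p then twisted p (h p) else straight p (h p)) = P (x p) (x (nx p)) * (ind h b p)%:R.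
  by move=> hp; rewrite /twisted /straight /ind; case: (b p).
rewrite conslE //; case: ifP => [/forallP hi|/negbT].
  rewrite [RHS]big_mkcond; apply: eq_bigr => p _; rewrite inE /Kraw /= -val_eqE /=.
  case: (ltngtP p (h p)) => [hp|hp|e]; rewrite ?mul1r ?mulr1 //.
  by rewrite hE //; have := hi p; rewrite hp => /= ->; rewrite mulr1.
rewrite negb_forall => /existsP[p]; rewrite negb_imply => /andP[hp hn].
by rewrite /lwt (bigD1 p) //= hp hE // (negbTE hn) mulr0 mulr0 mul0r.
Qed.

Definition bits (h : {ffun I -> I}) (b : {ffun I -> bool}) : bool :=
  [forall p, [&& b (h p) == b p, (h p == p) ==> ~~ b p & (p \in adjs h) ==> b p]].

(** Expand the product over the pairs; the bit records which of the two terms is taken. *)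
Lemma sum_bits (h : {ffun I -> I}) : involutive h ->
  \prod_(p : I) ((if h p == p then la p else 1) *
    (if (p < h p)%N then G%:R * twisted p (h p) + (p \notin adjs h)%:R * straight p (h p) else 1)) =
  \sum_(b : {ffun I -> bool} | bits h b && (G || [forall p, ~~ b p])) lwt h b.
Proof.
move=> hK.
(* [J] is the set of first letters of twisted pairs; [bJ] spreads the bit to both letters of a
   pair. *)
pose bJ (J : {set I}) : {ffun I -> bool} := [ffun p => (p \in J) || (h p \in J)].
pose Jb (b : {ffun I -> bool}) : {set I} := [set p : I | (p < h p)%N && b p].
pose good (J : {set I}) := [&& J \subset Frst h, adjs h \subset J & G || (J == set0)].
rewrite (reindex_onto bJ Jb) /=; last first.
  move=> b /andP[/forallP hb _]; apply/ffunP => p; rewrite ffunE !inE hK.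
  have /and3P[/eqP b1 b2 _] := hb p; have := b2; rewrite b1 -val_eqE /=.
  by case: (ltngtP p (h p)) => _ /=; rewrite ?orbF // => /negbTE->.
have hJ (J : {set I}) (p : I) : J \subset Frst h -> (p < h p)%N -> bJ J p = (p \in J).
  move=> /subsetP hs hp; rewrite ffunE; case: (boolP (h p \in J)); last by rewrite orbF.
  by move=> /hs; rewrite inE hK ltnNge (ltnW hp).
rewrite (eq_bigl good); last first.
  move=> J; apply/idP/idP.
    case/andP=> /andP[/forallP hb hG] /eqP hJb.
    have sF : J \subset Frst h by rewrite -hJb; apply/subsetP => p; rewrite !inE => /andP[].
    apply/and3P; split => //.
      apply/subsetP => p pa; have /and3P[_ _] := hb p; rewrite pa /= hJ //; exact: adjs_lt pa.
    case/orP: hG => [->//|/forallP h0]; apply/orP; right; apply/eqP/setP => p; rewrite inE.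
    by have := h0 p; rewrite ffunE negb_or => /andP[/negbTE].
  case/and3P=> sF sA hG; apply/andP; split; last first.
    apply/eqP/setP => p; rewrite inE; case: (boolP (p < h p)%N) => hp /=; first by rewrite hJ.
    by symmetry; apply/negP => /(subsetP sF); rewrite inE (negbTE hp).
  apply/andP; split.
    apply/forallP => p; apply/and3P; split.
    - by rewrite !ffunE hK orbC.
    - apply/implyP => /eqP e; rewrite ffunE e orbb; apply/negP => /(subsetP sF).
      by rewrite inE e ltnn.
    - apply/implyP => pa; rewrite ffunE (subsetP sA) //.
  case/orP: hG => [->//|/eqP->]; apply/orP; right; apply/forallP => p; by rewrite ffunE !inE.
rewrite big_split /=.
have -> : \prod_(p : I) (if (p < h p)%N then G%:R * twisted p (h p) + (p \notin adjs h)%:R * straight p (h p) else 1) =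
  \prod_(p : I) ((if (p < h p)%N then G%:R * twisted p (h p) else 0) +
     (if (p < h p)%N then (p \notin adjs h)%:R * straight p (h p) else 1)).
  by apply: eq_bigr => p _; case: ifP => // _; rewrite add0r.
rewrite bigA_distr mulr_sumr (bigID good) /= [X in _ + X]big1 ?addr0; last first.
  move=> J; rewrite !negb_and => /or3P[/subsetPn[p pJ]|/subsetPn[p pa pJ]|].
  - by rewrite inE => hp; rewrite [X in _ * X](bigD1 p) //= pJ (negbTE hp) mul0r mulr0.
  - by rewrite [X in _ * X](bigD1 p) //= (negbTE pJ) (adjs_lt pa) pa mul0r mul0r mulr0.
  - rewrite negb_or => /andP[/negbTE g0 /set0Pn[p pJ]].
    rewrite [X in _ * X](bigD1 p) //= pJ g0; case: ifP => _; by rewrite !mul0r mulr0.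
apply: eq_bigr => J /and3P[sF sA hG]; rewrite /lwt big_split /=; congr (_ * _); apply: eq_bigr => p _.
case: (boolP (p < h p)%N) => hp; last first.
  by case: ifP => // pJ; have := subsetP sF p pJ; rewrite inE (negbTE hp).
rewrite hJ //; case: ifP => pJ.
  case/orP: hG => [->|/eqP e]; first by rewrite mul1r.
  by rewrite e inE in pJ.
have -> : p \notin adjs h by apply/negP => /(subsetP sA); rewrite pJ.
by rewrite mul1r.
Qed.

Lemma adjs_prop (h : {ffun I -> I}) (b : {ffun I -> bool}) :
  involutive h /\ bits h b <-> rawdiag rt h b.
Proof.
split=> [[hK /forallP hb]|[hK h1 h2 h3]].
  split => // p; have /and3P[/eqP b1 b2 b3] := hb p => //.
  - by move/eqP => e; rewrite e in b2.
  - by move=> e1 e2; apply: (implyP b3); rewrite inE e1 e2 eqxx.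
split=> //; apply/forallP => p; apply/and3P; split; first by rewrite h1.
  by apply/implyP => /eqP/h2.
by apply/implyP; rewrite inE => /andP[h4 /eqP]; apply: h3.
Qed.

End FixedLabels.

Lemma sum_labels_raw :
  \sum_(x : {ffun I -> 'I_N}) \sum_(D : {set I} | valid D) (-1) ^+ #|D| * haf (aD x D) (cD x D) setT =
  \sum_(u in rawset n rt | G || [forall p, ~~ u.2 p]) dval nx u.1 u.2 (Kraw A P u).
Proof.
under eq_bigr do rewrite sum_dominoes.
rewrite exchange_big /=.
transitivity (\sum_(h in invol_on [set: I]) \sum_(b : {ffun I -> bool} | bits h b && (G || [forall p, ~~ b p]))
    dval nx h b (Kraw A P (h, b))).
  apply: eq_bigr => h /invol_onP[hK _].
  under eq_bigr do rewrite sum_bits //.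
  rewrite exchange_big /=; apply: eq_bigr => b /andP[hb _].
  have [_ h1 _ _] := proj1 (adjs_prop h b) (conj hK hb).
  by rewrite /dval [RHS]big_mkcond; apply: eq_bigr => x _; rewrite lwtE.
rewrite pair_big_dep /=; apply: eq_big => [[h b]|[h b] _] //=.
apply/andP/andP => [[/invol_onP[hK _] /andP[hb hG]]|[/rawsetP hu hG]].
  by split => //; apply/rawsetP/adjs_prop.
have [hK hb] := proj2 (adjs_prop h b) hu.
by split; [apply/invol_onP; split=> // p; rewrite inE|rewrite hb].
Qed.

Variable x0 : 'I_N.
Local Notation T := (bool * 'I_N)%type.
Local Notation nth0 := (nthf (false, x0)).

Definition ebit (z : {ffun I -> T}) (p : I) : bool := ~~ rt p && (nth0 z p.-1).1.
Definition mono (z : {ffun I -> T}) : {set I} := [set p | ~~ (z p).1 && ~~ ebit z p].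
(** The part of the weight of a tiling that does not contain the random matrix. *)
Definition cf (z : {ffun I -> T}) (p : I) : F :=
  if (z p).1 then if ebit z p || rt (nx p) then 0 else - P (z p).2 (z (nx p)).2
  else if ebit z p then ((z (nx p)).2 == (nth0 z p.-1).2)%:R else 1.

Lemma tn_split (X : 'M[F]_N) (z : {ffun I -> T}) (p : I) : tn X P n rt (nth0 z) p =
  cf z p * (if p \in mono z then X (z p).2 (z (nx p)).2 else 1).
Proof.
rewrite /tn nthfE -[nxn n rt p]/(nat_of_ord (nx p)) nthfE /tw /cf inE -/(ebit z p).
by case: (z p).1; case: (ebit z p); rewrite /= ?mulr1 ?mul1r.
Qed.

Definition labels (z : {ffun I -> T}) : {ffun I -> 'I_N} := [ffun p => (z p).2].
Definition dset (z : {ffun I -> T}) : {set I} := [set p | (z p).1].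

Lemma ebit_nx z p : nx p \notin Rt -> ebit z (nx p) = (z p).1.
Proof.
move=> h; rewrite /ebit; move: (h); rewrite inE => ->.
by rewrite (nx_nonroot_val h) /= nthfE.
Qed.

Lemma ebitE z p : valid (dset z) -> ebit z p = (p \in [set nx q | q in dset z]).
Proof.
move=> /forall_inP v; apply/idP/imsetP => [/andP[h1 h2]|[q hq ->]]; last first.
  by have /andP[v1 _] := v q hq; rewrite ebit_nx //; move: hq; rewrite inE.
have p0 : (0 < p)%N by rewrite lt0n; apply: contra h1 => /eqP->.
have hq : (p.-1 < n)%N by apply: leq_ltn_trans (leq_pred _) (ltn_ord p).
have e : nx (Ordinal hq) = p by apply: val_inj; rewrite /= /nxn prednK // ltn_ord h1.
by exists (Ordinal hq) => //; rewrite inE -(nthfE (false, x0)).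
Qed.

Lemma cf_prod z : (\prod_p cf z p) * haf (la (labels z)) (lcov (labels z)) (mono z) =
  if valid (dset z) then (-1) ^+ #|dset z| * haf (aD (labels z) (dset z)) (cD (labels z) (dset z)) setT else 0.
Proof.
set D := dset z; set x := labels z.
have [vD|] := boolP (valid D); last first.
  rewrite negb_forall_in => /exists_inP[p pD]; rewrite negb_and !negbK => hp.
  have zp : (z p).1 by move: pD; rewrite inE.
  have [hR|hR] := boolP (nx p \in Rt).
    by rewrite (bigD1 p) //= /cf zp; move: hR; rewrite inE => ->; rewrite orbT !mul0r.
  rewrite (negbTE hR) /= in hp; rewrite (bigD1 (nx p)) //= /cf ebit_nx // zp.
  by move: hp; rewrite inE => ->; rewrite !mul0r.
rewrite haf_dominoes // mulrA.
have -> : mono z = ~: dom D.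
  by apply/setP => p; rewrite !inE negb_or (ebitE _ vD).
congr (_ * _); have /forall_inP v := vD.
have -> : (-1) ^+ #|D| = \prod_(p in D) -1 :> F by rewrite prodr_const.
rewrite -big_split /=.
rewrite (eq_bigr (fun p => (if p \in D then - P (x p) (x (nx p)) else 1) *
   (if p \in [set nx q | q in D] then (x (nx p) == (nth0 z p.-1).2)%:R else 1))); last first.
  move=> p _; rewrite /cf (ebitE _ vD) !ffunE; have -> : (z p).1 = (p \in D) by rewrite inE.
  case: (boolP (p \in D)) => pD; last by rewrite mul1r.
  have -> : (p \in [set nx q | q in D]) = false.
    apply/negP => /imsetP[q qD e]; have /andP[_] := v q qD; by rewrite -e pD.
  by have /andP[v1 _] := v p pD; rewrite inE in v1; rewrite (negbTE v1) mulr1.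
rewrite big_split /= -!big_mkcond /= big_imset /=; last by move=> q1 q2 _ _; apply: nxo_inj.
rewrite -big_split /=; apply: eq_bigr => p pD; have /andP[v1 _] := v p pD.
have e := nx_nonroot_val v1; rewrite /= in e; rewrite e /= nthfE /straight eqxx andbT mulN1r mulNr !ffunE.
by rewrite (eq_sym (z (nx (nx p))).2).
Qed.

Lemma raw_formula :
  \sum_(z : {ffun I -> T}) (\prod_p cf z p) * haf (la (labels z)) (lcov (labels z)) (mono z) =
  \sum_(u in rawset n rt | G || [forall p, ~~ u.2 p]) dval nx u.1 u.2 (Kraw A P u).
Proof.
rewrite -sum_labels_raw; under eq_bigr do rewrite cf_prod.
under [RHS]eq_bigr do rewrite big_mkcond.
rewrite pair_bigA /=.
rewrite (reindex (fun u : {ffun I -> 'I_N} * {set I} => [ffun p => (p \in u.2, u.1 p)] : {ffun I -> T})) /=; last first.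
  exists (fun z => (labels z, dset z)) => [[x D] _|z _].
    by congr pair; [apply/ffunP => p; rewrite !ffunE|apply/setP => p; rewrite inE ffunE].
  by apply/ffunP => p; rewrite !ffunE inE -surjective_pairing.
apply: eq_bigr => -[x D] _ /=.
have -> : labels [ffun p => (p \in D, x p)] = x by apply/ffunP => p; rewrite !ffunE.
by have -> : dset [ffun p => (p \in D, x p)] = D by apply/setP => p; rewrite inE ffunE.
Qed.

End RawFormula.

From mathcomp Require Import all_classical all_reals all_analysis.
From mathcomp.real_closed Require Import complex.
From mathcomp Require Import measurable_realfun spectral.
Require Import Defs.
Import numFieldNormedType.Exports.
Import Order.TTheory GRing.Theory Num.Theory.

(** * Summing the series in the defect *)

Section Series.
Variable R : realType.

Lemma expR_partial_sum (x : R) n : 0 <= x -> \sum_(k < n) x ^+ k / k`!%:R <= expR x.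
Proof.
move=> x0; rewrite -(big_mkord xpredT (fun k => x ^+ k / k`!%:R)).
have h : nondecreasing_seq (series (exp_coeff x)).
  by apply: nondecreasing_series => k _ _; rewrite exp_coeff_ge0.
exact: (nondecreasing_cvgn_le h (is_cvg_series_exp_coeff x) n).
Qed.

Lemma fact_le_succ_exp k : (k`! <= k.+1 ^ k)%N.
Proof.
elim: k => // k IH; rewrite factS expnS; apply: leq_mul => //.
by apply: leq_trans IH _; case: k => // k; rewrite leq_exp2r.
Qed.

Lemma exp_over_succ (x : R) k : 0 <= x -> (x / k.+1%:R) ^+ k <= x ^+ k / k`!%:R.
Proof.
move=> x0; rewrite expr_div_n; apply: ler_wpM2l; first exact: exprn_ge0.
by rewrite lef_pV2 ?posrE ?exprn_gt0 ?ltr0n ?fact_gt0 // -natrX ler_nat fact_le_succ_exp.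
Qed.

Lemma sum_sqr_le n (f : nat -> R) : (forall k, 0 <= f k) ->
  \sum_(k < n) f k ^+ 2 <= (\sum_(k < n) f k) ^+ 2.
Proof.
move=> f0; elim: n => [|n IH]; first by rewrite !big_ord0 expr0n.
have S0 : 0 <= \sum_(k < n) f k by apply: sumr_ge0.
rewrite !big_ord_recr /=; have := f0 n; nra.
Qed.

Lemma exprD_le (a b : R) m : 0 <= a -> 0 <= b -> (a + b) ^+ m <= (2 * a) ^+ m + (2 * b) ^+ m.
Proof.
move=> a0 b0; case: (leP a b) => h.
  apply: (@le_trans _ _ ((2 * b) ^+ m)); last by rewrite lerDr exprn_ge0 // mulr_ge0.
  by apply: lerXn2r; rewrite ?nnegrE ?addr_ge0 ?mulr_ge0 //; lra.
apply: (@le_trans _ _ ((2 * a) ^+ m)); last by rewrite lerDl exprn_ge0 // mulr_ge0.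
by apply: lerXn2r; rewrite ?nnegrE ?addr_ge0 ?mulr_ge0 //; lra.
Qed.

(** Split t + n/(k+1) with [exprD_le]. The part with n/(k+1) becomes (y^k/k!)^2 with y^2 = 2c n^3/N,
    and the sum of squares is at most the square of the sum, so exp(2y) arises. The part with t
    becomes x^k/k! with x = 2c n^2 t/N. Both use (k+1)^(-k) <= 1/k!. *)
Lemma series_bound (s t n N : nat) (c : R) : 1 <= c -> (0 < n)%N -> (0 < N)%N ->
  \sum_(k < n) c ^+ k.+1 * k.+1%:R ^+ k * ((t%:R + n%:R / k.+1%:R) ^+ (k + s) * (n%:R / k.+1%:R) ^+ (2 * k) * N%:R ^- k)
  <= c * 2 ^+ s * n%:R ^+ s * (expR (2 * Num.sqrt (2 * c * n%:R ^+ 3 / N%:R))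
     + Num.max 1 (t%:R / n%:R) ^+ s * expR (2 * c * n%:R ^+ 2 * t%:R / N%:R)).
Proof.
move=> c1 n0 N0.
have nR : 0 < n%:R :> R by rewrite ltr0n.
have NR : 0 < N%:R :> R by rewrite ltr0n.
have c0 : 0 <= c := le_trans ler01 c1.
set y := Num.sqrt _; set x := 2 * c * n%:R ^+ 2 * t%:R / N%:R.
have x0 : 0 <= x by rewrite !mulr_ge0 ?invr_ge0 ?exprn_ge0.
have y0 : 0 <= y by apply: sqrtr_ge0.
have y2 : y ^+ 2 = 2 * c * n%:R ^+ 3 / N%:R.
  by rewrite sqr_sqrtr // !mulr_ge0 ?invr_ge0 ?exprn_ge0.
have split k : c ^+ k.+1 * k.+1%:R ^+ k * ((t%:R + n%:R / k.+1%:R) ^+ (k + s) * (n%:R / k.+1%:R) ^+ (2 * k) * N%:R ^- k)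
   <= c * 2 ^+ s * n%:R ^+ s * ((y ^+ k / k`!%:R) ^+ 2 + (t%:R / n%:R) ^+ s * (x ^+ k / k`!%:R)).
  have kR : 0 < k.+1%:R :> R by rewrite ltr0n.
  have t0 : 0 <= t%:R :> R by [].
  have q0 : 0 <= n%:R / k.+1%:R :> R by rewrite divr_ge0 ?ltW.
  have -> : c ^+ k.+1 * k.+1%:R ^+ k * ((t%:R + n%:R / k.+1%:R) ^+ (k + s) * (n%:R / k.+1%:R) ^+ (2 * k) * N%:R ^- k) =
    (c ^+ k.+1 * k.+1%:R ^+ k * (n%:R / k.+1%:R) ^+ (2 * k) * N%:R ^- k) * (t%:R + n%:R / k.+1%:R) ^+ (k + s) by ring.
  apply: le_trans (ler_wpM2l _ (exprD_le _ t0 q0)) _.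
    by rewrite !mulr_ge0 ?exprn_ge0 ?invr_ge0 ?exprn_ge0.
  rewrite mulrDr addrC mulrDr; set U := n%:R / k.+1%:R in q0 *.
  have key (V : R) : c ^+ k.+1 * k.+1%:R ^+ k * U ^+ (2 * k) * N%:R ^- k * (2 * V) ^+ (k + s) =
     c * (2 * V) ^+ s * (2 * c * k.+1%:R * U ^+ 2 * V / N%:R) ^+ k.
    rewrite (exprS c) (exprD (2 * V)) (exprM U) -exprVn !exprMn; move: (U ^+ 2) => W. by ring.
  rewrite !key; apply: lerD.
    have -> : 2 * c * k.+1%:R * U ^+ 2 * U / N%:R = (y / k.+1%:R) ^+ 2.
      by rewrite (expr_div_n y) y2 /U; field; rewrite !gt_eqF.
    rewrite exprAC -!mulrA; apply: ler_wpM2l => //; rewrite mulrA; apply: ler_pM.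
    - by rewrite exprn_ge0 // mulr_ge0.
    - by rewrite exprn_ge0 // exprn_ge0 // divr_ge0 // ltW.
    - rewrite exprMn; apply: ler_wpM2l; first exact: exprn_ge0.
      have Un : U <= n%:R by rewrite ler_pdivrMr // ler_peMr // ler1n.
      by apply: lerXn2r; rewrite ?nnegrE.
    - apply: lerXn2r; rewrite ?nnegrE ?exp_over_succ //; first by rewrite exprn_ge0 // divr_ge0 // ltW.
      by rewrite mulr_ge0 ?exprn_ge0 // invr_ge0.
  have -> : 2 * c * k.+1%:R * U ^+ 2 * t%:R / N%:R = x / k.+1%:R.
    by rewrite /x /U; field; rewrite !gt_eqF.
  have -> : 2 * t%:R = 2 * n%:R * (t%:R / n%:R) :> R by field; rewrite gt_eqF.
  clear key q0; clearbody x U y; rewrite (exprMn s (2 * n%:R)) (exprMn s 2) -!mulrA.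
  do 4! (apply: ler_wpM2l; first by rewrite ?exprn_ge0 // divr_ge0).
  exact: exp_over_succ.
apply: (@le_trans _ _ (\sum_(k < n) c * 2 ^+ s * n%:R ^+ s * ((y ^+ k / k`!%:R) ^+ 2 + (t%:R / n%:R) ^+ s * (x ^+ k / k`!%:R)))).
  by apply: ler_sum => k _; apply: split.
rewrite -mulr_sumr big_split /=; apply: ler_wpM2l; first by rewrite !mulr_ge0 ?exprn_ge0.
apply: lerD.
  apply: le_trans (sum_sqr_le (f := fun k => y ^+ k / k`!%:R) n _) _.
    by move=> k; rewrite divr_ge0 ?exprn_ge0.
  rewrite expRM_natl; apply: lerXn2r; rewrite ?nnegrE ?expR_ge0 ?expR_partial_sum //.
  by apply: sumr_ge0 => k _; rewrite divr_ge0 ?exprn_ge0.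
rewrite -mulr_sumr; apply: ler_pM; rewrite ?exprn_ge0 ?divr_ge0 ?expR_partial_sum //.
  by apply: sumr_ge0 => k _; rewrite divr_ge0 ?exprn_ge0.
by apply: lerXn2r; rewrite ?nnegrE ?divr_ge0 ?le_max ?ler01 ?lexx ?orbT.
Qed.

(** The base 256 = 2 * 2 * 16 * 4 collects Q + 1 <= 2^Q, the root sets, the codes, and the factor
    4^Q of the difference estimate. The power (Q+1)^(k+s) yields (k+1)^k and an exponential. *)
Lemma weight_nat_bound s k Q : Q = (6 * k + 4 * s)%N ->
  (Q.+1 * (2 ^ Q * (16 ^ Q * Q.+1 ^ (k + s))) * (4 ^ Q * k.+1) <=
   (256 ^ (6 + 4 * s) * ((4 * s + 6) ^ (1 + s) * 2 ^ s.+1)) ^ k.+1 * k.+1 ^ k)%N.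
Proof.
move=> eQ.
have pw b al be : (0 < b)%N -> (b ^ (al * k + be) <= (b ^ (al + be)) ^ k.+1)%N.
  move=> b0; rewrite -expnM; apply: leq_pexp2l => //.
  by rewrite mulnDl leq_add // ?leq_mul // leq_pmulr.
have h1 : (Q.+1 * (2 ^ Q * (16 ^ Q * 4 ^ Q)) <= (256 ^ (6 + 4 * s)) ^ k.+1)%N.
  apply: leq_trans (pw 256%N 6%N (4 * s)%N isT); rewrite -eQ (_ : 256 = 2 * (2 * (16 * 4)))%N // !expnMn.
  by apply: leq_mul => //; apply: ltn_expl.
have h2 : (Q.+1 ^ (k + s) <= ((4 * s + 6) ^ (1 + s)) ^ k.+1 * ((2 ^ s) ^ k.+1 * k.+1 ^ k))%N.
  apply: (@leq_trans ((4 * s + 6) ^ (k + s) * k.+1 ^ (k + s))).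
    rewrite -expnMn; have hQ : (Q.+1 <= (4 * s + 6) * k.+1)%N by rewrite eQ; nia.
    by case: (k + s)%N => // m; rewrite leq_exp2r.
  apply: leq_mul; first by have := pw (4 * s + 6)%N 1%N s; rewrite mul1n; apply; rewrite addn_gt0 orbT.
  rewrite addnC expnD; apply: leq_mul => //; rewrite -expnM mulnC expnM.
  by clear; case: s => // s'; rewrite leq_exp2r //; apply: ltnW; apply: ltn_expl.
have h3 : (k.+1 <= 2 ^ k.+1)%N by apply: ltnW; apply: ltn_expl.
have -> : (Q.+1 * (2 ^ Q * (16 ^ Q * Q.+1 ^ (k + s))) * (4 ^ Q * k.+1) =
  Q.+1 * (2 ^ Q * (16 ^ Q * 4 ^ Q)) * (Q.+1 ^ (k + s) * k.+1))%N.
  by move: (2 ^ Q)%N => a; move: (16 ^ Q)%N => a1; move: (4 ^ Q)%N => a2; move: (Q.+1 ^ _)%N => a3; ring.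
apply: leq_trans (leq_mul h1 (leq_mul h2 h3)) _.
rewrite (expnS 2 s) (expnMn (256 ^ _)) (expnMn ((4 * s + 6) ^ _)) (expnMn 2 (2 ^ s)); apply/eq_leq.
move: ((256 ^ _) ^ _)%N => a; move: (((4 * s + 6) ^ _) ^ _)%N => a1; move: ((2 ^ s) ^ _)%N => a2.
by move: (2 ^ _)%N => a3; move: (_ ^ k)%N => a4; ring.
Qed.

(** The factor e comes from (1+h)^n <= e^(k+1); the exponents of [r] and [G] are those that dominate
    2k + 2s and k + s once the whole is raised to the power k + 1. *)
Definition cst_of (s : nat) (r G : R) : R :=
  (256 ^ (6 + 4 * s) * ((4 * s + 6) ^ (1 + s) * 2 ^ s.+1))%N%:R * expR 1 * r ^+ (2 + 2 * s) * G ^+ (1 + s).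

Lemma cst_of_ge1 s r G : 1 <= r -> 1 <= G -> 1 <= cst_of s r G.
Proof.
move=> r1 G1; have r0 := le_trans ler01 r1; have G0 := le_trans ler01 G1.
have e1 : 1 <= expR 1 :> R by have := expR_ge1Dx (1 : R); lra.
rewrite /cst_of; apply: mulr_ege1; last exact: exprn_ege1.
apply: mulr_ege1; last exact: exprn_ege1.
apply: mulr_ege1 => //; rewrite ler1n.
by rewrite muln_gt0 (expn_gt0 256) muln_gt0 (expn_gt0 2) (expn_gt0 (4 * s + 6)) addnS.
Qed.

Lemma weight_bound (s t n N k Q : nat) (r G U : R) : 1 <= r -> 1 <= G -> (0 < n)%N ->
  Q = (6 * k + 4 * s)%N -> U = n%:R / k.+1%:R ->
  (Q.+1 * (2 ^ Q * (16 ^ Q * Q.+1 ^ (k + s))))%N%:R * ((4 ^ Q * k.+1)%N%:R *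
    ((1 + U^-1) ^+ n * (r ^+ (2 * k + 2 * s) * (G * (t%:R + U)) ^+ (k + s) * U ^+ (2 * k) * N%:R ^- k))) <=
  cst_of s r G ^+ k.+1 * k.+1%:R ^+ k * ((t%:R + U) ^+ (k + s) * U ^+ (2 * k) * N%:R ^- k).
Proof.
move=> r1 G1 n0 eQ eU; have r0 := le_trans ler01 r1; have G0 := le_trans ler01 G1.
have U0 : 0 < U by rewrite eU divr_gt0 ?ltr0n.
have he : (1 + U^-1) ^+ n <= expR 1 ^+ k.+1.
  apply: (@le_trans _ _ (expR U^-1 ^+ n)).
    by apply: lerXn2r; rewrite ?nnegrE ?expR_ge0 ?expR_ge1Dx // addr_ge0 // invr_ge0 ltW.
  rewrite -!expRM_natl mulr1 ler_expR eU invf_div mulrC divfK // pnatr_eq0 -lt0n //.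
have pw (b : R) al be : 1 <= b -> b ^+ (al * k + be) <= (b ^+ (al + be)) ^+ k.+1.
  move=> b1; rewrite -exprM; apply: ler_weXn2l => //.
  by rewrite mulnDl leq_add // ?leq_mul // leq_pmulr.
have hr := pw r 2%N (2 * s)%N r1.
have hG := pw G 1%N s G1; rewrite mul1n in hG.
have hW : (Q.+1 * (2 ^ Q * (16 ^ Q * Q.+1 ^ (k + s))))%N%:R * (4 ^ Q * k.+1)%N%:R <=
   (256 ^ (6 + 4 * s) * ((4 * s + 6) ^ (1 + s) * 2 ^ s.+1))%N%:R ^+ k.+1 * k.+1%:R ^+ k :> R.
  by rewrite -!natrX -!natrM ler_nat; apply: (weight_nat_bound eQ).
rewrite /cst_of; move: hW; move: (_ * (2 ^ Q * _))%N (4 ^ Q * _)%N (256 ^ _ * _)%N => W1 W2 W3 hW.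
set Z := (t%:R + U) ^+ (k + s) * U ^+ (2 * k) * N%:R ^- k.
have Z0 : 0 <= Z by rewrite !mulr_ge0 ?exprn_ge0 ?invr_ge0 ?exprn_ge0 ?addr_ge0 // ltW.
have -> : W1%:R * (W2%:R * ((1 + U^-1) ^+ n * (r ^+ (2 * k + 2 * s) * (G * (t%:R + U)) ^+ (k + s) * U ^+ (2 * k) * N%:R ^- k)))
  = (W1%:R * W2%:R) * ((1 + U^-1) ^+ n * (r ^+ (2 * k + 2 * s) * G ^+ (k + s))) * Z.
  by rewrite /Z exprMn; ring.
apply: ler_wpM2r => //.
have -> : (W3%:R * expR 1 * r ^+ (2 + 2 * s) * G ^+ (1 + s)) ^+ k.+1 * k.+1%:R ^+ k =
  (W3%:R ^+ k.+1 * k.+1%:R ^+ k) * (expR 1 ^+ k.+1 * ((r ^+ (2 + 2 * s)) ^+ k.+1 * (G ^+ (1 + s)) ^+ k.+1)).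
  by rewrite !(exprMn k.+1); ring.
have U1 : 0 <= 1 + U^-1 by rewrite addr_ge0 // invr_ge0 ltW.
apply: ler_pM => //; first by rewrite !mulr_ge0 ?exprn_ge0.
apply: ler_pM => //; [by rewrite exprn_ge0|by rewrite mulr_ge0 ?exprn_ge0|].
by apply: ler_pM => //; rewrite exprn_ge0.
Qed.

End Series.

Local Open Scope classical_set_scope.
Local Open Scope ring_scope.

Import HBNNSimple.

(** * Comparing weighted laws of real variables *)

Section WeightedLaw.
Variable R : realType.

Lemma weighted_simple d (T : measurableType d) (nu : {measure set T -> \bar R}) (X h : T -> R)
    (f : {nnsfun R >-> R}) : measurable_fun setT X -> measurable_fun setT h -> (forall x, 0 <= h x) ->
  (\int[nu]_x (f (X x) * h x)%:E =
   \sum_(r \in range f) (r%:E * \int[nu]_x (\1_(f @^-1` [set r]) (X x) * h x)%:E))%E.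
Proof.
move=> mX mh h0.
have mi r : measurable_fun setT (fun x => \1_(f @^-1` [set r]) (X x) * h x).
  apply: measurable_funM => //; apply: measurableT_comp => //; exact: measurable_indic.
have i0 r x : 0 <= \1_(f @^-1` [set r]) (X x) * h x by rewrite mulr_ge0.
transitivity (\int[nu]_x (\sum_(r \in range f) (r * (\1_(f @^-1` [set r]) (X x) * h x))%:E))%E.
  apply: eq_integral => x _; rewrite EFinM {1}(fimfunE f (X x)) -fsumEFin //.
  rewrite ge0_mule_fsuml; last by move=> r; rewrite EFinM nnfun_muleindic_ge0.
  by apply: eq_fsbigr => r _; rewrite -EFinM mulrA.
rewrite ge0_integral_fsum //; first last.
- move=> r x _; rewrite lee_fin mulrA mulr_ge0 //.
  have := nnfun_muleindic_ge0 f r (X x); by rewrite -EFinM lee_fin.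
- by move=> r; apply/measurable_EFinP; apply: measurable_funM.
apply: eq_fsbigr => r; rewrite inE => -[y _ <-].
under eq_integral do rewrite EFinM.
rewrite ge0_integralZl_EFin //.
- by move=> x _; rewrite lee_fin.
- exact/measurable_EFinP.
Qed.

Lemma weighted_limit d (T : measurableType d) (nu : {measure set T -> \bar R}) (X h : T -> R)
    (f : R -> R) (fn : {nnsfun R >-> R}^nat) :
  measurable_fun setT X -> measurable_fun setT h -> (forall x, 0 <= h x) ->
  (forall y, (fn n y)%:E @[n --> \oo] --> (f y)%:E) ->
  (forall y, {homo (fun n => fn n y) : n m / (n <= m)%N >-> n <= m}) ->
  (\int[nu]_x (fn n (X x) * h x)%:E)%E @[n --> \oo] --> (\int[nu]_x (f (X x) * h x)%:E)%E.
Proof.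
move=> mX mh h0 cf ndf.
pose g n x := (fn n (X x) * h x)%:E.
have := @cvg_monotone_convergence _ _ _ nu setT measurableT g _ _ _.
have -> : (\int[nu]_x (fun x0 => limn (g^~ x0)) x = \int[nu]_x (f (X x) * h x)%:E)%E.
  apply: eq_integral => x _; apply/cvg_lim => //; rewrite /g.
  under eq_fun do rewrite EFinM.
  by rewrite EFinM; apply: cvgeZr.
apply.
- move=> n; apply/measurable_EFinP; apply: measurable_funM => //.
  exact: measurableT_comp.
- by move=> n x _; rewrite lee_fin mulr_ge0.
- by move=> x _ n m nm; rewrite lee_fin ler_wpM2r // ndf.
Qed.

(** Indicators, then simple functions, then monotone limits. The weight stands for the remaining
    factors of a product, so that independence can be extended one factor at a time. *)
Lemma weighted_ext d1 d2 (T1 : measurableType d1) (T2 : measurableType d2)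
    (nu1 : {measure set T1 -> \bar R}) (nu2 : {measure set T2 -> \bar R})
    (X1 h1 : T1 -> R) (X2 h2 : T2 -> R) :
  measurable_fun setT X1 -> measurable_fun setT h1 -> (forall x, 0 <= h1 x) ->
  measurable_fun setT X2 -> measurable_fun setT h2 -> (forall x, 0 <= h2 x) ->
  (forall B, measurable B -> (\int[nu1]_x (\1_B (X1 x) * h1 x)%:E = \int[nu2]_x (\1_B (X2 x) * h2 x)%:E)%E) ->
  forall f : R -> R, measurable_fun setT f -> (forall y, 0 <= f y) ->
  (\int[nu1]_x (f (X1 x) * h1 x)%:E = \int[nu2]_x (f (X2 x) * h2 x)%:E)%E.
Proof.
move=> mX1 mh1 h10 mX2 mh2 h20 hB f mf f0.
have mf' : measurable_fun setT (EFin \o f) by apply/measurable_EFinP.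
pose fn := nnsfun_approx measurableT mf'.
have cf y : (fn n y)%:E @[n --> \oo] --> (f y)%:E.
  by apply: (cvg_nnsfun_approx measurableT mf') => // x _; rewrite lee_fin.
have ndf y : {homo (fun n => fn n y) : n m / (n <= m)%N >-> n <= m}.
  by move=> n m nm; have /lefP := nd_nnsfun_approx measurableT mf' nm; apply.
have c1 := weighted_limit (nu := nu1) mX1 mh1 h10 cf ndf.
have c2 := weighted_limit (nu := nu2) mX2 mh2 h20 cf ndf.
rewrite -(cvg_lim _ c1) // -(cvg_lim _ c2) //; congr (limn _); apply/funext => n.
rewrite !weighted_simple //; apply: eq_fsbigr => r _; rewrite hB //.
Qed.

End WeightedLaw.

(** * Products of functions of independent Gaussian variables *)

Section Independence.
Variables (R : realType) (d : measure_display) (T : measurableType d) (P : probability T R).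
Variables (K : finType) (g : K -> T -> R).
Hypothesis gauss : forall k, std_gaussian P (g k).
Hypothesis indep : mutually_independent P g.
Local Notation phi := (normal_pdf (0 : R) 1).
Local Notation leb := (@lebesgue_measure R).

Let phi0 x : 0 <= phi x := normal_pdf_ge0 0 1 x.
Let mphi : measurable_fun setT phi := measurable_normal_pdf 0 1.

Lemma measurable_family (f : K -> R -> R) : (forall k, measurable_fun setT (f k)) ->
  measurable_fun setT (fun w => \prod_k f k (g k w)).
Proof.
move=> mf; apply: measurable_prod => k _; apply: measurableT_comp => //.
by have [] := gauss k.
Qed.

Lemma indep_indic (B : K -> set R) (v : K -> R) : (forall k, measurable (B k)) ->
  (forall k, \int[leb]_x (\1_(B k) x * phi x)%:E = (v k)%:E)%E ->
  (\int[P]_w (\prod_k \1_(B k) (g k w))%:E = (\prod_k v k)%:E)%E.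
Proof.
move=> mB hv.
have e w : \prod_k \1_(B k) (g k w) = \1_(\bigcap_(k in [set k | k \in [set: K]%SET]) (g k @^-1` B k)) w :> R.
  rewrite indicE; case: (boolP (w \in _)) => [|].
    rewrite inE => h; apply: big1 => k _; rewrite indicE mem_set //; apply: (h k); by rewrite /= inE.
  rewrite notin_setE => /existsNP[k] /not_implyP[_ hk].
  by rewrite (bigD1 k) //= indicE memNset // mul0r.
under eq_integral do rewrite e.
rewrite integral_indic //; last first.
  apply: fin_bigcap_measurable; first exact: finite_finset.
  by move=> k _; rewrite -[X in measurable X]setTI; have [mk _] := gauss k; apply: mk.
rewrite setIT; transitivity (\prod_(k in [set: K]%SET) P (g k @^-1` B k))%E; first exact: indep.
rewrite -prodEFin (eq_bigl xpredT); last by move=> k; rewrite inE.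
apply: eq_bigr => k _; have [_ ->] := gauss k => //.
rewrite -hv /normal_prob [RHS]integral_mkcond /= [LHS]integral_mkcond; apply: eq_integral => x _.
by rewrite /patch indicE; case: (boolP (x \in B k)) => _; rewrite ?mul1r ?mul0r ?in_setT.
Qed.

(** [U] contains the factors not yet known to be indicators. One of them is traded for an indicator
    by [weighted_ext], the product of the others serving as weight. *)
Lemma indep_nonneg (U : {set K}) (f : K -> R -> R) (v : K -> R) :
  (forall k, k \notin U -> exists2 B, measurable B & f k = \1_B) ->
  (forall k, measurable_fun setT (f k)) -> (forall k y, 0 <= f k y) ->
  (forall k, \int[leb]_x (f k x * phi x)%:E = (v k)%:E)%E ->
  (\int[P]_w (\prod_k f k (g k w))%:E = (\prod_k v k)%:E)%E.
Proof.
move: {2}#|U| (erefl #|U|) => m; elim: m U f v => [|m IH] U f v hU hB mf f0 hv.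
  move: hU => /eqP; rewrite cards_eq0 => /eqP U0.
  have /boolp.choice[B hBB] : forall k, exists B, measurable B /\ f k = \1_B.
    by move=> k; have [|B ? ?] := hB k; [rewrite U0 inE|exists B].
  have fE k : f k = \1_(B k) by case: (hBB k).
  under eq_integral do under eq_bigr do rewrite fE.
  apply: indep_indic => k; first by case: (hBB k).
  by have := hv k; rewrite fE.
have [k0 k0U] : exists k0, k0 \in U by apply/card_gt0P; rewrite hU.
pose c := \prod_(k | k != k0) v k.
have v0 k : 0 <= v k.
  have : (0 <= (v k)%:E)%E by rewrite -hv integral_ge0 // => x _; rewrite lee_fin mulr_ge0.
  by rewrite lee_fin.
have c0 : 0 <= c by apply: prodr_ge0.
pose h w := \prod_(k | k != k0) f k (g k w).
have mh : measurable_fun setT h.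
  rewrite /h; under eq_fun do rewrite big_mkcond; apply: measurable_prod => k _.
  by case: (k != k0) => //; apply: measurableT_comp => //; have [] := gauss k.
transitivity (\int[P]_w (f k0 (g k0 w) * h w)%:E)%E.
  by apply: eq_integral => w _; rewrite (bigD1 k0).
rewrite (@weighted_ext _ _ _ _ _ P leb (g k0) h id (fun x => c * phi x)) //.
- under eq_integral do rewrite mulrCA EFinM.
  rewrite ge0_integralZl_EFin //; last 2 first.
  + by move=> x _; rewrite lee_fin mulr_ge0.
  + by apply/measurable_EFinP; apply: measurable_funM; [exact: mf|exact: mphi].
  by rewrite hv -EFinM (bigD1 k0) //= mulrC.
- by have [] := gauss k0.
- by move=> w; apply: prodr_ge0.
- by apply: measurable_funM; [exact: measurable_cst|exact: mphi].
- by move=> x; rewrite mulr_ge0.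
move=> B mB.
pose vB := fine (normal_prob 0 1 B).
have hvB : (\int[leb]_x (\1_B x * phi x)%:E = vB%:E)%E.
  rewrite /vB fineK; last exact: fin_num_measure.
  rewrite /normal_prob [RHS]integral_mkcond; apply: eq_integral => x _.
  by rewrite /patch indicE; case: (x \in B); rewrite ?mul1r ?mul0r.
have := IH (U :\ k0) (fun k => if k == k0 then \1_B else f k) (fun k => if k == k0 then vB else v k).
rewrite (bigD1 k0) //= eqxx (eq_bigr v); last by move=> k /negbTE->.
move=> E; transitivity (vB * c)%:E; last first.
  under [RHS]eq_integral do rewrite mulrCA EFinM.
  rewrite ge0_integralZl_EFin ?hvB -?EFinM 1?mulrC //.
    by move=> x _; rewrite lee_fin mulr_ge0.
  by apply/measurable_EFinP; apply: measurable_funM; [apply: measurable_indic|exact: mphi].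
rewrite -E.
- apply: eq_integral => w _; rewrite (bigD1 k0) //= eqxx /h; congr (_ * _)%:E.
  by apply: eq_bigr => k /negbTE->.
- by apply/eqP; rewrite -eqSS -hU (cardsD1 k0 U) k0U.
- move=> k; rewrite !inE; case: eqP => [->|_] /=; first by exists B.
  exact: hB.
- by move=> k; case: eqP.
- by move=> k y; case: eqP.
- by move=> k; case: eqP.
Qed.

Definition good (f : R -> R) (v : R) : Prop :=
  [/\ measurable_fun setT f, leb.-integrable setT (fun x => (f x * phi x)%:E) &
      (\int[leb]_x (f x * phi x)%:E = v%:E)%E].

(** Here [U] contains the factors that may change sign; writing f = (|f| + f) - |f| removes one of
    them from [U]. *)
Lemma indep_good (U : {set K}) (f : K -> R -> R) (v : K -> R) : (forall k, good (f k) (v k)) ->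
  (forall k y, k \notin U -> 0 <= f k y) ->
  P.-integrable setT (fun w => (\prod_k f k (g k w))%:E) /\
  (\int[P]_w (\prod_k f k (g k w))%:E = (\prod_k v k)%:E)%E.
Proof.
move: {2}#|U| (erefl #|U|) => m; elim: m U f v => [|m IH] U f v hU hf f0.
  have {}f0 k y : 0 <= f k y.
    by apply: f0; move/eqP: hU; rewrite cards_eq0 => /eqP->; rewrite inE.
  have mf k : measurable_fun setT (f k) by case: (hf k).
  have hv : (\int[P]_w (\prod_k f k (g k w))%:E = (\prod_k v k)%:E)%E.
    by apply: (@indep_nonneg [set: K]%SET) => // k; [rewrite inE|case: (hf k)].
  split=> //; apply/integrableP; split; first by apply/measurable_EFinP; apply: measurable_family.
  under eq_integral do rewrite gee0_abs ?lee_fin ?prodr_ge0 //.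
  by rewrite hv ltry.
have [k0 k0U] : exists k0, k0 \in U by apply/card_gt0P; rewrite hU.
have [m0 i0 e0] := hf k0.
pose a y := `|f k0 y|; pose p y := a y + f k0 y.
have ma : measurable_fun setT a by apply: measurableT_comp.
have ia : leb.-integrable setT (fun x => (a x * phi x)%:E).
  have := integrable_abse i0; congr (_.-integrable _ _); apply/funext => x /=.
  by rewrite /a normrM (ger0_norm (phi0 x)).
pose va := fine (\int[leb]_x (a x * phi x)%:E).
have ea : (\int[leb]_x (a x * phi x)%:E = va%:E)%E by rewrite fineK // integrable_fin_num.
have ga : good a va by split.
have gp : good p (va + v k0).
  split; first exact: measurable_funD.
  - have := integrableD measurableT ia i0; congr (_.-integrable _ _); apply/funext => x /=.
    by rewrite /p mulrDl.
  - rewrite EFinD -ea -e0 -integralD_EFin //; apply: eq_integral => x _ /=.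
    by rewrite /p mulrDl.
have cardU : #|U :\ k0| = m by apply/eqP; rewrite -eqSS -hU (cardsD1 k0 U) k0U.
have step (q : R -> R) vq : good q vq -> (forall y, 0 <= q y) ->
    P.-integrable setT (fun w => (q (g k0 w) * \prod_(k | k != k0) f k (g k w))%:E) /\
    (\int[P]_w (q (g k0 w) * \prod_(k | k != k0) f k (g k w))%:E = (vq * \prod_(k | k != k0) v k)%:E)%E.
  move=> gq q0.
  have := IH (U :\ k0) (fun k => if k == k0 then q else f k) (fun k => if k == k0 then vq else v k) cardU.
  rewrite (bigD1 k0) //= eqxx (eq_bigr v); last by move=> k /negbTE->.
  have eqf w : \prod_k (if k == k0 then q else f k) (g k w) = q (g k0 w) * \prod_(k | k != k0) f k (g k w).
    rewrite (bigD1 k0) //= eqxx; congr (_ * _); by apply: eq_bigr => k /negbTE->.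
  under eq_integral do rewrite eqf.
  have -> : (fun w => (\prod_k (if k == k0 then q else f k) (g k w))%:E) =
    (fun w => (q (g k0 w) * \prod_(k | k != k0) f k (g k w))%:E) by apply/funext => w; rewrite eqf.
  by apply=> [k|k y]; [case: eqP|rewrite !inE; case: eqP => //= _; apply: f0].
have p0 y : 0 <= p y by have := ler_norm (- f k0 y); rewrite normrN /p /a; lra.
have [ip ep] := step p _ gp p0.
have [ia' ea'] := step a _ ga (fun y => normr_ge0 _).
have dE w : (\prod_k f k (g k w))%:E = ((p (g k0 w) * \prod_(k | k != k0) f k (g k w))%:E -
   (a (g k0 w) * \prod_(k | k != k0) f k (g k w))%:E)%E.
  by rewrite -EFinB (bigD1 k0) //= /p mulrDl addrAC subrr add0r.
under eq_integral do rewrite dE.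
have -> : (fun w => (\prod_k f k (g k w))%:E) = (fun w => ((p (g k0 w) * \prod_(k | k != k0) f k (g k w))%:E -
   (a (g k0 w) * \prod_(k | k != k0) f k (g k w))%:E)%E) by apply/funext => w; rewrite dE.
split; first exact: integrableB.
by rewrite integralB_EFin // ep ea' -EFinB [in RHS](bigD1 k0) //= mulrDl addrAC subrr add0r.
Qed.

End Independence.

(** * Gaussian moments *)

Section Moments.
Variable R : realType.
Local Notation phi := (normal_pdf (0 : R) 1).
Local Notation leb := (@lebesgue_measure R).

Lemma normal_pdf_std s x : s != 0 -> normal_pdf (0 : R) s x = normal_peak s * expR (- x ^+ 2 / (s ^+ 2 *+ 2)).
Proof. by move=> s0; rewrite normal_pdfE //= /normal_fun subr0. Qed.

(** The number 3/8 = 1/2 - 1/8 is the gap between the Gaussian exponents for standard deviations 1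
    and 2; hence [normal_pdf 0 2] dominates every moment integrand. *)
Lemma power_le_exp m (x : R) : `|x| ^+ m <= (1 + (8 / 3) ^+ m.+1 * (m.+1)`!%:R) * expR (3 / 8 * x ^+ 2).
Proof.
set y := 3 / 8 * x ^+ 2; have y0 : 0 <= y by rewrite mulr_ge0 ?sqr_ge0 //; lra.
have h1 := expR_ge1Dxn m y0; have f0 : 0 < (m.+1)`!%:R :> R by rewrite ltr0n fact_gt0.
have h2 : y ^+ m.+1 <= (m.+1)`!%:R * expR y.
  by rewrite -ler_pdivrMl //; apply: le_trans h1; rewrite mulrC lerDr.
have h3 : (`|x| ^+ m.+1) ^+ 2 = (8 / 3) ^+ m.+1 * y ^+ m.+1.
  by rewrite -exprMn exprAC real_normK ?num_real // /y; congr (_ ^+ _); field.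
have e1 : 1 <= expR y by apply: le_trans h1; rewrite lerDl divr_ge0 ?exprn_ge0.
have c0 : 0 <= (8 / 3) ^+ m.+1 :> R by rewrite exprn_ge0 //; lra.
apply: (@le_trans _ _ (1 + (`|x| ^+ m.+1) ^+ 2)); last first.
  rewrite h3; move: c0; move: ((8 / 3) ^+ m.+1) => c c0.
  by rewrite mulrDl mul1r; apply: lerD => //; rewrite -mulrA; apply: ler_wpM2l.
case: (leP `|x| 1) => hx.
  by apply: (@le_trans _ _ 1); [exact: exprn_ile1|rewrite lerDl sqr_ge0].
apply: (@le_trans _ _ ((`|x| ^+ m.+1) ^+ 2)); last by rewrite lerDr.
rewrite -exprM; apply: ler_weXn2l; first exact: ltW.
by rewrite muln2 -addnn; apply: leq_trans (leqnSn m) (leq_addr _ _).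
Qed.

Lemma moment_bound m : exists2 C : R, 0 <= C & forall x, `|x ^+ m * phi x| <= C * normal_pdf 0 2 x.
Proof.
have p1 : 0 < normal_peak (1 : R) by rewrite normal_peak_gt0 // oner_eq0.
have p2 : 0 < normal_peak (2 : R) by rewrite normal_peak_gt0 // pnatr_eq0.
have c0 : 0 <= 1 + (8 / 3) ^+ m.+1 * (m.+1)`!%:R :> R.
  by rewrite addr_ge0 // mulr_ge0 // exprn_ge0 //; lra.
exists ((1 + (8 / 3) ^+ m.+1 * (m.+1)`!%:R) * normal_peak 1 / normal_peak 2).
  by rewrite divr_ge0 ?mulr_ge0 // ltW.
move=> x; rewrite normrM normrX !normal_pdf_std ?oner_eq0 ?pnatr_eq0 //.
rewrite (ger0_norm (mulr_ge0 (ltW p1) (expR_ge0 _))).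
rewrite [leRHS]mulrA divfK ?gt_eqF // [leLHS]mulrCA -[leRHS]mulrA [leRHS]mulrCA; apply: ler_wpM2l; first exact: ltW.
apply: le_trans (ler_wpM2r (expR_ge0 _) (power_le_exp m x)) _.
rewrite -[leLHS]mulrA -expRD; apply: ler_wpM2l => //; rewrite ler_expR le_eqVlt; apply/orP; left; apply/eqP.
by field.
Qed.

Lemma measurable_moment m : measurable_fun setT (fun x : R => x ^+ m * phi x).
Proof.
apply: measurable_funM; last exact: measurable_normal_pdf.
exact: exprn_measurable.
Qed.

Lemma moment_integrable m : leb.-integrable setT (fun x => (x ^+ m * phi x)%:E).
Proof.
have [C C0 hC] := moment_bound m.
have iN : leb.-integrable setT (fun x => (normal_pdf (0 : R) 2 x)%:E) := integrable_normal_pdf 0 2.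
have := integrableZl measurableT C iN; apply: le_integrable => //.
  by apply/measurable_EFinP; apply: measurable_moment.
move=> x _ /=; rewrite lee_fin; apply: le_trans (hC x) _.
by rewrite ger0_norm // mulr_ge0 // normal_pdf_ge0.
Qed.

Definition Mm m : R := fine (\int[leb]_x (x ^+ m * phi x)%:E).

Lemma MmE m : (\int[leb]_x (x ^+ m * phi x)%:E = (Mm m)%:E)%E.
Proof. by rewrite fineK // integrable_fin_num //; apply: moment_integrable. Qed.

Lemma Mm0 : Mm 0 = 1.
Proof.
rewrite /Mm; under eq_integral do rewrite expr0 mul1r.
by rewrite integral_normal_pdf.
Qed.

Lemma phiE : phi = (fun x => normal_peak 1 * expR (- x ^+ 2 / 2)).
Proof. by apply/funext => x; rewrite normal_pdf_std ?oner_eq0 // expr1n. Qed.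

Lemma derive_weighted k (x : R) :
  is_derive x 1 (fun y => y ^+ k * phi y) (k%:R * x ^+ k.-1 * phi x - x ^+ k.+1 * phi x).
Proof.
rewrite phiE; have d1 : is_derive x 1 (fun y : R => - y ^+ 2 / 2) (- x).
  by apply: is_derive_eq; rewrite /GRing.scale /= !mulr0 ?addr0; field.
have d2 : is_derive x 1 (fun y : R => expR (- y ^+ 2 / 2)) (expR (- x ^+ 2 / 2) * - x).
  exact: is_derive1_comp.
have d3 : is_derive x 1 (fun y : R => y ^+ k) ((k%:R * x ^+ k.-1) *: 1).
  by have := is_deriveX k (is_derive_id x 1); rewrite exprfctE.
have d4 : is_derive x 1 (fun y : R => normal_peak 1 * expR (- y ^+ 2 / 2))
    (normal_peak 1 * (expR (- x ^+ 2 / 2) * - x)) := is_deriveZ (normal_peak 1) d2.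
have d5 := is_deriveM d3 d4; apply: (is_derive_eq d5).
by rewrite /GRing.scale /= (exprS x k); move: (normal_peak 1) (expR _) (x ^+ k) (x ^+ k.-1) => *; ring.
Qed.

Lemma continuous_weighted k : continuous (fun y : R => y ^+ k * phi y).
Proof.
move=> x; apply: differentiable_continuous; apply/derivable1_diffP.
by have [] := derive_weighted k x.
Qed.

Lemma weighted_at_infty k : (n.+1%:R ^+ k * phi n.+1%:R : R) @[n --> \oo] --> 0.
Proof.
have [C C0 hC] := moment_bound k.+1.
have c2 := normal_pdf_ub 0.
apply: (@squeeze_cvgr _ _ _ _ (fun=> 0) (fun n => C * normal_peak 2 * n.+1%:R^-1)).
- apply: nearW => n; have n0 : 0 < n.+1%:R :> R by rewrite ltr0n.
  rewrite mulr_ge0 ?exprn_ge0 ?normal_pdf_ge0 //= ler_pdivlMr //.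
  apply: (@le_trans _ _ (C * normal_pdf 0 2 n.+1%:R)).
    by apply: le_trans (hC _); rewrite exprSr mulrAC; exact: ler_norm.
  by apply: ler_wpM2l => //; apply: c2; rewrite pnatr_eq0.
- exact: cvg_cst.
- rewrite -[X in _ --> X](mulr0 (C * normal_peak 2)); apply: cvgM; first exact: cvg_cst.
  exact: cvg_harmonic.
Qed.

Lemma weighted_opp k (y : R) : (- y) ^+ k * phi (- y) = (-1) ^+ k * (y ^+ k * phi y).
Proof.
rewrite !normal_pdf_std ?oner_eq0 // sqrrN (exprNn y) [RHS]mulrA //.
Qed.

(** The function y^k phi(y) has derivative k y^(k-1) phi(y) - y^(k+1) phi(y) and vanishes at
    infinity. Integrate over growing symmetric intervals and pass to the limit by domination. For k
    = 0 the factor k kills the term with the truncated index. *)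
Lemma Mm_rec k : Mm k.+1 = k%:R * Mm k.-1.
Proof.
pose G (y : R) := y ^+ k * phi y.
pose G' (y : R) := k%:R * y ^+ k.-1 * phi y - y ^+ k.+1 * phi y.
have iG' : leb.-integrable setT (EFin \o G').
  have i1 := integrableZl measurableT k%:R (moment_integrable k.-1).
  have := integrableB measurableT i1 (moment_integrable k.+1).
  congr (_.-integrable _ _); apply/funext => y; by rewrite /= /G' -mulrA EFinB EFinM.
have cG' : continuous G'.
  have -> : G' = (cst k%:R * (fun y : R => y ^+ k.-1 * phi y) - (fun y : R => y ^+ k.+1 * phi y))%R.
    by apply/funext => z; rewrite /G' -mulrA.
  move=> y; apply: continuousB; last exact: continuous_weighted.
  by apply: continuousM; [exact: cst_continuous|exact: continuous_weighted].
have ftc n : (\int[leb]_(x in `[(- n.+1%:R : R)%R, (n.+1%:R : R)%R]) (G' x)%:E = (G n.+1%:R - G (- n.+1%:R))%:E)%E.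
  rewrite (@continuous_FTC2 _ G' G) ?EFinB //.
  - by rewrite gtrN // ltr0n.
  - exact: continuous_subspaceT.
  - split.
    + by move=> x _; have [] := derive_weighted k x.
    + by apply: cvg_at_right_filter; apply: continuous_weighted.
    + by apply: cvg_at_left_filter; apply: continuous_weighted.
  - by move=> x _; rewrite derive1E; have [_ ->] := derive_weighted k x.
have lim1 : (\int[leb]_(x in `[(- n.+1%:R : R)%R, (n.+1%:R : R)%R]) (G' x)%:E)%E @[n --> \oo] --> (0 : R)%:E.
  under eq_fun do rewrite ftc; apply/cvg_EFin; first exact: nearW.
  have c1 := @weighted_at_infty k.
  rewrite (_ : _ \o _ = fun n => G n.+1%:R - (-1) ^+ k * G n.+1%:R); last first.
    by apply/funext => n /=; rewrite {2}/G weighted_opp.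
  rewrite -[X in _ --> X](subr0 0) -[X in _ --> _ - X](mulr0 ((-1) ^+ k)).
  by apply: cvgB => //; apply: cvgM => //; exact: cvg_cst.
have lim2 : (\int[leb]_(x in `[(- n.+1%:R : R)%R, (n.+1%:R : R)%R]) (G' x)%:E)%E @[n --> \oo] --> (\int[leb]_x (G' x)%:E)%E.
  under eq_fun do rewrite integral_mkcond.
  apply: (@dominated_cvg _ _ _ leb setT measurableT _ _ (fun x => `|(G' x)%:E|%E)) => //.
  - move=> n; apply/measurable_restrict => //; apply: measurable_funTS.
    exact: (measurable_int leb iG').
  - move=> x _; apply: cvg_near_cst; near=> n; rewrite /patch ifT // inE /= in_itv /= -ler_norml.
    near: n; exists (Num.bound `|x|) => // m /= hm; apply: ltW; apply: lt_le_trans (archi_boundP (normr_ge0 _)) _.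
    by rewrite ler_nat leqW.
  - exact: integrable_abse.
  - move=> n x _; rewrite /patch; case: ifP => _ //; by rewrite abse0 abse_ge0.
have e0 : (\int[leb]_x (G' x)%:E = 0)%E.
  by apply: (cvg_unique _ lim2 lim1).
move: e0; rewrite /G'; under eq_integral do rewrite EFinB -mulrA EFinM.
rewrite integralB //; last 2 first.
- exact: (integrableZl measurableT k%:R (moment_integrable k.-1)).
- exact: moment_integrable.
rewrite integralZl //; last exact: moment_integrable.
rewrite !MmE -EFinM -EFinB => -[/eqP]; rewrite subr_eq0 => /eqP-> //.
Unshelve. all: by end_near.
Qed.

Lemma good_power m : good (fun x : R => x ^+ m) (Mm m).
Proof. by split; [exact: exprn_measurable|exact: moment_integrable|exact: MmE]. Qed.

End Moments.

(** * Complex expectations and Gaussian affine forms *)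

Section ComplexExpectation.
Variables (R : realType) (d : measure_display) (T : measurableType d) (P : probability T R).
Local Notation C := (R[i]).

Lemma ReD (z w : C) : complex.Re (z + w) = complex.Re z + complex.Re w.
Proof. by case: z w => ? ? []. Qed.
Lemma ImD (z w : C) : complex.Im (z + w) = complex.Im z + complex.Im w.
Proof. by case: z w => ? ? []. Qed.
Lemma ReM (z w : C) : complex.Re (z * w) = complex.Re z * complex.Re w - complex.Im z * complex.Im w.
Proof. by case: z w => ? ? []. Qed.
Lemma ImM (z w : C) : complex.Im (z * w) = complex.Re z * complex.Im w + complex.Im z * complex.Re w.
Proof. by case: z w => ? ? []. Qed.

Definition intE (f : T -> R) (v : R) : Prop :=
  P.-integrable setT (EFin \o f) /\ (\int[P]_w (f w)%:E = v%:E)%E.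

Lemma intE_ext f f' v : f =1 f' -> intE f v -> intE f' v.
Proof. by move=> /funext->. Qed.

Lemma intE_lin a b f g v u : intE f v -> intE g u -> intE (fun w => a * f w + b * g w) (a * v + b * u).
Proof.
move=> [f1 f2] [g1 g2].
have i1 : P.-integrable setT (EFin \o (fun w => a * f w)) := integrableZl measurableT a f1.
have i2 : P.-integrable setT (EFin \o (fun w => b * g w)) := integrableZl measurableT b g1.
split; first exact: (integrableD measurableT i1 i2).
have -> : (\int[P]_w (a * f w + b * g w)%:E = \int[P]_w (a * f w)%:E + \int[P]_w (b * g w)%:E)%E.
  by rewrite -integralD_EFin.
under eq_integral do rewrite EFinM; rewrite integralZl // f2.
by under eq_integral do rewrite EFinM; rewrite integralZl // g2 -!EFinM -EFinD.
Qed.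

Lemma intE0 : intE (fun=> 0) 0.
Proof. by split; [exact: integrable0|rewrite integral0]. Qed.

Definition isE (F : T -> C) (v : C) : Prop :=
  intE (fun w => complex.Re (F w)) (complex.Re v) /\ intE (fun w => complex.Im (F w)) (complex.Im v).

Lemma isE_ext F F' v : F =1 F' -> isE F v -> isE F' v.
Proof. by move=> /funext->. Qed.

Lemma isE_lin c F v G u : isE F v -> isE G u -> isE (fun w => c * F w + G w) (c * v + u).
Proof.
move=> [F1 F2] [G1 G2]; split.
  rewrite ReD ReM.
  have h := intE_lin 1 1 (intE_lin (complex.Re c) (- complex.Im c) F1 F2) G1.
  rewrite !mul1r mulNr in h; apply: intE_ext h => w; by rewrite !mul1r mulNr ReD ReM.
rewrite ImD ImM.
have h := intE_lin 1 1 (intE_lin (complex.Re c) (complex.Im c) F2 F1) G2.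
by rewrite !mul1r in h; apply: intE_ext h => w; rewrite !mul1r ImD ImM.
Qed.

Lemma isE0 : isE (fun=> 0) 0.
Proof. by split; exact: intE0. Qed.

Lemma isE_sum (I : finType) (c : I -> C) (F : I -> T -> C) (v : I -> C) : (forall i, isE (F i) (v i)) ->
  isE (fun w => \sum_i c i * F i w) (\sum_i c i * v i).
Proof.
move=> h; elim: (index_enum I) => [|i l IH].
  by rewrite big_nil; apply: isE_ext isE0 => w; rewrite big_nil.
rewrite big_cons; apply: isE_ext (isE_lin (c i) (h i) IH) => w.
by rewrite big_cons.
Qed.

Variables (K : finType) (g : K -> T -> R).
Hypothesis gauss : forall k, std_gaussian P (g k).
Hypothesis indep : mutually_independent P g.

Definition mword (w : seq K) : C := cplx (\prod_k @Mm R (count_mem k w)).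

Lemma cplxM (x y : R) : cplx (x * y) = cplx x * cplx y.
Proof. exact: (rmorphM (real_complex R)). Qed.
Lemma cplx_prod (I : Type) (s : seq I) (f : I -> R) : cplx (\prod_(i <- s) f i) = \prod_(i <- s) cplx (f i).
Proof. exact: (rmorph_prod (real_complex R)). Qed.
Lemma cplx_sum (I : Type) (s : seq I) (Q : pred I) (f : I -> R) :
  cplx (\sum_(i <- s | Q i) f i) = \sum_(i <- s | Q i) cplx (f i).
Proof. exact: (rmorph_sum (real_complex R)). Qed.
Lemma cplx_nat n : cplx (n%:R : R) = n%:R.
Proof. exact: (rmorph_nat (real_complex R)). Qed.

Lemma mword_perm w w' : perm_eq w w' -> mword w = mword w'.
Proof. by move=> /permP h; congr cplx; apply: eq_bigr => k _; rewrite h. Qed.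

Lemma mword_nil : mword [::] = 1.
Proof. by rewrite /mword big1 // => k _; rewrite Mm0. Qed.

(** By independence only the moment in the variable [k] changes, and for it this is [Mm_rec]. *)
Lemma mword_stein k w : mword (k :: w) = (count_mem k w)%:R * mword (rem k w).
Proof.
rewrite /mword -cplx_nat -cplxM; congr cplx.
have c1 : count_mem k (rem k w) = (count_mem k w).-1.
  rewrite count_rem /= eqxx andbT; case: (boolP (k \in w)) => h; first by rewrite subn1.
  by rewrite (count_memPn h).
have c2 j : j != k -> count_mem j (rem k w) = count_mem j w.
  by move=> hj; rewrite count_rem /= eq_sym (negbTE hj) andbF subn0.
rewrite (bigD1 k) //= eqxx add1n Mm_rec [in RHS](bigD1 k) //= c1 mulrA.
by congr (_ * _); apply: eq_bigr => j hj; rewrite eq_sym (negbTE hj) add0n c2.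
Qed.

Lemma prod_count (F : K -> R) w : \prod_(k <- w) F k = \prod_k F k ^+ count_mem k w.
Proof.
elim: w => [|j w IH]; first by rewrite big_nil big1.
rewrite big_cons IH (bigD1 j) //= [in RHS](bigD1 j) //= eqxx add1n exprS mulrA; congr (_ * _).
by apply: eq_bigr => k /negbTE hk; rewrite eq_sym hk.
Qed.

Lemma isE_word w : isE (fun t => \prod_(k <- w) cplx (g k t)) (mword w).
Proof.
have e t : \prod_(k <- w) cplx (g k t) = cplx (\prod_k (g k t) ^+ count_mem k w).
  by rewrite -cplx_prod prod_count.
have [h1 h2] := @indep_good _ _ _ P K g gauss indep [set: K]%SET (fun k x => x ^+ count_mem k w)
  (fun k => Mm R (count_mem k w)) (fun k => good_power R _) (fun k y => ltac:(by rewrite inE)).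
apply: isE_ext (fun t => esym (e t)) _; split; first by split.
exact: intE0.
Qed.

Section Forms.
Variables (n : nat) (a : 'I_n -> C) (c : 'I_n -> K -> C).
Definition form p t : C := a p + \sum_k c p k * cplx (g k t).

Lemma isE_wordv w l : isE (fun t => \prod_(k <- w) cplx (g k t) * \prod_(p <- l) form p t) (wordv mword a c w l).
Proof.
elim: l w => [|p l IH] w /=.
  by apply: isE_ext (isE_word w) => t; rewrite big_nil mulr1.
have h := isE_lin (a p) (IH w) (isE_sum (c p) (fun k => IH (k :: w))).
apply: isE_ext h => t; rewrite big_cons /form mulrDl mulrDr mulrCA; congr (_ + _).
rewrite mulr_suml mulr_sumr; apply: eq_bigr => k _; rewrite big_cons; ring.
Qed.

Lemma isE_haf (S : {set 'I_n}) : isE (fun t => \prod_(p in S) form p t) (haf a (cov c) S).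
Proof.
have -> : S = [set p in enum S] by apply/setP => p; rewrite inE mem_enum.
rewrite -(wordv_haf mword_perm mword_stein mword_nil) ?enum_uniq //.
apply: isE_ext (isE_wordv [::] (enum S)) => t; rewrite big_nil mul1r big_enum.
by apply: eq_bigl => p; rewrite inE mem_enum.
Qed.
End Forms.

End ComplexExpectation.

(** * Matrix entries as linear forms in the Gaussian family *)

Section EnsembleCovariance.
Variables (R : realType) (e : ensemble) (N : nat).
Local Notation C := (R[i]).
Local Notation K := ('I_N * 'I_N * bool)%type.

(** [Wmat] reads the upper triangle of the family, so the entries (x, y) and (y, x) share this
    index. *)
Definition mnp (x y : 'I_N) : 'I_N * 'I_N := if (x <= y)%N then (x, y) else (y, x).
Definition wal (x y : 'I_N) : C :=
  match e with
  | GOE => if x == y then cplx (Num.sqrt 2) else 1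
  | GUE => if x == y then 1 else cplx (Num.sqrt 2)^-1
  end.
(** Off the diagonal the exponent is 2 above and 1 below, which conjugates the lower triangle. *)
Definition wbe (x y : 'I_N) : C :=
  match e with
  | GOE => 0
  | GUE => if x == y then 0 else Complex 0 ((-1) ^+ (x <= y)%N.+1 / Num.sqrt 2)
  end.
Definition wco (x y : 'I_N) (k : K) : C :=
  if k.1 == mnp x y then if k.2 then wbe x y else wal x y else 0.

Lemma sum_pairs (V : nmodType) (f : K -> V) (pr : 'I_N * 'I_N) :
  (forall k, k.1 != pr -> f k = 0) -> \sum_k f k = f (pr, false) + f (pr, true).
Proof.
move=> h; rewrite (bigD1 (pr, false)) //=; congr (_ + _).
rewrite (bigD1 (pr, true)) /=; last by rewrite xpair_eqE andbF.
rewrite -[RHS]addr0; congr (_ + _); apply: big1 => -[q b] /andP[h1 h2].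
by apply: h => /=; apply: contra_neq h1 => e0; move: h2; rewrite e0; case: b => //; rewrite eqxx.
Qed.

Lemma Wmat_form (g : 'I_N -> 'I_N -> bool -> R) x y :
  Wmat e g x y = \sum_k wco x y k * cplx (g k.1.1 k.1.2 k.2).
Proof.
rewrite (@sum_pairs _ _ (mnp x y)); last by move=> k hk; rewrite /wco (negbTE hk) mul0r.
rewrite /wco /= eqxx mxE /mnp /wal /wbe /Wentry /cplx.
have s2 : Num.sqrt 2 != 0 :> R by rewrite gt_eqF // sqrtr_gt0.
case: (leqP x y) => hxy /=; case: e; rewrite ?[y == x]eq_sym; case: (eqVneq x y) => [exy|ne];
  rewrite /= ?exy; apply/eqP; rewrite eq_complex /=; apply/andP; split; apply/eqP; simpc; rewrite ?expr0 ?expr1 ?mulr0 ?mul0r ?addr0 ?subr0 ?oppr0 ?mul1r; try (by field); try by [].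
all: by rewrite ?(ltn_eqF hxy) // in exy *; field.
Qed.

Lemma mnp_eq x y z w : (mnp x y == mnp z w) = ((x == z) && (y == w)) || ((x == w) && (y == z)).
Proof.
rewrite /mnp; case: (leqP x y) => h1; case: (leqP z w) => h2; rewrite xpair_eqE -!val_eqE /=;
  apply/idP/idP; move: h1 h2; lia.
Qed.

End EnsembleCovariance.

(** * The complex modulus and the Cauchy-Schwarz inequality *)

Section Norm.
Variable R : realType.
Local Notation C := (R[i]).
Definition nm (z : C) : R := Normc.normc z.

Lemma nm_ge0 z : 0 <= nm z. Proof. by case: z => x y; apply: sqrtr_ge0. Qed.
Lemma nm0 : nm 0 = 0. Proof. exact: Normc.normc0. Qed.
Lemma nm1 : nm 1 = 1. Proof. exact: Normc.normc1. Qed.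
Lemma nmM : {morph nm : z w / z * w}. Proof. exact: Normc.normcM. Qed.
Lemma nmD z w : nm (z + w) <= nm z + nm w. Proof. exact: le_normcD. Qed.
Lemma nm_sqr z : nm z ^+ 2 = complex.Re z ^+ 2 + complex.Im z ^+ 2.
Proof. by case: z => x y; rewrite /nm /= sqr_sqrtr // addr_ge0 ?sqr_ge0. Qed.
Lemma nm_cplx x : nm (cplx x) = `|x|.
Proof. by rewrite /nm /= expr0n addr0 sqrtr_sqr. Qed.
Lemma nmV (m : nat) : nm (m%:R^-1) = m%:R^-1.
Proof.
have <- : real_complex R (m%:R^-1) = m%:R^-1 by rewrite fmorphV rmorph_nat.
by rewrite [LHS]nm_cplx ger0_norm // invr_ge0.
Qed.
Lemma nm_conj z : nm (Num.conj z) = nm z.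
Proof. by case: z => x y; rewrite /nm /= sqrrN. Qed.
Lemma nmX z k : nm (z ^+ k) = nm z ^+ k.
Proof. by elim: k => [|k IH]; rewrite ?expr0 ?nm1 // !exprS nmM IH. Qed.
Lemma nm_suml (I : finType) (Q : pred I) (f : I -> C) : nm (\sum_(i | Q i) f i) <= \sum_(i | Q i) nm (f i).
Proof.
apply: (big_ind2 (fun x y => nm x <= y)) => //; first by rewrite nm0.
by move=> x1 y1 x2 y2 h1 h2; apply: le_trans (nmD _ _) (lerD h1 h2).
Qed.
Lemma Re_le_nm z : complex.Re z <= nm z.
Proof.
apply: le_trans (ler_norm _) _; rewrite -sqrtr_sqr /nm; case: z => x y /=.
by apply: ler_wsqrtr; rewrite lerDl sqr_ge0.
Qed.
Lemma nm_conjM z : z * Num.conj z = cplx (nm z ^+ 2).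
Proof. by rewrite nm_sqr; case: z => x y; apply/eqP; rewrite eq_complex /=; apply/andP; split; apply/eqP; ring. Qed.

(** From Lagrange's identity for the double sum of the squares of f_i h_j - f_j h_i. *)
Lemma cauchy_schwarz (I : finType) (Q : pred I) (f h : I -> R) : (forall i, 0 <= f i) -> (forall i, 0 <= h i) ->
  \sum_(i | Q i) f i * h i <= Num.sqrt (\sum_(i | Q i) f i ^+ 2) * Num.sqrt (\sum_(i | Q i) h i ^+ 2).
Proof.
move=> f0 h0; have F0 : 0 <= \sum_(i | Q i) f i ^+ 2 by apply: sumr_ge0 => i _; apply: sqr_ge0.
have H0 : 0 <= \sum_(i | Q i) h i ^+ 2 by apply: sumr_ge0 => i _; apply: sqr_ge0.
have S0 : 0 <= \sum_(i | Q i) f i * h i by apply: sumr_ge0 => i _; apply: mulr_ge0.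
rewrite -sqrtrM // -[leLHS](ger0_norm S0) -sqrtr_sqr; apply: ler_wsqrtr.
have : 0 <= \sum_(i | Q i) \sum_(j | Q j) (f i * h j - f j * h i) ^+ 2.
  by apply: sumr_ge0 => i _; apply: sumr_ge0 => j _; apply: sqr_ge0.
set X := \sum_(i | Q i) f i * h i; set Y := \sum_(i | Q i) f i ^+ 2; set Z := \sum_(i | Q i) h i ^+ 2.
have -> : \sum_(i | Q i) \sum_(j | Q j) (f i * h j - f j * h i) ^+ 2 = 2 * (Y * Z - X ^+ 2).
  transitivity (\sum_(i | Q i) (f i ^+ 2 * Z + h i ^+ 2 * Y - 2 * (f i * h i) * X)).
    apply: eq_bigr => i _; rewrite /X /Y /Z !mulr_sumr -big_split -sumrB /=; apply: eq_bigr => j _; ring.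
  rewrite sumrB big_split /= -!mulr_suml -mulr_sumr -/X -/Y -/Z; ring.
by lra.
Qed.
End Norm.

(** * Powers of a Hermitian matrix of low rank *)

Section Spectral.
Variables (R : realType) (N : nat) (A : 'M[R[i]]_N).
Hypothesis hA : hermitian A.
Local Notation C := (R[i]).
Local Notation cj := (@Num.conj C).
Let U := spectralmx A.
Let lam (l : 'I_N) : C := spectral_diag A ord0 l.

Let UU l l' : \sum_x U l x * cj (U l' x) = (l == l')%:R.
Proof.
have /unitarymxP /matrixP /(_ l l') := spectral_unitarymx A.
by rewrite !mxE => <-; apply: eq_bigr => x _; rewrite !mxE.
Qed.

Let UV x y : \sum_l cj (U l x) * U l y = (x == y)%:R.
Proof.
have /unitarymxP /mulmx1C /matrixP /(_ x y) := spectral_unitarymx A.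
by rewrite !mxE => <-; apply: eq_bigr => l _; rewrite !mxE.
Qed.

Let AE x y : A x y = \sum_l cj (U l x) * (lam l * U l y).
Proof.
have nA : A \is normalmx.
  apply/normalmxP; have -> : (A ^t* )%sesqui = A; last by [].
  by apply/matrixP => i j; rewrite !mxE; symmetry; apply: hA.
have /orthomx_spectralP e := nA; rewrite {1}e invmx_unitary ?spectral_unitarymx // -mulmxA mxE.
by apply: eq_bigr => l _; rewrite mul_diag_mx !mxE.
Qed.

Lemma spectral_pow k x y : (A ^+ k) x y = \sum_l cj (U l x) * (lam l ^+ k * U l y).
Proof.
elim: k x y => [|k IH] x y.
  rewrite expr0 -[1]/(1%:M) mxE -UV; by apply: eq_bigr => l _; rewrite expr0 mul1r.
rewrite exprS -[_ * _]/(_ *m _) mxE.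
under eq_bigr do rewrite AE IH big_distrlr /=.
rewrite exchange_big /=; apply: eq_bigr => l _; rewrite exchange_big /= (bigD1 l) //= [X in _ + X]big1 ?addr0.
  have := UU l l; rewrite eqxx => u1.
  transitivity ((\sum_z U l z * cj (U l z)) * (cj (U l x) * (lam l ^+ k.+1 * U l y))); last by rewrite u1 mul1r.
  by rewrite mulr_suml; apply: eq_bigr => z _; rewrite exprS; ring.
move=> l' hl; transitivity ((\sum_z U l z * cj (U l' z)) * (cj (U l x) * lam l * lam l' ^+ k * U l' y)).
  by rewrite mulr_suml; apply: eq_bigr => z _; ring.
by rewrite UU eq_sym (negbTE hl) mul0r.
Qed.

Lemma sqnormvE (v : 'cV[C]_N) : sqnormv v = \sum_i nm (v i 0) ^+ 2.
Proof. by apply: eq_bigr => i _; rewrite nm_sqr. Qed.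

Let row_norm l : \sum_x nm (U l x) ^+ 2 = 1.
Proof.
have := UU l l; rewrite eqxx; under eq_bigr do rewrite nm_conjM.
by rewrite -[LHS](rmorph_sum (real_complex R)) => /(congr1 (@complex.Re R)).
Qed.

Let col_norm x : \sum_l nm (U l x) ^+ 2 = 1.
Proof.
have := UV x x; rewrite eqxx; under eq_bigr do rewrite mulrC nm_conjM.
by rewrite -[LHS](rmorph_sum (real_complex R)) => /(congr1 (@complex.Re R)).
Qed.

Local Notation opset := [set Num.sqrt (sqnormv (A *m v)) | v in [set v : 'cV[C]_N | sqnormv v = 1]].

Lemma opset_ubound : has_ubound opset.
Proof.
exists (Num.sqrt (\sum_i (\sum_j nm (A i j)) ^+ 2)) => _ [v /= hv <-].
apply: ler_wsqrtr; rewrite sqnormvE; apply: ler_sum => i _.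
have v1 j : nm (v j 0) <= 1.
  rewrite -(@expr_le1 _ 2) ?nm_ge0 // -hv sqnormvE (bigD1 j) //= lerDl.
  by apply: sumr_ge0 => l _; apply: sqr_ge0.
have S0 : 0 <= \sum_j nm (A i j) by apply: sumr_ge0 => j _; apply: nm_ge0.
apply: lerXn2r; rewrite ?nnegrE ?nm_ge0 //.
rewrite mxE; apply: le_trans (nm_suml _ _) _; apply: ler_sum => j _.
by rewrite nmM ler_piMr ?nm_ge0.
Qed.

Lemma opnorm_ge0 : 0 <= opnorm A.
Proof.
rewrite /opnorm; have [->|/set0P[x hx]] := eqVneq opset set0; first by rewrite sup0.
have x0 : 0 <= x by case: hx => v _ <-; apply: sqrtr_ge0.
by apply: (le_trans x0); apply: ub_le_sup => //; apply: opset_ubound.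
Qed.

(** The conjugate of row [l] of [U] is a unit eigenvector for [lam l]. *)
Let lam_le l : nm (lam l) <= opnorm A.
Proof.
pose v : 'cV[C]_N := \col_x cj (U l x).
have vE x : nm (v x 0) = nm (U l x) by rewrite mxE nm_conj.
have AvE x : (A *m v) x 0 = lam l * v x 0.
  rewrite mxE; under eq_bigr do rewrite AE mulr_suml.
  rewrite exchange_big /= (bigD1 l) //= [X in _ + X]big1 ?addr0.
    transitivity ((\sum_z U l z * cj (U l z)) * (lam l * cj (U l x))).
      by rewrite mulr_suml; apply: eq_bigr => z _; rewrite !mxE; ring.
    by rewrite UU eqxx mul1r mxE.
  move=> l' hl; transitivity ((\sum_z U l' z * cj (U l z)) * (lam l' * cj (U l' x))).
    by rewrite mulr_suml; apply: eq_bigr => z _; rewrite !mxE; ring.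
  by rewrite UU (negbTE hl) mul0r.
apply: ub_le_sup; first exact: opset_ubound.
exists v => /=.
  by rewrite sqnormvE -[RHS](row_norm l); apply: eq_bigr => x _; rewrite vE.
rewrite sqnormvE; under eq_bigr do rewrite AvE nmM exprMn vE.
by rewrite -mulr_sumr row_norm mulr1 sqrtr_sqr ger0_norm // nm_ge0.
Qed.

Let Sp : {set 'I_N} := [set l | lam l != 0]%SET.

(** The rows of [U] with nonzero eigenvalue are orthonormal and lie in the row space of [A]. *)
Let card_Sp : (#|Sp| <= \rank A)%N.
Proof.
pose W : 'M[C]_(#|Sp|, N) := \matrix_(i, x) U (enum_val i) x.
have Wu : W \is unitarymx.
  apply/unitarymxP/matrixP => i j; rewrite !mxE -(inj_eq enum_val_inj) -UU.
  by apply: eq_bigr => x _; rewrite !mxE.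
rewrite -(mxrank_unitary Wu); apply: mxrankS; apply/submxP.
exists (\matrix_(i, x) ((lam (enum_val i))^-1 * U (enum_val i) x)).
apply/matrixP => i y; rewrite !mxE; set l := enum_val i.
have l0 : lam l != 0 by have := enum_valP i; rewrite inE.
under eq_bigr do rewrite mxE AE mulr_sumr.
rewrite exchange_big /= (bigD1 l) //= [X in _ + X]big1 ?addr0.
  transitivity ((\sum_z U l z * cj (U l z)) * U l y); first by rewrite UU eqxx mul1r.
  by rewrite mulr_suml; apply: eq_bigr => z _; rewrite -/l; field.
move=> l' hl; transitivity ((\sum_z U l z * cj (U l' z)) * ((lam l)^-1 * lam l' * U l' y)).
  by rewrite mulr_suml; apply: eq_bigr => z _; rewrite -/l; ring.
by rewrite UU eq_sym (negbTE hl) mul0r.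
Qed.

(** Take q(x)^2 to be the squared length of the projection of the basis vector x onto the range of
    A. For k > 0 only nonzero eigenvalues contribute to A^k, and Cauchy-Schwarz separates x from
    y. *)
Lemma hermitian_power_bound : exists q : 'I_N -> R,
  [/\ forall x, 0 <= q x, forall x, q x <= 1, \sum_x q x ^+ 2 <= (\rank A)%:R &
      forall k x y, (0 < k)%N -> nm ((A ^+ k) x y) <= opnorm A ^+ k * (q x * q y)].
Proof.
exists (fun x => Num.sqrt (\sum_(l in Sp) nm (U l x) ^+ 2)).
have s0 x : 0 <= \sum_(l in Sp) nm (U l x) ^+ 2 by apply: sumr_ge0 => l _; apply: sqr_ge0.
split=> [x|x||k x y k0].
- exact: sqrtr_ge0.
- rewrite -[leRHS]sqrtr1; apply: ler_wsqrtr; rewrite -(col_norm x) [leRHS](bigID (mem Sp)) /= lerDl.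
  by apply: sumr_ge0 => l _; apply: sqr_ge0.
- under eq_bigr do rewrite sqr_sqrtr //.
  rewrite exchange_big /=; under eq_bigr do rewrite row_norm.
  by rewrite sumr_const ler_nat card_Sp.
rewrite spectral_pow; apply: le_trans (nm_suml _ _) _.
rewrite (bigID (mem Sp)) /= [X in _ + X]big1 ?addr0; last first.
  by move=> l; rewrite inE negbK => /eqP->; rewrite expr0n gtn_eqF // mul0r mulr0 nm0.
have ha := opnorm_ge0.
apply: (@le_trans _ _ (\sum_(l in Sp) opnorm A ^+ k * (nm (U l x) * nm (U l y)))).
  apply: ler_sum => l _; rewrite !nmM nmX nm_conj mulrCA; apply: ler_wpM2r.
    by rewrite mulr_ge0 ?nm_ge0.
  by apply: lerXn2r; rewrite ?nnegrE ?nm_ge0.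
rewrite -mulr_sumr; apply: ler_wpM2l; first exact: exprn_ge0.
by apply: cauchy_schwarz => l; apply: nm_ge0.
Qed.

End Spectral.

(** * The expectation as a sum over diagrams *)

Definition is_goe (e : ensemble) : bool := if e is GOE then true else false.

Lemma cplxV (R : realType) (x : R) : cplx x^-1 = (cplx x)^-1.
Proof. exact: (fmorphV (real_complex R)). Qed.

Section EnsembleFormula.
Variables (R : realType) (e : ensemble) (N : nat).
Local Notation C := (R[i]).
Local Notation K := ('I_N * 'I_N * bool)%type.

(** In GUE the contributions of real and imaginary parts cancel in E W_xy^2 off the diagonal and add
    up in E W_xy W_yx; in GOE the entry is its own transpose, which gives the twisted term. *)
Lemma wco_cov (x y z w : 'I_N) : \sum_k wco R e x y k * wco R e z w k =
  ((x == w) && (y == z))%:R + (is_goe e)%:R * ((x == z) && (y == w))%:R.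
Proof.
rewrite (sum_pairs (pr := mnp x y)); last by move=> k hk; rewrite /wco (negbTE hk) mul0r.
rewrite /wco /= eqxx mnp_eq.
have s2 : (Num.sqrt 2 : R) ^+ 2 = 2 by rewrite sqr_sqrtr.
have s0 : Num.sqrt 2 != 0 :> R by rewrite gt_eqF // sqrtr_gt0.
have c2 : cplx (Num.sqrt 2) * cplx (Num.sqrt 2) = 2 :> C by rewrite -cplxM -expr2 s2 cplx_nat.
have half : cplx (2^-1 : R) = 2^-1 by rewrite cplxV cplx_nat.
have h2 : cplx (Num.sqrt 2)^-1 * cplx (Num.sqrt 2)^-1 = 2^-1 :> C.
  by rewrite -half -cplxM -expr2 exprVn s2.
have i2 (a b : R) : Complex 0 (a / Num.sqrt 2) * Complex 0 (b / Num.sqrt 2) = - (cplx (a * b) / 2) :> C.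
  rewrite -half -cplxM.
  apply/eqP; rewrite eq_complex /=; apply/andP; split; apply/eqP; rewrite ?mul0r ?mulr0 ?addr0 ?subr0 ?oppr0 //.
  by rewrite sub0r mulf_div -expr2 s2.
have [exy|nxy] := eqVneq x y.
  subst y; rewrite /wal /wbe !eqxx; have [exz|nxz] := eqVneq x z.
    subst z; have [exw|nxw] := eqVneq x w.
      by subst w; rewrite /= ?eqxx /=; case: e; rewrite /= ?c2 ?mul0r ?mul1r ?addr0 //; ring.
    by rewrite /= ?(negbTE nxw) ?andbF /= ?mulr0 ?addr0.
  by rewrite ?(negbTE nxz) ?andbF /= ?mulr0 ?addr0.
rewrite /wal /wbe (negbTE nxy); have [h1|h1] := boolP ((x == z) && (y == w)).
  case/andP: h1 => /eqP ez /eqP ew; subst z w.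
  rewrite /= (negbTE nxy) /=; case: e; rewrite /= ?mulr0 ?mul0r ?mul1r ?mulr1 ?addr0 ?add0r //.
  rewrite h2 i2 -exprD addnn -mul2n exprM sqrrN expr1n expr1n /=.
  by rewrite mul1r subrr.
have [h3|h3] := boolP ((x == w) && (y == z)); last by rewrite !mulr0 addr0.
case/andP: h3 => /eqP ew /eqP ez; subst z w.
rewrite eq_sym (negbTE nxy) /=; case: e; rewrite /= ?mulr0 ?mul0r ?mul1r ?mulr1 ?addr0 ?add0r //.
rewrite h2 i2; have -> : (-1) ^+ (x <= y)%N.+1 * (-1) ^+ (y <= x)%N.+1 = -1 :> R.
  have : (x <= y)%N (+) (y <= x)%N.
    by by rewrite leq_eqVlt (inj_eq val_inj) (negbTE nxy) /= [X in _ (+) X]leqNgt; case: (x < y)%N.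
  by case: (x <= y)%N; case: (y <= x)%N => //= _; ring.
have -> : cplx (-1 : R) = -1 by exact: (rmorphN1 (real_complex R)).
by field.
Qed.

Variables (d : measure_display) (T : measurableType d) (P : probability T R).
Variables (g : 'I_N -> 'I_N -> bool -> T -> R).
Hypothesis hg : gaussian_family P g.
Variables (S : 'M[R]_N) (A : 'M[C]_N).
Hypothesis N0 : (0 < N)%N.
Hypothesis S_sym : S^T = S.
Hypothesis S_row : forall i, \sum_j S i j ^+ 2 = 1.
Let x0 : 'I_N := Ordinal N0.
Definition Pc : 'M[C]_N := map_mx (@cplx R) (pmat S).

Let X (t : T) := Xmat e S A (fun i j b => g i j b t).
Let gk (k : K) := g k.1.1 k.1.2 k.2.

Lemma Pc_row x : \sum_y Pc x y = 1.
Proof.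
under eq_bigr do rewrite !mxE; by rewrite -cplx_sum S_row.
Qed.

Lemma S_symE x y : S x y = S y x.
Proof. by rewrite -[in LHS]S_sym mxE. Qed.

Lemma Pc_sym x y : Pc x y = Pc y x.
Proof. by rewrite !mxE S_symE. Qed.

Lemma Pc_col y : \sum_x Pc x y = 1.
Proof. by under eq_bigr do rewrite Pc_sym; apply: Pc_row. Qed.

Section Diagrams.
Variables (n : nat) (rt : pred nat).
Hypothesis rt0 : rt 0%N.
Local Notation nx := (@nxo n rt).
Local Notation Z := ({ffun 'I_n -> bool * 'I_N}).
Let lc (x : {ffun 'I_n -> 'I_N}) (p : 'I_n) (k : K) : C := cplx (S (x p) (x (nx p))) * wco R e (x p) (x (nx p)) k.

Lemma form_entry (x : {ffun 'I_n -> 'I_N}) p t :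
  form gk (la rt A x) (lc x) p t = X t (x p) (x (nx p)).
Proof.
rewrite /form /X /Xmat !mxE addrC -[if _ then _ else _](mxE matrix_key (fun i j => if (i <= j)%N then Wentry e _ i j else conjc (Wentry e _ j i))) -/(Wmat _ _).
rewrite Wmat_form mulr_sumr; congr (_ + _); apply: eq_bigr => k _; by rewrite /lc mulrA.
Qed.

Lemma cov_lc (x : {ffun 'I_n -> 'I_N}) p q : cov (lc x) p q = lcov rt Pc (is_goe e) x p q.
Proof.
rewrite /cov /lc /lcov /straight /twisted.
transitivity (cplx (S (x p) (x (nx p))) * cplx (S (x q) (x (nx q))) *
   \sum_k wco R e (x p) (x (nx p)) k * wco R e (x q) (x (nx q)) k).
  by rewrite mulr_sumr; apply: eq_bigr => k _; ring.
rewrite wco_cov mulrDr mulrCA !mxE expr2 cplxM; congr (_ + _ * _).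
  case: andP => [[/eqP-> /eqP->]|_]; last by rewrite !mulr0.
  by rewrite (S_symE (x (nx q))).
by case: andP => [[/eqP-> /eqP->]|_]; rewrite ?mulr0.
Qed.

(** In each tiling the letters X are Gaussian forms with mean A, so Wick's formula yields a hafnian;
    [raw_formula] then sums over the tilings. *)
Lemma isE_diagrams : isE P (fun t => \sum_(z : Z) \prod_(p < n) tn (X t) Pc n rt (nthf (false, x0) z) p)
  (\sum_(u in rawset n rt | is_goe e || [forall p, ~~ u.2 p]) dval nx u.1 u.2 (Kraw A Pc u)).
Proof.
rewrite -(@raw_formula C n N rt rt0 A Pc (is_goe e) Pc_sym x0).
have gs k : std_gaussian P (gk k) by case: hg => h _; apply: h.
have gi : mutually_independent P gk by case: hg.
have hz (z : Z) : isE P (fun t => \prod_(p in mono rt x0 z) form gk (la rt A (labels z)) (lc (labels z)) p t)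
    (haf (la rt A (labels z)) (lcov rt Pc (is_goe e) (labels z)) (mono rt x0 z)).
  rewrite -(@haf_congr _ _ (la rt A (labels z)) _ (cov (lc (labels z)))) //; last by move=> p q _ _; rewrite cov_lc.
  exact: isE_haf.
apply: isE_ext (isE_sum (fun z => \prod_p cf rt Pc x0 z p) hz) => t.
apply: eq_bigr => z _; under [RHS]eq_bigr do rewrite (tn_split rt Pc x0).
rewrite big_split /=; congr (_ * _); rewrite [LHS]big_mkcond; apply: eq_bigr => p _.
by case: ifP => // _; rewrite form_entry !ffunE.
Qed.
End Diagrams.

Lemma expectation_formula s (n : 'I_s -> nat) nn (rt : pred nat) : rt 0%N ->
  (forall (F : comPzRingType) (N : nat) (X P : 'M[F]_N) (x0 : 'I_N) (Y : nat -> 'M[F]_N),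
    (forall x, \sum_y P x y = 1) -> Y 0 = 1%:M -> Y 1 = X -> (forall k, Y k.+2 = X *m Y k.+1 - Y k) ->
    \prod_(j < s) \tr (Y (n j)) =
    \sum_(z : {ffun 'I_nn -> bool * 'I_N}) \prod_(p < nn) tn X P nn rt (nthf (false, x0) z) p) ->
  ('E_P[fun t => trU_prod n (X t)] =
   (complex.Re (\sum_(u in rawset nn rt | is_goe e || [forall p, ~~ u.2 p])
      dval (@nxo nn rt) u.1 u.2 (Kraw A Pc u)))%:E)%E.
Proof.
move=> rt0 ht; rewrite unlock; have [[_ <-] _] := isE_diagrams nn rt0.
apply: eq_integral => t _; congr (_%:E); rewrite /trU_prod; congr (complex.Re _).
have h2 : (cplx (2^-1) *: X t) *+ 2 = X t.
  rewrite -scaler_nat scalerA -cplx_nat -cplxM mulfV ?pnatr_eq0 //; exact: scale1r.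
(* [Y k] is U_k(X/2), whose recursion has no factor 2 left. *)
apply: (ht _ _ (X t) Pc x0 (fun k => chebU (cplx (2^-1) *: X t) k)) => //; first exact: Pc_row.
move=> k; rewrite /chebU /=; case: (chebU_pair _ k) => a b /=.
by rewrite h2.
Qed.

End EnsembleFormula.

(** * Bounds at a fixed matrix size *)

Definition series_value (R : realType) (c : R) (s t n N : nat) : R :=
  c * 2 ^+ s * n%:R ^+ s * (expR (2 * Num.sqrt (2 * c * n%:R ^+ 3 / N%:R))
     + Num.max 1 (t%:R / n%:R) ^+ s * expR (2 * c * n%:R ^+ 2 * t%:R / N%:R)).

Section WeightedSums.
Variables (R : realType) (n N t s : nat) (rt : pred nat) (r G : R).
Hypothesis n0 : (0 < n)%N.
Hypothesis N0 : (0 < N)%N.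
Hypothesis cs : #|Rto n rt| = s.
Hypothesis r1 : 1 <= r.
Hypothesis G1 : 1 <= G.
Let T0 (k : nat) : R := G * (t%:R + Rk R n k).
Let c := cst_of s r G.

Lemma RT0 k : Rk R n k <= T0 k.
Proof.
have h := Rk_gt0 R n0 k; apply: (@le_trans _ _ (t%:R + Rk R n k)); first by rewrite lerDr.
by rewrite ler_peMl // addr_ge0 // ltW.
Qed.

Lemma weighted_term k : (Wk n rt k)%:R * ((4 ^ (6 * k + 4 * s) * k.+1)%N%:R * Bk n rt N r T0 k) <=
  c ^+ k.+1 * k.+1%:R ^+ k * ((t%:R + n%:R / k.+1%:R) ^+ (k + s) * (n%:R / k.+1%:R) ^+ (2 * k) * N%:R ^- k).
Proof. by rewrite /Wk /Bk cs; apply: weight_bound. Qed.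

Lemma sum_diff_le : \sum_(k < n) (Wk n rt k)%:R * ((4 ^ (6 * k + 4 * s) * k.+1)%N%:R * Bk n rt N r T0 k)
  <= series_value c s t n N.
Proof.
have c1 : 1 <= c by apply: cst_of_ge1.
by apply: le_trans (series_bound s t c1 n0 N0); apply: ler_sum => k _; apply: weighted_term.
Qed.

(** The extra factor 4^Q (k+1) of the difference series is at least 1, so that series dominates this
    one. *)
Lemma sum_main_le : \sum_(k < n) (Wk n rt k)%:R * Bk n rt N r T0 k <= series_value c s t n N.
Proof.
apply: le_trans sum_diff_le; apply: ler_sum => k _; apply: ler_wpM2l => //.
have hB : 0 <= Bk n rt N r T0 k by apply: Bk_ge0 => //; apply: RT0.
by rewrite ler_peMl // ler1n muln_gt0 expn_gt0.
Qed.
End WeightedSums.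

Section OneSize.
Variables (R : realType) (e : ensemble) (N : nat).
Variables (d : measure_display) (T : measurableType d) (P : probability T R).
Variables (g : 'I_N -> 'I_N -> bool -> T -> R) (S : 'M[R]_N) (A : 'M[R[i]]_N) (r t : nat) (G : R).
Hypothesis hg : gaussian_family P g.
Hypothesis vS : variance_profile S.
Hypothesis hA : admissible_A e A.
Hypothesis rA : (\rank A <= r)%N.
Hypothesis t0 : (0 < t)%N.
Hypothesis G1 : 1 <= G.
Hypothesis B1 : forall x y, \sum_(w < t) (pmat S ^+ w.+1) x y <= G * t%:R / N%:R.
Variables (s : nat) (n : 'I_s -> nat).
Hypothesis s0 : (0 < s)%N.
Hypothesis n_gt0 : forall j, (0 < n j)%N.
Let nn := (\sum_(j < s) n j)%N.
Let a := opnorm A.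
(** The maximum with 1 makes powers monotone, so that all runs of A-letters together are bounded by
    [a1 ^+ nn]. *)
Let a1 := Num.max 1 a.
Let c := cst_of s (r.+1%:R : R) G.

Lemma nn_gt0 : (0 < nn)%N.
Proof.
apply: leq_trans (n_gt0 (Ordinal s0)) _; rewrite /nn (bigD1 (Ordinal s0)) //= leq_addr //.
Qed.

Lemma pm_ge0 x y : 0 <= pmat S x y. Proof. by rewrite mxE sqr_ge0. Qed.
Lemma pm_row x : \sum_y pmat S x y = 1.
Proof. by under eq_bigr do rewrite mxE; case: vS. Qed.
Lemma pm_col y : \sum_x pmat S x y = 1.
Proof.
have [Ss _ _] := vS; rewrite -(pm_row y); apply: eq_bigr => x _.
by rewrite !mxE (S_symE Ss).
Qed.

Lemma Pc_pow (Q : 'M[R]_N) j x y : (map_mx (@cplx R) Q ^+ j) x y = cplx ((Q ^+ j) x y).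
Proof.
elim: j x y => [|j IH] x y.
  by rewrite !expr0 !mxE; case: (x == y); rewrite ?mulr1n ?mulr0n.
rewrite !exprS -[LHS]/((_ *m _) x y) -[(Q * _) x y]/((_ *m _) x y) !mxE cplx_sum.
by apply: eq_bigr => z _; rewrite IH mxE cplxM.
Qed.

Lemma herm : hermitian A. Proof. by move: hA; case: e => //= -[]. Qed.

Lemma a1_ge1 : 1 <= a1. Proof. by rewrite le_max lexx. Qed.

Lemma Gpow q : (forall k x y, (0 < k)%N -> nm ((A ^+ k) x y) <= a ^+ k * (q x * q y)) -> (forall x, 0 <= q x) ->
  forall k x y, (0 < k)%N -> nm ((A ^+ k) x y) <= a1 ^+ k * (q x * q y).
Proof.
move=> h q0 k x y k0; apply: le_trans (h k x y k0) _; apply: ler_wpM2r; first exact: mulr_ge0.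
by apply: lerXn2r; rewrite ?nnegrE ?opnorm_ge0 ?le_max ?lexx ?orbT // ler01.
Qed.

Lemma expectation_bound : (0 < N)%N -> exists2 v : R,
  ('E_P[fun w => trU_prod n (Xmat e S A (fun i j b => g i j b w))] = v%:E)%E &
  v <= a1 ^+ nn * series_value c s t nn N.
Proof.
move=> N0; have [Ss _ Sr] := vS.
have [rt [rt0 cs] ht] := tilings_exist n_gt0 (erefl nn).
have E := expectation_formula e hg A N0 Ss Sr rt0 ht.
move: E; set v := complex.Re _ => E; exists v; first exact: E.
rewrite /v.
apply: le_trans (Re_le_nm _) _; apply: le_trans (nm_suml _ _) _.
have [q [q0 q1 qs qp]] := hermitian_power_bound herm.
(* The diagram bounds ask for a constant that is at least 1, hence r + 1. *)
have qs' : \sum_x q x ^+ 2 <= (r.+1)%:R.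
  by apply: le_trans qs _; rewrite ler_nat; apply: leq_trans rA (leqnSn _).
pose T0 (k : nat) : R := G * (t%:R + Rk R nn k).
apply: (@le_trans _ _ (\sum_(u in rawset nn rt) nm (dval (@nxo nn rt) u.1 u.2 (Kraw A (Pc S) u)))).
  rewrite [leRHS](bigID (fun u : {ffun 'I_nn -> 'I_nn} * {ffun 'I_nn -> bool} => is_goe e || [forall p, ~~ u.2 p])) /=.
  by rewrite lerDl; apply: sumr_ge0 => u _; apply: nm_ge0.
have r1 : 1 <= r.+1%:R :> R by rewrite ler1n.
apply: (le_trans (@diagram_sum _ R (@nm R) (@nm_ge0 R) (nm0 R) (nm1 R) (@nmM R) (@nmD R) (@nmV R) nn rt N rt0 nn_gt0 N0
  A q r.+1%:R a1 q0 q1 qs' r1 a1_ge1 (Gpow qp q0) T0 (fun j x y => (pmat S ^+ j) x y) 1 _ _ _ _ (Pc S) _ (erefl _) _)).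
- by move=> k; apply: RT0 => //; apply: nn_gt0.
- by move=> j x y; apply: pow_ge0 => //; apply: pm_ge0.
- by move=> j x; rewrite (pow_row pm_row).
- move=> k x y kn; rewrite mul1r.
  by apply: (laplace_pow N0 t0 pm_ge0 pm_row G1 B1); apply: Rk_gt0 nn_gt0 _.
- by move=> z; apply: Pc_col.
- by move=> j x y _; rewrite /Pc Pc_pow nm_cplx ger0_norm // pow_ge0 //; apply: pm_ge0.
apply: ler_wpM2l; first by rewrite exprn_ge0 // (le_trans ler01 a1_ge1).
exact: (sum_main_le t nn_gt0 N0 cs r1 G1).
Qed.

Variable dl : R.
Hypothesis dl0 : 0 <= dl.
Hypothesis dl1 : dl <= 2^-1.
Hypothesis B2 : forall x y j, (t <= j)%N -> `|(pmat S ^+ j) x y - N%:R^-1| <= dl / N%:R.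

(** The normalised ensemble has the profile with all entries N^(-1/2), for which every positive
    power of P is the uniform matrix. Both expectations are therefore sums over the same diagrams,
    and [diagram_diff] applies with D = (G + 2) t from [difference_sum]. *)
Lemma expectation_diff : (0 < N)%N ->
  `|fine 'E_P[fun w => trU_prod n (Xmat e S A (fun i j b => g i j b w))] -
    fine 'E_P[fun w => trU_prod n (Xtilde e A (fun i j b => g i j b w))]| <=
  a1 ^+ nn * ((G + 2) * t%:R / nn%:R * series_value c s t nn N).
Proof.
move=> N0; have [Ss _ Sr] := vS.
have [rt [rt0 cs] ht] := tilings_exist n_gt0 (erefl nn).
have NR : 0 < N%:R :> R by rewrite ltr0n.
pose S' : 'M[R]_N := const_mx (Num.sqrt N%:R)^-1.
have S's : S'^T = S' by apply/matrixP => i j; rewrite !mxE.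
have S'2 i j : S' i j ^+ 2 = N%:R^-1 by rewrite mxE exprVn sqr_sqrtr.
have S'r i : \sum_j S' i j ^+ 2 = 1.
  by under eq_bigr do rewrite S'2; rewrite sumr_const card_ord -[_ *+ N]mulr_natl mulfV ?gt_eqF.
have eX w : Xtilde e A (fun i j b => g i j b w) = Xmat e S' A (fun i j b => g i j b w).
  by apply/matrixP => i j; rewrite !mxE.
under [X in `|_ - fine (expectation _ X)|]eq_fun do rewrite eX.
rewrite (expectation_formula e hg A N0 Ss Sr rt0 ht) (expectation_formula e hg A N0 S's S'r rt0 ht) /=.
set U := \sum_(u in _ | _) _; set V := \sum_(u in _ | _) _.
have h1 : `|complex.Re U - complex.Re V| <= nm (U - V).
  have -> : complex.Re U - complex.Re V = complex.Re (U - V) by case: U V => ? ? [].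
  move: (U - V) => z; rewrite ler_norml Re_le_nm andbT lerNl.
  have -> : - complex.Re z = complex.Re (- z) by case: z.
  by apply: le_trans (Re_le_nm _) _; case: z => x y; rewrite /nm /= !sqrrN.
apply: (le_trans h1); rewrite /U /V -sumrB; apply: le_trans (nm_suml _ _) _.
have [q [q0 q1 qs qp]] := hermitian_power_bound herm.
have qs' : \sum_x q x ^+ 2 <= (r.+1)%:R.
  by apply: le_trans qs _; rewrite ler_nat; apply: leq_trans rA (leqnSn _).
pose T0 (k : nat) : R := G * (t%:R + Rk R nn k).
apply: (@le_trans _ _ (\sum_(u in rawset nn rt) nm (dval (@nxo nn rt) u.1 u.2 (Kraw A (Pc S) u)
    - dval (@nxo nn rt) u.1 u.2 (Kraw A (Pc S') u)))).
  rewrite [leRHS](bigID (fun u : {ffun 'I_nn -> 'I_nn} * {ffun 'I_nn -> bool} => is_goe e || [forall p, ~~ u.2 p])) /=.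
  by rewrite lerDl; apply: sumr_ge0 => u _; apply: nm_ge0.
have r1 : 1 <= r.+1%:R :> R by rewrite ler1n.
have G0 : 0 <= G + 2 by rewrite addr_ge0 // (le_trans ler01).
have p0 j x y : 0 <= (pmat S ^+ j) x y by apply: pow_ge0 => //; apply: pm_ge0.
have Ni : 0 <= N%:R^-1 :> R by rewrite invr_ge0.
have pS' j x y : (0 < j)%N -> (pmat S' ^+ j) x y = N%:R^-1.
  case: j => // j _; elim: j x y => [|j IH] x y; first by rewrite expr1 mxE S'2.
  rewrite exprS -[LHS]/((_ *m _) x y) mxE; under eq_bigr do rewrite mxE S'2 IH.
  by rewrite sumr_const card_ord -[_ *+ N]mulr_natl mulrA mulfV ?gt_eqF // mul1r.
apply: (le_trans (@diagram_diff _ R (@nm R) (@nm_ge0 R) (nm0 R) (nm1 R) (@nmM R) (@nmD R) (@nmV R) nn rt N rt0 nn_gt0 N0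
  A q r.+1%:R a1 q0 q1 qs' r1 a1_ge1 (Gpow qp q0) T0 (fun j x y => (pmat S ^+ j) x y + N%:R^-1) 2 _ _ _ _ (Pc S) (Pc S')
  (fun j x y => `|(pmat S ^+ j) x y - N%:R^-1|) ((G + 2) * t%:R) _ _ (erefl _) _ _ _ _ _ _)).
- by move=> k; apply: RT0 => //; apply: nn_gt0.
- by move=> j x y; rewrite addr_ge0.
- move=> j x; rewrite big_split /= (pow_row pm_row) sumr_const card_ord -[_ *+ N]mulr_natl mulfV ?gt_eqF //.
- move=> k x y kn; have hR := Rk_gt0 R nn_gt0 k.
  under eq_bigr do rewrite mulrDr; rewrite big_split /= -mulr_suml.
  have -> : 2 * (T0 k / N%:R) = T0 k / N%:R + T0 k / N%:R by ring.
  apply: lerD; first by apply: (laplace_pow N0 t0 pm_ge0 pm_row G1 B1).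
  apply: ler_wpM2r => //; apply: le_trans (geometric_le _ _) _; first by rewrite invr_gt0.
  by rewrite invrK; apply: RT0 => //; apply: nn_gt0.
- by move=> z; apply: Pc_col.
- by move=> z; apply: Pc_col.
- by rewrite mulr_ge0.
- by [].
- by move=> j x y _; rewrite /Pc Pc_pow nm_cplx ger0_norm // lerDl.
- by move=> j x y j0; rewrite /Pc Pc_pow nm_cplx pS' // ger0_norm // lerDr.
- move=> j x y j0; rewrite /Pc !Pc_pow pS' // -[cplx _ - cplx _](rmorphB (real_complex R)).
  by rewrite [leLHS]nm_cplx.
- move=> x y; exact: (difference_sum N0 t0 pm_ge0 pm_row pm_col G1 B1 dl0 dl1 B2).
apply: ler_wpM2l; first by rewrite exprn_ge0 // (le_trans ler01 a1_ge1).
apply: (@le_trans _ _ ((G + 2) * t%:R / nn%:R * \sum_(k < nn) (Wk nn rt k)%:R *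
    ((4 ^ (6 * k + 4 * s) * k.+1)%N%:R * Bk nn rt N r.+1%:R T0 k))); last first.
  apply: ler_wpM2l; first by rewrite divr_ge0 // mulr_ge0.
  exact: (sum_diff_le t nn_gt0 N0 cs r1 G1).
rewrite mulr_sumr le_eqVlt; apply/orP; left; apply/eqP/eq_bigr => k _.
have hn : nn%:R != 0 :> R by rewrite pnatr_eq0 -lt0n nn_gt0.
rewrite cs natrM natrX /Rk invf_div; move: (Bk _ _ _ _ _ _) (4%:R ^+ _) => B4 q4; ring.
Qed.

End OneSize.

(** * The two asymptotic estimates *)

Unset Implicit Arguments.
Set Strict Implicit.

(** The factor 4c of C absorbs the 2 in front of the square root, because 8c <= (4c)^2 for c >= 1,
    and 2^s is the one in [series_value]. The two exponentials of [series_value] match the first two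
    summands, and the last summand is nonnegative. *)
Lemma main_inequality (R : realType) (c a C : R) (s t n N : nat) :
  1 <= c -> 0 <= a -> (0 < s)%N -> (0 < n)%N -> (0 < N)%N ->
  C = 4 * c * 2 ^+ s ->
  Num.max 1 a ^+ n * series_value c s t n N <=
  (1 + a ^+ n) * (C * n%:R) ^+ s * (expR (C * n%:R * Num.sqrt n%:R / Num.sqrt N%:R)
   + Num.max 1 (t%:R / n%:R) ^+ s * expR (C * n%:R ^+ 2 * t%:R / N%:R)
   + Num.min ((C * n%:R ^+ 2 * t%:R / N%:R) ^+ (n %/ t)) 1 * expR (C * n%:R ^+ 3 / N%:R)).
Proof.
move=> c1 a0 s0 n0 N0 eC.
have NR : 0 < N%:R :> R by rewrite ltr0n.
have nR : 0 < n%:R :> R by rewrite ltr0n.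
have p2 : 1 <= 2 ^+ s :> R by rewrite exprn_ege1 // ler1n.
have c0 : 0 <= c := le_trans ler01 c1.
have C1 : 4 * c <= C by rewrite eC ler_peMr // mulr_ge0.
have Cc : c * 2 ^+ s <= C by rewrite eC -mulrA ler_peMl ?mulr_ge0 ?exprn_ge0 //; lra.
have C0 : 0 <= C by apply: le_trans C1; lra.
have C1' : 1 <= C by apply: le_trans C1; lra.
have mx : Num.max 1 a ^+ n <= 1 + a ^+ n.
  case: (leP 1 a) => h; first by rewrite lerDr.
  by rewrite expr1n lerDl exprn_ge0.
have cC : c * 2 ^+ s * n%:R ^+ s <= (C * n%:R) ^+ s.
  rewrite exprMn; apply: ler_wpM2r; first exact: exprn_ge0.
  apply: (le_trans Cc); case: (s) s0 => // s' _.
  by rewrite exprS ler_peMr // exprn_ege1.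
have m0 : 0 <= Num.max 1 (t%:R / n%:R) ^+ s :> R by rewrite exprn_ge0 // le_max ler01.
have sq : 2 * Num.sqrt (2 * c * n%:R ^+ 3 / N%:R) <= C * n%:R * Num.sqrt n%:R / Num.sqrt N%:R.
  have X0 : 0 <= 2 * c * n%:R ^+ 3 / N%:R by rewrite divr_ge0 ?(ltW NR) // !mulr_ge0 ?exprn_ge0.
  have Y0 : 0 <= C * n%:R * Num.sqrt n%:R / Num.sqrt N%:R by rewrite divr_ge0 ?sqrtr_ge0 // !mulr_ge0 ?sqrtr_ge0.
  rewrite -(@ler_pXn2r _ 2) ?nnegrE ?(mulr_ge0 _ (sqrtr_ge0 _)) //.
  rewrite exprMn sqr_sqrtr // expr_div_n !exprMn !sqr_sqrtr ?(ltW nR) ?(ltW NR) //.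

  have -> : 2 ^+ 2 * (2 * c * n%:R ^+ 3 / N%:R) = (8 * c) * (n%:R ^+ 3 / N%:R) by ring.
  have -> : C ^+ 2 * n%:R ^+ 2 * n%:R / N%:R = C ^+ 2 * (n%:R ^+ 3 / N%:R) by ring.
  apply: ler_wpM2r; first by rewrite divr_ge0 ?exprn_ge0 ?ltW.
  by have : (4 * c) ^+ 2 <= C ^+ 2; [rewrite ler_pXn2r ?nnegrE ?mulr_ge0|nra].
rewrite /series_value [in leRHS]mulrDr -[leLHS]addr0 mulrA; apply: lerD.
  apply: ler_pM.
  - by rewrite !mulr_ge0 ?exprn_ge0 ?le_max ?ler01.
  - by rewrite addr_ge0 ?expR_ge0 // mulr_ge0 ?expR_ge0.
  - by apply: ler_pM; rewrite ?exprn_ge0 ?le_max ?ler01 // !mulr_ge0 ?exprn_ge0.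
  - apply: lerD; first by rewrite ler_expR.
    apply: ler_wpM2l => //; rewrite ler_expR; apply: ler_wpM2r; first by rewrite invr_ge0 ltW.
    apply: ler_wpM2r => //; apply: ler_wpM2r; first by rewrite exprn_ge0.
    by apply: le_trans C1; lra.
have Cn : 0 <= (C * n%:R) ^+ s by rewrite exprn_ge0 // mulr_ge0.
have Z0 : 0 <= C * n%:R ^+ 2 * t%:R / N%:R by rewrite divr_ge0 ?(ltW NR) // !mulr_ge0 ?exprn_ge0.
apply: mulr_ge0; first by apply: mulr_ge0 => //; rewrite addr_ge0 ?exprn_ge0.
by apply: mulr_ge0; [rewrite le_min ler01 andbT exprn_ge0|exact: expR_ge0].
Qed.

(** Here y is N^(1/3). The bound n <= L y gives n^3/N <= L^3, and it turns max(1, a)^n into at most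
    e^(n K/y) <= e^(K L). Only the small factor t/n remains. *)
Lemma critical_inequality (R : realType) (c a G K L y : R) (s t n N : nat) :
  1 <= c -> 0 <= G -> 0 <= K -> 0 <= L -> 0 < y -> y ^+ 3 = N%:R -> (0 < n)%N ->
  a <= 1 + K / y -> n%:R <= L * y -> (t <= n)%N ->
  Num.max 1 a ^+ n * (G * t%:R / n%:R * series_value c s t n N) / n%:R ^+ s <=
  expR (K * L) * G * (c * 2 ^+ s) * (expR (2 * Num.sqrt (2 * c * L ^+ 3)) + expR (2 * c * L ^+ 3)) * (t%:R / n%:R).
Proof.
move=> c1 G0 K0 L0 y0 yN n0 ha hn tn.
have c0 : 0 <= c := le_trans ler01 c1.
have nR : 0 < n%:R :> R by rewrite ltr0n.
have NR : 0 < N%:R :> R by rewrite -yN exprn_gt0.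
have tn1 : t%:R / n%:R <= 1 :> R by rewrite ler_pdivrMr // mul1r ler_nat.
have q0 : 0 <= t%:R / n%:R :> R by rewrite divr_ge0 // ltW.
have n3 : n%:R ^+ 3 / N%:R <= L ^+ 3 :> R.
  by rewrite ler_pdivrMr // -yN -exprMn lerXn2r ?nnegrE // mulr_ge0 ?(ltW y0).
have mx : Num.max 1 a ^+ n <= expR (K * L).
  have h : Num.max 1 a <= expR (K / y).
    have e := expR_ge1Dx (K / y); rewrite ge_max (le_trans ha e) andbT.
    by apply: le_trans e; rewrite lerDl divr_ge0 // ltW.
  apply: (@le_trans _ _ (expR (K / y) ^+ n)).
    by apply: lerXn2r; rewrite ?nnegrE ?expR_ge0 ?le_max ?ler01 //.
  rewrite -expRM_natl ler_expR mulrCA; apply: ler_wpM2l => //.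
  by rewrite ler_pdivrMr.
have e1 : expR (2 * Num.sqrt (2 * c * n%:R ^+ 3 / N%:R)) <= expR (2 * Num.sqrt (2 * c * L ^+ 3)).
  rewrite ler_expR; apply: ler_wpM2l => //; apply: ler_wsqrtr.
  by rewrite -(mulrA (2 * c)); apply: ler_wpM2l => //; rewrite mulr_ge0.
have e2 : expR (2 * c * n%:R ^+ 2 * t%:R / N%:R) <= expR (2 * c * L ^+ 3).
  rewrite ler_expR; apply: (@le_trans _ _ (2 * c * (n%:R ^+ 3 / N%:R))).
    rewrite -(mulrA (2 * c) (n%:R ^+ 2)) -(mulrA (2 * c)).
    apply: ler_wpM2l; first by rewrite mulr_ge0.
    apply: ler_wpM2r; first by rewrite invr_ge0 ltW.
    by rewrite [in leRHS](exprSr _ 2); apply: ler_wpM2l; [exact: exprn_ge0|rewrite ler_nat].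
  by apply: ler_wpM2l => //; rewrite mulr_ge0.
rewrite /series_value (max_idPl tn1) expr1n mul1r.
have M0 : 0 <= Num.max 1 a ^+ n by rewrite exprn_ge0 // le_max ler01.
have Q0 : 0 <= G * (c * 2 ^+ s) * (t%:R / n%:R) by rewrite !mulr_ge0 ?exprn_ge0 ?invr_ge0.
have X0 : n%:R ^+ s != 0 :> R by rewrite expf_neq0 // gt_eqF.
have eM (M X E Z : R) : X != 0 -> M * (G * t%:R / n%:R * (Z * X * E)) / X = M * E * (G * Z * (t%:R / n%:R)).
  by move=> hX; field; rewrite hX gt_eqF.
have eH (H Z F q : R) : H * G * Z * F * q = H * F * (G * Z * q) by ring.
rewrite eM // eH; apply: ler_wpM2r => //.
by apply: ler_pM; rewrite ?addr_ge0 ?expR_ge0 ?lerD.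
Qed.

Theorem theorem4p4 (R : realType) (e : ensemble)
  (S : forall N : nat, 'M[R]_N) (A : forall N : nat, 'M[R[i]]_N)
  (t : nat -> nat) (r : nat) (gamma delta : R) (N0 s : nat)
  (d : measure_display) (T : measurableType d) (P : probability T R)
  (g : forall N : nat, 'I_N -> 'I_N -> bool -> T -> R) :
  (forall N, variance_profile (S N)) ->
  (forall N, admissible_A e (A N) /\ (\rank (A N) <= r)%N) ->
  {homo t : m n / (m <= n)%N} -> (forall N, (0 < t N)%N) ->
  condB1 S t gamma N0 -> condB2 S t delta ->
  (forall N, gaussian_family P (g N)) ->
  (0 < s)%N ->
  (* (i) *)
  (exists C : R, 0 < C /\
     forall (N : nat) (n : 'I_s -> nat), (forall j, (0 < n j)%N) ->
       let nn := (\sum_(j < s) n j)%N in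
       let a := opnorm (A N) in
       let NR : R := N%:R in let nR : R := nn%:R in let tR : R := (t N)%:R in
       ('E_P[fun w => trU_prod n (Xmat e (S N) (A N) (fun i j b => g N i j b w))]
        <= ((1 + a ^+ nn) * (C * nR) ^+ s *
            (expR (C * nR * Num.sqrt nR / Num.sqrt NR)
             + Num.max 1 (tR / nR) ^+ s * expR (C * nR ^+ 2 * tR / NR)
             + Num.min ((C * nR ^+ 2 * tR / NR) ^+ (nn %/ t N)) 1
               * expR (C * nR ^+ 3 / NR)))%:E)%E)
  /\
  (* (ii) *)
  (forall n : 'I_s -> nat -> nat,
     (forall j N, (0 < n j N)%N) ->
     (exists K : R, exists N1 : nat, forall N, (N1 <= N)%N ->
        opnorm (A N) <= 1 + K * (N%:R `^ (- 3^-1)) /\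
        forall j, (n j N)%:R <= K * (N%:R `^ 3^-1)) ->
     (forall j, ((t N)%:R / (n j N)%:R : R) @[N --> \oo] --> 0) ->
     ((fine 'E_P[fun w => trU_prod (fun j => n j N)
                     (Xmat e (S N) (A N) (fun i j b => g N i j b w))]
       - fine 'E_P[fun w => trU_prod (fun j => n j N)
                     (Xtilde e (A N) (fun i j b => g N i j b w))])
      / ((\sum_(j < s) n j N)%N%:R ^+ s) : R) @[N --> \oo] --> 0).
Proof.
move=> hS hA _ t0 [g1 hB1] [/andP[d0 d1] hB2] hg s0.
(* For N < N0 the entries of the powers are at most 1, which is at most N0/N; with this constant the
   bound of (B1) holds for every N >= 1. *)
pose G := Num.max gamma N0%:R.
have G1 : 1 <= G by rewrite le_max g1.
have B1 N : (0 < N)%N -> forall x y : 'I_N, \sum_(w < t N) (pmat (S N) ^+ w.+1) x y <= G * (t N)%:R / N%:R.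
  move=> hN x y; have NR : 0 < N%:R :> R by rewrite ltr0n.
  have tR : 0 < (t N)%:R :> R by rewrite ltr0n.
  case: (leqP N0 N) => hNN.
    have := hB1 N hNN x y; rewrite big_add1 big_mkord ler_pdivrMl // => h; apply: (le_trans h).
    rewrite mulrA (mulrC (t N)%:R); apply: ler_wpM2r; first by rewrite invr_ge0 ltW.
    by apply: ler_wpM2r; [exact: ltW|rewrite le_max lexx].
  apply: (@le_trans _ _ (\sum_(w < t N) 1)).
    apply: ler_sum => w _; apply: pow_le1 => [u v|u]; first exact: pm_ge0.
    exact: pm_row.
  rewrite sumr_const card_ord ler_pdivlMr // mulrC -[leLHS]/(N%:R * (t N)%:R); apply: ler_wpM2r; first exact: ltW.
  by rewrite le_max ler_nat (ltnW hNN) orbT.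
have B2 N : forall (x y : 'I_N) j, (t N <= j)%N -> `|(pmat (S N) ^+ j) x y - N%:R^-1| <= delta / N%:R.
  by move=> x y j; apply: hB2.
have dl : delta <= 2^-1.
  by apply: ltW; apply: lt_le_trans d1 _; rewrite lef_pV2 ?posrE ?ltr0n // ler_nat.
have [c c1 ec] : exists2 c : R, 1 <= c & c = cst_of s (r.+1%:R : R) G.
  by exists (cst_of s r.+1%:R G) => //; apply: cst_of_ge1; rewrite ?ler1n.
have c0 : 0 < c := lt_le_trans ltr01 c1.
have cs0 : 0 < 4 * c * 2 ^+ s by rewrite !mulr_gt0 ?exprn_gt0.
split.
  exists (4 * c * 2 ^+ s); split=> //.
  move=> N n n0; cbv zeta; have [hAN rAN] := hA N.
  set nn := (\sum_(j < s) n j)%N; set a := opnorm (A N).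
  have nn0 : (0 < nn)%N by apply: nn_gt0.
  have a0 : 0 <= a by apply: opnorm_ge0.
  (* At N = 0 the product contains the trace of an empty matrix and vanishes, so the bound only has
     to be nonnegative. *)
  case: (posnP N) => [N0'|hN]; last first.
    have [v -> hv] := expectation_bound (hg N) (hS N) hAN rAN (t0 N) G1 (B1 N hN) s0 n0 hN.
    by rewrite -ec in hv; rewrite lee_fin; apply: (le_trans hv); apply: (main_inequality _ c).
  have tr0 w : trU_prod n (Xmat e (S N) (A N) (fun i j b => g N i j b w)) = 0.
    rewrite /trU_prod (bigD1 (Ordinal s0)) //=; move: (chebU _ _).
    by move: {+}N N0' => N' -> M; rewrite /mxtrace big_ord0 mul0r.
  under [X in expectation _ X]eq_fun do rewrite tr0.
  rewrite unlock integral0 lee_fin; have {}cs0 := ltW cs0.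
  set C := 4 * c * 2 ^+ s in cs0 *; clearbody C.
  have Z0 : 0 <= C * nn%:R ^+ 2 * (t N)%:R / N%:R by rewrite divr_ge0 ?mulr_ge0 ?exprn_ge0.
  have m0 : 0 <= Num.max 1 ((t N)%:R / nn%:R) ^+ s :> R by rewrite exprn_ge0 // le_max ler01.
  have w0 : 0 <= Num.min ((C * nn%:R ^+ 2 * (t N)%:R / N%:R) ^+ (nn %/ t N)) 1.
    by rewrite le_min ler01 andbT exprn_ge0.
  apply: mulr_ge0; last first.
    apply: addr_ge0; first apply: addr_ge0; first exact: expR_ge0.
    - by apply: mulr_ge0 => //; exact: expR_ge0.
    - by apply: mulr_ge0 => //; exact: expR_ge0.
  by apply: mulr_ge0; [rewrite addr_ge0 ?exprn_ge0|rewrite exprn_ge0 // mulr_ge0].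
move=> n n0 [K [N1 hK]] ht.
(* [K] may be negative. The factor s in [L] accounts for the total of s lengths, each at most [K1]
   N^(1/3). *)
pose K1 := `|K|; pose L := s%:R * K1; pose j0 := Ordinal s0.
have K10 : 0 <= K1 by apply: normr_ge0.
have L0 : 0 <= L by apply: mulr_ge0.
have G20 : 0 <= G + 2 by rewrite addr_ge0 // (le_trans ler01).
pose D := expR (K1 * L) * (G + 2) * (c * 2 ^+ s) * (expR (2 * Num.sqrt (2 * c * L ^+ 3)) + expR (2 * c * L ^+ 3)).
have D0 : 0 <= D.
  apply: mulr_ge0; last by rewrite addr_ge0 ?expR_ge0.
  by apply: mulr_ge0; [apply: mulr_ge0 => //; exact: expR_ge0|rewrite mulr_ge0 ?exprn_ge0 // ltW].
(* A single index [j0] suffices: t/n_j0 tending to 0 gives t <= n for large N and also makes the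
   bound tend to 0, since n_j0 <= n. *)
apply/norm_cvg0P; apply: (@squeeze_cvgr _ _ _ _ (fun=> 0) (fun N => D * ((t N)%:R / (n j0 N)%:R))).
- near=> N; rewrite normr_ge0 /=.
  have hN : (0 < N)%N by near: N; exists 1%N.
  have hN1 : (N1 <= N)%N by near: N; exists N1.
  have tn : (t N)%:R / (n j0 N)%:R < 1 :> R by near: N; apply: (cvgr_lt 0) => //; exact: ltr01.
  have nj0 : 0 < (n j0 N)%:R :> R by rewrite ltr0n.
  rewrite ltr_pdivrMr // mul1r ltr_nat in tn.
  have [hAN rAN] := hA N; have [ha hn] := hK N hN1.
  set nn := (\sum_(j < s) n j N)%N.
  have nj : (n j0 N <= nn)%N by rewrite /nn (bigD1 j0) //= leq_addr.
  have nn0 : (0 < nn)%N by apply: leq_trans nj.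
  have nR : 0 < nn%:R :> R by rewrite ltr0n.
  pose y : R := N%:R `^ 3^-1.
  have NR : 0 < N%:R :> R by rewrite ltr0n.
  have y0 : 0 < y by apply: powR_gt0.
  have y3 : y ^+ 3 = N%:R.
    by rewrite -powR_mulrn ?powR_ge0 // -powRrM mulVf ?pnatr_eq0 // powRr1 // ltW.
  have ha' : opnorm (A N) <= 1 + K1 / y.
    apply: (le_trans ha); rewrite lerD2l powRN; apply: ler_wpM2r; first by rewrite invr_ge0 ltW.
    exact: ler_norm.
  have hn' : nn%:R <= L * y.
    rewrite /nn natr_sum; apply: (@le_trans _ _ (\sum_(j < s) K1 * y)).
      apply: ler_sum => j _; apply: (le_trans (hn j)); apply: ler_wpM2r; first exact: ltW.
      exact: ler_norm.
    by rewrite sumr_const card_ord -[_ *+ s]mulr_natl mulrA.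
  have ed := expectation_diff (hg N) (hS N) hAN rAN (t0 N) G1 (B1 N hN) s0 (fun j => n0 j N)
    (ltW d0) dl (B2 N) hN.
  rewrite -ec in ed; rewrite normrM normfV (ger0_norm (exprn_ge0 _ (ltW nR))).
  apply: (le_trans (ler_wpM2r _ ed)); first by rewrite invr_ge0 exprn_ge0 // ltW.
  have tnn : (t N <= nn)%N by apply: leq_trans (ltnW tn) nj.
  apply: (le_trans (critical_inequality _ _ _ _ _ _ _ s (t N) nn N c1 G20 K10 L0 y0 y3 nn0 ha' hn' tnn)).
  apply: ler_wpM2l => //; apply: ler_wpM2l => //.
  by rewrite lef_pV2 ?posrE // ler_nat.
- exact: cvg_cst.
- rewrite -[X in _ --> X](mulr0 D); apply: cvgM; first exact: cvg_cst.
  exact: ht.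
Unshelve. all: by end_near.
Qed.
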